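(* Let $(G_0,\psi)$ be a $\mathbb Z_2$-gain graph. Then $(G_0,\psi)$ is $(2,2,0)$-gain-tight if and only if $(G_0,\psi)$ can be generated from vertex-disjoint copies of graphs in $\mathcal B$ by applying H1, H2, H3, vertex-to-$K_4$ and vertex splitting moves.
   Context: $\mathbb Z_2=\{1,-1\}$. A $\mathbb Z_2$-gain graph $(G_0,\psi)$ is a finite multigraph $G_0=(V_0,E_0)$, loops allowed, with a gain map $\psi:E_0\to\mathbb Z_2$ such that parallel edges have different gains and every loop has gain $-1$ (so each vertex has at most one loop and each pair of vertices at most two edges). Orientation is irrelevant. $(uv,\alpha)$ denotes an edge joining $u$ and $v$ with gain $\alpha$. Switching at a vertex $v$ multiplies the gains of all non-loop edges at $v$ by $-1$; gain graphs related by switchings are regarded as equivalent and are identified throughout (so one may switch at any stage of a construction). A loop contributes 2 to the degree. A set of edges (or subgraph) is balanced if every cycle in it (loops and pairs of parallel edges count as cycles) has product of gains equal to $1$. $(G_0,\psi)$ is $(2,2,0)$-gain-tight if $|E_0|=2|V_0|$, $|F|\le2|V(F)|-2$ for each nonempty balanced $F\subseteq E_0$, and $|F|\le2|V(F)|$ for all $F\subseteq E_0$, where $V(F)$ is the set of vertices incident with $F$. Base graphs. $\mathcal B$ consists (up to switching and isomorphism) of the following: (a) $2K_2^1$: two vertices joined by two edges (gains $1,-1$), with a loop at each vertex; (b) a balanced triangle (all gains $1$) with a loop at each of its three vertices; (c) $R$: vertices $v,w,z$; edges $(vw,1),(vw,-1),(vz,1),(vz,-1),(wz,1)$ and a loop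 at $v$; (d)–(h) the graphs formed from a copy of $K_4$ with all gains $1$ by adding two further edges of gain $-1$: (d) loops at two distinct vertices; (e) a loop at $x$ and a second edge parallel to an edge of $K_4$ incident with $x$; (f) a loop at $x$ and a second edge parallel to an edge of $K_4$ not incident with $x$; (g) second edges parallel to two adjacent edges of $K_4$; (h) second edges parallel to two disjoint edges of $K_4$. Moves (gains of new edges are arbitrary unless specified, subject to the result being a $\mathbb Z_2$-gain graph). In H1, H2 and H3 a new vertex $v$ is added. H1a: $v$ is joined by one edge to each of two distinct vertices. H1b: $v$ is joined to one vertex by two parallel edges (gains $1,-1$). H1c: $v$ has a loop of gain $-1$ and is joined by one edge to one vertex. H2a: delete $(xy,\alpha)$, $x\ne y$; add $(xv,\beta),(yv,\gamma)$ with $\beta\gamma=\alpha$ and an edge from $v$ to a third vertex distinct from $x,y$. H2b: delete $(xy,\alpha)$, $x\neq y$; add $(xv,1),(xv,-1),(yv,\delta)$. H2c: delete a loop at $x$; add $(xv,1),(xv,-1),(yv,\delta)$ with $y\ne x$. H2d: delete $(xy,\alpha)$, $x\ne y$; add $(xv,\beta),(yv,\gamma),(vv,-1)$ with $\beta\gamma=\alpha$. H2e: delete a loop at $x$; add $(xv,1),(xv,-1),(vv,-1)$. H3a: delete $(xy,\alpha),(zw,\beta)$ with $x,y,z,w$ distinct; add $(xv,\gamma),(yv,\delta),(zv,\epsilon),(wv,\zeta)$ with $\gamma\delta=\alpha$, $\epsilon\zeta=\beta$. H3b: delete $(xy,\alpha),(yw,\beta)$ with $x,y,w$ distinct; add $(xv,\alpha),(yv,1),(yv,-1),(wv,-\beta)$.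 H3c: delete a loop at $x$ and $(zw,\beta)$ with $x,z,w$ distinct; add $(xv,1),(xv,-1),(zv,\epsilon),(wv,\zeta)$ with $\epsilon\zeta=\beta$. H3d: delete loops at distinct vertices $x,z$; add $(xv,1),(xv,-1),(zv,1),(zv,-1)$. Vertex-to-$K_4$: remove a vertex $v$ and all its incident edges and add a new copy of $K_4$ with all gains $1$; each removed edge $(xv,\gamma)$, $x\ne v$, is replaced by an edge $(xy,\gamma)$ for some $y$ in the new $K_4$, and a removed loop $(vv,-1)$ is replaced by $(wz,-1)$ for some, not necessarily distinct, vertices $w,z$ of the new $K_4$. Vertex splitting: choose a vertex $v_1$ and an edge from $v_1$ to a neighbour $v_2$; partition the remaining non-loop edges at $v_1$ into two classes; add a new vertex $v_0$ and replace the end $v_1$ of each edge of the first class by $v_0$ (keeping its gain); a loop at $v_1$, if any, is left unchanged or replaced by a loop at $v_0$; finally add the edge $v_0v_1$ with gain $1$ and an edge $v_0v_2$ with the same gain as the chosen edge $v_1v_2$. *)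

(* Defs.v *)
From HB Require Import structures.
From mathcomp Require Import all_boot.

Set Implicit Arguments.
Unset Strict Implicit.
Unset Printing Implicit Defensive.

(* The group Z_2 = {1, -1} is bool with product (+): false is 1, true is -1
   (a bool b stands for (-1) ^ b). *)
Notation gain := bool (only parsing).
Notation pos := false (only parsing).
Notation neg := true (only parsing).

(* Parallel edges have different gains and orientation is irrelevant, so an
   edge is determined by its set of ends (a singleton for a loop) and its gain;
   the edge set of a gain graph on V is a set of such pairs. *)
Definition gedge (V : finType) : finType := ({set V} * gain)%type.

Definition edge (V : finType) (u v : V) (a : gain) : gedge V := ([set u; v], a).

Definition loop (V : finType) (v : V) : gedge V := edge v v neg.

Definition gain_graph (V : finType) (E : {set gedge V}) : bool :=
  [forall e in E, (#|e.1| == 2) || (#|e.1| == 1) && (e.2 == neg)].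

Definition edge_map (V W : finType) (f : V -> W) (e : gedge V) : gedge W :=
  (f @: e.1, e.2).

Definition map_edges (V W : finType) (f : V -> W) (E : {set gedge V}) :
  {set gedge W} := edge_map f @: E.

Definition switch (V : finType) (v : V) (E : {set gedge V}) : {set gedge V} :=
  [set (e.1, e.2 (+) ((v \in e.1) && (#|e.1| == 2))) | e : gedge V in E].

(* A closed walk v_0, a_0, v_1, a_1, ..., v_(k-1), a_(k-1) is the sequence of
   the pairs (v_i, a_i), where a_i is the gain of the edge used from v_i to
   v_(i+1), indices mod k.  For k = 1 that edge is a loop. *)
Definition walk_edges (V : finType) (c : seq (V * gain)) : seq (gedge V) :=
  [seq edge p.1.1 p.2.1 p.1.2 | p <- zip c (rot 1 c)].

(* Distinctness of the edges only matters for k = 2: it excludes traversing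
   one edge back and forth. *)
Definition is_cycle (V : finType) (F : {set gedge V}) (c : seq (V * gain)) :
  bool :=
  [&& c != [::], uniq (unzip1 c), uniq (walk_edges c)
    & all (mem F) (walk_edges c)].

Definition walk_gain (V : finType) (c : seq (V * gain)) : gain :=
  \big[addb/pos]_(p <- c) p.2.

Definition balanced (V : finType) (F : {set gedge V}) : Prop :=
  forall c : seq (V * gain), is_cycle F c -> walk_gain c = pos.

Definition vertices_of (V : finType) (F : {set gedge V}) : {set V} :=
  \bigcup_(e in F) e.1.

Definition gain_tight_220 (V : finType) (E : {set gedge V}) : Prop :=
  [/\ #|E| = 2 * #|V|,
      forall F : {set gedge V}, F \subset E -> F != set0 -> balanced F ->
        #|F| + 2 <= 2 * #|vertices_of F|
    & forall F : {set gedge V}, F \subset E -> #|F| <= 2 * #|vertices_of F|].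

Definition complete (V : finType) : {set gedge V} :=
  [set edge p.1 p.2 pos | p : V * V & p.1 != p.2].

Inductive base_graph (V : finType) : {set gedge V} -> Prop :=
| Base_2K2 x y of #|V| = 2 & uniq [:: x; y] :
    base_graph [set edge x y pos; edge x y neg; loop x; loop y]
| Base_triangle of #|V| = 3 :
    base_graph (complete V :|: [set loop x | x : V])
| Base_R v w z of #|V| = 3 & uniq [:: v; w; z] :
    base_graph [set edge v w pos; edge v w neg; edge v z pos; edge v z neg;
                    edge w z pos; loop v]
| Base_K4_loops x y of #|V| = 4 & uniq [:: x; y] :
    base_graph (complete V :|: [set loop x; loop y])
| Base_K4_loop_incident x y of #|V| = 4 & uniq [:: x; y] :
    base_graph (complete V :|: [set loop x; edge x y neg])
| Base_K4_loop_apart x y z of #|V| = 4 & uniq [:: x; y; z] :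
    base_graph (complete V :|: [set loop x; edge y z neg])
| Base_K4_adjacent x y z of #|V| = 4 & uniq [:: x; y; z] :
    base_graph (complete V :|: [set edge x y neg; edge x z neg])
| Base_K4_disjoint x y z w of #|V| = 4 & uniq [:: x; y; z; w] :
    base_graph (complete V :|: [set edge x y neg; edge z w neg]).

(* A vertex is added by passing from V to option V: None is the new vertex.
   add_vertex E D N deletes D and adds N. *)
Definition add_vertex (V : finType) (E D : {set gedge V})
    (N : {set gedge (option V)}) : {set gedge (option V)} :=
  map_edges Some (E :\: D) :|: N.

Definition to_new (V : finType) (x : V) (a : gain) : gedge (option V) :=
  edge (Some x) None a.

Definition new_loop (V : finType) : gedge (option V) := loop None.

Inductive H1_move (V : finType) (E : {set gedge V}) :
  {set gedge (option V)} -> Prop :=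
| H1a x y a b of uniq [:: x; y] :
    H1_move E (add_vertex E set0 [set to_new x a; to_new y b])
| H1b x :
    H1_move E (add_vertex E set0 [set to_new x pos; to_new x neg])
| H1c x a :
    H1_move E (add_vertex E set0 [set new_loop V; to_new x a]).

Inductive H2_move (V : finType) (E : {set gedge V}) :
  {set gedge (option V)} -> Prop :=
| H2a x y z a b c d of uniq [:: x; y; z] & edge x y a \in E & b (+) c = a :
    H2_move E (add_vertex E [set edge x y a]
                 [set to_new x b; to_new y c; to_new z d])
| H2b x y a d of uniq [:: x; y] & edge x y a \in E :
    H2_move E (add_vertex E [set edge x y a]
                 [set to_new x pos; to_new x neg; to_new y d])
| H2c x y d of uniq [:: x; y] & loop x \in E :
    H2_move E (add_vertex E [set loop x]
                 [set to_new x pos; to_new x neg; to_new y d])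
| H2d x y a b c of uniq [:: x; y] & edge x y a \in E & b (+) c = a :
    H2_move E (add_vertex E [set edge x y a]
                 [set to_new x b; to_new y c; new_loop V])
| H2e x of loop x \in E :
    H2_move E (add_vertex E [set loop x]
                 [set to_new x pos; to_new x neg; new_loop V]).

Inductive H3_move (V : finType) (E : {set gedge V}) :
  {set gedge (option V)} -> Prop :=
| H3a x y z w a b c d e f of uniq [:: x; y; z; w]
    & edge x y a \in E & edge z w b \in E & c (+) d = a & e (+) f = b :
    H3_move E (add_vertex E [set edge x y a; edge z w b]
                 [set to_new x c; to_new y d; to_new z e; to_new w f])
| H3b x y w a b of uniq [:: x; y; w]
    & edge x y a \in E & edge y w b \in E :
    H3_move E (add_vertex E [set edge x y a; edge y w b]
                 [set to_new x a; to_new y pos; to_new y neg; to_new w (~~ b)])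
| H3c x z w b e f of uniq [:: x; z; w]
    & loop x \in E & edge z w b \in E & e (+) f = b :
    H3_move E (add_vertex E [set loop x; edge z w b]
                 [set to_new x pos; to_new x neg; to_new z e; to_new w f])
| H3d x z of uniq [:: x; z] & loop x \in E & loop z \in E :
    H3_move E (add_vertex E [set loop x; loop z]
                 [set to_new x pos; to_new x neg; to_new z pos; to_new z neg]).

(* The vertices other than v, together with those of the new K_4. *)
Definition K4_vertex (V : finType) (v : V) : finType :=
  ({x : V | x != v} + 'I_4)%type.

(* The edge (xv, a) becomes (xy, a) with y = f x a, and a loop at v becomes
   (wz, -1).  The four pieces are the edges not incident with v, the replaced
   non-loop edges, the replaced loop (if any) and the new K_4. *)
Definition vertex_to_K4 (V : finType) (E : {set gedge V}) (v : V)
    (f : V -> gain -> 'I_4) (w z : 'I_4) : {set gedge (K4_vertex v)} :=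
  map_edges (inl : {x : V | x != v} -> K4_vertex v)
    [set e : gedge {x : V | x != v} | edge_map val e \in E]
  :|: [set edge (inl p.1 : K4_vertex v) (inr (f (val p.1) p.2)) p.2
      | p : {x : V | x != v} * gain & edge (val p.1) v p.2 \in E]
  :|: [set e in [set edge (inr w : K4_vertex v) (inr z) neg] | loop v \in E]
  :|: map_edges (inr : 'I_4 -> K4_vertex v) (complete 'I_4).

(* The new vertex v_0 is None.  C consists of the edges whose end v1 becomes
   v_0: the first class of the partition of the non-loop edges at v1 other than
   the chosen one, and also the loop at v1 when it is moved to v_0. *)
Definition vertex_split (V : finType) (E : {set gedge V}) (v1 v2 : V) (a : gain)
    (C : {set gedge V}) : {set gedge (option V)} :=
  add_vertex E C
    (map_edges (fun x => if x == v1 then None else Some x) C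
     :|: [set edge None (Some v1) pos; edge None (Some v2) a]).

Inductive move (V : finType) (E : {set gedge V}) :
  forall W : finType, {set gedge W} -> Prop :=
| Move_H1 E' of H1_move E E' : move E E'
| Move_H2 E' of H2_move E E' : move E E'
| Move_H3 E' of H3_move E E' : move E E'
| Move_vertex_to_K4 v f w z : move E (vertex_to_K4 E v f w z)
| Move_vertex_split v1 v2 a (C : {set gedge V}) of v1 != v2 & edge v1 v2 a \in E
    & C \subset [set e in E | v1 \in e.1] :\ edge v1 v2 a :
    move E (vertex_split E v1 v2 a C).

Definition disjoint_union (I : finType) (V : I -> finType)
    (E : forall i, {set gedge (V i)}) : {set gedge {i : I & V i}} :=
  \bigcup_(i : I) map_edges (fun x : V i => existT (fun j => V j) i x) (E i).

Inductive generated : forall V : finType, {set gedge V} -> Prop :=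
| Gen_base (I : finType) (V : I -> finType) (E : forall i, {set gedge (V i)}) :
    (forall i, base_graph (E i)) -> generated (disjoint_union E)
| Gen_move (V W : finType) (E : {set gedge V}) (E' : {set gedge W}) :
    generated E -> move E E' -> gain_graph E' -> generated E'
| Gen_switch (V : finType) (E : {set gedge V}) (v : V) :
    generated E -> generated (switch v E)
| Gen_iso (V W : finType) (f : V -> W) (E : {set gedge V}) :
    bijective f -> generated E -> generated (map_edges f E).

(* Main.v *)
(* A subset of the double cover V x Z_2 of the gain graph is used for each of the
   two sparsity counts: a balanced subgraph on X is, up to switching, a section of
   the cover over X (a transversal set), and an arbitrary one is the full preimage
   of X (a symmetric set).  Both counts are submodular in this form.

   That the moves preserve tightness is a count for each move.  Conversely, let E be
   tight and suppose that no inverse move leads to a smaller tight graph.  A vertex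
   of degree three then lies in a copy of R or of a balanced K_4; if the K_4 spans
   fewer than two further edges, an outside vertex has two neighbours in it, and the
   obstructions to contracting an edge there force a tight graph on five vertices,
   which is excluded in turn.  Counting degrees shows that every tight symmetric set
   is a union of components, and that a component without vertices of degree three
   is 4-regular.  In a 4-regular component the three ways of pairing the neighbours
   of a loopless vertex are all blocked for H3, and an uncrossing inequality for the
   three blocking sets leaves only a K_4, a copy of R or a star, along which a vertex
   split can be undone; if every vertex has a loop the component is 2K_2^1 or the
   triangle with loops.  So E is a disjoint union of base graphs. *)
Require Import Defs.
From mathcomp Require Import all_boot zify.
From Stdlib Require Import Classical.

Set Implicit Arguments.
Unset Strict Implicit.
Unset Printing Implicit Defensive.

(** * The double cover *)

(** Put f(S) = 4 |S| - ee(S, S). Sparsity says that f is at least 0 on symmetric sets and at least 4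
    on nonempty transversal sets, and a block is a nonempty set where f attains its bound. Since ee
    is a sum of nonnegative weights over pairs of points, an uncrossing inequality follows from an
    inequality in the membership bits of two points, which is a finite truth table. The obstacle is
    that the union of two transversal sets S and T may contain conjugate points. Then S meets both T
    and the conjugate of T, and these two intersections, with f at least 4 each, pay for replacing
    the union by its symmetric closure. Parity provides the remaining constants: f is even on
    transversal sets and divisible by 4 on symmetric ones, so a set that is not a block has room for
    one more edge, which costs 2 or 4. The slack 6 of the last sections marks the sets with room for
    one new edge but not for two. *)

Definition allb (P : bool -> bool) := P true && P false.

Lemma allbP (P : bool -> bool) : allb P -> forall b, P b.
Proof. by case/andP=> ? ?; case. Qed.

Ltac by_truth_table :=
  repeat match goal with b : bool |- _ => revert b; apply: allbP end;
  vm_compute; reflexivity.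

Section Edges.
Variable V : finType.
Implicit Types (E F D : {set gedge V}) (s t : V * bool) (S T : {set V * bool}).

Lemma edgeC (u v : V) a : edge u v a = edge v u a.
Proof. by rewrite /edge setUC. Qed.

Lemma set2_eq (u v x y : V) :
  ([set u; v] == [set x; y]) =
  ((u == x) && (v == y)) || ((u == y) && (v == x)).
Proof.
apply/eqP/idP => [H|/orP[]/andP[/eqP-> /eqP->] //]; last by rewrite setUC.
have Hu : u \in [set x; y] by rewrite -H !inE eqxx.
have Hv : v \in [set x; y] by rewrite -H !inE eqxx orbT.
have Hx : x \in [set u; v] by rewrite H !inE eqxx.
have Hy : y \in [set u; v] by rewrite H !inE eqxx orbT.
move: Hu Hv Hx Hy; rewrite !inE (eq_sym x) (eq_sym x v) (eq_sym y) (eq_sym y v).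
by do 4 case: (_ == _).
Qed.

Lemma edge_eq (u v x y : V) a b :
  (edge u v a == edge x y b) =
  (a == b) && (((u == x) && (v == y)) || ((u == y) && (v == x))).
Proof. by rewrite /edge xpair_eqE set2_eq andbC. Qed.

Lemma gedge_cases (e : gedge V) :
  (#|e.1| == 2) || (#|e.1| == 1) && (e.2 == neg) ->
  exists u v a, e = edge u v a /\ ((u != v) || a).
Proof.
case: e => A a /= /orP[/cards2P[x [y [xy ->]]]|/andP[/cards1P[x ->] /eqP->]].
  by exists x, y, a; rewrite xy.
by exists x, x, true; rewrite /edge setUid orbT.
Qed.

Lemma gain_graphP E :
  reflect (forall e, e \in E -> exists u v a, e = edge u v a /\ ((u != v) || a))
          (gain_graph E).
Proof.
apply: (iffP forall_inP) => H e eE; first exact/gedge_cases/H.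
have [u [v [a [-> ]]]] := H _ eE.
rewrite /= cards2; case: eqVneq => //= _ ->.
by [].
Qed.

Lemma gain_graph_ok E (u v : V) a : gain_graph E -> edge u v a \in E -> (u != v) || a.
Proof.
move=> /gain_graphP gE /gE [x [y [b [/eqP]]]].
rewrite edge_eq => /andP[/eqP<-] /orP[]/andP[/eqP-> /eqP->] //.
by rewrite eq_sym.
Qed.

Lemma gain_graph_ext E F : gain_graph E -> gain_graph F ->
  (forall u v a, (edge u v a \in E) = (edge u v a \in F)) -> E = F.
Proof.
move=> /gain_graphP gE /gain_graphP gF H; apply/setP=> e.
by apply/idP/idP=> eE; [have [u [v [a [ee _]]]] := gE _ eE
                       |have [u [v [a [ee _]]]] := gF _ eE];
  move: eE; rewrite ee H.
Qed.

Lemma gain_graph_sub E F : F \subset E -> gain_graph E -> gain_graph F.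
Proof. by move=> /subsetP FE /forall_inP H; apply/forall_inP=> e /FE /H. Qed.

Lemma gain_graphU E F : gain_graph E -> gain_graph F -> gain_graph (E :|: F).
Proof.
move=> /forall_inP gE /forall_inP gF; apply/forall_inP=> e.
by rewrite inE => /orP[/gE|/gF].
Qed.

Lemma gain_graph1 (u v : V) a : (u != v) || a -> gain_graph [set edge u v a].
Proof.
by move=> H; apply/gain_graphP=> e; rewrite inE => /eqP->; exists u, v, a.
Qed.

Lemma gain_graph0 : gain_graph (set0 : {set gedge V}).
Proof. by apply/forall_inP=> e; rewrite inE. Qed.

(* A pair (v, b) is the vertex of level b over v in the double cover: an edge
   uv of gain a joins (u, b) to (v, b (+) a), and [cj] exchanges the two levels. *)
Definition cj s : V * bool := (s.1, ~~ s.2).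

Lemma cjK : involutive cj.
Proof. by case=> u i; rewrite /cj /= negbK. Qed.

Lemma cj_inj : injective cj. Proof. exact: inv_inj cjK. Qed.

Lemma cj_neq s : (cj s == s) = false.
Proof. by case: s => u []; rewrite /cj xpair_eqE eqxx. Qed.

Lemma cj_eq s t : (cj s == t) = (s == cj t).
Proof. by apply/eqP/eqP=> [<-|->]; rewrite cjK. Qed.

Lemma same_vertex s t : (s.1 == t.1) = (s == t) || (s == cj t).
Proof.
by case: s t => [u i] [v j]; rewrite /cj !xpair_eqE /=; case: i j => [] []; case: eqP.
Qed.

Lemma cover_neq s t : s.1 != t.1 -> (s != t) && (s != cj t).
Proof. by rewrite same_vertex negb_or. Qed.

Definition cjs S : {set V * bool} := [set s | cj s \in S].

Lemma in_cjs s S : (s \in cjs S) = (cj s \in S). Proof. by rewrite inE. Qed.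

Lemma cjsK : involutive cjs.
Proof. by move=> S; apply/setP=> s; rewrite !inE cjK. Qed.

Lemma cjsE S : cjs S = cj @: S.
Proof.
apply/setP=> s; rewrite inE; apply/idP/imsetP=> [H|[t tS ->]]; last by rewrite cjK.
by exists (cj s); rewrite ?cjK.
Qed.

Lemma card_cjs S : #|cjs S| = #|S|.
Proof. by rewrite cjsE card_imset //; exact: cj_inj. Qed.

Definition cedge s t : gedge V := edge s.1 t.1 (s.2 (+) t.2).
Definition adj E s t := cedge s t \in E.
(* A loop at v lifts to the single pair {(v, 0), (v, 1)}; the weight 2 makes every
   edge contribute 4 to [ee E S S] for S the preimage of a set containing its ends,
   and 2 for S a section over which it lifts. *)
Definition wt E s t : nat := (s.1 == t.1).+1 * adj E s t.
Definition ee E S T := \sum_(s in S) \sum_(t in T) wt E s t.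

Lemma cedgeC s t : cedge s t = cedge t s.
Proof. by rewrite /cedge edgeC addbC. Qed.

Lemma cedge_cj s t : cedge (cj s) (cj t) = cedge s t.
Proof. by rewrite /cedge /= addNb addbN negbK. Qed.

Lemma cedge_cjl s t : cedge (cj s) t = cedge s (cj t).
Proof. by rewrite -{1}(cjK t) cedge_cj. Qed.

Lemma cedge_eq s t s' t' : (cedge s t == cedge s' t') =
  [|| (s == s') && (t == t'), (s == t') && (t == s'),
      (s == cj s') && (t == cj t') | (s == cj t') && (t == cj s')].
Proof.
case: s t s' t' => [u i] [v j] [x k] [y l]; rewrite /cedge /cj edge_eq !xpair_eqE /=.
case: (u == x); case: (v == y); case: (u == y); case: (v == x);
by case: i j k l => [] [] [] [].
Qed.

Lemma adjC E s t : adj E s t = adj E t s.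
Proof. by rewrite /adj cedgeC. Qed.

Lemma adj_cj E s t : adj E (cj s) (cj t) = adj E s t.
Proof. by rewrite /adj cedge_cj. Qed.

Lemma adj_cjl E s t : adj E (cj s) t = adj E s (cj t).
Proof. by rewrite /adj cedge_cjl. Qed.

Lemma adj_irr E s : gain_graph E -> adj E s s = false.
Proof.
move=> gE; apply/negP=> H; have := gain_graph_ok gE H.
by rewrite eqxx addbb.
Qed.

Lemma edge_cedge (u v : V) a : edge u v a = cedge (u, false) (v, a).
Proof. by []. Qed.

Lemma wtC E s t : wt E s t = wt E t s.
Proof. by rewrite /wt eq_sym adjC. Qed.

Lemma wt_cj E s t : wt E (cj s) (cj t) = wt E s t.
Proof. by rewrite /wt adj_cj. Qed.

Lemma wt_ss E s : gain_graph E -> wt E s s = 0.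
Proof. by move=> gE; rewrite /wt adj_irr // muln0. Qed.

Lemma wtU E F s t : [disjoint E & F] -> wt (E :|: F) s t = wt E s t + wt F s t.
Proof.
move=> dEF; rewrite /wt /adj inE -mulnDr; congr (_ * _).
case: (boolP (cedge s t \in E)) => [H|_] //=.
by rewrite (disjointFr dEF H).
Qed.

Lemma wt_leU E F s t : wt (E :|: F) s t <= wt E s t + wt F s t.
Proof.
by rewrite /wt /adj inE -mulnDr leq_mul2l /=; case: (_ \in E); case: (_ \in F).
Qed.

(** The four products are the two lifts of the edge in both orders. For a loop, where [q = cj p],
    they coincide in pairs, which produces the weight 2. *)
Lemma wt_set1 s t p q : p != q ->
  wt [set cedge p q] s t =
  (s == p) * (t == q) + (s == cj p) * (t == cj q)
  + (s == q) * (t == p) + (s == cj q) * (t == cj p).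
Proof.
case: s t p q => [u i] [v j] [x k] [y l].
rewrite /wt /adj /cj inE /cedge edge_eq !xpair_eqE /= => pq.
case: (eqVneq x y) pq => [->|xy] /= pq.
  case: (eqVneq u v) => [->|uv] /=.
    by case: (v == y); case: i j k l pq => [] [] [] [].
  case: (eqVneq u y) uv => [->|uy]; rewrite ?eqxx /= ?andbF ?muln0 ?mul0n //=.
  by rewrite eq_sym => /negPf->; case: i j k l pq => [] [] [] [].
have yx : (y == x) = false by rewrite eq_sym; exact: negPf.
case: (eqVneq u x) => [->|ux].
  rewrite (negPf xy); case: (eqVneq v x) => [->|vx]; rewrite ?(negPf xy) /=.
    by case: i j k l {pq} => [] [] [] [].
  by case: (v == y); case: i j k l {pq} => [] [] [] [].
rewrite /= ?andbF /=.
case: (eqVneq v x) => [->|vx].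
  by rewrite (negPf ux); case: (u == y); case: i j k l {pq} => [] [] [] [].
by rewrite !andbF /= !muln0.
Qed.

Lemma eeE E S T : ee E S T = \sum_s \sum_t wt E s t * ((s \in S) * (t \in T)).
Proof.
rewrite /ee big_mkcond; apply: eq_bigr => s _.
case: (s \in S); last by rewrite big1 // => t _; rewrite muln0.
by rewrite big_mkcond; apply: eq_bigr => t _; case: (t \in T); rewrite ?muln1 ?muln0.
Qed.

Lemma eeC E S T : ee E S T = ee E T S.
Proof.
rewrite /ee exchange_big /=.
by apply: eq_bigr => s _; apply: eq_bigr => t _; rewrite wtC.
Qed.

(** Exchanging the sums turns a comparison of counts over lists of rectangles into a comparison at
    each pair of points, weighted by [wt]. The uncrossing inequalities are instances of this. *)
Lemma ee_leq E (l r : seq ({set V * bool} * {set V * bool})) :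
  (forall s t, \sum_(p <- l) (s \in p.1) * (t \in p.2)
            <= \sum_(p <- r) (s \in p.1) * (t \in p.2)) ->
  \sum_(p <- l) ee E p.1 p.2 <= \sum_(p <- r) ee E p.1 p.2.
Proof.
move=> H.
have K m : \sum_(p <- m) ee E p.1 p.2 =
    \sum_s \sum_t wt E s t * \sum_(p <- m) (s \in p.1) * (t \in p.2).
  under eq_bigr do rewrite eeE.
  rewrite exchange_big; apply: eq_bigr => s _; rewrite exchange_big.
  by apply: eq_bigr => t _; rewrite big_distrr.
rewrite !K; apply: leq_sum => s _; apply: leq_sum => t _.
by rewrite leq_mul2l H orbT.
Qed.

Lemma card_leq (l r : seq {set V * bool}) :
  (forall s, \sum_(A <- l) (s \in A) <= \sum_(A <- r) (s \in A)) ->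
  \sum_(A <- l) #|A| <= \sum_(A <- r) #|A|.
Proof.
have K (m : seq {set V * bool}) : \sum_(A <- m) #|A| = \sum_(s : V * bool) \sum_(A <- m) (s \in A).
  rewrite [RHS]exchange_big /=; apply: eq_bigr => A _.
  by rewrite -sum1_card big_mkcond; apply: eq_bigr => s _; case: (s \in A).
by move=> H; rewrite !K; apply: leq_sum => s _.
Qed.

Lemma ee_cjs E S T : ee E (cjs S) (cjs T) = ee E S T.
Proof.
rewrite !eeE (reindex_inj cj_inj); apply: eq_bigr => s _ /=.
rewrite (reindex_inj cj_inj); apply: eq_bigr => t _ /=.
by rewrite wt_cj !inE !cjK.
Qed.

Lemma eeU E F S T : [disjoint E & F] -> ee (E :|: F) S T = ee E S T + ee F S T.
Proof.
move=> dEF; rewrite /ee -big_split; apply: eq_bigr => s _.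
by rewrite -big_split; apply: eq_bigr => t _; rewrite wtU.
Qed.

Lemma ee_leU E F S T : ee (E :|: F) S T <= ee E S T + ee F S T.
Proof.
rewrite /ee -big_split; apply: leq_sum => s _.
by rewrite -big_split; apply: leq_sum => t _; rewrite wt_leU.
Qed.

Lemma eeD E F S T : F \subset E -> ee E S T = ee (E :\: F) S T + ee F S T.
Proof.
move=> FE; rewrite -eeU; last by rewrite disjoint_sym disjoints_subset setCD subsetUr.
by congr ee; rewrite setUC -{1}(setID E F) (setIidPr FE).
Qed.

Lemma ee_sub E F S T : F \subset E -> ee F S T <= ee E S T.
Proof. by move=> FE; rewrite (eeD _ _ FE) leq_addl. Qed.

Lemma ee0 S T : ee set0 S T = 0.
Proof. by rewrite /ee big1 // => s _; rewrite big1 // => t _; rewrite /wt /adj inE muln0. Qed.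

Lemma ee_mono E S T S' T' : S \subset S' -> T \subset T' -> ee E S T <= ee E S' T'.
Proof.
move=> /subsetP H /subsetP K.
have := @ee_leq E [:: (S, T)] [:: (S', T')]; rewrite !big_seq1 /=; apply=> s t.
rewrite !big_seq1 /=; case: (boolP (s \in S)) => // /H ->.
by case: (boolP (t \in T)) => // /K ->.
Qed.

Lemma sum_delta2 (p q : V * bool) S T :
  \sum_(s in S) \sum_(t in T) (s == p) * (t == q) = (p \in S) && (q \in T).
Proof.
have K (x : V * bool) (A : {set V * bool}) : \sum_(s in A) (s == x) = (x \in A).
  case: (boolP (x \in A)) => xA.
    by rewrite (bigD1 x) //= eqxx big1 // => i /andP[_ /negPf ->].
  by rewrite big1 // => i iA; case: eqVneq iA xA => // -> ->.
under eq_bigr do rewrite -big_distrr /= K.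
by rewrite -big_distrl /= K mulnb.
Qed.

Lemma ee_set1 p q S : p != q ->
  ee [set cedge p q] S S =
  2 * ((p \in S) && (q \in S)) + 2 * ((cj p \in S) && (cj q \in S)).
Proof.
move=> pq; rewrite /ee.
under eq_bigr do under eq_bigr do rewrite wt_set1 //.
under eq_bigr do rewrite !big_split /=.
rewrite !big_split /= !sum_delta2.
by case: (p \in S); case: (q \in S); case: (cj p \in S); case: (cj q \in S).
Qed.

Lemma ee_sum E S T : ee E S T = \sum_(e in E) ee [set e] S T.
Proof.
move: {2}#|E| (leqnn #|E|) => n; elim: n E => [|n IH] E.
  by rewrite leqn0 cards_eq0 => /eqP->; rewrite ee0 big_set0.
case: (set_0Vmem E) => [->|[e eE]]; first by rewrite ee0 big_set0.
rewrite (cardsD1 e) eE ltnS => /IH En.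
have dE : [disjoint [set e] & E :\ e] by rewrite disjoints_subset sub1set !inE eqxx.
by rewrite -{1}(setD1K eE) eeU // En -{2}(setD1K eE) big_setU1 // !inE eqxx.
Qed.
End Edges.

(** * Balance and the sparsity counts *)

Section Balanced.
Variable V : finType.
Implicit Types (E F : {set gedge V}) (p : V -> bool).

(** The usual characterisation of balance: switching at the vertices where [p] holds makes all gains
    of [F] trivial. *)
Definition potential p F := forall u v a, edge u v a \in F -> a = p u (+) p v.

(** The gains telescope along a closed walk, whose starting points and end points are the same list
    up to rotation. *)
Lemma potential_balanced p F : potential p F -> balanced F.
Proof.
move=> pF c /and4P[_ _ _ /allP cF].
have sz : size (rot 1 c) = size c by rewrite size_rot.
pose z := zip c (rot 1 c).
have z1 : unzip1 z = c by rewrite unzip1_zip ?sz.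
have z2 : unzip2 z = rot 1 c by rewrite unzip2_zip ?sz.
have zE x : x \in z -> x.1.2 = p x.1.1 (+) p x.2.1.
  by move=> xz; apply: pF; apply: cF; apply/mapP; exists x.
rewrite /walk_gain -{1}z1 /unzip1 big_map (eq_big_seq _ zE) big_split /=.
rewrite -(big_map (fst : _ * _ -> V * bool) xpredT (fun y => p y.1)).
rewrite -(big_map (snd : _ * _ -> V * bool) xpredT (fun y => p y.1)).
rewrite -/(unzip1 z) -/(unzip2 z) z1 z2.
by rewrite (perm_big (rot 1 c)) ?addbb // perm_sym perm_rot.
Qed.

Fixpoint path_steps p (x : V) (q : seq V) : seq (V * bool) :=
  if q is y :: q' then (x, p x (+) p y) :: path_steps p y q' else [::].

Fixpoint path_edges p (x : V) (q : seq V) : seq (gedge V) :=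
  if q is y :: q' then edge x y (p x (+) p y) :: path_edges p y q' else [::].

(** The second list is [rot 1 c] with an arbitrary last entry [z] in place of the head of [c].
    Leaving [z] free makes the statement inductive. *)
Lemma walk_edges_path p x q (z : V * bool) a :
  [seq edge i.1.1 i.2.1 i.1.2 | i <-
     let c := rcons (path_steps p x q) (last x q, a) in zip c (rcons (behead c) z)]
  = rcons (path_edges p x q) (edge (last x q) z.1 a).
Proof.
elim: q x => [|y q IH] x //=.
by case: q IH => [|w q] IH //=; congr cons; apply: IH.
Qed.

Lemma unzip1_path p x q a :
  unzip1 (rcons (path_steps p x q) (last x q, a)) = x :: q.
Proof. by elim: q x => [|y q IH] x //=; rewrite IH. Qed.

Lemma walk_gain_path p x q a :
  walk_gain (rcons (path_steps p x q) (last x q, a)) =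
  p x (+) p (last x q) (+) a.
Proof.
rewrite /walk_gain; elim: q x => [|y q IH] x /=.
  by rewrite big_seq1 addbb.
by rewrite big_cons IH !addbA addbK.
Qed.

Lemma path_edges_mem p x q e : e \in path_edges p x q -> e.1 \subset x :: q.
Proof.
elim: q x => [|y q IH] x //=; rewrite inE => /orP[/eqP->|/IH]; last first.
  by move=> /subset_trans; apply; apply/subsetP=> z zq; rewrite inE zq orbT.
by apply/subsetP=> z; rewrite !inE => /orP[]/eqP->; rewrite eqxx ?orbT.
Qed.

Lemma path_edges_uniq p x q : uniq (x :: q) -> uniq (path_edges p x q).
Proof.
elim: q x => [|y q IH] x //= /andP[xq /IH ->]; rewrite andbT.
apply/negP=> /path_edges_mem /subsetP /(_ x).
by rewrite !inE eqxx; move: xq; rewrite inE => /negPf-> /(_ isT).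
Qed.

Lemma path_edges_in p (r : rel V) (F : {set gedge V}) x q :
  (forall y z, r y z -> edge y z (p y (+) p z) \in F) ->
  path r x q -> {subset path_edges p x q <= F}.
Proof.
move=> H; elim: q x => [|y q IH] x //= /andP[/H xy /IH rq] z.
by rewrite inE => /orP[/eqP->|/rq].
Qed.

Lemma balanced_sub E F : F \subset E -> balanced E -> balanced F.
Proof.
move=> /subsetP FE bE c /and4P[c0 uc uw aF]; apply: bE; apply/and4P; split=> //.
by apply: sub_all aF => e /FE.
Qed.

(** Edges are added one at a time. If the potential of the rest does not fit the new edge, then
    either a path joins its ends and closes up to a cycle of gain -1, or the potential can be
    reversed on the component of [u]. *)
Lemma balanced_potential F : gain_graph F -> balanced F -> exists p, potential p F.
Proof.
move: {2}#|F| (leqnn #|F|) => n; elim: n F => [|n IH] F.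
  by rewrite leqn0 cards_eq0 => /eqP-> _ _; exists xpred0 => u v a; rewrite inE.
case: (set_0Vmem F) => [->|[e eF]] Fn gF bF.
  by exists xpred0 => u v a; rewrite inE.
have sF : F :\ e \subset F by apply: subsetDl.
have [|p pF] := IH (F :\ e) _ (gain_graph_sub sF gF) (balanced_sub sF bF).
  by move: Fn; rewrite (cardsD1 e) eF.
have /gain_graphP/(_ _ eF)[u [v [a [ee ok]]]] := gF.
have inF x y b : edge x y b \in F -> edge x y b = e \/ edge x y b \in F :\ e.
  by rewrite !inE => ->; rewrite andbT; case: eqP; [left|right].
have extend p' : potential p' (F :\ e) -> a = p' u (+) p' v -> potential p' F.
  move=> Hp Ha x y b /inF[]; last exact: Hp.
  rewrite ee => /eqP; rewrite edge_eq => /andP[/eqP->] /orP[]/andP[/eqP-> /eqP->] //.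
  by rewrite addbC.
case: (eqVneq u v) ok => [uv /= a1|uv _].
  exfalso; suff : true = false by [].
  rewrite -(bF [:: (u, true)]) ?/walk_gain ?big_seq1 //=.
  by rewrite /is_cycle /walk_edges /= andbT; move: eF; rewrite ee a1 -uv.
case: (eqVneq a (p u (+) p v)) => [Ha|nHa]; first by exists p; exact: extend.
pose r x y := [exists b, edge x y b \in F :\ e].
have [/connectP[q0 rq vq]|nc] := boolP (connect r u v).
  case/shortenP: rq vq => q rq uq _ vq.
  exfalso; suff : p u (+) p v (+) a = false.
    by move: nHa; case: (a); case: (p u); case: (p v).
  rewrite vq -walk_gain_path; apply: bF.
  have We : walk_edges (rcons (path_steps p u q) (last u q, a)) =
       rcons (path_edges p u q) (edge v u a).
    rewrite vq; case: q {rq uq} vq => [/eqP|y q]; first by rewrite eq_sym (negPf uv).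
    move=> _; rewrite /walk_edges rot1_cons.
    exact: (walk_edges_path p u (y :: q) (u, p u (+) p y) a).
  have peF : {subset path_edges p u q <= F :\ e}.
    apply: path_edges_in rq => x y /existsP[b xy].
    by rewrite -(pF _ _ _ xy).
  rewrite /is_cycle We unzip1_path uq rcons_uniq path_edges_uniq // andbT /=.
  apply/and3P; split; first by case: (path_steps _ _ _).
    by apply/negP=> /peF; rewrite !inE edgeC -ee eqxx.
  rewrite all_rcons /= edgeC -ee eF /=; apply/allP=> z /peF.
  by rewrite !inE => /andP[].
exists (fun x => p x (+) connect r u x); apply: extend => [x y b xy|].
  have rxy : r x y by apply/existsP; exists b.
  have ryx : r y x by apply/existsP; exists b; rewrite edgeC.
  have -> : connect r u x = connect r u y.
    by apply/idP/idP=> /connect_trans; apply; apply: connect1.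
  by rewrite (pF _ _ _ xy); case: (p x); case: (p y); case: (connect _ _ _).
by rewrite (negPf nc) connect0; move: nHa; case: (a); case: (p u); case: (p v).
Qed.
End Balanced.

Section Sparse.
Variable V : finType.
Implicit Types (E F D : {set gedge V}) (s t : V * bool) (S T : {set V * bool}).

Definition trans S := [forall s in S, cj s \notin S].
Definition symm S := cjs S == S.
Definition vlift (X : {set V}) : {set V * bool} := [set s | s.1 \in X].

Lemma transP S s : trans S -> s \in S -> (cj s \in S) = false.
Proof. by move=> /forall_inP/(_ s)/[apply]/negPf. Qed.

Lemma trans_and S s : trans S -> (s \in S) && (cj s \in S) = false.
Proof. by move=> tS; case: (boolP (s \in S)) => // /(transP tS) ->. Qed.

Lemma trans_nand S s : trans S -> ~~ ((s \in S) && (cj s \in S)).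
Proof. by move=> tS; rewrite trans_and. Qed.

Lemma transI S : (forall s, s \in S -> cj s \in S -> False) -> trans S.
Proof. by move=> H; apply/forall_inP=> s sS; apply/negP=> /(H _ sS). Qed.

Lemma trans_sub S T : S \subset T -> trans T -> trans S.
Proof.
by move=> /subsetP ST tT; apply: transI => s /ST /(transP tT) H /ST; rewrite H.
Qed.

Lemma trans_cjs S : trans S -> trans (cjs S).
Proof. by move=> tS; apply: transI => s; rewrite !inE cjK => a b; rewrite (transP tS b) in a. Qed.

Lemma symmP S s : symm S -> (cj s \in S) = (s \in S).
Proof. by move=> /eqP H; rewrite -{2}H inE. Qed.

Lemma symmI S : (forall s, s \in S -> cj s \in S) -> symm S.
Proof.
move=> H; apply/eqP/setP=> s; rewrite inE; apply/idP/idP=> [/H|/H //].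
by rewrite cjK.
Qed.

Lemma symm_vlift X : symm (vlift X). Proof. by apply: symmI=> s; rewrite !inE. Qed.

Lemma symmU S T : symm S -> symm T -> symm (S :|: T).
Proof. by move=> sS sT; apply: symmI=> s; rewrite !inE (symmP _ sS) (symmP _ sT). Qed.

Lemma symmI2 S T : symm S -> symm T -> symm (S :&: T).
Proof. by move=> sS sT; apply: symmI=> s; rewrite !inE (symmP _ sS) (symmP _ sT). Qed.

Lemma symmC S : symm S -> symm (~: S).
Proof. by move=> sS; apply: symmI=> s; rewrite !inE (symmP _ sS). Qed.

Lemma symmT : symm [set: V * bool].
Proof. by apply: symmI=> s; rewrite !inE. Qed.

Lemma card_vlift X : #|vlift X| = 2 * #|X|.
Proof.
have -> : vlift X = setX X [set: bool] by apply/setP=> -[x b]; rewrite !inE andbT.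
by rewrite cardsX cardsT card_bool mulnC.
Qed.

(** Over a vertex set X a symmetric set has 2 |X| points and each spanned edge counts 4; a
    transversal set has |X| points and each lifted edge counts 2. Both bounds therefore have leading
    term [4 * #|S|], and the constant 4 is twice the constant 2 of the balanced count. *)
Definition sparse E :=
  (forall S, symm S -> ee E S S <= 4 * #|S|) /\
  (forall S, trans S -> S != set0 -> ee E S S + 4 <= 4 * #|S|).

Lemma exists_cedge p q S :
  [exists s in S, [exists t in S, cedge p q == cedge s t]] =
  (p \in S) && (q \in S) || (cj p \in S) && (cj q \in S).
Proof.
apply/idP/idP=> [/exists_inP[s sS /exists_inP[t tS]]|].
  by rewrite cedge_eq => /or4P[]/andP[/eqP-> /eqP->]; rewrite ?cjK sS tS ?orbT.
case/orP=> /andP[pS qS]; apply/exists_inP.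
  by exists p => //; apply/exists_inP; exists q.
by exists (cj p) => //; apply/exists_inP; exists (cj q); rewrite ?cedge_cj.
Qed.

Lemma ee_trans E S : gain_graph E -> trans S ->
  ee E S S = 2 * #|[set e in E | [exists s in S, [exists t in S, e == cedge s t]]]|.
Proof.
move=> gE tS; rewrite ee_sum -sum1_card big_distrr /=.
rewrite [RHS](eq_bigl (fun e => (e \in E) && [exists s in S, [exists t in S, e == cedge s t]])).
  rewrite big_mkcondr; apply: eq_bigr => e /(elimT (gain_graphP _) gE)[u [v [a [-> ok]]]].
  rewrite edge_cedge ee_set1; last by rewrite xpair_eqE; case: (u == v) ok; case: a.
  rewrite exists_cedge; case: (boolP ((u, false) \in S)) => [/(transP tS) ->|_] /=.
    by rewrite orbF; case: (_ \in S).
  by case: (_ && _).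
by move=> e; rewrite inE.
Qed.

Lemma ee_vlift E (X : {set V}) : gain_graph E ->
  ee E (vlift X) (vlift X) = 4 * #|[set e in E | e.1 \subset X]|.
Proof.
move=> gE; rewrite ee_sum -sum1_card big_distrr /=.
rewrite [RHS](eq_bigl (fun e => (e \in E) && (e.1 \subset X))); last by move=> e; rewrite inE.
rewrite big_mkcondr; apply: eq_bigr => e /(elimT (gain_graphP _) gE)[u [v [a [-> ok]]]].
rewrite edge_cedge ee_set1; last by rewrite xpair_eqE; case: (u == v) ok; case: a.
by rewrite !inE /= subUset !sub1set; case: (u \in X); case: (v \in X).
Qed.

Lemma symm_vlift_eq S : symm S -> S = vlift [set x | (x, false) \in S].
Proof.
move=> sS; apply/setP=> -[x b]; rewrite !inE /=; case: b => //.
by rewrite -(symmP _ sS).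
Qed.

Lemma ee_setT E : gain_graph E -> ee E setT setT = 4 * #|E|.
Proof.
move=> gE; have -> : setT = vlift setT by apply/setP=> s; rewrite !inE.
rewrite ee_vlift //; congr (4 * #|pred_of_set _|); apply/setP=> e.
by rewrite !inE subsetT andbT.
Qed.

Lemma dvd_trans E S : gain_graph E -> trans S -> exists k, ee E S S = 2 * k.
Proof. by move=> gE tS; rewrite ee_trans //; eexists. Qed.

Lemma dvd_symm E S : gain_graph E -> symm S -> exists k, ee E S S = 4 * k.
Proof. by move=> gE /symm_vlift_eq->; rewrite ee_vlift //; eexists. Qed.

Lemma card_symm S : symm S -> exists k, #|S| = 2 * k.
Proof. by move=> /symm_vlift_eq->; rewrite card_vlift; eexists. Qed.

Lemma sparse_sub E F : F \subset E -> sparse E -> sparse F.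
Proof.
move=> FE [H1 H2]; split=> S HS; first exact: leq_trans (ee_sub _ _ FE) (H1 _ HS).
by move=> S0; apply: leq_trans (H2 _ HS S0); rewrite leq_add2r ee_sub.
Qed.

(** The levels of a transversal set form a potential for the edges that lift to it. Conversely a
    balanced set of edges lifts to the graph of its potential over its vertices. *)
Lemma sparse_gain_tight E : gain_graph E ->
  gain_tight_220 E <-> sparse E /\ #|E| = 2 * #|V|.
Proof.
move=> gE; split=> [[cE bE fE]|[[sE tE] cE]].
  split=> //; split=> S.
    move=> /symm_vlift_eq->; rewrite ee_vlift // card_vlift.
    set X := [set x | (x, false) \in S]; set F := [set e in E | e.1 \subset X].
    have FE : F \subset E by apply/subsetP=> e; rewrite inE => /andP[].
    have := fE F FE; have : #|vertices_of F| <= #|X|; last by lia.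
    by apply: subset_leq_card; apply/bigcupsP=> e; rewrite inE => /andP[].
  move=> tS S0; rewrite ee_trans //.
  set F := [set e in E | [exists s in S, [exists t in S, e == cedge s t]]].
  have FE : F \subset E by apply/subsetP=> e; rewrite inE => /andP[].
  have c0 : 0 < #|S| by rewrite card_gt0.
  have [->|F0] := eqVneq F set0; first by rewrite cards0; lia.
  have bF : balanced F.
    apply: (@potential_balanced _ (fun x => (x, true) \in S)) => u v a.
    rewrite inE => /andP[_ /exists_inP[s sS /exists_inP[t tS' /eqP]]].
    case: s t sS tS' => [x i] [y j] xS yS /eqP; rewrite /cedge edge_eq /=.
    have K z k : (z, k) \in S -> ((z, true) \in S) = k.
      by case: k => // zS; have := transP tS zS; rewrite /cj.
    by move=> /andP[/eqP->] /orP[]/andP[/eqP-> /eqP->]; rewrite (K _ _ xS) (K _ _ yS) // addbC.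
  have := bE F FE F0 bF; have : #|vertices_of F| <= #|S|; last by lia.
  apply: leq_trans (leq_imset_card (@fst V bool) S).
  apply: subset_leq_card; apply/bigcupsP=> e.
  rewrite inE => /andP[_ /exists_inP[s sS /exists_inP[t tS' /eqP->]]].
  by apply/subsetP=> x; rewrite /cedge /= !inE => /orP[]/eqP->; apply: imset_f.
split=> // F FE.
  move=> F0 bF; have gF := gain_graph_sub FE gE.
  have [p pF] := balanced_potential gF bF.
  pose S := [set s : V * bool | (s.1 \in vertices_of F) && (s.2 == p s.1)].
  have tS : trans S by apply: transI=> -[x b]; rewrite !inE /= => /andP[_ /eqP->] /andP[_]; case: (p x).
  have cS : #|S| = #|vertices_of F|.
    rewrite -(card_imset _ (_ : injective (fun x => (x, p x)))); last by move=> x y [].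
    apply: eq_card => -[x b]; rewrite !inE /=; apply/andP/imsetP=> [[xF /eqP->]|[y yF [-> ->]]].
      by exists x.
    by rewrite yF.
  have eeF : 2 * #|F| <= ee F S S.
    rewrite ee_trans // leq_mul2l /=; apply: subset_leq_card; apply/subsetP=> e eF.
    rewrite inE eF /=; have [u [v [a [ee ok]]]] := elimT (gain_graphP _) gF e eF.
    have [uF vF] : u \in vertices_of F /\ v \in vertices_of F.
      by split; apply/bigcupP; exists e; rewrite // ee !inE eqxx ?orbT.
    apply/exists_inP; exists (u, p u); first by rewrite inE uF /= eqxx.
    apply/exists_inP; exists (v, p v); first by rewrite inE vF /= eqxx.
    by rewrite /cedge /=; rewrite ee in eF *; rewrite -(pF _ _ _ eF).
  have S0 : S != set0.
    apply: contraNneq F0 => S0; rewrite -cards_eq0; move: eeF; rewrite S0.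
    by rewrite /ee big_set0 leqn0 muln_eq0.
  have := tE S tS S0; clearbody S; have := ee_sub S S FE; move: eeF; rewrite cS; lia.
have := sE _ (symm_vlift (vertices_of F)); rewrite ee_vlift // card_vlift.
set G := [set e in E | _ \subset _].
suff : #|F| <= #|G| by lia.
apply: subset_leq_card; apply/subsetP=> e eF; rewrite inE (subsetP FE) //=.
exact: (bigcup_sup e).
Qed.
End Sparse.

(** * Isomorphism, switching and vertex addition *)

Ltac sym_neqs :=
  repeat match goal with H : is_true (?a != ?b) |- _ =>
    lazymatch goal with
    | _ : is_true (b != a) |- _ => fail
    | _ => let K := fresh in pose proof H as K; rewrite eq_sym in K
    end
  end.

Ltac use_neqs :=
  sym_neqs; repeat match goal with H : is_true (?a != ?b) |- _ =>
    progress rewrite ?(negPf H) end.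

Definition memb (T : finType) (S : {set T}) (x : T) : bool := x \in S.

Ltac bool_atoms :=
  unfold reverse_coercion;
  repeat match goal with
  | |- context [@in_mem ?T ?a (@mem ?near_tight_quad ?P (@pred_of_set.body ?F ?S))] =>
      change (@in_mem T a (@mem near_tight_quad P (@pred_of_set.body F S))) with (memb S a)
  end;
  repeat match goal with
  | |- context [@memb ?T ?S ?a] =>
      let b := fresh "b" in generalize (@memb T S a); intro b
  end.

(* [reverse_coercion] is the identity; it makes convertible atoms look different. *)
Ltac rlia := unfold reverse_coercion in *; lia.

Definition ncard (T : finType) (S : {set T}) : nat := #|S|.

(* Like [rlia], but only uses what has been pushed into the goal. *)
Ltac nlia :=
  unfold reverse_coercion;
  repeat match goal with
  | |- context [@card.body ?T (@mem ?near_tight_quad ?P (@pred_of_set.body ?F ?S))] =>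
      change (@card.body T (@mem near_tight_quad P (@pred_of_set.body F S))) with (ncard S)
  end;
  repeat match goal with
  | |- context [@ee ?V ?E ?S ?T] => generalize (@ee V E S T)
  | |- context [@ncard ?T ?S] => generalize (@ncard T S)
  | |- context [@card.body ?T ?M] => generalize (@card.body T M)
  end; clear; lia.

Definition tight (V : finType) (E : {set gedge V}) :=
  sparse E /\ #|E| = 2 * #|V|.

Section Maps.
Variables V W : finType.
Implicit Types (f : V -> W) (E : {set gedge V}).

Definition pre f (S : {set W * bool}) : {set V * bool} := [set s | (f s.1, s.2) \in S].

Lemma in_pre f S s : (s \in pre f S) = ((f s.1, s.2) \in S).
Proof. by rewrite inE. Qed.

Lemma edge_map_edge f u v a : edge_map f (edge u v a) = edge (f u) (f v) a.
Proof. by rewrite /edge_map /edge /= imsetU !imset_set1. Qed.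

Lemma edge_map_inj f : injective f -> injective (edge_map f).
Proof. by move=> fI [A a] [B b] [/(imset_inj fI)-> ->]. Qed.

Lemma edge_in_map f E u v a : injective f ->
  (edge (f u) (f v) a \in map_edges f E) = (edge u v a \in E).
Proof. by move=> fI; rewrite -edge_map_edge mem_imset //; exact: edge_map_inj. Qed.

Lemma card_map_edges f E : injective f -> #|map_edges f E| = #|E|.
Proof. by move=> fI; rewrite card_imset //; exact: edge_map_inj. Qed.

Lemma gain_graph_map f E : injective f -> gain_graph E -> gain_graph (map_edges f E).
Proof.
move=> fI /gain_graphP gE; apply/gain_graphP=> _ /imsetP[e /gE[u [v [a [-> ok]]]] ->].
by rewrite edge_map_edge; exists (f u), (f v), a; rewrite (inj_eq fI).
Qed.

Lemma gain_edge_neq (X : finType) (u v : X) a : (u != v) || a -> (u, false) != (v, a).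
Proof. by rewrite xpair_eqE; case: (u == v); case: a. Qed.

Lemma ee_map f E (S : {set W * bool}) : injective f -> gain_graph E ->
  ee (map_edges f E) S S = ee E (pre f S) (pre f S).
Proof.
move=> fI /gain_graphP gE; rewrite ee_sum /map_edges big_imset /=; last first.
  by move=> e e' _ _; apply: edge_map_inj.
rewrite [RHS]ee_sum; apply: eq_bigr => e /gE[u [v [a [-> ok]]]].
rewrite edge_map_edge !edge_cedge !ee_set1 ?gain_edge_neq ?(inj_eq fI) //.
by rewrite !inE.
Qed.

Lemma symm_pre f S : symm S -> symm (pre f S).
Proof. by move=> sS; apply: symmI=> s; rewrite !inE -(symmP _ sS). Qed.

Lemma trans_pre f S : trans S -> trans (pre f S).
Proof. by move=> tS; apply: transI=> s; rewrite !inE => /(transP tS); rewrite /cj => ->. Qed.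

Lemma card_pre_bij f (S : {set W * bool}) : bijective f -> #|pre f S| = #|S|.
Proof.
case=> g fK gK; have -> : pre f S = [set (g s.1, s.2) | s in S].
  apply/setP=> -[x b]; rewrite inE /=; apply/idP/imsetP=> [H|[[y c] yS [-> ->]]].
    by exists (f x, b); rewrite //= fK.
  by rewrite gK.
by rewrite card_imset // => -[x b] [y c] /= [/(can_inj gK)-> ->].
Qed.

Lemma tight_iso f E : bijective f -> gain_graph E -> tight E -> tight (map_edges f E).
Proof.
move=> bf gE [[H1 H2] cE]; have fI := bij_inj bf.
split; last by rewrite card_map_edges // cE (bij_eq_card bf).
split=> S HS; rewrite ee_map // -(card_pre_bij S bf); first exact/H1/symm_pre.
move=> S0; apply: H2; first exact: trans_pre.
by rewrite -card_gt0 card_pre_bij // card_gt0.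
Qed.
End Maps.

Lemma map_edgesK (V W : finType) (f : V -> W) g (E : {set gedge V}) :
  cancel f g -> map_edges g (map_edges f E) = E.
Proof.
move=> fK; rewrite /map_edges -imset_comp -[RHS]imset_id; apply: eq_imset => -[A a] /=.
rewrite /edge_map /= -imset_comp (eq_imset _ (g := id)) ?imset_id //.
Qed.

Section Switch.
Variable V : finType.
Implicit Types (E : {set gedge V}).

Definition flip (v : V) (s : V * bool) := (s.1, s.2 (+) (s.1 == v)).

Lemma flipK v : involutive (flip v).
Proof. by case=> x b; rewrite /flip /= addbK. Qed.

Lemma switchK v : involutive (@switch V v).
Proof.
move=> E; rewrite /switch -imset_comp -[RHS]imset_id; apply: eq_imset => -[A a] /=.
by rewrite addbK.
Qed.

Lemma adj_switch v E s t : gain_graph E ->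
  adj (switch v E) s t = adj E (flip v s) (flip v t).
Proof.
move=> gE.
have K (F : {set gedge V}) (p q : V * bool) :
    adj F p q -> adj (switch v F) (flip v p) (flip v q).
  move=> pq; apply/imsetP; exists (cedge p q) => //.
  rewrite /cedge /edge /= cards2 !inE; congr (_, _).
  rewrite !(eq_sym v); case: p q {pq} => [x i] [y j] /=.
  case: (eqVneq x y) => [->|xy]; first by case: (y == v); case: i; case: j.
  case: (eqVneq x v) xy => [->|_]; case: (eqVneq y v) => _;
    rewrite ?eqxx //; by case: i; case: j.
apply/idP/idP=> [/K|/K]; last by rewrite !flipK.
by rewrite switchK.
Qed.

Lemma gain_graph_switch v E : gain_graph E -> gain_graph (switch v E).
Proof.
move=> /forall_inP gE; apply/forall_inP=> _ /imsetP[e /gE H ->] /=.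
by case/orP: H => [->//|/andP[/eqP-> /eqP->]]; rewrite eqxx andbF.
Qed.

Lemma card_switch v E : #|switch v E| = #|E|.
Proof.
apply/eqP; rewrite eqn_leq leq_imset_card -{1}(switchK v E).
exact: leq_imset_card.
Qed.

Definition flips v (S : {set V * bool}) := [set s | flip v s \in S].

Lemma ee_switch v E S T : gain_graph E ->
  ee (switch v E) S T = ee E (flips v S) (flips v T).
Proof.
move=> gE; rewrite !eeE (reindex_inj (inv_inj (flipK v))); apply: eq_bigr => s _ /=.
rewrite (reindex_inj (inv_inj (flipK v))); apply: eq_bigr => t _ /=.
by rewrite /wt adj_switch // !flipK !inE.
Qed.

Lemma card_flips v S : #|flips v S| = #|S|.
Proof.
have -> : flips v S = flip v @: S.
  apply/setP=> s; rewrite inE; apply/idP/imsetP=> [H|[t tS ->]]; last by rewrite flipK.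
  by exists (flip v s); rewrite ?flipK.
by rewrite card_imset //; exact: inv_inj (flipK v).
Qed.

Lemma flip_cj v s : flip v (cj s) = cj (flip v s).
Proof. by rewrite /flip /cj /= addNb. Qed.

Lemma symm_flips v S : symm S -> symm (flips v S).
Proof. by move=> sS; apply: symmI=> s; rewrite !inE flip_cj (symmP _ sS). Qed.

Lemma trans_flips v S : trans S -> trans (flips v S).
Proof. by move=> tS; apply: transI=> s; rewrite !inE flip_cj => /(transP tS)->. Qed.

Lemma tight_switch v E : gain_graph E -> tight E -> tight (switch v E).
Proof.
move=> gE [[H1 H2] cE]; split; last by rewrite card_switch.
split=> S HS; rewrite ee_switch // -(card_flips v S); first exact/H1/symm_flips.
move=> S0; apply: H2; first exact: trans_flips.
by rewrite -card_gt0 card_flips card_gt0.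
Qed.
End Switch.

Section AddVertex.
Variable V : finType.
Implicit Types (E D : {set gedge V}) (N : {set gedge (option V)}).

(** The room for the new edges inside S: the count of the deleted edges, plus 4 for each point of S
    over the new vertex. One condition serves symmetric and transversal sets alike. *)
Definition new_ok D N := forall S,
  ee N S S <= ee D (pre Some S) (pre Some S)
              + 4 * (((None, false) \in S) + ((None, true) \in S)).

Lemma card_option_cover (S : {set option V * bool}) :
  #|S| = #|pre Some S| + (((None, false) \in S) + ((None, true) \in S)).
Proof.
rewrite (cardsD1 (None, false)) (cardsD1 (None, true) (S :\ _)) !inE /= addnA addnC.
congr (_ + _).
have -> : S :\ (None, false) :\ (None, true) = (fun s => (Some s.1, s.2)) @: pre Some S.
  apply/setP=> -[x b]; rewrite !inE !xpair_eqE; apply/and3P/imsetP=> /=.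
    case: x => [x [_ _ xS]|[]]; last by case: b.
    by exists (x, b); rewrite ?inE.
  by move=> [[y c] yS [-> ->]]; rewrite inE in yS.
by rewrite card_imset // => -[x b] [y c] [-> ->].
Qed.

Lemma ee_add_vertex E D N S : gain_graph E -> D \subset E ->
  ee (add_vertex E D N) S S + ee D (pre Some S) (pre Some S)
  <= ee E (pre Some S) (pre Some S) + ee N S S.
Proof.
move=> gE DE; have := ee_leU (map_edges Some (E :\: D)) N S S.
rewrite ee_map; [|exact: Some_inj|exact: gain_graph_sub (subsetDl _ _) gE].
by rewrite (eeD (pre Some S) (pre Some S) DE) addnAC leq_add2r.
Qed.

Lemma sparse_add_vertex E D N : gain_graph E -> sparse E -> D \subset E ->
  gain_graph (add_vertex E D N) -> new_ok D N -> sparse (add_vertex E D N).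
Proof.
move=> gE [H1 H2] DE gE' ok; split=> S HS.
  have := ee_add_vertex N S gE DE; have := ok S; have := H1 _ (symm_pre Some HS).
  by have := card_option_cover S; rlia.
move=> S0; have [E0|N0] := eqVneq (pre Some S) set0; last first.
  have := ee_add_vertex N S gE DE; have := ok S; have := H2 _ (trans_pre Some HS) N0.
  by have := card_option_cover S; rlia.
(* The transversal bound holds for nonempty sets only, so it says nothing about [pre Some S] here.
   But then S is a single point over the new vertex and spans nothing. *)
have [s sS] : exists s, S = [set s].
  apply/cards1P; rewrite card_option_cover E0 cards0 eqn_leq.
  have := S0; rewrite -card_gt0 card_option_cover E0 cards0 => ->.
  have := trans_and (None, false) HS; rewrite /cj /=.
  by case: ((_, false) \in S); case: ((_, true) \in S).
by rewrite sS /ee !big_set1 wt_ss // cards1.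
Qed.

Lemma card_add_vertex E D N : D \subset E -> (forall e, e \in N -> None \in e.1) ->
  #|add_vertex E D N| = #|E| - #|D| + #|N|.
Proof.
move=> DE HN; rewrite cardsU (_ : _ :&: N = set0) ?cards0 ?subn0.
  by rewrite card_map_edges ?cardsDS //; exact: Some_inj.
apply/setP=> e; rewrite !inE; apply/negP=> /andP[/imsetP[e' _ ->] /HN /imsetP[]] //.
Qed.

Lemma tight_add_vertex E D N : gain_graph E -> tight E -> D \subset E ->
  gain_graph (add_vertex E D N) -> (forall e, e \in N -> None \in e.1) ->
  #|N| = #|D| + 2 -> new_ok D N -> tight (add_vertex E D N).
Proof.
move=> gE [sE cE] DE gE' HN cN ok; split; first exact: sparse_add_vertex.
rewrite card_add_vertex // card_option; have := subset_leq_card DE; lia.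
Qed.

Lemma card_setU1r (T : finType) (A : {set T}) x : #|A :|: [set x]| = (x \notin A) + #|A|.
Proof. by rewrite setUC cardsU1. Qed.

Lemma ee_setU1 (X : finType) (F : {set gedge X}) e S :
  ee (F :|: [set e]) S S <= ee F S S + ee [set e] S S.
Proof. exact: ee_leU. Qed.

Lemma ee_set2 (X : finType) (e e' : gedge X) S : e != e' ->
  ee [set e; e'] S S = ee [set e] S S + ee [set e'] S S.
Proof.
by move=> ne; rewrite eeU // disjoints_subset sub1set !inE.
Qed.

Lemma to_new_eq (x y : V) a b : (to_new x a == to_new y b) = (x == y) && (a == b).
Proof. by rewrite /to_new edge_eq (inj_eq Some_inj) eqxx /= ?andbT ?andbF ?orbF andbC. Qed.

Lemma to_new_loop (x : V) a : (to_new x a == new_loop V) = false.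
Proof. by rewrite /to_new edge_eq /= ?andbF. Qed.

Lemma new_loop_to (x : V) a : (new_loop V == to_new x a) = false.
Proof. by rewrite eq_sym to_new_loop. Qed.

Definition newE := (to_new_eq, to_new_loop, new_loop_to).
End AddVertex.

(** * The moves preserve tightness *)

Section HMoves.
Variable V : finType.
Implicit Types (E D : {set gedge V}) (N : {set gedge (option V)}).

Lemma ee_le2 (X : finType) (e1 e2 : gedge X) S :
  ee [set e1; e2] S S <= ee [set e1] S S + ee [set e2] S S.
Proof. exact: ee_setU1. Qed.

Lemma ee_le3 (X : finType) (e1 e2 e3 : gedge X) S :
  ee [set e1; e2; e3] S S <= ee [set e1] S S + ee [set e2] S S + ee [set e3] S S.
Proof. by apply: leq_trans (ee_setU1 _ _ _) _; rewrite leq_add2r ee_le2. Qed.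

Lemma ee_le4 (X : finType) (e1 e2 e3 e4 : gedge X) S :
  ee [set e1; e2; e3; e4] S S
  <= ee [set e1] S S + ee [set e2] S S + ee [set e3] S S + ee [set e4] S S.
Proof. by apply: leq_trans (ee_setU1 _ _ _) _; rewrite leq_add2r ee_le3. Qed.

Lemma ee_edge (X : finType) (u v : X) a S : (u != v) || a ->
  ee [set edge u v a] S S =
  2 * (((u, false) \in S) && ((v, a) \in S))
  + 2 * (((u, true) \in S) && ((v, ~~ a) \in S)).
Proof. by move=> ok; rewrite edge_cedge ee_set1 // gain_edge_neq. Qed.

Lemma ee_to_new (x : V) a S :
  ee [set to_new x a] S S =
  2 * (((Some x, false) \in S) && ((None, a) \in S))
  + 2 * (((Some x, true) \in S) && ((None, ~~ a) \in S)).
Proof. exact: ee_edge. Qed.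

Lemma ee_new_loop S :
  ee [set new_loop V] S S =
  2 * (((None, false) \in S) && ((None, true) \in S))
  + 2 * (((None, true) \in S) && ((None, false) \in S)).
Proof. by apply: ee_edge; rewrite orbT. Qed.

Lemma ee_loop (X : finType) (x : X) S :
  ee [set loop x] S S =
  2 * (((x, false) \in S) && ((x, true) \in S))
  + 2 * (((x, true) \in S) && ((x, false) \in S)).
Proof. by apply: ee_edge; rewrite orbT. Qed.

Lemma edge_neq_vertices (x y z w : V) a b :
  x \notin [:: z; w] -> edge x y a != edge z w b.
Proof. by rewrite !inE negb_or edge_eq => /andP[/negPf-> /negPf->]; rewrite andbF. Qed.

End HMoves.

Ltac new_tac :=
  rewrite ?ee_to_new ?ee_new_loop ?ee_loop ?in_pre /=;
  repeat match goal with a : bool |- _ => destruct a end;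
  rewrite ?in_pre /=; bool_atoms; by_truth_table.

Ltac none_tac :=
  let e := fresh "e" in let H := fresh "H" in
  intros e H; rewrite !inE in H;
  repeat match type of H with
  | is_true (_ || _) => destruct (orP H) as [H0|H0]; clear H; rename H0 into H
  end; rewrite (eqP H) !inE eqxx ?orbT; reflexivity.

Section HTight.
Variable V : finType.
Implicit Types (E D : {set gedge V}).

Lemma H1_tight E (E' : {set gedge (option V)}) : gain_graph E -> tight E -> H1_move E E' -> gain_graph E' -> tight E'.
Proof.
move=> gE tE; case=> [x y a b|x|x a].
- rewrite /= inE andbT => xy gE'; apply: tight_add_vertex => //.
  + exact: sub0set.
  + by none_tac.
  + by rewrite cards0 cards2 newE (negPf xy).
  + move=> S; apply: leq_trans (ee_le2 _ _ _) _; rewrite ee0; new_tac.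
- move=> gE'; apply: tight_add_vertex => //.
  + exact: sub0set.
  + by none_tac.
  + by rewrite cards0 cards2 newE andbF.
  + move=> S; apply: leq_trans (ee_le2 _ _ _) _; rewrite ee0; new_tac.
- move=> gE'; apply: tight_add_vertex => //.
  + exact: sub0set.
  + by none_tac.
  + by rewrite cards0 cards2 newE.
  + move=> S; apply: leq_trans (ee_le2 _ _ _) _; rewrite ee0; new_tac.
Qed.

Lemma H2_tight E (E' : {set gedge (option V)}) : gain_graph E -> tight E -> H2_move E E' -> gain_graph E' -> tight E'.
Proof.
move=> gE tE; case=> [x y z a b c d u xyE abc|x y a d|x y d|x y a b c|x].
- subst a; move: u; rewrite /= !inE !negb_or andbT => /andP[/andP[xy xz] yz] gE'.
  apply: tight_add_vertex => //; first by rewrite sub1set.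
  + by none_tac.
  + by rewrite !card_setU1r !cards1 !inE !newE; use_neqs; rewrite ?andbF.
  + move=> S; apply: leq_trans (ee_le3 _ _ _ _) _; rewrite ee_edge ?xy //; new_tac.
- rewrite /= !inE andbT => xy xyE gE'.
  apply: tight_add_vertex => //; first by rewrite sub1set.
  + by none_tac.
  + by rewrite !card_setU1r !cards1 !inE !newE; use_neqs; rewrite ?andbF.
  + move=> S; apply: leq_trans (ee_le3 _ _ _ _) _; rewrite ee_edge ?xy //; new_tac.
- rewrite /= !inE andbT => xy xyE gE'.
  apply: tight_add_vertex => //; first by rewrite sub1set.
  + by none_tac.
  + by rewrite !card_setU1r !cards1 !inE !newE; use_neqs; rewrite ?andbF.
  + move=> S; apply: leq_trans (ee_le3 _ _ _ _) _; new_tac.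
- rewrite /= !inE andbT => xy xyE abc gE'; subst a.
  apply: tight_add_vertex => //; first by rewrite sub1set.
  + by none_tac.
  + by rewrite !card_setU1r !cards1 !inE !newE; use_neqs; rewrite ?andbF.
  + move=> S; apply: leq_trans (ee_le3 _ _ _ _) _; rewrite ee_edge ?xy //; new_tac.
- move=> xE gE'.
  apply: tight_add_vertex => //; first by rewrite sub1set.
  + by none_tac.
  + by rewrite !card_setU1r !cards1 !inE !newE; use_neqs; rewrite ?andbF.
  + move=> S; apply: leq_trans (ee_le3 _ _ _ _) _; new_tac.
Qed.

Lemma H3_tight E (E' : {set gedge (option V)}) : gain_graph E -> tight E -> H3_move E E' -> gain_graph E' -> tight E'.
Proof.
move=> gE tE; case=> [x y z w a b c d e f u xyE zwE cda efb|x y w a b u xyE ywE|x z w b e f u xE zwE efb|x z u xE zE].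
- subst a b; move: u; rewrite /= !inE !negb_or andbT.
  move=> /and3P[/and3P[xy xz xw] /andP[yz yw] zw] gE'.
  have ne : edge x y (c (+) d) != edge z w (e (+) f) by apply: edge_neq_vertices; rewrite !inE; use_neqs.
  apply: tight_add_vertex => //; first by rewrite subUset !sub1set xyE.
  + by none_tac.
  + by rewrite !card_setU1r !cards1 !inE !newE; use_neqs; rewrite ?andbF.
  + move=> S; apply: leq_trans (ee_le4 _ _ _ _ _) _.
    rewrite ee_set2 // !ee_edge ?xy ?zw //; new_tac.
- move: u; rewrite /= !inE !negb_or andbT => /andP[/andP[xy xw] yw] gE'.
  have ne : edge x y a != edge y w b by apply: edge_neq_vertices; rewrite !inE; use_neqs.
  apply: tight_add_vertex => //; first by rewrite subUset !sub1set xyE.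
  + by none_tac.
  + by rewrite !card_setU1r !cards1 !inE !newE; use_neqs; rewrite ?andbF.
  + move=> S; apply: leq_trans (ee_le4 _ _ _ _ _) _.
    rewrite ee_set2 // !ee_edge ?xy ?yw //; new_tac.
- subst b; move: u; rewrite /= !inE !negb_or andbT => /andP[/andP[xz xw] zw] gE'.
  have ne : loop x != edge z w (e (+) f) by apply: edge_neq_vertices; rewrite !inE; use_neqs.
  apply: tight_add_vertex => //; first by rewrite subUset !sub1set xE.
  + by none_tac.
  + by rewrite !card_setU1r !cards1 !inE !newE; use_neqs; rewrite ?andbF.
  + move=> S; apply: leq_trans (ee_le4 _ _ _ _ _) _.
    rewrite ee_set2 // !ee_loop !ee_edge ?zw //; new_tac.
- move: u; rewrite /= !inE andbT => xz gE'.
  have ne : loop x != loop z by apply: edge_neq_vertices; rewrite !inE; use_neqs.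
  apply: tight_add_vertex => //; first by rewrite subUset !sub1set xE.
  + by none_tac.
  + by rewrite !card_setU1r !cards1 !inE !newE; use_neqs; rewrite ?andbF.
  + move=> S; apply: leq_trans (ee_le4 _ _ _ _ _) _.
    rewrite ee_set2 // !ee_loop; new_tac.
Qed.
End HTight.

(** * The base graphs and their disjoint unions *)

Section Base.
Variable V : finType.
Implicit Types (E D : {set gedge V}) (S T : {set V * bool}).

Lemma trans_card S : trans S -> #|S| <= #|V|.
Proof.
move=> tS; rewrite -(card_in_imset (f := fst) (D := S)) ?max_card //.
move=> [x b] [y c] xS yS /= xy; subst y; congr pair.
case: (eqVneq b c) => // bc; move: (transP tS xS).
by rewrite /cj /= (_ : ~~ b = c) ?yS //; move: bc; case: b xS; case: c yS.
Qed.

Lemma wt_trans_le1 E S s t : gain_graph E -> trans S -> s \in S -> t \in S ->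
  wt E s t <= (s != t).
Proof.
move=> gE tS sS tS'; case: eqVneq => [<-|st]; first by rewrite wt_ss.
rewrite /wt same_vertex (negPf st) /= (_ : s == cj t = false); first by rewrite mul1n; case: adj.
by apply: contraTF sS => /eqP->; rewrite (transP tS tS').
Qed.

Lemma ee_trans_le E S : gain_graph E -> trans S -> ee E S S <= #|S| * (#|S|.-1).
Proof.
move=> gE tS; rewrite -sum_nat_const; apply: leq_sum => s sS.
apply: (@leq_trans (\sum_(t in S) (s != t))).
  by apply: leq_sum => t tS'; apply: wt_trans_le1 sS tS'.
rewrite (bigD1 s) //= eqxx add0n.
have -> : #|S|.-1 = #|S :\ s| by rewrite (cardsD1 s S) sS.
rewrite -sum1_card [X in _ <= X](eq_bigl (fun t => (t \in S) && (t != s))).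
  by apply: leq_sum => t _; case: eqP.
by move=> t; rewrite !inE andbC.
Qed.

(** A balanced graph on k vertices has at most k(k-1)/2 edges, and this is at most 2k - 2 for k
    between 1 and 4. *)
Lemma base_trans E S : gain_graph E -> #|V| <= 4 -> trans S -> S != set0 ->
  ee E S S + 4 <= 4 * #|S|.
Proof.
move=> gE V4 tS; rewrite -card_gt0 => S0.
have := leq_trans (trans_card tS) V4; have := ee_trans_le gE tS.
by move: (#|S|) S0 => [|[|[|[|[|n]]]]] //=; lia.
Qed.

Lemma ee_wt_le2 E s t : wt E s t <= (s.1 == t.1).+1.
Proof. by rewrite /wt; case: adj; rewrite ?muln1 ?muln0. Qed.

Definition pos_level S : {set V * bool} := [set s in S | ~~ s.2].

Lemma pos_level_trans S : trans (pos_level S).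
Proof. by apply: transI=> -[x []]; rewrite !inE /= ?andbF. Qed.

Lemma pos_level_split S : symm S -> S = pos_level S :|: cjs (pos_level S).
Proof.
move=> sS; apply/setP=> -[x b]; rewrite !inE /= negbK (symmP _ sS).
by case: b; rewrite ?andbT ?andbF ?orbF.
Qed.

Lemma ee_split E P : trans P ->
  ee E (P :|: cjs P) (P :|: cjs P) = 2 * ee E P P + 2 * ee E P (cjs P).
Proof.
move=> tP; have L : ee E (cjs P) (cjs P) = ee E P P := ee_cjs _ _ _.
have C : ee E (cjs P) P = ee E P (cjs P) := eeC _ _ _.
have := @ee_leq _ E [:: (P :|: cjs P, P :|: cjs P)] [:: (P, P); (P, cjs P); (cjs P, P); (cjs P, cjs P)].
have := @ee_leq _ E [:: (P, P); (P, cjs P); (cjs P, P); (cjs P, cjs P)] [:: (P :|: cjs P, P :|: cjs P)].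
rewrite !big_cons !big_nil !addn0 /= => H1 H2; apply/eqP; rewrite eqn_leq; apply/andP; split.
  apply: leq_trans (H2 _) _; last lia.
  move=> s t; rewrite !big_cons !big_nil /= !inE.
  by case: (s \in P); case: (cj s \in P); case: (t \in P); case: (cj t \in P).
apply: leq_trans (H1 _); first lia.
move=> s t; rewrite !big_cons !big_nil /= !inE.
have := trans_and s tP; have := trans_and t tP.
by case: (s \in P); case: (cj s \in P); case: (t \in P); case: (cj t \in P).
Qed.

Lemma card_split (P : {set V * bool}) : trans P -> #|P :|: cjs P| = 2 * #|P|.
Proof.
move=> tP; rewrite cardsU card_cjs (_ : _ :&: _ = set0) ?cards0; first by lia.
by apply/setP=> s; rewrite !inE trans_and.
Qed.

(** On k vertices there are at most k(k-1) non-loop edges and k loops, hence at most k^2 edges; here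
    S has 2k points. *)
Lemma ee_symm_le E S : gain_graph E -> symm S -> ee E S S <= #|S| * #|S|.
Proof.
move=> gE sS; rewrite {1 2}(pos_level_split sS) ee_split ?pos_level_trans //.
have cS := card_split (pos_level_trans S); rewrite -(pos_level_split sS) in cS.
have H1 := ee_trans_le gE (pos_level_trans S).
suff H2 : ee E (pos_level S) (cjs (pos_level S)) <= #|pos_level S| * #|pos_level S|.+1.
  by move: (#|pos_level S|) H1 H2 cS => [|n] /=; nia.
rewrite -sum_nat_const; apply: leq_sum => s sS'.
apply: (@leq_trans (\sum_(t in cjs (pos_level S)) (1 + (t == cj s)))).
  apply: leq_sum => t; rewrite !inE /= => /andP[_]; rewrite negbK => t2.
  apply: leq_trans (ee_wt_le2 _ _ _) _; rewrite same_vertex -cj_eq (eq_sym t).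
  have -> : s == t = false; last by [].
  by apply/eqP=> st; move: sS'; rewrite st inE t2 andbF.
rewrite big_split /= sum1_card card_cjs -addn1 leq_add2l.
have sC : cj s \in cjs (pos_level S) by rewrite in_cjs cjK.
by rewrite (bigD1 (cj s)) //= eqxx big1 // => t /andP[_ /negPf->].
Qed.

(** The trivial bound k^2 is at most 2k for k up to 2. Three vertices are all vertices, where the
    number of edges is given. *)
Lemma base_small E : gain_graph E -> #|V| <= 3 -> #|E| = 2 * #|V| -> tight E.
Proof.
move=> gE V3 cE; split=> //; split=> S HS; last by apply: base_trans => //; apply: leq_trans V3 _.
have [k cS] := card_symm HS.
have : #|S| <= 2 * #|V| by rewrite mulnC -card_bool -card_prod max_card.
have H := ee_symm_le gE HS; move=> SV.
have [k3|k3] := leqP 3 k; last by rewrite cS in H *; move: k k3 H {cS SV} => [|[|[|]]] //=; lia.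
have ST : S = setT.
  apply/eqP; rewrite eqEcard subsetT cardsT card_prod card_bool cS; lia.
rewrite ST ee_setT // cE cardsT card_prod card_bool; lia.
Qed.

Lemma adj_complete s t : adj (complete V) s t = (s.1 != t.1) && (s.2 == t.2).
Proof.
rewrite /adj /complete; case: s t => [x b] [y c] /=; apply/imsetP/andP=> /=.
  move=> [[u v]]; rewrite inE /= => uv /eqP; rewrite edge_eq /=.
  by case: b; case: c => //= /orP[]/andP[/eqP-> /eqP->] //; rewrite eq_sym.
by move=> [xy /eqP->]; exists (x, y); rewrite ?inE //= /cedge /= addbb.
Qed.

Lemma gain_graph_complete : gain_graph (complete V).
Proof.
apply/gain_graphP=> e /imsetP[[x y]]; rewrite inE /= => xy ->.
by exists x, y, false; rewrite xy.
Qed.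

Lemma wt_complete s t : wt (complete V) s t = (s.1 != t.1) && (s.2 == t.2).
Proof. by rewrite /wt adj_complete; case: eqP => //=; case: (_ == _). Qed.

Lemma ee_complete_cross P : trans P -> (forall s, s \in P -> ~~ s.2) ->
  ee (complete V) P (cjs P) = 0.
Proof.
move=> tP P0; rewrite /ee big1 // => s /P0 s2; rewrite big1 // => t; rewrite inE => /P0.
by rewrite wt_complete /= negbK; case: (s.2) s2 => // _ ->; rewrite andbF.
Qed.

Lemma ee_complete_pos P : trans P -> (forall s, s \in P -> ~~ s.2) ->
  ee (complete V) P P = #|P| * #|P|.-1.
Proof.
move=> tP P0; rewrite -sum_nat_const; apply: eq_bigr => s sP.
rewrite (cardsD1 s P) sP /= -sum1_card.
rewrite (bigD1 s) //= wt_complete eqxx add0n.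
rewrite [RHS](eq_bigl (fun t => (t \in P) && (t != s))); last by move=> t; rewrite !inE andbC.
apply: eq_bigr => t /andP[tP' ts]; rewrite wt_complete same_vertex eq_sym (negPf ts) /=.
have := P0 _ sP; have := P0 _ tP'; case: t s {ts sP tP'} => [x []] [y []] //= _ _.
by rewrite /cj xpair_eqE andbF.
Qed.

Lemma card_complete : #|complete V| = 'C(#|V|, 2).
Proof.
have := ee_setT gain_graph_complete; rewrite (pos_level_split (symmT V)) ee_split ?pos_level_trans //.
have h0 s : s \in pos_level setT -> ~~ s.2 by rewrite !inE.
rewrite ee_complete_pos ?ee_complete_cross ?pos_level_trans // => H.
have := card_split (pos_level_trans [set: V * bool]); rewrite -pos_level_split ?symmT //.
rewrite cardsT card_prod card_bool => H2; have e : #|pos_level setT| = #|V| by lia.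
rewrite bin2; move: H; rewrite e; lia.
Qed.

(** On k vertices the complete graph contributes 2k(k-1) to the symmetric count and the two negative
    edges at most 8. The sum is at most 8k for k between 2 and 4, and the trivial bound settles
    smaller k. *)
Lemma base_K4 e1 e2 : #|V| = 4 -> e1 != e2 -> gain_graph [set e1; e2] ->
  e1.2 -> e2.2 -> tight (complete V :|: [set e1; e2]).
Proof.
move=> V4 ne g12 n1 n2.
have dis : [disjoint complete V & [set e1; e2]].
  rewrite -setI_eq0; apply/eqP/setP=> e; rewrite !inE; apply/negP=> /andP[/imsetP[p _ ->]].
  by move=> /orP[]/eqP ee; [rewrite -ee in n1|rewrite -ee in n2].
have gE : gain_graph (complete V :|: [set e1; e2]).
  exact: gain_graphU gain_graph_complete g12.
split; last first.
  have /eqP di : complete V :&: [set e1; e2] == set0 by rewrite setI_eq0.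
  by rewrite cardsU di cards0 card_complete cards2 V4 ne.
split=> S HS; last by apply: base_trans => //; rewrite V4.
rewrite eeU // {1 2}(pos_level_split HS) ee_split ?pos_level_trans //.
have h0 s : s \in pos_level S -> ~~ s.2 by rewrite !inE => /andP[].
rewrite ee_complete_pos ?ee_complete_cross ?pos_level_trans // addn0.
have cS := card_split (pos_level_trans S); rewrite -pos_level_split // in cS.
have H2 : ee [set e1; e2] S S <= 8.
  apply: leq_trans (ee_mono _ (subsetT S) (subsetT S)) _.
  by rewrite ee_setT // cards2 ne.
have : #|pos_level S| <= 4 by rewrite -V4; apply/trans_card/pos_level_trans.
have [S1|S1] := leqP #|S| 2; last first.
  by move: (#|pos_level S|) cS S1 => [|[|[|[|[|n]]]]] //=; lia.
have := ee_symm_le g12 HS; move: (#|pos_level S|) cS S1 => [|[|n]] //= cS S1; rewrite cS /=; lia.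
Qed.

Lemma base_tight E : base_graph E -> gain_graph E /\ tight E.
Proof.
case=> [x y V2 u|V3|v w z V3 u|x y V4 u|x y V4 u|x y z V4 u|x y z V4 u|x y z w V4 u].
- move: u; rewrite /= !inE andbT => xy.
  have gE : gain_graph [set edge x y pos; edge x y neg; loop x; loop y].
    by do ?apply: gain_graphU; apply: gain_graph1; rewrite ?xy ?orbT.
  split=> //; apply: base_small; rewrite ?V2 //.
  by rewrite /loop !card_setU1r !cards1 !inE !edge_eq /=; use_neqs; rewrite ?eqxx ?andbF.
- have gE : gain_graph (complete V :|: [set loop x | x : V]).
    apply: gain_graphU; first exact: gain_graph_complete.
    by apply/gain_graphP=> _ /imsetP[x _ ->]; exists x, x, true; rewrite orbT.
  split=> //; apply: base_small; rewrite ?V3 //.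
  rewrite cardsU (_ : _ :&: _ = set0) ?cards0 ?card_complete ?V3.
    by rewrite card_imset ?V3 // => x y /eqP; rewrite edge_eq /= orbb andbb => /eqP.
  apply/setP=> e; rewrite !inE; apply/negP=> /andP[/imsetP[p _ ->]].
  by move=> /imsetP[x _] /eqP; rewrite edge_eq.
- move: u; rewrite /= !inE !negb_or andbT => /andP[/andP[vw vz] wz].
  have gE : gain_graph [set edge v w pos; edge v w neg; edge v z pos; edge v z neg;
                    edge w z pos; loop v].
    by do ?apply: gain_graphU; apply: gain_graph1; rewrite ?vw ?vz ?wz ?orbT.
  split=> //; apply: base_small; rewrite ?V3 //.
  by rewrite /loop !card_setU1r !cards1 !inE !edge_eq /=; use_neqs; rewrite ?eqxx ?andbF.
all: move: u; rewrite /= !inE ?negb_or ?andbT.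
- move=> xy; have g : gain_graph [set loop x; loop y] by do ?apply: gain_graphU; apply: gain_graph1; rewrite ?orbT.
  split; first exact: gain_graphU gain_graph_complete g.
  by apply: base_K4; rewrite // edge_eq; use_neqs.
- move=> xy; have g : gain_graph [set loop x; edge x y neg] by do ?apply: gain_graphU; apply: gain_graph1; rewrite ?orbT.
  split; first exact: gain_graphU gain_graph_complete g.
  by apply: base_K4; rewrite // edge_eq; use_neqs; rewrite ?andbF.
- move=> /andP[/andP[xy xz] yz]; have g : gain_graph [set loop x; edge y z neg] by do ?apply: gain_graphU; apply: gain_graph1; rewrite ?orbT.
  split; first exact: gain_graphU gain_graph_complete g.
  by apply: base_K4; rewrite // edge_eq; use_neqs; rewrite ?andbF.
- move=> /andP[/andP[xy xz] yz]; have g : gain_graph [set edge x y neg; edge x z neg] by do ?apply: gain_graphU; apply: gain_graph1; rewrite ?orbT.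
  split; first exact: gain_graphU gain_graph_complete g.
  by apply: base_K4; rewrite // edge_eq; use_neqs; rewrite ?andbF.
- move=> /and3P[/and3P[xy xz xw] /andP[yz yw] zw]; have g : gain_graph [set edge x y neg; edge z w neg] by do ?apply: gain_graphU; apply: gain_graph1; rewrite ?orbT.
  split; first exact: gain_graphU gain_graph_complete g.
  by apply: base_K4; rewrite // edge_eq; use_neqs; rewrite ?andbF.
Qed.
End Base.

Section DisjointUnion.
Variables (I : finType) (V : I -> finType) (E : forall i, {set gedge (V i)}).
Hypotheses (gE : forall i, gain_graph (E i)) (tE : forall i, tight (E i)).

Let W : finType := {i : I & V i}.
Let inj i (x : V i) : W := existT (fun j => V j) i x.

Lemma inj_tagged i : injective (@inj i).
Proof. exact: (@eq_from_Tagged _ V). Qed.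

Let emb i := map_edges (@inj i) (E i).

Lemma emb_disjoint i j : i != j -> [disjoint emb i & emb j].
Proof.
move=> ij; rewrite -setI_eq0; apply/eqP/setP=> e; rewrite !inE; apply/negP=> /andP[].
move=> /imsetP[e1 e1E ->] /imsetP[e2 e2E].
have [u [v [a [-> _]]]] := elimT (gain_graphP _) (gE i) _ e1E.
have [x [y [b [-> _]]]] := elimT (gain_graphP _) (gE j) _ e2E.
move=> /eqP; rewrite !edge_map_edge edge_eq => /andP[_ /orP[]/andP[/eqP H _]];
by move: ij; rewrite -[i]/(tag (inj u)) H eqxx.
Qed.

Lemma gain_graph_disjoint : gain_graph (disjoint_union E).
Proof.
apply/gain_graphP=> e /bigcupP[i _ eE].
by apply: (elimT (gain_graphP _) (gain_graph_map (@inj_tagged i) (gE i))).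
Qed.

Lemma ee_disjoint (S : {set W * bool}) : ee (disjoint_union E) S S = \sum_i ee (E i) (pre (@inj i) S) (pre (@inj i) S).
Proof.
rewrite ee_sum partition_disjoint_bigcup; last exact: emb_disjoint.
apply: eq_bigr => i _; rewrite -ee_map //; last exact: inj_tagged.
by rewrite [RHS]ee_sum.
Qed.

Lemma card_disjoint (S : {set W * bool}) : #|S| = \sum_i #|pre (@inj i) S|.
Proof.
pose F i := [set s in S | tag s.1 == i].
have -> : S = \bigcup_i F i.
  apply/setP=> s; apply/idP/bigcupP=> [sS|[i _]]; last by rewrite inE => /andP[].
  by exists (tag s.1); rewrite // inE sS eqxx.
rewrite -sum1_card partition_disjoint_bigcup => [|i j ij]; last first.
  rewrite -setI_eq0; apply/eqP/setP=> s; rewrite !inE; apply/negP=> /andP[/andP[_ /eqP ti] /andP[_ /eqP tj]].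
  by rewrite -ti tj eqxx in ij.
apply: eq_bigr => i _; rewrite sum1_card.
have <- : (fun s => (inj s.1, s.2)) @: pre (@inj i) (\bigcup_i F i) = F i.
  apply/setP=> s; apply/imsetP/idP=> [[t tS ->]|].
    by move: tS; rewrite !inE /= eqxx andbT => /bigcupP[k _]; rewrite inE => /andP[].
  case: s => -[j x] b; rewrite inE /= => /andP[sS /eqP ji]; subst j; exists (x, b) => //.
  by rewrite inE /=; apply/bigcupP; exists i; rewrite // inE sS /=.
rewrite card_imset // => -[x b] [y c] /= /eqP.
by rewrite xpair_eqE => /andP[/eqP/inj_tagged-> /eqP->].
Qed.

Lemma tight_disjoint : tight (disjoint_union E).
Proof.
split; last first.
  rewrite -sum1_card partition_disjoint_bigcup; last exact: emb_disjoint.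
  have cW : 2 * #|W| = \sum_i 2 * #|V i|.
    have := card_disjoint [set: W * bool]; rewrite cardsT card_prod card_bool mulnC => ->.
    apply: eq_bigr => i _; have -> : pre (@inj i) setT = setT by apply/setP=> s; rewrite !inE.
    by rewrite cardsT card_prod card_bool mulnC.
  rewrite cW; apply: eq_bigr => i _; rewrite sum1_card card_map_edges; last exact: inj_tagged.
  by have [_ ->] := tE i.
split=> S HS; rewrite ee_disjoint card_disjoint big_distrr /=.
  by apply: leq_sum => i _; have [[H _] _] := tE i; apply/H/symm_pre.
case/set0Pn=> -[[i x] b] sS.
rewrite (bigD1 i) //= [X in _ <= X](bigD1 i) //= addnAC leq_add //.
  have [[_ H] _] := tE i; apply: H; first exact: trans_pre.
  by apply/set0Pn; exists (x, b); rewrite inE.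
apply: leq_sum => j _; have [[_ H] _] := tE j.
have [->|n0] := eqVneq (pre (@inj j) S) set0; first by rewrite /ee big_set0.
by apply: leq_trans (H _ (trans_pre _ HS) n0); rewrite leq_addr.
Qed.
End DisjointUnion.

(** * Vertex splitting preserves tightness *)

Section NonTransversal.
Variable V : finType.
Implicit Types (E D : {set gedge V}) (S T : {set V * bool}).

Lemma ee_sub_loop E (v : V) S : gain_graph E -> trans S ->
  ee (E :\ loop v) S S = ee E S S.
Proof.
move=> gE tS; case: (boolP (loop v \in E)) => vE; last first.
  by congr ee; apply/setP=> e; rewrite !inE; case: eqP => // ->; rewrite (negPf vE).
rewrite [RHS](eeD _ _ (_ : [set loop v] \subset E)) ?sub1set // ee_loop.
have := trans_and (v, false) tS; have := trans_and (v, true) tS; rewrite /cj /= => -> ->.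
by rewrite !addn0.
Qed.

(** Contracting vertices may turn a transversal set into one that contains both points over a single
    vertex [v]. Uncrossing S with its conjugate gives a symmetric union, with 2 |S| - 2 points, and
    an intersection that spans nothing once the loop at [v] is removed; halving yields the same
    constant 4 as for transversal sets. *)
Lemma nontrans_bound E S (v : V) : gain_graph E -> sparse E ->
  S :&: cjs S = vlift [set v] ->
  ee (E :\ loop v) S S + 4 + 2 * (loop v \in E) <= 4 * #|S|.
Proof.
move=> gE [sE _] Sv; set F := E :\ loop v.
have gF : gain_graph F by apply: gain_graph_sub gE; apply: subsetDl.
have H1 : ee F S S + ee F (cjs S) (cjs S) <=
   ee F (S :|: cjs S) (S :|: cjs S) + ee F (S :&: cjs S) (S :&: cjs S).
  have := @ee_leq _ F [:: (S, S); (cjs S, cjs S)] [:: (S :|: cjs S, S :|: cjs S); (S :&: cjs S, S :&: cjs S)].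
  rewrite !big_cons !big_nil !addn0 /=; apply=> s t; rewrite !big_cons !big_nil /= !inE.
  by case: (s \in S); case: (cj s \in S); case: (t \in S); case: (cj t \in S).
have H2 : ee F (S :&: cjs S) (S :&: cjs S) = 0.
  rewrite Sv /ee big1 // => -[x b]; rewrite !inE /= => /eqP->.
  rewrite big1 // => -[y c]; rewrite !inE /= => /eqP->; rewrite /wt.
  case: (eqVneq b c) => [->|bc]; first by rewrite adj_irr // muln0.
  rewrite /adj /cedge /= (_ : b (+) c = true) ?inE ?eqxx ?muln0 //.
  by move: bc; case: b; case: c.
have H3 : ee F (S :|: cjs S) (S :|: cjs S) + 4 * (loop v \in E) <= 4 * #|S :|: cjs S|.
  have sS : symm (S :|: cjs S) by apply: symmI => s; rewrite !inE cjK orbC.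
  case: (boolP (loop v \in E)) => vE; last first.
    by rewrite addn0; apply: leq_trans (ee_sub _ _ (subsetDl _ _)) (sE _ _).
  apply: leq_trans (sE _ sS); rewrite [X in _ <= X](eeD _ _ (_ : [set loop v] \subset E)) ?sub1set //.
  rewrite leq_add2l ee_loop.
  have K b : (v, b) \in S :|: cjs S.
    have : (v, b) \in S :&: cjs S by rewrite Sv !inE /=.
    by rewrite inE => /andP[K _]; rewrite inE K.
  by rewrite !K.
have H4 : #|S :|: cjs S| + 2 = 2 * #|S|.
  have c1 : #|vlift [set v]| = 2 by rewrite card_vlift cards1.
  by have := cardsUI S (cjs S); rewrite Sv card_cjs c1 => ->; lia.
rewrite ee_cjs in H1; lia.
Qed.
End NonTransversal.

Section SplitTight.
Variables (V : finType) (E : {set gedge V}) (v1 v2 : V) (a : bool) (C : {set gedge V}).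
Hypotheses (gE : gain_graph E) (tE : tight E) (v12 : v1 != v2) (eE : edge v1 v2 a \in E).
Hypothesis CE : C \subset [set e in E | v1 \in e.1] :\ edge v1 v2 a.
Hypothesis gE' : gain_graph (vertex_split E v1 v2 a C).

Let g (x : V) : option V := if x == v1 then None else Some x.
Let e12 := edge v1 v2 a.

Lemma split_g_inj : injective g.
Proof.
by move=> x y; rewrite /g; case: (eqVneq x v1) => [->|_]; case: eqVneq => // _ [].
Qed.

Let CsubE : C \subset E.
Proof. by apply/subsetP=> e /(subsetP CE); rewrite !inE => /and3P[]. Qed.

Let e12C : e12 \notin C.
Proof. by apply/negP=> /(subsetP CE); rewrite in_setD1 /e12 eqxx. Qed.

Let R := E :\: C :\ e12.
Let ER : E = [set e12] :|: (R :|: C).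
Proof.
apply/setP=> e; rewrite !inE; case: eqVneq => [->|] //=.
by case: (boolP (e \in C)) => [/(subsetP CsubE)->|]; rewrite ?orbT ?orbF.
Qed.

Let gR : gain_graph R. Proof. by apply: gain_graph_sub gE; rewrite ER; apply/subsetP=> e; rewrite !inE => ->; rewrite orbT. Qed.
Let gC : gain_graph C. Proof. exact: gain_graph_sub CsubE gE. Qed.

Lemma ee_split_decomp (F : {set gedge V}) S : (forall e, e \in F -> e \in E) -> e12 \in F ->
  ee F S S = ee [set e12] S S + ee (F :&: R) S S + ee (F :&: C) S S.
Proof.
move=> FE eF; rewrite -addnA -!eeU.
- congr ee; apply/setP=> e; move: (FE e); rewrite {1}ER !inE; case: eqVneq => [->|_] /=; first by rewrite eF.
  by case: (e \in F) => //= /(_ isT).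
- rewrite -setI_eq0; apply/eqP/setP=> e; rewrite !inE; case: eqVneq => [->|] //=.
  by rewrite (negPf e12C) !andbF.
- rewrite -setI_eq0; apply/eqP/setP=> e; rewrite !inE.
  by case: (e \in C); rewrite ?andbF.
Qed.

(* [contr S] is the image of [S] when the new vertex is contracted into [v1]. *)
Definition contr (S : {set option V * bool}) : {set V * bool} :=
  [set s | ((Some s.1, s.2) \in S) || (s.1 == v1) && ((None, s.2) \in S)].

Let preS S : pre Some S \subset contr S.
Proof. by apply/subsetP=> s; rewrite !inE => ->. Qed.

Let preg S : pre g S \subset contr S.
Proof.
apply/subsetP=> s; rewrite !inE /g; case: eqVneq => //= _ ->; by rewrite ?orbT.
Qed.

Lemma card_contr (S : {set option V * bool}) : #|S| = #|contr S|
  + (((None, false) \in S) && ((Some v1, false) \in S))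
  + (((None, true) \in S) && ((Some v1, true) \in S)).
Proof.
have H : pre Some S = contr S :\: [set s in vlift [set v1] | (Some s.1, s.2) \notin S].
  apply/setP=> s; rewrite !inE; case: (_ \in S) => /=; first by rewrite andbF.
  by case: (s.1 == v1).
have := cardsID [set s in vlift [set v1] | (Some s.1, s.2) \notin S] (contr S).
rewrite -H card_option_cover => <-.
have -> : contr S :&: [set s in vlift [set v1] | (Some s.1, s.2) \notin S]
   = [set s in [set (v1, false); (v1, true)] | ((Some s.1, s.2) \notin S) && ((None, s.2) \in S)].
  apply/setP=> -[x b]; rewrite !inE !xpair_eqE /=.
  by case: (x == v1); case: b => /=;
    (case: ((Some x, _) \in S); case: ((None, _) \in S)).
set X := [set s in _ | _].
have -> : #|X| = (((Some v1, false) \notin S) && ((None, false) \in S))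
                + (((Some v1, true) \notin S) && ((None, true) \in S)).
  rewrite -sum1_card (eq_bigl (fun s : V * bool => (s \in [set (v1, false); (v1, true)])
    && (((Some s.1, s.2) \notin S) && ((None, s.2) \in S)))); last by move=> s; rewrite in_set.
  rewrite big_mkcondr big_setU1 /= ?inE ?xpair_eqE ?andbF // big_set1 /=.
  by do 2 case: ifP.
move: #|pre Some S| ((None, false) \in S) ((None, true) \in S)
   ((Some v1, false) \in S) ((Some v1, true) \in S) => n b1 b2 b3 b4; clear.
by case: b1; case: b2; case: b3; case: b4; rewrite /=; lia.
Qed.

(** Each level at which S contains both halves of the split vertex adds 4 to [4 * #|S|]. It gains 2
    from the edge between the halves and at most 2 from the doubled edge to [v2]. The set [F] will
    be E, or E without the loop at [v1]. *)
Lemma ee_split_le (F : {set gedge V}) S : (forall e, e \in F -> e \in E) -> e12 \in F ->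
  ee (map_edges Some (F :&: R)) S S + ee (map_edges g (F :&: C)) S S
   + ee [set edge (Some v1) (Some v2) a] S S
   + ee [set edge None (Some v1) pos] S S + ee [set edge None (Some v2) a] S S
  + 4 * #|contr S| <= ee F (contr S) (contr S) + 4 * #|S|.
Proof.
move=> FE eF; rewrite ee_split_decomp //.
have gFR : gain_graph (F :&: R) by apply: gain_graph_sub gR; apply: subsetIr.
have gFC : gain_graph (F :&: C) by apply: gain_graph_sub gC; apply: subsetIr.
have SI : injective (@Some V) by move=> x y [].
rewrite (ee_map _ SI gFR) (ee_map _ split_g_inj gFC).
have H1 := ee_mono (F :&: R) (preS S) (preS S).
have H2 := ee_mono (F :&: C) (preg S) (preg S).
have := card_contr S.
have : ee [set edge (Some v1) (Some v2) a] S S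
   + ee [set edge None (Some v1) pos] S S + ee [set edge None (Some v2) a] S S
  <= ee [set e12] (contr S) (contr S)
   + 4 * ((((None, false) \in S) && ((Some v1, false) \in S))
  + (((None, true) \in S) && ((Some v1, true) \in S))).
  rewrite !ee_edge ?v12 // /contr !inE /= !eqxx (eq_sym v2) (negPf v12) /=.
  case: (a); bool_atoms; by_truth_table.
move: (nat_of_bool _) (nat_of_bool _) => b1 b2; move: H1 H2.
move: (ee _ _ _) (ee _ _ _) (ee _ _ _) (ee _ _ _) (ee _ _ _) (ee _ _ _) (ee _ _ _) (ee _ _ _) (#|_|) (#|_|).
clear; lia.
Qed.

Let n1 : gedge (option V) := edge None (Some v1) pos.
Let n2 : gedge (option V) := edge None (Some v2) a.

(** Contracting the new vertex into [v1] maps the edges other than [n1] and [n2] onto a set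
    containing E. The opposite inequality will follow from sparsity of the whole cover. *)
Lemma split_card : #|E| + 2 <= #|vertex_split E v1 v2 a C|.
Proof.
set E' := vertex_split E v1 v2 a C.
have n12 : n1 != n2 by rewrite edge_eq /= (inj_eq Some_inj) (negPf v12) ?andbF.
have nE : [set n1; n2] \subset E'.
  by rewrite subUset !sub1set !inE !eqxx ?orbT.
have := cardsID [set n1; n2] E'; rewrite (setIidPr nE) cards2 n12 => <-.
rewrite addnC leq_add2l.
apply: leq_trans (leq_imset_card (edge_map (odflt v1)) _).
apply: subset_leq_card; apply/subsetP=> e eE1.
have [u [v [b [ee ok]]]] := elimT (gain_graphP _) gE _ eE1.
have nn (e' : gedge (option V)) : edge_map (odflt v1) e' = e -> e' \in E' ->
    (e' == n2 -> e12 != e) -> e \in edge_map (odflt v1) @: (E' :\: [set n1; n2]).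
  move=> e'e e'E H; apply/imsetP; exists e' => //; rewrite in_setD e'E andbT in_set2 negb_or.
  apply/andP; split; apply/negP=> e'2.
    move: e'e eE1; rewrite (eqP e'2) edge_map_edge /= => <- /(gain_graph_ok gE).
    by rewrite eqxx.
  by move: (H e'2); rewrite -e'e (eqP e'2) edge_map_edge eqxx.
case: (boolP (e \in C)) => eC.
  apply: (nn (edge_map g e)).
  - rewrite ee !edge_map_edge /g.
    by case: (eqVneq u v1) => [->|_]; case: (eqVneq v v1) => [->|_].
  - by rewrite /E' /vertex_split /add_vertex !inE (_ : edge_map g e \in map_edges _ C) ?orbT // imset_f.
  - by move=> _; apply/eqP=> e1; move: e12C; rewrite e1 eC.
apply: (nn (edge_map Some e)).
- by rewrite ee !edge_map_edge.
- by rewrite /E' /vertex_split /add_vertex inE imset_f // inE eC.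
- by rewrite ee edge_map_edge /n2 edge_eq /= ?andbF.
Qed.

Lemma split_tight : tight (vertex_split E v1 v2 a C).
Proof.
have [[sE1 sE2] cE] := tE.
have eq1 : vertex_split E v1 v2 a C =
    map_edges Some R :|: map_edges g C :|: [set edge (Some v1) (Some v2) a] :|: [set n1] :|: [set n2].
  apply/setP=> e; rewrite !inE -/n1 -/n2.
  have -> : (e \in map_edges Some (E :\: C)) = (e \in map_edges Some R) || (e == edge (Some v1) (Some v2) a).
    have -> : E :\: C = R :|: [set e12].
      apply/setP=> e'; rewrite !inE; case: eqVneq => [->|]; rewrite ?orbF ?orbT //=.
      by rewrite e12C eE.
    by rewrite /map_edges imsetU imset_set1 edge_map_edge !inE.
  by rewrite -/g; do ! case: (_ \in _); do ! case: (_ == _).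
have e12E : forall e : gedge V, e \in E -> e \in E by [].
have ERI : E :&: R = R by apply/setIidPr; rewrite ER; apply/subsetP=> e; rewrite !inE => ->; rewrite orbT.
have ECI : E :&: C = C by apply/setIidPr.
have up S : ee (vertex_split E v1 v2 a C) S S + 4 * #|contr S| <= ee E (contr S) (contr S) + 4 * #|S|.
  apply: leq_trans (ee_split_le S e12E eE); rewrite leq_add2r ERI ECI eq1.
  do 3 (apply: leq_trans (ee_setU1 _ _ _) _; rewrite leq_add2r).
  exact: ee_leU.
have sp : sparse (vertex_split E v1 v2 a C).
  split=> S HS.
    have sC : symm (contr S) by apply: symmI=> s; rewrite !inE /= !(symmP (_, s.2) HS).
    have := up S; have := sE1 _ sC; nlia.
  move=> S0.
  have C0 : contr S != set0.
    case/set0Pn: S0 => -[[x|] b] sS; apply/set0Pn; first by exists (x, b); rewrite inE /= sS.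
    by exists (v1, b); rewrite inE /= eqxx sS orbT.
  case: (boolP (trans (contr S))) => [tC|]; first by have := up S; have := sE2 _ tC C0; nlia.
  (* S contains the two halves of the split vertex at opposite levels. No loop lifts to the
     transversal set S, so the loop at [v1] may be discarded before the bound for one full fibre is
     applied. *)
  move=> ntC; pose F := E :\ loop v1.
  have FE e : e \in F -> e \in E by rewrite inE => /andP[].
  have eF : e12 \in F by rewrite !inE eE /e12 edge_eq (eq_sym v2) (negPf v12) !andbF.
  have := ee_split_le S FE eF.
  have tv : contr S :&: cjs (contr S) = vlift [set v1].
    have K (s : V * bool) : s \in contr S -> cj s \in contr S -> s.1 == v1.
      rewrite !inE /=; case: eqVneq => //= _; rewrite !orbF => sS.
      by have := transP HS sS; rewrite /cj /= => ->.
    move: ntC; rewrite negb_forall => /existsP[s]; rewrite negb_imply negbK => /andP[s1 s2].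
    apply/setP=> t; rewrite !inE; apply/andP/idP=> [[t1 t2]|/eqP t1].
      by apply: K; rewrite inE.
    have /eqP sv := K _ s1 s2.
    have [->|->] : t = s \/ t = cj s.
      by case: t s t1 sv {s1 s2} => [x []] [y []] /= -> ->; [left|right|right|left].
    + by move: s1 s2; rewrite !inE.
    + by move: s1 s2; rewrite !inE /= negbK.
  have := leq_trans (leq_addr _ _) (nontrans_bound gE (conj sE1 sE2) tv); rewrite -/F.
  have h1 : ee (map_edges Some (F :&: R)) S S = ee (map_edges Some R) S S.
    rewrite !ee_map //; try exact: Some_inj; last by apply: gain_graph_sub gR; apply: subsetIr.
    rewrite -(ee_sub_loop v1 gR); last exact: trans_pre.
    by congr ee; apply/setP=> e; rewrite -{2}ERI !inE -andbA.
  have h2 : ee (map_edges g (F :&: C)) S S = ee (map_edges g C) S S.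
    rewrite !ee_map //; try exact: split_g_inj; last by apply: gain_graph_sub gC; apply: subsetIr.
    rewrite -(ee_sub_loop v1 gC); last exact: trans_pre.
    by congr ee; apply/setP=> e; rewrite -{2}ECI !inE -andbA.
  rewrite h1 h2.
  suff : ee (vertex_split E v1 v2 a C) S S <= ee (map_edges Some R) S S + ee (map_edges g C) S S
   + ee [set edge (Some v1) (Some v2) a] S S
   + ee [set edge None (Some v1) pos] S S + ee [set edge None (Some v2) a] S S by nlia.
  rewrite eq1; do 3 (apply: leq_trans (ee_setU1 _ _ _) _; rewrite leq_add2r).
  exact: ee_leU.
split=> //; apply/eqP; rewrite eqn_leq.
have [H _] := sp; have := H _ (symmT _); rewrite ee_setT // cardsT card_prod card_bool.
have := split_card; rewrite card_option cE; nlia.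
Qed.
End SplitTight.

(** * The vertex-to-K_4 move preserves tightness *)

Section K4Tight.
Variables (V : finType) (E : {set gedge V}) (v : V) (f : V -> bool -> 'I_4) (w z : 'I_4).
Hypotheses (gE : gain_graph E) (tE : tight E).

Let U : finType := {x : V | x != v}.
Let X : finType := K4_vertex v.
Let E' : {set gedge X} := vertex_to_K4 E v f w z.
Hypothesis gE' : gain_graph E'.

Let il (x : U) : X := inl x.
Let ir (i : 'I_4) : X := inr i.
Let il_inj : injective il. Proof. by move=> x y []. Qed.
Let ir_inj : injective ir. Proof. by move=> x y []. Qed.
Let vl : U -> V := val.
Let vl_inj : injective vl. Proof. exact: val_inj. Qed.
Let E1 : {set gedge U} := [set e : gedge U | edge_map vl e \in E].
Let P : {set U * bool} := [set p | edge (vl p.1) v p.2 \in E].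
Let nX (p : U * bool) : gedge X := edge (il p.1) (ir (f (vl p.1) p.2)) p.2.
Let nV (p : U * bool) : gedge V := edge (vl p.1) v p.2.
Let L : {set gedge X} := [set e in [set edge (ir w) (ir z) neg] | loop v \in E].
Let K : {set gedge X} := map_edges ir (complete 'I_4).

Lemma K4_parts : E' = map_edges il E1 :|: nX @: P :|: L :|: K.
Proof.
by congr (_ :|: _ :|: _ :|: _).
Qed.

Let gE1 : gain_graph E1.
Proof.
apply/forall_inP=> e; rewrite inE => /(forall_inP gE) /=.
by rewrite card_imset.
Qed.

Let vlN (x : U) : vl x != v. Proof. exact: (valP x). Qed.

(** The image of S under contraction of the new K_4; [insub] returns [None] exactly at [v]. *)
Let contrK (S : {set X * bool}) : {set V * bool} :=
  [set s | match insub s.1 with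
           | Some x => (il x, s.2) \in S
           | None => [exists i, (ir i, s.2) \in S]
           end].

Let in_contr_l S (x : U) b : ((vl x, b) \in contrK S) = ((il x, b) \in S).
Proof. by rewrite inE /= valK. Qed.

Let in_contr_v S b : ((v, b) \in contrK S) = [exists i, (ir i, b) \in S].
Proof. by rewrite inE /= insubF // eqxx. Qed.

Let q (S : {set X * bool}) (b : bool) := #|[set i | (ir i, b) \in S]|.

Let q_le S b : q S b <= 4.
Proof. by apply: leq_trans (max_card _) _; rewrite card_ord. Qed.

Let q_pos S b : ((v, b) \in contrK S) = (0 < q S b).
Proof.
rewrite in_contr_v card_gt0; apply/existsP/set0Pn=> -[i]; first by exists i; rewrite inE.
by rewrite inE; exists i.
Qed.

Let card_pre_inl S : #|contrK S| = #|pre il S| + (0 < q S false) + (0 < q S true).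
Proof.
rewrite (cardsD1 (v, false)) (cardsD1 (v, true) (_ :\ _)) in_setD1 -!q_pos xpair_eqE andbF /=.
have -> : contrK S :\ (v, false) :\ (v, true) = (fun s => (vl s.1, s.2)) @: pre il S.
  apply/setP=> -[x b]; apply/idP/imsetP=> [|[[y c] yS [-> ->]]].
    rewrite !in_setD1 !xpair_eqE => /and3P[n1 n2].
    have xv : x != v by apply/eqP=> xv; move: n1 n2; rewrite xv eqxx; case: b.
    by rewrite -[x]/(vl (Sub x xv)) in_contr_l => xS; exists (Sub x xv, b); rewrite ?inE.
  by rewrite !in_setD1 !xpair_eqE (negPf (vlN y)) in_contr_l /=; rewrite inE in yS.
rewrite card_imset; first by rewrite addnA addnC addnA.
by move=> [x b] [y c] /= [/vl_inj -> ->].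
Qed.

Let card_pre_all (S : {set X * bool}) : #|S| = #|pre il S| + q S false + q S true.
Proof.
rewrite -sum1_card big_mkcond /=.
rewrite (eq_bigr (fun p : X * bool => ((p.1, p.2) \in S : nat))); last first.
  by move=> [x b] _ /=; case: (_ \in S).
rewrite -(pair_big xpredT xpredT (fun (x : X) b => ((x, b) \in S : nat))) /=.
rewrite big_sumType /= -addnA; congr (_ + _).
  rewrite pair_big -sum1_card [RHS]big_mkcond; apply: eq_bigr => -[x b] _ /=.
  by rewrite inE /=; case: (_ \in S).
rewrite (eq_bigr (fun i => (((ir i, true) \in S) + ((ir i, false) \in S))%N)); last first.
  by move=> i _; rewrite big_bool.
rewrite big_split /= addnC; congr (_ + _); rewrite /q -sum1_card [RHS]big_mkcond;
  by apply: eq_bigr => i _; rewrite inE; case: (_ \in S).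
Qed.

Let F := E :\ loop v.
Let F1 := map_edges vl E1.
Let F2 := nV @: P.

Let F12 : F1 :|: F2 \subset F.
Proof.
apply/subsetP=> e; rewrite in_setU => /orP[] /imsetP[].
  move=> e1 e1E ->; have := e1E; rewrite in_set in_setD1 => ->; rewrite andbT.
  have [u [x [a [-> _]]]] := elimT (gain_graphP _) gE1 e1 e1E.
  by rewrite edge_map_edge edge_eq (negPf (vlN u)) !andbF.
by move=> p; rewrite !inE => pE ->; rewrite pE andbT edge_eq (negPf (vlN _)) !andbF.
Qed.

Let F12_dis : [disjoint F1 & F2].
Proof.
rewrite -setI_eq0; apply/eqP/setP=> e; rewrite !inE; apply/negP=> /andP[/imsetP[e1 e1E ->]].
have [u [x [a [-> _]]]] := elimT (gain_graphP _) gE1 e1 e1E.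
rewrite edge_map_edge => /imsetP[p _ /eqP].
by rewrite edge_eq !(negPf (vlN _)) !andbF.
Qed.

Let nV_inj : injective nV.
Proof.
move=> [x a] [y b] /eqP; rewrite edge_eq /= eqxx (negPf (vlN _)) andbT orbF.
by move=> /andP[/eqP-> /eqP/vl_inj->].
Qed.

Let nX_inj : injective nX.
Proof.
move=> [x a] [y b] /eqP; rewrite edge_eq /= (inj_eq il_inj).
by case: a; case: b => //=; rewrite ?andbF ?orbF => /andP[/eqP->].
Qed.

Let ee_parts S :
  ee E' S S <= ee F (contrK S) (contrK S) + ee L S S
    + (q S false * (q S false).-1 + q S true * (q S true).-1).
Proof.
rewrite K4_parts; apply: leq_trans (ee_leU _ _ _ _) _.
have HK : ee K S S = q S false * (q S false).-1 + q S true * (q S true).-1.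
  rewrite ee_map //; last exact: gain_graph_complete.
  rewrite /ee.
  have pr s : (s \in pre ir S) = ((ir s.1, s.2) \in S) by rewrite inE.
  rewrite (eq_bigl _ _ pr); under eq_bigr do rewrite (eq_bigl _ _ pr).
  rewrite big_mkcond (eq_bigr (fun s : 'I_4 * bool => \sum_(i : 'I_4)
     (((ir s.1, s.2) \in S) && ((ir i, s.2) \in S) && (i != s.1) : nat))); last first.
    move=> [i b] _ /=; case: ((ir i, b) \in S); last by rewrite big1.
    rewrite big_mkcond /= (eq_bigr (fun t : 'I_4 * bool =>
       if (t.2 == b) && ((ir t.1, b) \in S) && (t.1 != i) then 1 else 0)); last first.
      move=> [j c] _ /=; rewrite wt_complete /= (eq_sym i) (eq_sym b).
      by case: (eqVneq c b) => [->|_]; case: (_ \in S); rewrite ?andbF //; case: eqP.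
    rewrite -(pair_big xpredT xpredT (fun (j : 'I_4) c =>
       if (c == b) && ((ir j, b) \in S) && (j != i) then 1 else 0)) /=.
    by apply: eq_bigr => j _; rewrite big_bool; case: b => /=; case: (_ && _).
  rewrite -(pair_big xpredT xpredT (fun (i : 'I_4) b => \sum_(j : 'I_4)
     (((ir i, b) \in S) && ((ir j, b) \in S) && (j != i) : nat))) /= exchange_big big_bool /= addnC.
  have H b : \sum_i \sum_j (((ir i, b) \in S) && ((ir j, b) \in S) && (j != i) : nat)
      = q S b * (q S b).-1.
    rewrite /q -sum_nat_const [RHS]big_mkcond; apply: eq_bigr => i _.
    rewrite inE; case: (boolP (_ \in S)) => iS /=; last by rewrite big1.
    rewrite (cardsD1 i) inE iS /= -sum1_card [RHS]big_mkcond.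
    by apply: eq_bigr => j _; rewrite !inE andbC; case: (_ && _).
  by rewrite !H.
rewrite HK leq_add2r; apply: leq_trans (ee_leU _ _ _ _) _; rewrite leq_add2r.
apply: leq_trans (ee_leU _ _ _ _) _.
apply: leq_trans (ee_sub _ _ F12); rewrite eeU //; apply: leq_add.
  rewrite !ee_map //; apply: ee_mono; apply/subsetP=> s; rewrite !in_pre -in_contr_l; exact.
rewrite ee_sum big_imset /=; last by move=> ? ? _ _; apply: nX_inj.
rewrite [X in _ <= X]ee_sum big_imset /=; last by move=> ? ? _ _; apply: nV_inj.
apply: leq_sum => -[x a] _; rewrite /nX /nV !ee_edge ?vlN //=.
have Hx b c : nat_of_bool (((il x, b) \in S) && ((ir (f (vl x) a), c) \in S)) <=
    ((vl x, b) \in contrK S) && ((v, c) \in contrK S).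
  rewrite in_contr_l in_contr_v; case: (_ \in S) => //=.
  by case: (boolP (_ \in S)) => // iS; rewrite (_ : [exists _, _]) //; apply/existsP; exists (f (vl x) a).
by rewrite leq_add // leq_mul2l Hx.
Qed.

Let E_loop (S : {set V * bool}) : ee E S S = ee F S S + 4 * ((loop v \in E) && ((v, false) \in S) && ((v, true) \in S)).
Proof.
case: (boolP (loop v \in E)) => vE /=; last first.
  rewrite addn0; congr ee; apply/setP=> e; rewrite !inE; case: eqVneq => // ->.
  by rewrite (negPf vE).
rewrite (eeD _ _ (_ : [set loop v] \subset E)) ?sub1set // ee_loop.
by case: ((v, false) \in S); case: ((v, true) \in S).
Qed.

Let ee_L (S : {set X * bool}) : ee L S S <= (loop v \in E) *
  (2 * (((ir w, false) \in S) && ((ir z, true) \in S))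
  + 2 * (((ir w, true) \in S) && ((ir z, false) \in S))).
Proof.
rewrite /L; case: (loop v \in E); last first.
  by rewrite (_ : [set e in _ | _] = set0) ?ee0 //; apply/setP=> e; rewrite !inE andbF.
rewrite (_ : [set e in _ | _] = [set edge (ir w) (ir z) neg]); last first.
  by apply/setP=> e; rewrite !inE andbT.
by rewrite ee_edge ?orbT // mul1n.
Qed.

Let q_in (S : {set X * bool}) b i : (ir i, b) \in S -> 0 < q S b.
Proof. by move=> iS; rewrite card_gt0; apply/set0Pn; exists i; rewrite inE. Qed.

(** Replacing a point over [v] by q points of the K_4 at the same level adds q(q-1) to the count and
    4(q-1) to the bound, which is enough because q is at most 4. If a transversal set uses both
    levels, the bound for one full fibre applies, and the two numbers of points add up to at most
    4. *)
Let sparse_K4 : sparse E'.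
Proof.
have [[sE1 sE2] cE] := tE; split=> S HS.
  have sC : symm (contrK S).
    apply: symmI=> -[x b]; rewrite /cj !inE /=; case: insub => [y|].
      by rewrite -(symmP _ HS).
    by move=> /existsP[i iS]; apply/existsP; exists i; rewrite -(symmP _ HS) in iS.
  have qq : q S true = q S false.
    by apply: eq_card => i; rewrite !inE -(symmP _ HS).
  have := sE1 _ sC; rewrite E_loop !q_pos.
  have := ee_parts S; have := ee_L S.
  have -> : ((ir w, true) \in S) = ((ir w, false) \in S) by rewrite -(symmP _ HS).
  have -> : ((ir z, true) \in S) = ((ir z, false) \in S) by rewrite -(symmP _ HS).
  have := @q_in S false w; rewrite card_pre_inl card_pre_all qq.
  have := q_le S false; case: ((ir w, false) \in S) => /=; last first.
    by case: (q S false) => [|[|[|[|[|n]]]]] //= _ _; nlia.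
  move=> + /(_ isT); case: ((ir z, false) \in S); case: (loop v \in E);
    by case: (q S false) => [|[|[|[|[|n]]]]] //= _ _; nlia.
move=> S0.
have cx s : s \in contrK S -> cj s \in contrK S -> (s.1 == v) && (0 < q S false) && (0 < q S true).
  case: s => x b; case: (eqVneq x v) => [->|xv]; rewrite /cj /=.
    by rewrite !q_pos; case: b => -> ->.
  by rewrite -[x]/(vl (Sub x xv)) !in_contr_l => /(transP HS); rewrite /cj /= => ->.
have qd : q S false + q S true <= 4.
  have := cardsUI [set i | (ir i, false) \in S] [set i | (ir i, true) \in S].
  rewrite (_ : _ :&: _ = set0) ?cards0 ?addn0 => [<-|].
    by apply: leq_trans (max_card _) _; rewrite card_ord.
  by apply/setP=> i; rewrite !inE; have := trans_and (ir i, false) HS.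
have C0 : contrK S != set0.
  case/set0Pn: S0 => -[[x|i] b] sS; apply/set0Pn.
    by exists (vl x, b); rewrite in_contr_l.
  by exists (v, b); rewrite q_pos; apply: q_in sS.
have := ee_parts S; have := ee_L S; rewrite card_pre_all.
case: (boolP ((0 < q S false) && (0 < q S true))) => [/andP[q0 q1]|nq].
  have tv : contrK S :&: cjs (contrK S) = vlift [set v].
    apply/setP=> s; have -> : (s \in vlift [set v]) = (s.1 == v) by rewrite inE inE.
    rewrite in_setI in_cjs; apply/andP/idP=> [[s1 s2]|/eqP sv].
      by have /andP[/andP[->]] := cx _ s1 s2.
    by case: s sv => x b /= ->; rewrite /cj /= !q_pos; case: b.
  have := nontrans_bound gE (conj sE1 sE2) tv; rewrite -/F card_pre_inl q0 q1.
  have := trans_and (ir w, false) HS; rewrite /cj /=.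
  move: q0 q1 qd; case: ((ir w, false) \in S); case: ((ir w, true) \in S) => //=;
  case: (loop v \in E); case: ((ir z, false) \in S); case: ((ir z, true) \in S) => //=;
  case: (q S false) => [|[|[|[|[|n]]]]] //; case: (q S true) => [|[|[|[|[|m]]]]] //= _ _ _ _; nlia.
have tC : trans (contrK S).
  by apply: transI => s s1 s2; have := cx s s1 s2; rewrite -andbA (negPf nq) andbF.
have := sE2 _ tC C0; rewrite -(ee_sub_loop v gE tC) -/F card_pre_inl.
have L0 b : ((ir w, b) \in S) && ((ir z, ~~ b) \in S) = false.
  by apply: contraNF nq => /andP[/q_in q1 /q_in q2]; case: b q1 q2 => /= -> ->.
rewrite (L0 false) (L0 true) muln0.
move: nq qd; case: (q S false) => [|[|[|[|[|n]]]]] //; case: (q S true) => [|[|[|[|[|m]]]]] //= _ _;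
nlia.
Qed.

(** Contracting the new K_4 to [v] maps the remaining edges onto a set containing E. *)
Let ext_K4 : #|E| + 6 <= #|E'|.
Proof.
have cK : #|K| = 6.
  by rewrite card_map_edges // card_complete card_ord.
have KE : K \subset E' by rewrite K4_parts subsetUr.
have := cardsID K E'; rewrite (setIidPr KE) cK => <-.
rewrite addnC leq_add2l.
pose c (x : X) : V := if x is inl y then vl y else v.
apply: leq_trans (leq_imset_card (edge_map c) _).
apply: subset_leq_card; apply/subsetP=> e eE1.
have nn (e' : gedge X) : edge_map c e' = e -> e' \in E' -> e \in edge_map c @: (E' :\: K).
  move=> e'e e'E; apply/imsetP; exists e' => //; rewrite in_setD e'E andbT.
  apply/negP=> /imsetP[k /imsetP[[i j] _ ->] ek].
  move: e'e eE1; rewrite ek !edge_map_edge /= => <- /(gain_graph_ok gE).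
  by rewrite eqxx.
have star (x : U) a : edge (vl x) v a \in E -> edge (il x) (ir (f (vl x) a)) a \in E'.
  move=> xE; rewrite K4_parts !in_setU; apply/orP; left; apply/orP; left; apply/orP; right.
  by apply/imsetP; exists (x, a); rewrite ?inE.
have [u [y [a [ee ok]]]] := elimT (gain_graphP _) gE _ eE1.
have [uv|uv] := eqVneq u v; have [yv|yv] := eqVneq y v.
- have a1 : a = true by move: ok; rewrite uv yv eqxx.
  apply: (nn (edge (ir w) (ir z) true)).
    by rewrite edge_map_edge /= ee uv yv a1.
  rewrite K4_parts !in_setU; apply/orP; left; apply/orP; right.
  by rewrite /L inE inE eqxx; move: eE1; rewrite ee uv yv a1.
- apply: (nn (edge (il (Sub y yv)) (ir (f y a)) a)).
    by rewrite edge_map_edge /= ee uv edgeC.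
  have yE : edge y v a \in E by move: eE1; rewrite ee uv edgeC.
  exact: (star (Sub y yv)).
- apply: (nn (edge (il (Sub u uv)) (ir (f u a)) a)).
    by rewrite edge_map_edge /= ee yv.
  have uE : edge u v a \in E by move: eE1; rewrite ee yv.
  exact: (star (Sub u uv)).
- apply: (nn (edge (il (Sub u uv)) (il (Sub y yv)) a)).
    by rewrite edge_map_edge /= ee.
  rewrite K4_parts !in_setU; apply/orP; left; apply/orP; left; apply/orP; left.
  rewrite -(edge_map_edge il); apply: imset_f.
  by rewrite inE edge_map_edge /= -ee.
Qed.

Lemma K4_tight : tight E'.
Proof.
split; first exact: sparse_K4.
have cX : #|X| + 1 = #|V| + 4.
  rewrite card_sum card_ord card_sig (cardC1 v); have : 0 < #|V| by apply/card_gt0P; exists v.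
  by case: #|V| => //= n _; rewrite addn1 addnC addn4.
have [_ cE] := tE.
have [H _] := sparse_K4; have := H _ (symmT _); rewrite ee_setT // cardsT card_prod card_bool.
have := ext_K4; rewrite cE => H1 H2; apply/eqP; rewrite eqn_leq.
by move: cX H1 H2; nlia.
Qed.
End K4Tight.

Lemma generated_tight (V : finType) (E : {set gedge V}) :
  generated E -> gain_graph E /\ tight E.
Proof.
elim=> {V E} [I V E bE|V W E E' _ [gE tE] mv gE'|V E v _ [gE tE]|V W f E bf _ [gE tE]].
- have gE i : gain_graph (E i) by case: (base_tight (bE i)).
  have tE i : tight (E i) by case: (base_tight (bE i)).
  by split; [exact: gain_graph_disjoint|exact: tight_disjoint].
- split=> //; case: mv gE' => {W E'} [E' h|E' h|E' h|v f w z|v1 v2 a C v12 eE CE] gE'.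
  + exact: H1_tight h gE'.
  + exact: H2_tight h gE'.
  + exact: H3_tight h gE'.
  + exact: K4_tight.
  + exact: split_tight.
- by split; [exact: gain_graph_switch|exact: tight_switch].
- by split; [exact: gain_graph_map (bij_inj bf) _|exact: tight_iso].
Qed.

(** * Blocks *)

Lemma imp2 (a b c : bool) : a ==> b ==> c -> a -> b -> c.
Proof. by case: a; case: b. Qed.

Lemma imp4 (a b c d e : bool) : a ==> b ==> c ==> d ==> e -> a -> b -> c -> d -> e.
Proof. by case: a; case: b; case: c; case: d. Qed.

Section Blocks.
Variable V : finType.
Implicit Types (E D : {set gedge V}) (s t u : V * bool) (S T Z : {set V * bool}).

(* The sets that are tight for one of the two counts. *)
Definition block E Z :=
  (Z != set0) && (trans Z && (4 * #|Z| <= ee E Z Z + 4)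
                  || symm Z && (4 * #|Z| <= ee E Z Z)).

Definition dg E Z s := ee E [set s] Z.

Lemma dgE E Z s : dg E Z s = \sum_(t in Z) wt E s t.
Proof. by rewrite /dg /ee big_set1. Qed.

Lemma ee_dg E S Z : ee E S Z = \sum_(s in S) dg E Z s.
Proof. by apply: eq_bigr => s _; rewrite dgE. Qed.

Lemma dg_cj E Z s : dg E (cjs Z) (cj s) = dg E Z s.
Proof.
rewrite /dg -ee_cjs cjsK; congr ee; apply/setP=> t.
by rewrite !inE cj_eq cjK.
Qed.

Lemma dg_symm E Z s : symm Z -> dg E Z (cj s) = dg E Z s.
Proof. by move=> /eqP sZ; rewrite -{1}sZ dg_cj. Qed.

Lemma ee_disjU E S T : [disjoint S & T] ->
  ee E (S :|: T) (S :|: T) = ee E S S + ee E T T + 2 * ee E S T.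
Proof.
move=> dST; have C := eeC E S T.
have D s : ~~ ((s \in S) && (s \in T)).
  by case: (boolP (s \in S)) => // sS; rewrite (disjointFr dST).
have H1 : ee E (S :|: T) (S :|: T) <= ee E S S + ee E T T + ee E S T + ee E T S.
  have := @ee_leq _ E [:: (S :|: T, S :|: T)] [:: (S, S); (T, T); (S, T); (T, S)].
  rewrite !big_cons !big_nil !addn0 ?addnA; apply=> s t.
  rewrite !big_cons !big_nil /= !inE; move: (D s) (D t); apply: imp2; bool_atoms; by_truth_table.
have H2 : ee E S S + ee E T T + ee E S T + ee E T S <= ee E (S :|: T) (S :|: T).
  have := @ee_leq _ E [:: (S, S); (T, T); (S, T); (T, S)] [:: (S :|: T, S :|: T)].
  rewrite !big_cons !big_nil !addn0 ?addnA; apply=> s t.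
  rewrite !big_cons !big_nil /= !inE; move: (D s) (D t); apply: imp2; bool_atoms; by_truth_table.
by move: C H1 H2; nlia.
Qed.

Lemma ee_rect E S T Z : [disjoint S & T] -> ee E (S :|: T) Z = ee E S Z + ee E T Z.
Proof. by move=> dST; rewrite /ee -bigU //; apply: eq_bigl => s; rewrite !inE. Qed.

Lemma ee_add1 E Z s : gain_graph E -> s \notin Z ->
  ee E (s |: Z) (s |: Z) = ee E Z Z + 2 * dg E Z s.
Proof.
move=> gE sZ; rewrite ee_disjU; last by rewrite disjoints_subset sub1set inE.
by rewrite {1}/ee !big_set1 wt_ss.
Qed.

Lemma ee_rem1 E Z s : gain_graph E -> s \in Z ->
  ee E Z Z = ee E (Z :\ s) (Z :\ s) + 2 * dg E Z s.
Proof.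
move=> gE sZ; rewrite -{1 2}(setD1K sZ) ee_add1 ?setD11 //; congr (_ + 2 * _).
by rewrite !dgE -{2}(setD1K sZ) big_setU1 ?setD11 //= wt_ss.
Qed.

Lemma dg_ge E Z s (l : seq (V * bool)) : uniq l ->
  all (fun t => (t \in Z) && adj E s t) l -> size l <= dg E Z s.
Proof.
move=> ul /allP al; apply: (@leq_trans (dg E [set t in l] s)).
  rewrite dgE -(card_uniqP ul) -cardsE -sum1_card; apply: leq_sum => t.
  by rewrite inE => /al /andP[_ ts]; rewrite /wt ts muln1.
by apply: ee_mono => //; apply/subsetP=> t; rewrite inE => /al /andP[].
Qed.

Lemma dg_mono E Z Z' s : Z \subset Z' -> dg E Z s <= dg E Z' s.
Proof. by move=> ZZ; apply: ee_mono. Qed.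

Lemma block_cjs E Z : block E Z -> block E (cjs Z).
Proof.
rewrite /block ee_cjs card_cjs => /andP[Z0 H].
have -> : cjs Z != set0 by rewrite -card_gt0 card_cjs card_gt0.
case/orP: H => /andP[H ->]; first by rewrite trans_cjs.
by rewrite (eqP H : cjs Z = Z) H orbT.
Qed.

Lemma sparse_cap E S T : sparse E -> trans S \/ trans T -> S :&: T != set0 ->
  ee E (S :&: T) (S :&: T) + 4 <= 4 * #|S :&: T|.
Proof.
move=> [_ sE] tST; apply: sE.
by case: tST; apply: trans_sub; [exact: subsetIl|exact: subsetIr].
Qed.

(** S, T and their conjugates have slack at most 4 each, and the four nonempty intersections have
    slack at least 4 each. Uncrossing leaves slack 0 for the symmetric closure of the union. *)
Lemma block_union_tt E S T : sparse E -> trans S -> trans T ->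
  4 * #|S| <= ee E S S + 4 -> 4 * #|T| <= ee E T T + 4 -> S :&: T != set0 ->
  S :&: cjs T != set0 ->
  4 * #|(S :|: T) :|: cjs (S :|: T)| <= ee E ((S :|: T) :|: cjs (S :|: T)) ((S :|: T) :|: cjs (S :|: T)).
Proof.
move=> sE tS tT hS hT ST0 SC0; set Y := (S :|: T) :|: _.
have h1 := sparse_cap sE (or_introl tS) ST0.
have h2 := sparse_cap sE (or_introl tS) SC0.
have : ee E S S + ee E (cjs S) (cjs S) + ee E T T + ee E (cjs T) (cjs T) <=
  ee E Y Y + ee E (S :&: T) (S :&: T) + ee E (cjs (S :&: T)) (cjs (S :&: T))
  + ee E (S :&: cjs T) (S :&: cjs T) + ee E (cjs (S :&: cjs T)) (cjs (S :&: cjs T)).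
  have := @ee_leq _ E [:: (S, S); (cjs S, cjs S); (T, T); (cjs T, cjs T)]
    [:: (Y, Y); (S :&: T, S :&: T); (cjs (S :&: T), cjs (S :&: T));
       (S :&: cjs T, S :&: cjs T); (cjs (S :&: cjs T), cjs (S :&: cjs T))].
  rewrite !big_cons !big_nil !addn0 ?addnA; apply=> s t.
  rewrite !big_cons !big_nil /= !inE !cjK.
  move: (trans_nand s tS) (trans_nand s tT) (trans_nand t tS) (trans_nand t tT).
  by apply: imp4; bool_atoms; by_truth_table.
have : #|Y| + #|S :&: T| + #|cjs (S :&: T)| + #|S :&: cjs T| + #|cjs (S :&: cjs T)|
    <= #|S| + #|cjs S| + #|T| + #|cjs T|.
  have := @card_leq _ [:: Y; S :&: T; cjs (S :&: T); S :&: cjs T; cjs (S :&: cjs T)]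
    [:: S; cjs S; T; cjs T].
  rewrite !big_cons !big_nil !addn0 ?addnA; apply=> s.
  rewrite !big_cons !big_nil /= !inE !cjK.
  move: (trans_nand s tS) (trans_nand s tT).
  by apply: imp2; bool_atoms; by_truth_table.
move: h1 h2 hS hT; rewrite !card_cjs !ee_cjs; nlia.
Qed.

Lemma block_union_st E S T : sparse E -> symm S -> trans T ->
  4 * #|S| <= ee E S S -> 4 * #|T| <= ee E T T + 4 -> S :&: T != set0 ->
  4 * #|S :|: (T :|: cjs T)| <= ee E (S :|: (T :|: cjs T)) (S :|: (T :|: cjs T)).
Proof.
move=> sE sS tT hS hT ST0; set Y := S :|: _.
have h1 := sparse_cap sE (or_intror tT) ST0.
have : ee E S S + ee E T T + ee E (cjs T) (cjs T) <=
    ee E Y Y + ee E (S :&: T) (S :&: T) + ee E (cjs (S :&: T)) (cjs (S :&: T)).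
  have := @ee_leq _ E [:: (S, S); (T, T); (cjs T, cjs T)]
    [:: (Y, Y); (S :&: T, S :&: T); (cjs (S :&: T), cjs (S :&: T))].
  rewrite !big_cons !big_nil !addn0 ?addnA; apply=> s t.
  rewrite !big_cons !big_nil /= !inE !(symmP _ sS).
  move: (trans_nand s tT) (trans_nand t tT).
  by apply: imp2; bool_atoms; by_truth_table.
have : #|Y| + #|S :&: T| + #|cjs (S :&: T)| <= #|S| + #|T| + #|cjs T|.
  have := @card_leq _ [:: Y; S :&: T; cjs (S :&: T)] [:: S; T; cjs T].
  rewrite !big_cons !big_nil !addn0 ?addnA; apply=> s.
  rewrite !big_cons !big_nil /= !inE !(symmP _ sS).
  move: (trans_nand s tT) (trans_nand s tT).
  by apply: imp2; bool_atoms; by_truth_table.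
move: h1 hS hT; rewrite !card_cjs !ee_cjs; nlia.
Qed.

Lemma ee_submod E S T :
  ee E S S + ee E T T <= ee E (S :|: T) (S :|: T) + ee E (S :&: T) (S :&: T).
Proof.
have := @ee_leq _ E [:: (S, S); (T, T)] [:: (S :|: T, S :|: T); (S :&: T, S :&: T)].
rewrite !big_cons !big_nil !addn0 ?addnA; apply=> s t.
by rewrite !big_cons !big_nil /= !inE; bool_atoms; by_truth_table.
Qed.

Lemma symm_union_tight E S T : sparse E -> symm S -> symm T ->
  4 * #|S| <= ee E S S -> 4 * #|T| <= ee E T T ->
  4 * #|S :|: T| <= ee E (S :|: T) (S :|: T) /\ 4 * #|S :&: T| <= ee E (S :&: T) (S :&: T).
Proof.
move=> [sE _] sS sT hS hT; have h1 := sE _ (symmI2 sS sT); have h2 := sE _ (symmU sS sT).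
have h3 := ee_submod E S T; have h4 := cardsUI S T.
by split; move: h1 h2 h3 h4 hS hT; nlia.
Qed.

(** The kinds of the two blocks may differ, and the result may be larger than the union. The last
    conjunct ensures that a vertex avoided by both blocks at both levels is still avoided. *)
Lemma block_union E S T : sparse E -> block E S -> block E T -> S :&: T != set0 ->
  exists Z, [/\ block E Z, S :|: T \subset Z &
    forall x, x \in Z -> (x \in S :|: T) || (cj x \in S :|: T)].
Proof.
move=> sE /andP[S0 bS] /andP[T0 bT] ST0.
have ne (A B : {set V * bool}) : A != set0 -> A \subset B -> B != set0.
  by move=> /set0Pn[x xA] /subsetP AB; apply/set0Pn; exists x; exact: AB.
have symX (A : {set V * bool}) : symm (A :|: cjs A) by apply: symmI=> s; rewrite !inE cjK orbC.
case/orP: bS => /andP[hS eS]; case/orP: bT => /andP[hT eT].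
- have [SC0|SC0] := eqVneq (S :&: cjs T) set0; last first.
    exists ((S :|: T) :|: cjs (S :|: T)); split; [|exact: subsetUl|by move=> x; rewrite in_setU in_cjs].
    rewrite /block (symX (S :|: T)) block_union_tt // orbT andbT.
    by apply: ne S0 _; rewrite -setUA subsetUl.
  exists (S :|: T); split=> //; last by move=> x ->.
  rewrite /block (ne _ _ S0 (subsetUl _ _)) /=; apply/orP; left; apply/andP; split.
    have K s : s \in S -> cj s \in T -> False.
      by move=> sS sT; have : s \in S :&: cjs T; [rewrite inE sS inE|rewrite SC0 inE].
    apply: transI=> s; rewrite !inE => /orP[] s1 /orP[] s2.
    + by rewrite (transP hS s1) in s2.
    + exact: K s1 s2.
    + by apply: (K _ s2); rewrite cjK.
    + by rewrite (transP hT s1) in s2.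
  have := sparse_cap sE (or_introl hS) ST0; have := ee_submod E S T.
  by have := cardsUI S T; move: eS eT; nlia.
- exists (T :|: (S :|: cjs S)); split; [|by rewrite setUC setUS // subsetUl|by move=> x; rewrite !inE; case: (x \in S); case: (x \in T); case: (cj x \in S); rewrite ?orbT].
  rewrite /block (symmU hT (symX S)) block_union_st //= ?orbT ?andbT; last by rewrite setIC.
  exact: ne T0 (subsetUl _ _).
- exists (S :|: (T :|: cjs T)); split; [|by rewrite setUS // subsetUl|by move=> x; rewrite !inE; case: (x \in S); case: (x \in T); case: (cj x \in T); rewrite ?orbT].
  rewrite /block (symmU hS (symX T)) block_union_st //= ?orbT ?andbT.
  exact: ne S0 (subsetUl _ _).
- exists (S :|: T); split=> //; last by move=> x ->.
  have [h _] := symm_union_tight sE hS hT eS eT.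
  by rewrite /block (symmU hS hT) h orbT andbT (ne _ _ S0 (subsetUl _ _)).
Qed.

(** Three edges add 6 to the count of a transversal block, while a point adds 4 to the bound. In the
    symmetric case the point and its conjugate give 12 against 8. *)
Lemma no_block3 E Z s : gain_graph E -> sparse E -> block E Z ->
  s \notin Z -> cj s \notin Z -> 3 <= dg E Z s -> False.
Proof.
move=> gE [sE tE] /andP[Z0 bZ] sZ csZ d3; case/orP: bZ => /andP[hZ eZ].
  have tr : trans (s |: Z).
    apply: transI => t; rewrite !inE => /orP[/eqP->|tZ]; first by rewrite cj_neq (negPf csZ).
    by rewrite (transP hZ tZ) orbF => /eqP cs; move: csZ; rewrite -cs cjK tZ.
  have ne : s |: Z != set0 by apply/set0Pn; exists s; rewrite !inE eqxx.
  have := tE _ tr ne; rewrite ee_add1 // cardsU1 sZ; move: eZ d3; nlia.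
have sy : symm (cj s |: (s |: Z)).
  by apply: symmI => t; rewrite !inE (symmP _ hZ) (inj_eq (@cj_inj V)) cj_eq => /or3P[] ->; rewrite ?orbT.
have cs2 : cj s \notin s |: Z by rewrite !inE cj_neq.
have := sE _ sy; rewrite ee_add1 // ee_add1 // !cardsU1 cs2 sZ.
have : dg E Z s <= dg E (s |: Z) (cj s).
  by rewrite -(dg_symm _ _ hZ); apply: dg_mono; apply: subsetUr.
by move: eZ d3; nlia.
Qed.

Lemma block_add E Z s t u : gain_graph E -> sparse E -> block E Z ->
  t \in Z -> u \in Z -> t != u -> adj E s t -> adj E s u ->
  exists Z', [/\ block E Z', s \in Z', Z \subset Z' &
    forall x, x \in Z' -> [|| x \in Z, cj x \in Z, x == s | x == cj s]].
Proof.
move=> gE sE bZ tZ uZ tu st su; have [sZ|sZ] := boolP (s \in Z); first by exists Z; split=> // x ->.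
have d2 : 2 <= dg E Z s.
  apply: (@dg_ge E Z s [:: t; u]); rewrite /= ?inE ?tu ?tZ ?uZ ?st ?su //.
have [Z0 bZ'] := andP bZ; case/orP: bZ' => /andP[hZ eZ]; last first.
  have csZ : cj s \notin Z by rewrite (symmP _ hZ).
  exists (cj s |: (s |: Z)); split; last first.
  - by move=> x; rewrite !inE => /or3P[] ->; rewrite ?orbT.
  - by apply/subsetP=> x xZ; rewrite !inE xZ !orbT.
  - by rewrite !inE eqxx orbT.
  apply/andP; split; first by apply/set0Pn; exists s; rewrite !inE eqxx orbT.
  have -> : symm (cj s |: (s |: Z)).
    by apply: symmI => x; rewrite !inE (symmP _ hZ) (inj_eq (@cj_inj V)) cj_eq => /or3P[] ->; rewrite ?orbT.
  have cs2 : cj s \notin s |: Z by rewrite !inE cj_neq.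
  rewrite ee_add1 // ee_add1 // !cardsU1 cs2 sZ /=; apply/orP; right.
  have : dg E Z s <= dg E (s |: Z) (cj s).
    by rewrite -(dg_symm _ _ hZ); apply: dg_mono; apply: subsetUr.
  by move: eZ d2; nlia.
have [csZ|csZ] := boolP (cj s \in Z); last first.
  exists (s |: Z); split; last first.
  - by move=> x; rewrite !inE => /orP[] ->; rewrite ?orbT.
  - exact: subsetUr.
  - by rewrite !inE eqxx.
  apply/andP; split; first by apply/set0Pn; exists s; rewrite !inE eqxx.
  apply/orP; left; apply/andP; split; last by rewrite ee_add1 // cardsU1 sZ; move: eZ d2; nlia.
  apply: transI => x; rewrite !inE => /orP[/eqP->|xZ]; first by rewrite cj_neq (negPf csZ).
  by rewrite (transP hZ xZ) orbF => /eqP cs; move: csZ; rewrite -cs cjK xZ.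
(* Adding [s] would put conjugate points into the transversal block, so the symmetric closure is
   taken. It is tight once the weight between Z and its conjugate is at least 4; the row of [cj s]
   and the column of [s] supply this, and their common entry, a loop, has weight 2. *)
exists (Z :|: cjs Z); split; last first.
- by move=> x; rewrite !inE => /orP[] ->; rewrite ?orbT.
- exact: subsetUl.
- by rewrite !inE csZ orbT.
have sy : symm (Z :|: cjs Z) by apply: symmI=> x; rewrite !inE cjK orbC.
apply/andP; split; first by apply/set0Pn; exists t; rewrite inE tZ.
apply/orP; right; rewrite sy ee_split // card_split //=.
suff : 4 <= ee E Z (cjs Z) by move: eZ; nlia.
have sC : s \in cjs Z by rewrite inE.
have H1 : ee E Z (cjs Z) >= dg E Z s + dg E (Z :\ cj s) s.
  rewrite ee_dg (bigD1 (cj s)) //= dg_cj leq_add2l dgE.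
  rewrite [X in X <= _](eq_bigl (fun i => (i \in Z) && (i != cj s))); last first.
    by move=> i; rewrite in_setD1 andbC.
  by apply: leq_sum => i _; rewrite dgE (bigD1 s) //= wtC leq_addr.
have H2 : dg E Z s = wt E s (cj s) + dg E (Z :\ cj s) s.
  by rewrite !dgE -{1}(setD1K csZ) big_setU1 ?setD11.
have H3 : 0 < wt E s (cj s) -> 1 <= dg E (Z :\ cj s) s.
  move=> _; have [tc|tc] := eqVneq t (cj s).
    by apply: (@dg_ge E _ s [:: u]); rewrite //= in_setD1 -tc eq_sym tu uZ su.
  by apply: (@dg_ge E _ s [:: t]); rewrite //= in_setD1 tc tZ st.
have H4 : wt E s (cj s) = 2 * adj E s (cj s) by rewrite /wt eqxx.
by rewrite H4 in H2 H3; case: adj H2 H3 => H2 H3; [have := H3 isT|]; move: H1 H2 d2; nlia.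
Qed.

(** Restoring the edge would raise the count above its bound. The use is to delete an edge, to
    uncross blocks that remain blocks without it, and to reach a block through both its ends. *)
Lemma block_adj E Z s t : gain_graph E -> sparse E -> s != t -> adj E s t ->
  block (E :\ cedge s t) Z -> s \in Z -> t \in Z -> False.
Proof.
move=> gE [sE tE] st ast /andP[Z0 bZ] sZ tZ.
have H : ee E Z Z = ee (E :\ cedge s t) Z Z + ee [set cedge s t] Z Z.
  by apply: eeD; rewrite sub1set.
rewrite ee_set1 // sZ tZ /= in H.
case/orP: bZ => /andP[hZ eZ].
  by have := tE _ hZ Z0; move: H eZ; case: (_ && _); nlia.
have := sE _ hZ; move: H eZ; rewrite !(symmP _ hZ) sZ tZ /=; nlia.
Qed.

Lemma block_del E e Z : block E Z -> ee [set e] Z Z = 0 -> block (E :\ e) Z.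
Proof.
move=> bZ e0; have -> : block (E :\ e) Z = block E Z; last by [].
rewrite /block; have [eE|eE] := boolP (e \in E).
  by rewrite [in RHS](eeD _ _ (_ : [set e] \subset E)) ?sub1set // e0 addn0.
by have -> : E :\ e = E by apply/setP=> x; rewrite !inE; case: eqVneq => // ->; rewrite (negPf eE).
Qed.

Lemma block_trans E M : trans M -> M != set0 -> 4 * #|M| <= ee E M M + 4 -> block E M.
Proof. by move=> tM M0 eM; rewrite /block M0 tM eM. Qed.

Lemma ee_extra E M (l : seq ((V * bool) * (V * bool))) : trans M ->
  uniq [seq cedge p.1 p.2 | p <- l] ->
  all (fun p => [&& p.1 \in M, cj p.2 \in M & adj E p.1 p.2]) l ->
  2 * ee E M M + 4 * size l <= ee E (M :|: cjs M) (M :|: cjs M).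
Proof.
move=> tM ul /allP al.
pose F := [set e in [seq cedge p.1 p.2 | p <- l]].
have FE : F \subset E.
  by apply/subsetP=> e; rewrite inE => /mapP[p /al /and3P[_ _ pE] ->].
rewrite [X in _ <= X](eeD _ _ FE).
have HF A : ee F A A = \sum_(p <- l) ee [set cedge p.1 p.2] A A.
  rewrite ee_sum -(big_map (fun p => cedge p.1 p.2) xpredT (fun e => ee [set e] A A)) /=.
  rewrite [RHS]big_uniq //=; apply: eq_bigl => e; by rewrite inE.
have ne p : p \in l -> p.1 != p.2.
  by move=> /al /and3P[p1 p2 _]; apply: contraTneq p2 => <-; rewrite (transP tM p1).
have F1 : ee F M M = 0.
  rewrite HF big_seq big1 // => p pl; rewrite ee_set1 ?ne //.
  have /and3P[p1 p2 _] := al _ pl.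
  by have := transP tM p2; rewrite cjK => ->; rewrite (transP tM p1) andbF.
have F2 : ee F (M :|: cjs M) (M :|: cjs M) = 4 * size l.
  rewrite HF big_seq (eq_bigr (fun=> 4)); first by rewrite -big_seq big_const_seq count_predT iter_addn_0.
  move=> p pl; rewrite ee_set1 ?ne // !inE !cjK.
  by have /and3P[p1 p2 _] := al _ pl; rewrite p1 p2 !orbT.
have F3 : ee E M M = ee (E :\: F) M M by rewrite (eeD _ _ FE) F1 addn0.
have F4 : 2 * ee (E :\: F) M M <= ee (E :\: F) (M :|: cjs M) (M :|: cjs M).
  by rewrite ee_split // leq_addr.
by rewrite F2 F3; move: F4; nlia.
Qed.

(* An edge between a transversal block and its conjugate is not part of the
   block, and the count for the symmetric closure leaves room for two of them. *)
Lemma extra_le2 E M (l : seq ((V * bool) * (V * bool))) : sparse E ->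
  trans M -> 4 * #|M| <= ee E M M + 4 ->
  uniq [seq cedge p.1 p.2 | p <- l] ->
  all (fun p => [&& p.1 \in M, cj p.2 \in M & adj E p.1 p.2]) l -> size l <= 2.
Proof.
move=> [sE _] tM eM ul al; have := ee_extra tM ul al.
have sS : symm (M :|: cjs M) by apply: symmI=> x; rewrite !inE cjK orbC.
by have := sE _ sS; rewrite card_split //; move: eM; nlia.
Qed.
End Blocks.

(** * Inverse moves *)

Definition smaller_generated (n : nat) := forall (W : finType) (E : {set gedge W}),
  #|W| < n -> gain_graph E -> tight E -> generated E.

Section ReduceAt.
Variables (V : finType) (E : {set gedge V}) (v : V).
Hypotheses (gE : gain_graph E) (tE : tight E) (IH : smaller_generated #|V|).

Definition others : finType := {u : V | u != v}.
Definition star := [set e in E | v \in e.1].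
Definition avoids (S : {set V * bool}) := ((v, false) \notin S) && ((v, true) \notin S).
(** The test for adding [D] once the vertex [v] is deleted, so only sets without points over [v] are
    subject to it. *)
Definition addable (D : {set gedge V}) :=
  (forall S, symm S -> avoids S -> ee E S S + ee D S S <= 4 * #|S|) /\
  (forall S, trans S -> S != set0 -> avoids S -> ee E S S + ee D S S + 4 <= 4 * #|S|).

Definition unopt (o : option others) : V := if o is Some x then val x else v.

Lemma unopt_bij : bijective unopt.
Proof.
exists (fun u => insub u) => [[x|]|u] /=; first exact: valK.
  by rewrite insubF // eqxx.
by case: insubP => [x _ <-|] //=; rewrite negbK => /eqP->.
Qed.

(** The common scheme for undoing H1, H2 and H3: the star of [v] is replaced by the edges [D']
    between the other vertices, the induction hypothesis generates the result, and the move leads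
    back to E up to the relabelling [unopt]. *)
Lemma reduce_at (D' : {set gedge others}) (N' : {set gedge (option others)}) :
  gain_graph D' -> [disjoint map_edges val D' & E] ->
  map_edges unopt N' = star -> #|star| = #|D'| + 2 ->
  addable (map_edges val D') ->
  (forall E' : {set gedge others}, D' \subset E' -> move E' (add_vertex E' D' N')) ->
  generated E.
Proof.
move=> gD dDE eN cN [aS aT] mv.
have vI : injective (val : others -> V) by apply: val_inj.
pose E0 : {set gedge others} := [set e | edge_map val e \in E].
have gE0 : gain_graph E0.
  by apply/forall_inP=> e; rewrite inE => /(forall_inP gE) /=; rewrite card_imset.
have dis : [disjoint E0 & D'].
  rewrite -setI_eq0; apply/eqP/setP=> e; rewrite !inE; apply/negP=> /andP[eE eD].
  by rewrite (disjointFr dDE (imset_f _ eD)) in eE.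
have E0star : E = map_edges val E0 :|: star.
  apply/setP=> e; rewrite !inE; apply/idP/orP=> [eE|[/imsetP[e0]|/andP[]//]]; last first.
    by rewrite inE => ? ->.
  have [ve|ve] := boolP (v \in e.1); [by right; rewrite eE|left].
  have [u [w [a [ee _]]]] := elimT (gain_graphP _) gE _ eE.
  move: ve; rewrite ee !inE negb_or !(eq_sym v) => /andP[uv wv].
  apply/imsetP; exists (edge (Sub u uv : others) (Sub w wv) a); last by rewrite edge_map_edge.
  by rewrite inE edge_map_edge /= -ee.
have dstar : [disjoint map_edges val E0 & star].
  rewrite -setI_eq0; apply/eqP/setP=> e; rewrite !inE; apply/negP=> /andP[/imsetP[e0 _ ->]].
  by move=> /andP[_ /imsetP[x _ xv]]; move: (valP x); rewrite -xv eqxx.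
have sub0 : map_edges val E0 \subset E by apply/subsetP=> e eE; rewrite E0star inE eE.
pose up (S : {set others * bool}) : {set V * bool} := (fun s => (val s.1, s.2)) @: S.
have eeE S : ee (E0 :|: D') S S <= ee E (up S) (up S) + ee (map_edges val D') (up S) (up S).
  have preS : pre val (up S) = S.
    apply/setP=> -[x b]; rewrite inE; apply/imsetP/idP=> /= [[[y c] yS [/vI-> ->]] //|xS].
    by exists (x, b).
  apply: leq_trans (ee_leU _ _ _ _) _; apply: leq_add; last by rewrite ee_map ?preS.
  by apply: leq_trans (ee_sub _ _ sub0); rewrite ee_map ?preS.
have cS S : #|up S| = #|S|.
  by rewrite card_imset // => -[x b] [y c] /= [/vI-> ->].
have avS S : avoids (up S).
  by apply/andP; split; apply/imsetP=> -[[x b] _ [xv _]]; move: (valP x); rewrite /= -xv eqxx.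
have cV : #|others|.+1 = #|V|.
  have := card_option others; rewrite (bij_eq_card unopt_bij) => ->; done.
have sp : sparse (E0 :|: D').
  split=> S HS.
    have sy : symm (up S).
      apply: symmI=> s /imsetP[t tS ->]; apply/imsetP; exists (cj t) => //.
      by rewrite (symmP _ HS).
    by move: (eeE S) (aS _ sy (avS S)) (cS S); nlia.
  move=> S0.
  have tr : trans (up S).
    apply: transI=> s /imsetP[[x b] tS ->] /imsetP[[y c] yS []] /= /vI xy bc.
    by move: tS; rewrite xy => /(transP HS); rewrite /cj /= bc yS.
  have ne : up S != set0.
    by rewrite -card_gt0 cS card_gt0.
  by move: (eeE S) (aT _ tr ne (avS S)) (cS S); nlia.
have gen : generated (E0 :|: D').
  apply: IH; [by rewrite -cV|exact: gain_graphU|split=> //].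
  have [_ cE] := tE.
  have di1 : E0 :&: D' = set0 by apply/eqP; rewrite setI_eq0.
  have di2 : map_edges val E0 :&: star = set0 by apply/eqP; rewrite setI_eq0.
  have := cardsUI E0 D'; rewrite di1 cards0 addn0 => ->.
  have := cardsUI (map_edges val E0) star; rewrite -E0star di2 cards0 addn0 card_map_edges //.
  by move: cE cN cV; nlia.
have eq : E = map_edges unopt (add_vertex (E0 :|: D') D' N').
  rewrite /add_vertex /map_edges imsetU -/(map_edges unopt N') eN.
  rewrite {1}E0star; congr (_ :|: _).
  rewrite setDUl setDv setU0 (setDidPl dis) /map_edges -imset_comp.
  by apply: eq_imset => -[A a]; rewrite /edge_map /= -imset_comp.
have /mv h : D' \subset E0 :|: D' by apply: subsetUr.
rewrite eq; apply: Gen_iso; first exact: unopt_bij.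
apply: Gen_move gen h _.
have [g unK gK] := unopt_bij.
rewrite -(map_edgesK (add_vertex _ _ _) unK) -eq.
by apply: gain_graph_map => //; apply: can_inj gK.
Qed.

End ReduceAt.

Section Reductions.
Variables (V : finType) (E : {set gedge V}).
Hypotheses (gE : gain_graph E) (tE : tight E) (IH : smaller_generated #|V|).
Implicit Types (v x y : V) (n m : V * bool) (l : seq (V * bool)).

(** An edge of gain a from [v] to x is listed as the point (x, a), and a loop as [(v, true)]. The
    list thus enumerates the edges at [v], with a loop listed once. *)
Definition nbrs v l := uniq l /\ forall t, adj E (v, false) t = (t \in l).

Lemma nbrs_perm v l l' : nbrs v l -> perm_eq l l' -> nbrs v l'.
Proof. by move=> [ul al] p; split; [rewrite -(perm_uniq p)|move=> t; rewrite al (perm_mem p)]. Qed.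

Lemma star_nbrs v l : nbrs v l -> star E v = [set e in [seq edge n.1 v n.2 | n <- l]].
Proof.
move=> [_ al]; apply/setP=> e; rewrite !inE; apply/andP/mapP=> [[eE ve]|[n nl ->]]; last first.
  rewrite edgeC /edge /= !inE eqxx; split=> //.
  by move: nl; rewrite -al /adj /cedge /=.
have [u [w [a [ee _]]]] := elimT (gain_graphP _) gE _ eE.
move: ve; rewrite ee !inE => /orP[]/eqP vv; [exists (w, a)|exists (u, a)] => //=.
- by rewrite -al /adj /cedge /= vv -ee.
- by rewrite vv edgeC.
- by rewrite -al /adj /cedge /= vv edgeC -ee.
- by rewrite vv.
Qed.

Lemma card_star v l : nbrs v l -> #|star E v| = size l.
Proof.
move=> H; rewrite (star_nbrs H) cardsE; have [ul _] := H.
rewrite -(size_map (fun n => edge n.1 v n.2)); apply/card_uniqP.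
rewrite map_inj_uniq // => -[x a] [y b] /eqP; rewrite edge_eq /= eqxx andbT.
by case/andP=> /eqP-> /orP[/eqP->|/andP[/eqP-> /eqP->]].
Qed.

Lemma nbrs_neq v l n : nbrs v l -> n \in l -> n != (v, true) -> n.1 != v.
Proof.
move=> [_ al]; rewrite -al; case: n => x b; rewrite xpair_eqE /=; case: eqVneq => //= ->.
by case: b => //; rewrite adj_irr.
Qed.

Lemma addable0 v : addable E v set0.
Proof.
have [[h1 h2] _] := tE.
by split=> S HS *; rewrite ee0 addn0; [apply: h1|apply: h2].
Qed.

(** Parity of the counts: a transversal set that is not a block has slack at least 6, a symmetric
    one at least 4, and the new edge contributes 2 or 4 respectively. *)
Lemma addable1 v n m : n != m ->
  (forall Z, block E Z -> avoids v Z -> n \in Z -> m \in Z -> False) ->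
  addable E v [set cedge n m].
Proof.
move=> nm nb; have [[h1 h2] _] := tE; split=> S HS.
  move=> aS; rewrite ee_set1 // !(symmP _ HS).
  case: (boolP ((n \in S) && (m \in S))) => [/andP[nS mS]|_]; last by rewrite addn0 h1.
  have := h1 _ HS; rewrite leq_eqVlt => /orP[/eqP h|]; last first.
    by have [k ->] := dvd_symm gE HS; rewrite /=; nlia.
  exfalso; apply: (nb S) => //; apply/andP; split; first by apply/set0Pn; exists n.
  by rewrite HS h leqnn orbT.
move=> S0 aS; rewrite ee_set1 //.
have K Z : trans Z -> Z != set0 -> avoids v Z -> n \in Z -> m \in Z -> ee E Z Z + 6 <= 4 * #|Z|.
  move=> tZ Z0 aZ nZ mZ; have := h2 _ tZ Z0; rewrite leq_eqVlt => /orP[/eqP h|]; last first.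
    by have [k ->] := dvd_trans gE tZ; rewrite /=; nlia.
  by exfalso; apply: (nb Z) => //; apply/andP; split => //; rewrite tZ h leqnn.
case: (boolP ((n \in S) && (m \in S))) => [/andP[nS mS]|_].
  by rewrite (transP HS nS) /=; have := K S HS S0 aS nS mS; nlia.
case: (boolP ((cj n \in S) && (cj m \in S))) => [/andP[nS mS]|_]; last by rewrite addn0; apply: h2.
have aC : avoids v (cjs S) by rewrite /avoids !inE /cj /= andbC.
have := K (cjs S); rewrite ee_cjs card_cjs !inE trans_cjs // -card_gt0 card_cjs card_gt0 => /(_ isT S0 aC nS mS).
by rewrite /=; nlia.
Qed.

Lemma unopt_new v (x : others v) a : edge_map (@unopt V v) (to_new x a) = edge (val x) v a.
Proof. by rewrite edge_map_edge. Qed.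

Lemma unopt_loop v : edge_map (@unopt V v) (new_loop _) = edge v v true.
Proof. by rewrite edge_map_edge. Qed.

Lemma disjoint_set1 e : e \notin E -> [disjoint [set e] & E].
Proof. by move=> H; rewrite disjoints_subset sub1set inE. Qed.

Lemma map_edges_set1 (X : finType) (f : X -> V) e : map_edges f [set e] = [set edge_map f e].
Proof. by rewrite /map_edges imset_set1. Qed.

Lemma map_edges_set0 (X : finType) (f : X -> V) : map_edges f set0 = set0.
Proof. by rewrite /map_edges imset0. Qed.
End Reductions.

Definition gedge_eq (V : finType) (e e' : gedge V) : bool := e == e'.

Ltac set_perm :=
  let e := fresh "e" in
  apply/setP=> e; rewrite !inE /=;
  repeat match goal with |- context [@eq_op ?T e ?X] =>
    change (@eq_op T e X) with (gedge_eq e X) end;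
  repeat match goal with |- context [gedge_eq e ?X] =>
    let b := fresh "b" in generalize (gedge_eq e X); intro b end;
  apply/eqP; by_truth_table.

(** * Undoing H1, H2 and H3 *)

Section Moves.
Variables (V : finType) (E : {set gedge V}).
Hypotheses (gE : gain_graph E) (tE : tight E) (IH : smaller_generated #|V|).
Implicit Types (v x y : V) (n m : V * bool) (l : seq (V * bool)).

Lemma H1_red v n m : nbrs E v [:: n; m] -> generated E.
Proof.
move=> H; have cs := card_star gE H; have sE := star_nbrs gE H.
have g0 : gain_graph (set0 : {set gedge (others v)}) := gain_graph0 _.
have d0 (f : others v -> V) : [disjoint map_edges f set0 & E].
  by rewrite map_edges_set0 disjoints_subset sub0set.
have a0 : addable E v (map_edges val (set0 : {set gedge (others v)})).
  by rewrite map_edges_set0; apply: addable0.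
have loopcase k : nbrs E v [:: (v, true); k] -> generated E.
  move=> K; have [uK aK] := K.
  have kv : k.1 != v.
    apply: (nbrs_neq gE K); rewrite ?inE ?eqxx ?orbT //.
    by move: uK; rewrite /= inE andbT eq_sym.
  apply: (@reduce_at _ E v gE tE IH set0 [set new_loop _; to_new (Sub k.1 kv : others v) k.2]) => //.
  - rewrite /map_edges imsetU !imset_set1 unopt_loop unopt_new (star_nbrs gE K) /=.
    by set_perm.
  - by rewrite (card_star gE K) cards0.
  - by move=> E' _; apply: Move_H1; apply: H1c.
have [e|nv] := eqVneq n (v, true); first by apply: (loopcase m); rewrite -e.
have [e|mv] := eqVneq m (v, true).
  apply: (loopcase n); rewrite -e; apply: nbrs_perm H _.
  by apply/permP=> a /=; rewrite addnCA.
have nv1 : n.1 != v by apply: (nbrs_neq gE H); rewrite ?inE ?eqxx.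
have mv1 : m.1 != v by apply: (nbrs_neq gE H); rewrite ?inE ?eqxx ?orbT.
have [nm|nm] := eqVneq n.1 m.1.
  apply: (@reduce_at _ E v gE tE IH set0 [set to_new (Sub n.1 nv1 : others v) false; to_new (Sub n.1 nv1 : others v) true]) => //.
  - rewrite /map_edges imsetU !imset_set1 !unopt_new sE /=.
    have [uH _] := H; case: n m nm uH {H cs sE loopcase nv mv mv1} nv1 => [x a] [y b] /= <-.
    rewrite inE andbT xpair_eqE eqxx /= => ab xv.
    by case: a b ab => [] [] // _; set_perm.
  - by rewrite cs cards0.
  - by move=> E' _; apply: Move_H1; apply: H1b.
apply: (@reduce_at _ E v gE tE IH set0 [set to_new (Sub n.1 nv1 : others v) n.2; to_new (Sub m.1 mv1 : others v) m.2]) => //.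
- by rewrite /map_edges imsetU !imset_set1 !unopt_new sE /=; set_perm.
- by rewrite cs cards0.
- by move=> E' _; apply: Move_H1; apply: H1a; rewrite /= inE andbT.
Qed.

(** The restored edge is the one joining [n1] and [n2]. It is a loop if these are conjugate, which
    undoes H2c; if [n3] is conjugate to one of them H2b is undone, and otherwise H2a. *)
Lemma H2_red v n1 n2 n3 : nbrs E v [:: n1; n2; n3] -> (v, true) \notin [:: n1; n2; n3] ->
  ~~ adj E n1 n2 ->
  (forall Z, block E Z -> avoids v Z -> n1 \in Z -> n2 \in Z -> False) -> generated E.
Proof.
move=> H nl n12 nb; have cs := card_star gE H; have sE := star_nbrs gE H.
have [u _] := H.
move: nl; rewrite !inE !negb_or !(eq_sym (v, true)) => /and3P[l1 l2 l3].
have v1 : n1.1 != v by apply: (nbrs_neq gE H); rewrite ?inE ?eqxx.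
have v2 : n2.1 != v by apply: (nbrs_neq gE H); rewrite ?inE ?eqxx ?orbT.
have v3 : n3.1 != v by apply: (nbrs_neq gE H); rewrite ?inE ?eqxx ?orbT.
have [x1 X1] : exists x : others v, val x = n1.1 by exists (Sub n1.1 v1).
have [x2 X2] : exists x : others v, val x = n2.1 by exists (Sub n2.1 v2).
have [x3 X3] : exists x : others v, val x = n3.1 by exists (Sub n3.1 v3).
have ne12 : n1 != n2 by move: u; rewrite /= !inE negb_or => /andP[/andP[]].
have ne13 : n1 != n3 by move: u; rewrite /= !inE negb_or => /andP[/andP[]].
have ne23 : n2 != n3 by move: u; rewrite /= !inE negb_or => /and3P[].
pose D' := [set edge x1 x2 (n1.2 (+) n2.2)].
have mD : map_edges val D' = [set cedge n1 n2] by rewrite map_edges_set1 edge_map_edge X1 X2.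
have gD : gain_graph D'.
  apply: gain_graph1; rewrite -val_eqE /= X1 X2; move: ne12.
  by case: (n1) (n2) => [x []] [y []]; rewrite xpair_eqE /= ?andbT ?orbT // => ->.
have dD : [disjoint map_edges val D' & E] by rewrite mD disjoint_set1.
have cD : #|star E v| = #|D'| + 2 by rewrite cs cards1.
have aD : addable E v (map_edges val D') by rewrite mD; apply: addable1.
have [e12|d12] := eqVneq n1.1 n2.1.
  have e2 : n2 = cj n1 by move: ne12; rewrite eq_sym => /negPf H2; have := same_vertex n2 n1; rewrite e12 eqxx H2 => /esym/eqP.
  have d31 : n3.1 != n1.1 by rewrite same_vertex -e2 negb_or !(eq_sym n3) ne13 ne23.
  apply: (@reduce_at _ E v gE tE IH D' [set to_new x1 false; to_new x1 true; to_new x3 n3.2]) => //.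
  - rewrite /map_edges !imsetU !imset_set1 !unopt_new ?X1 ?X2 ?X3 sE /= e2 /=.
    by case: (n1.2); set_perm.
  - move=> E' DE; apply: Move_H2.
    have x21 : x2 = x1 by apply: val_inj; rewrite X1 X2 e12.
    have DL : D' = [set loop x1] by rewrite /D' x21 e2 /= addbN addbb.
    rewrite DL in DE *; apply: H2c; last by apply: (subsetP DE); rewrite inE.
    by rewrite /= inE andbT -val_eqE /= X1 X3 eq_sym.
have x12 : x1 != x2 by rewrite -val_eqE /= X1 X2.
have DE1 (E' : {set gedge (others v)}) : D' \subset E' -> edge x1 x2 (n1.2 (+) n2.2) \in E'.
  by move=> /subsetP; apply; rewrite inE.
have [e13|d13] := eqVneq n1.1 n3.1.
  have e3 : n3 = cj n1 by move: ne13; rewrite eq_sym => /negPf H2; have := same_vertex n3 n1; rewrite e13 eqxx H2 => /esym/eqP.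
  apply: (@reduce_at _ E v gE tE IH D' [set to_new x1 false; to_new x1 true; to_new x2 n2.2]) => //.
  - rewrite /map_edges !imsetU !imset_set1 !unopt_new ?X1 ?X2 ?X3 sE /= e3 /=.
    by case: (n1.2); set_perm.
  - by move=> E' /DE1 DE; apply: Move_H2; apply: H2b DE; rewrite /= inE andbT.
have [e23|d23] := eqVneq n2.1 n3.1.
  have e3 : n3 = cj n2 by move: ne23; rewrite eq_sym => /negPf H2; have := same_vertex n3 n2; rewrite e23 eqxx H2 => /esym/eqP.
  apply: (@reduce_at _ E v gE tE IH D' [set to_new x2 false; to_new x2 true; to_new x1 n1.2]) => //.
  - rewrite /map_edges !imsetU !imset_set1 !unopt_new ?X1 ?X2 ?X3 sE /= e3 /=.
    by case: (n2.2); set_perm.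
  - move=> E' /DE1 DE; apply: Move_H2; rewrite /D' edgeC; apply: H2b; last by rewrite edgeC.
    by rewrite /= inE andbT eq_sym.
apply: (@reduce_at _ E v gE tE IH D' [set to_new x1 n1.2; to_new x2 n2.2; to_new x3 n3.2]) => //.
- by rewrite /map_edges !imsetU !imset_set1 !unopt_new ?X1 ?X2 ?X3 sE /=; set_perm.
- move=> E' /DE1 DE; apply: Move_H2; apply: H2a DE _ => //.
  by rewrite /= !inE negb_or -!val_eqE /= ?X1 ?X2 ?X3 d12 d13 d23.
Qed.
End Moves.

Section Moves2.
Variables (V : finType) (E : {set gedge V}).
Hypotheses (gE : gain_graph E) (tE : tight E) (IH : smaller_generated #|V|).
Implicit Types (v x y : V) (n m s t : V * bool) (l : seq (V * bool)) (S Z : {set V * bool}).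

Lemma avoidsP v (S : {set V * bool}) (b : bool) : avoids v S -> (v, b) \notin S.
Proof. by case/andP; case: b. Qed.

Lemma ee_add_symm S s : symm S -> s \notin S ->
  ee E (cj s |: (s |: S)) (cj s |: (s |: S)) = ee E S S + 4 * dg E S s + 2 * wt E s (cj s).
Proof.
move=> sS sN; have csN : cj s \notin S by rewrite (symmP _ sS).
have cs2 : cj s \notin s |: S by rewrite !inE cj_neq.
rewrite ee_add1 // ee_add1 //.
have -> : dg E (s |: S) (cj s) = wt E s (cj s) + dg E S s.
  by rewrite -(dg_symm E s sS) !dgE big_setU1 //= wtC.
by lia.
Qed.

Lemma symm_add S s : symm S -> symm (cj s |: (s |: S)).
Proof.
move=> sS; apply: symmI => t.
by rewrite !inE (symmP _ sS) (inj_eq (@cj_inj V)) cj_eq => /or3P[] ->; rewrite ?orbT.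
Qed.

Lemma card_add_symm S s : symm S -> s \notin S -> #|cj s |: (s |: S)| = #|S| + 2.
Proof.
move=> sS sN; have csN : cj s \notin S by rewrite (symmP _ sS).
by rewrite !cardsU1 sN !inE cj_neq (negPf csN) !add1n addn2.
Qed.

Lemma symm_add_le S s : symm S -> s \notin S ->
  ee E S S + 4 * dg E S s + 2 * wt E s (cj s) <= 4 * #|S| + 8.
Proof.
move=> sS sN; have [[h _] _] := tE.
by have := h _ (symm_add s sS); rewrite ee_add_symm // card_add_symm // mulnDr.
Qed.

Lemma H2d_red v n m : nbrs E v [:: (v, true); n; m] -> n.1 != m.1 -> ~~ adj E n m ->
  (forall Z, block E Z -> avoids v Z -> n \in Z -> m \in Z -> False) -> generated E.
Proof.
move=> H nm1 anm nb; have cs := card_star gE H; have sE := star_nbrs gE H.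
have [u _] := H; have ne := nm1; move: ne => /cover_neq/andP[ne _].
have [l1 l2] : n != (v, true) /\ m != (v, true).
  by move: u; rewrite /= !inE negb_or !(eq_sym (v, true)) => /andP[/andP[]].
have v1 : n.1 != v by apply: (nbrs_neq gE H); rewrite ?inE ?eqxx ?orbT.
have v2 : m.1 != v by apply: (nbrs_neq gE H); rewrite ?inE ?eqxx ?orbT.
have [x1 X1] : exists x : others v, val x = n.1 by exists (Sub n.1 v1).
have [x2 X2] : exists x : others v, val x = m.1 by exists (Sub m.1 v2).
have x12 : x1 != x2 by rewrite -val_eqE /= X1 X2.
pose D' := [set edge x1 x2 (n.2 (+) m.2)].
have mD : map_edges val D' = [set cedge n m] by rewrite map_edges_set1 edge_map_edge X1 X2.
apply: (@reduce_at _ E v gE tE IH D' [set to_new x1 n.2; to_new x2 m.2; new_loop _]).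
- by apply: gain_graph1; rewrite x12.
- by rewrite mD disjoint_set1.
- by rewrite /map_edges !imsetU !imset_set1 !unopt_new unopt_loop ?X1 ?X2 sE /=; set_perm.
- by rewrite cs cards1.
- by rewrite mD; apply: addable1.
- move=> E' DE; apply: Move_H2; apply: H2d => //; first by rewrite /= inE andbT.
  by apply: (subsetP DE); rewrite inE.
Qed.

(** Nothing can block this move. A loop does not lift to a transversal set, and a tight symmetric
    set through [n] would receive weight 12 from the two points over [v], against a bound growing by
    8. *)
Lemma H2e_red v n : nbrs E v [:: (v, true); n; cj n] -> ~~ adj E n (cj n) -> generated E.
Proof.
move=> H ann; have cs := card_star gE H; have sE := star_nbrs gE H.
have [u al] := H; have ne : n != cj n by rewrite eq_sym cj_neq.
have l1 : n != (v, true) by move: u; rewrite /= !inE negb_or !(eq_sym (v, true)) => /andP[/andP[]].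
have v1 : n.1 != v by apply: (nbrs_neq gE H); rewrite ?inE ?eqxx ?orbT.
have [x1 X1] : exists x : others v, val x = n.1 by exists (Sub n.1 v1).
pose D' := [set loop x1].
have mD : map_edges val D' = [set cedge n (cj n)].
  by rewrite map_edges_set1 edge_map_edge X1 /cedge /= addbN addbb.
apply: (@reduce_at _ E v gE tE IH D' [set to_new x1 false; to_new x1 true; new_loop _]).
- by apply: gain_graph1; rewrite orbT.
- by rewrite mD disjoint_set1.
- rewrite /map_edges !imsetU !imset_set1 !unopt_new unopt_loop ?X1 sE /=.
  by case: (n.2); set_perm.
- by rewrite cs cards1.
- rewrite mD; apply: addable1 => // Z bZ aZ nZ cZ.
  have [Z0 /orP[/andP[tZ _]|/andP[sZ eZ]]] := andP bZ; first by rewrite (transP tZ nZ) in cZ.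
  have := symm_add_le sZ (avoidsP false aZ).
  have : 2 <= dg E Z (v, false).
    by apply: (@dg_ge _ E Z (v, false) [:: n; cj n]); rewrite /= ?inE ?ne ?nZ ?cZ ?al ?inE ?eqxx ?orbT.
  have -> : wt E (v, false) (cj (v, false)) = 2 by rewrite /wt eqxx al /cj /= inE eqxx.
  by move: eZ; nlia.
- move=> E' DE; apply: Move_H2; apply: H2e.
  by apply: (subsetP DE); rewrite inE.
Qed.

Section H3.
Variables (v : V) (n1 n2 n3 n4 : V * bool).
Hypotheses (H : nbrs E v [:: n1; n2; n3; n4]) (nl : (v, true) \notin [:: n1; n2; n3; n4]).

Let cs := card_star gE H.
Let sE := star_nbrs gE H.

Lemma H3_vertices :
  [/\ exists x : others v, val x = n1.1, exists x : others v, val x = n2.1,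
      exists x : others v, val x = n3.1 & exists x : others v, val x = n4.1].
Proof.
have h n : n \in [:: n1; n2; n3; n4] -> exists x : others v, val x = n.1.
  move=> nn; have nv : n.1 != v.
    by apply: (nbrs_neq gE H nn); apply: contraNneq nl => <-.
  by exists (Sub n.1 nv).
by split; apply: h; rewrite !inE eqxx ?orbT.
Qed.

Lemma H3_uniq : [/\ n1 != n2, n1 != n3, n1 != n4, n2 != n3 & n2 != n4] /\ n3 != n4.
Proof.
by have [] := H; rewrite /= !inE !negb_or andbT => /and3P[/and3P[-> -> ->] /andP[-> ->] ->].
Qed.

Hypotheses (a12 : ~~ adj E n1 n2) (a34 : ~~ adj E n3 n4) (ne : cedge n1 n2 != cedge n3 n4).
Hypothesis ad : addable E v [set cedge n1 n2; cedge n3 n4].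

Let disD : [disjoint [set cedge n1 n2; cedge n3 n4] & E].
Proof. by rewrite disjoints_subset subUset !sub1set !inE a12 a34. Qed.

Lemma H3_reduce (x1 x2 x3 x4 : others v) N' :
  val x1 = n1.1 -> val x2 = n2.1 -> val x3 = n3.1 -> val x4 = n4.1 ->
  map_edges (@unopt V v) N' = star E v ->
  (forall E' : {set gedge (others v)}, edge x1 x2 (n1.2 (+) n2.2) \in E' -> edge x3 x4 (n3.2 (+) n4.2) \in E' ->
    move E' (add_vertex E' [set edge x1 x2 (n1.2 (+) n2.2); edge x3 x4 (n3.2 (+) n4.2)] N')) ->
  generated E.
Proof.
move=> X1 X2 X3 X4 eN mv.
pose D' := [set edge x1 x2 (n1.2 (+) n2.2); edge x3 x4 (n3.2 (+) n4.2)].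
have [[u12 u13 u14 u23 u24] u34] := H3_uniq.
have mD : map_edges val D' = [set cedge n1 n2; cedge n3 n4].
  by rewrite /map_edges imsetU !imset_set1 !edge_map_edge X1 X2 X3 X4.
have okx (n m : V * bool) (x y : others v) : n != m -> val x = n.1 -> val y = m.1 ->
    (x != y) || (n.2 (+) m.2).
  move=> nm Xn Xm; rewrite -val_eqE /= Xn Xm; move: nm.
  by case: (n) (m) => [? []] [? []]; rewrite xpair_eqE /= ?andbT ?orbT // => ->.
apply: (@reduce_at _ E v gE tE IH D' N') => //.
- apply: gain_graphU; apply: gain_graph1; exact: okx.
- by rewrite mD.
- rewrite cs -(card_map_edges D' (val_inj : injective (val : others v -> V))) mD cards2 ne //.
- by rewrite mD.
- move=> E' DE; apply: mv; apply: (subsetP DE); rewrite !inE eqxx ?orbT //.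
Qed.

Lemma H3a_red : uniq [:: n1.1; n2.1; n3.1; n4.1] -> generated E.
Proof.
have [[x1 X1] [x2 X2] [x3 X3] [x4 X4]] := H3_vertices => u.
apply: (H3_reduce X1 X2 X3 X4 (N' := [set to_new x1 n1.2; to_new x2 n2.2; to_new x3 n3.2; to_new x4 n4.2])).
  by rewrite /map_edges !imsetU !imset_set1 !unopt_new ?X1 ?X2 ?X3 ?X4 sE /=; set_perm.
move=> E' e1 e2; apply: Move_H3; apply: H3a e1 e2 _ _ => //.
by move: u; rewrite /= !inE -!val_eqE /= X1 X2 X3 X4.
Qed.

Lemma H3c_red : n2 = cj n1 -> n3.1 != n4.1 -> generated E.
Proof.
have [[x1 X1] [x2 X2] [x3 X3] [x4 X4]] := H3_vertices => e2 d34.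
have [[u12 u13 u14 u23 u24] u34] := H3_uniq.
have x21 : x2 = x1 by apply: val_inj; rewrite X1 X2 e2.
apply: (H3_reduce X1 X2 X3 X4 (N' := [set to_new x1 false; to_new x1 true; to_new x3 n3.2; to_new x4 n4.2])).
  rewrite /map_edges !imsetU !imset_set1 !unopt_new ?X1 ?X3 ?X4 sE e2 /=.
  by case: (n1.2); set_perm.
have nn : n1.2 (+) n2.2 = true by rewrite e2 /= addbN addbb.
rewrite x21 nn => E' e1 e3; apply: Move_H3; apply: H3c e1 e3 _ => //.
have d13 : n1.1 != n3.1 by rewrite same_vertex negb_or u13 -cj_eq -e2 u23.
have d14 : n1.1 != n4.1 by rewrite same_vertex negb_or u14 -cj_eq -e2 u24.
by rewrite /= !inE negb_or andbT -!val_eqE /= X1 X3 X4 d13 d14 d34.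
Qed.

(** H3b gives the edge of gain 1 at the doubled neighbour to the first deleted edge and the one of
    gain -1 to the second, which fixes the level of [n1]. The other level is reached by exchanging
    the two pairs. *)
Lemma H3b_red0 : n1.2 = false -> n3 = cj n1 -> n2.1 != n4.1 -> generated E.
Proof.
have [[x1 X1] [x2 X2] [x3 X3] [x4 X4]] := H3_vertices => n10 e3 d24.
have [[u12 u13 u14 u23 u24] u34] := H3_uniq.
have x31 : x3 = x1 by apply: val_inj; rewrite X1 X3 e3.
have n32 : n3.2 = true by rewrite e3 /= n10.
apply: (H3_reduce X1 X2 X3 X4 (N' := [set to_new x2 n2.2; to_new x1 false; to_new x1 true; to_new x4 (~~ ~~ n4.2)])).
  rewrite /map_edges !imsetU !imset_set1 !unopt_new ?X1 ?X2 ?X4 sE e3 /= n10 negbK.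
  by set_perm.
rewrite x31 n10 n32 addFb addTb edgeC => E' e1 e4; apply: Move_H3; apply: H3b e1 e4.
have d12 : n1.1 != n2.1 by rewrite same_vertex negb_or u12 -cj_eq -e3 eq_sym u23.
have d14 : n1.1 != n4.1 by rewrite same_vertex negb_or u14 -cj_eq -e3 u34.
by rewrite /= !inE negb_or andbT -!val_eqE /= X1 X2 X4 eq_sym d12 d24 d14.
Qed.
End H3.

Lemma nbrs_swap v n1 n2 n3 n4 : nbrs E v [:: n1; n2; n3; n4] -> nbrs E v [:: n3; n4; n1; n2].
Proof. by move=> H; apply: nbrs_perm H _; rewrite (perm_catC [:: n1; n2]). Qed.

Lemma nbrs_swap12 v n1 n2 n3 n4 : nbrs E v [:: n1; n2; n3; n4] -> nbrs E v [:: n2; n1; n3; n4].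
Proof. by move=> H; apply: nbrs_perm H _; apply/permP=> a /=; rewrite addnCA. Qed.

Lemma nbrs_swap34 v n1 n2 n3 n4 : nbrs E v [:: n1; n2; n3; n4] -> nbrs E v [:: n1; n2; n4; n3].
Proof. by move=> H; apply: nbrs_perm H _; apply/permP=> a /=; rewrite (addnCA (a n3)). Qed.

Lemma H3b_red v n1 n2 n3 n4 : nbrs E v [:: n1; n2; n3; n4] -> (v, true) \notin [:: n1; n2; n3; n4] ->
  ~~ adj E n1 n2 -> ~~ adj E n3 n4 -> cedge n1 n2 != cedge n3 n4 ->
  addable E v [set cedge n1 n2; cedge n3 n4] -> n3 = cj n1 -> n2.1 != n4.1 -> generated E.
Proof.
move=> H nl a12 a34 ne ad e3 d24; case b1 : (n1.2); last exact: H3b_red0 H nl a12 a34 ne ad b1 e3 d24.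
apply: (H3b_red0 (nbrs_swap H)) => //.
- by move: nl; rewrite !inE !negb_or => /and4P[-> -> -> ->].
- by rewrite eq_sym.
- by rewrite setUC.
- by rewrite e3 /= b1.
- by rewrite e3 cjK.
- by rewrite eq_sym.
Qed.

(** The last condition leaves out the case of two conjugate pairs of neighbours, which belongs to
    H3d. Otherwise the coincidences between underlying vertices decide among H3a, H3b and H3c. *)
Lemma H3_red v n1 n2 n3 n4 : nbrs E v [:: n1; n2; n3; n4] -> (v, true) \notin [:: n1; n2; n3; n4] ->
  ~~ adj E n1 n2 -> ~~ adj E n3 n4 -> cedge n1 n2 != cedge n3 n4 ->
  addable E v [set cedge n1 n2; cedge n3 n4] ->
  ~~ [&& cj n1 \in [:: n2; n3; n4], cj n2 \in [:: n1; n3; n4], cj n3 \in [:: n1; n2; n4]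
    & cj n4 \in [:: n1; n2; n3]] -> generated E.
Proof.
move=> H nl a12 a34 ne ad nn.
have [[u12 u13 u14 u23 u24] u34] := H3_uniq H.
have nl' : (v, true) \notin [:: n3; n4; n1; n2].
  by move: nl; rewrite !inE !negb_or => /and4P[-> -> -> ->].
have nl12 : (v, true) \notin [:: n2; n1; n3; n4].
  by move: nl; rewrite !inE !negb_or => /and4P[-> -> -> ->].
have nl34 : (v, true) \notin [:: n1; n2; n4; n3].
  by move: nl; rewrite !inE !negb_or => /and4P[-> -> -> ->].
have nl1234 : (v, true) \notin [:: n2; n1; n4; n3].
  by move: nl; rewrite !inE !negb_or => /and4P[-> -> -> ->].
have V2 (n m : V * bool) : n != m -> n.1 = m.1 -> m = cj n.
  move=> nm /eqP; rewrite same_vertex (negPf nm) /= => /eqP->; by rewrite cjK.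
have nn12 : n2 = cj n1 -> n4 = cj n3 -> False.
  by move=> e e'; move: nn; rewrite e e' !cjK !inE !eqxx ?orbT.
have nn13 : n3 = cj n1 -> n4 = cj n2 -> False.
  by move=> e e'; move: nn; rewrite e e' !cjK !inE !eqxx ?orbT.
have nn14 : n4 = cj n1 -> n3 = cj n2 -> False.
  by move=> e e'; move: nn; rewrite e e' !cjK !inE !eqxx ?orbT.
have [d12|d12] := eqVneq n1.1 n2.1.
  have e2 := V2 _ _ u12 d12.
  apply: (H3c_red H nl a12 a34 ne ad e2).
  by apply/eqP=> d34; apply: (nn12 e2 (V2 _ _ u34 d34)).
have [d34|d34] := eqVneq n3.1 n4.1.
  have e4 := V2 _ _ u34 d34.
  by apply: (H3c_red (nbrs_swap H) nl' a34 a12 _ _ e4 d12); rewrite 1?eq_sym 1?setUC.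
have [d13|d13] := eqVneq n1.1 n3.1.
  have e3 := V2 _ _ u13 d13.
  apply: (H3b_red H nl a12 a34 ne ad e3).
  by apply/eqP=> d24; apply: (nn13 e3 (V2 _ _ u24 d24)).
have [d14|d14] := eqVneq n1.1 n4.1.
  have e4 := V2 _ _ u14 d14.
  apply: (H3b_red (nbrs_swap34 H) nl34 a12 _ _ _ e4); rewrite ?(cedgeC n4) 1?adjC //.
  by apply/eqP=> d23; apply: (nn14 e4 (V2 _ _ u23 d23)).
have [d23|d23] := eqVneq n2.1 n3.1.
  have e3 := V2 _ _ u23 d23.
  by apply: (H3b_red (nbrs_swap12 H) nl12 _ a34 _ _ e3 d14); rewrite ?(cedgeC n2) 1?adjC.
have [d24|d24] := eqVneq n2.1 n4.1.
  have e4 := V2 _ _ u24 d24.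
  by apply: (H3b_red (nbrs_swap34 (nbrs_swap12 H)) nl1234 _ _ _ _ e4 d13); rewrite ?(cedgeC n2) ?(cedgeC n4) 1?adjC.
by apply: (H3a_red H nl a12 a34 ne ad); rewrite /= !inE !negb_or d12 d13 d14 d23 d24 d34.
Qed.

(** The two restored edges are loops, which do not lift to transversal sets. A symmetric set
    containing both pairs has slack at least 8, as adding the points over [v] shows, so only a tight
    symmetric set through one pair could block the move. *)
Lemma N22_red v n m : nbrs E v [:: n; cj n; m; cj m] -> (v, true) \notin [:: n; cj n; m; cj m] ->
  ~~ adj E n (cj n) -> ~~ adj E m (cj m) ->
  (forall X, symm X -> 4 * #|X| <= ee E X X -> avoids v X -> (n \notin X) && (m \notin X)) ->
  generated E.
Proof.
move=> H nl an am cl; have [[x1 X1] [x2 X2] [x3 X3] [x4 X4]] := H3_vertices H nl.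
have [u al] := H.
have [[u12 u13 u14 u23 u24] u34] := H3_uniq H.
have x21 : x2 = x1 by apply: val_inj; rewrite X1 X2.
have x43 : x4 = x3 by apply: val_inj; rewrite X3 X4.
have nm : n.1 != m.1 by rewrite same_vertex negb_or u13 u14.
have ne : cedge n (cj n) != cedge m (cj m).
  by rewrite cedge_eq !cjK (negPf u13) (negPf u14).
apply: (H3_reduce H an am ne _ X1 X2 X3 X4 (N' := [set to_new x1 false; to_new x1 true; to_new x3 false; to_new x3 true])).
- have [[h1 h2] _] := tE; split=> S HS; last first.
    move=> S0 aS; rewrite ee_set2 // !ee_set1 // !cjK !(andbC (cj _ \in _)) !(trans_and _ HS) !addn0.
    exact: h2.
  move=> aS; rewrite ee_set2 // !ee_set1 // !(symmP _ HS).
  have [k ek] := dvd_symm gE HS.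
  have := cl _ HS; have := h1 _ HS; have := symm_add_le HS (avoidsP false aS).
  case: (boolP (n \in S)) => nS; case: (boolP (m \in S)) => mS /=.
  + have : 4 <= dg E S (v, false).
      apply: (@dg_ge _ E S (v, false) [:: n; cj n; m; cj m]) => //=.
      by rewrite !(symmP _ HS) nS mS !al !inE !eqxx ?orbT.
    by move=> d4 le4 _ _; move: d4 le4; nlia.
  + by rewrite ek => _ h hh; have [g|g] := leqP (4 * #|S|) (4 * k); [have := hh g aS|move: g; nlia].
  + by rewrite ek => _ h hh; have [g|g] := leqP (4 * #|S|) (4 * k); [have := hh g aS|move: g; nlia].
  + by rewrite addn0.
- rewrite /map_edges !imsetU !imset_set1 !unopt_new ?X1 ?X3 (star_nbrs gE H) /=.
  by case: (n.2); case: (m.2); set_perm.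
have tight_trans (b : bool) : b (+) ~~ b = true by case: b.
rewrite x21 x43 !tight_trans => E' e1 e3; apply: Move_H3; apply: H3d => //.
by rewrite /= inE andbT -val_eqE /= X1 X3.
Qed.
End Moves2.

(** Edges with a common image are counted once on the left and separately on the right. The map is
    allowed to contract. *)
Lemma ee_map_le (V W : finType) (f : V -> W) (F : {set gedge V}) S :
  gain_graph F -> gain_graph (map_edges f F) ->
  ee (map_edges f F) S S <= ee F (pre f S) (pre f S).
Proof.
move=> /gain_graphP gF gM; rewrite ee_sum [X in _ <= X]ee_sum.
rewrite [X in _ <= X](eq_bigr (fun e => ee [set edge_map f e] S S)); last first.
  move=> e eF; have [u [v [a [ee ok]]]] := gF e eF.
  have : edge_map f e \in map_edges f F by apply: imset_f.
  rewrite ee edge_map_edge => /(gain_graph_ok gM) ok'.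
  by rewrite !ee_edge // !inE.
rewrite [X in _ <= X](partition_big_imset (edge_map f)) /=.
apply: leq_sum => y /imsetP[e eF ->].
by rewrite (bigD1 e) /= ?eF ?eqxx // leq_addr.
Qed.

Lemma mem_map_edges (V W : finType) (f : V -> W) (F : {set gedge V}) x y a :
  gain_graph F -> reflect (exists u w, [/\ f u = x, f w = y & edge u w a \in F])
    (edge x y a \in map_edges f F).
Proof.
move=> /gain_graphP gF; apply: (iffP imsetP) => [[e eF]|[u [w [<- <- uw]]]]; last first.
  by exists (edge u w a); rewrite ?edge_map_edge.
have [u [w [b [ee _]]]] := gF e eF.
move=> /eqP; rewrite ee edge_map_edge edge_eq => /andP[/eqP-> /orP[]/andP[/eqP-> /eqP->]].
  by exists u, w; rewrite -ee.
by exists w, u; rewrite edgeC -ee.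
Qed.

(** * Undoing vertex-to-K_4 *)

Section K4Membership.
Variables (V : finType) (E : {set gedge V}) (v : V) (f : V -> bool -> 'I_4) (w z : 'I_4).
Let X := K4_vertex v.
Let U : finType := {x : V | x != v}.
Let il (x : U) : X := inl x.
Let ir (i : 'I_4) : X := inr i.

Let il_inj : injective il. Proof. by move=> x y []. Qed.
Let ir_inj : injective ir. Proof. by move=> x y []. Qed.

Let no_ll (F : {set gedge U}) (x : X) i a : (edge x (ir i) a \in map_edges il F) = false.
Proof.
apply/negP=> /imsetP[e _ [H _]]; have : ir i \in [set x; ir i] by rewrite !inE eqxx orbT.
by rewrite H => /imsetP[].
Qed.

Let no_rr (F : {set gedge 'I_4}) (y : X) x a : (edge (il x) y a \in map_edges ir F) = false.
Proof.
apply/negP=> /imsetP[e _ [H _]]; have : il x \in [set il x; y] by rewrite !inE eqxx.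
by rewrite H => /imsetP[].
Qed.

Lemma K4_mem_ll (x y : U) a : (edge (il x) (il y) a \in vertex_to_K4 E v f w z) = (edge (val x) (val y) a \in E).
Proof.
rewrite /vertex_to_K4 !in_setU no_rr orbF -/il (edge_in_map _ _ _ _ il_inj) inE edge_map_edge.
rewrite [X in _ || X]in_set in_set1 edge_eq /= ?andbF /= ?orbF.
rewrite [X in _ || X](_ : _ = false) ?orbF //; apply/negP=> /imsetP[p _ /eqP].
by rewrite edge_eq /= ?andbF.
Qed.

Lemma K4_mem_lr (x : U) i a : (edge (il x) (ir i) a \in vertex_to_K4 E v f w z) =
  (edge (val x) v a \in E) && (i == f (val x) a).
Proof.
rewrite /vertex_to_K4 !in_setU no_ll no_rr orbF /=.
rewrite [X in _ || X]in_set in_set1 edge_eq /= ?andbF /= ?orbF.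
apply/imsetP/andP=> [[[y b]]|[xE /eqP->]]; last by exists (x, a); rewrite ?inE.
rewrite inE /= => yE /eqP; rewrite edge_eq /= ?andbF ?orbF => /andP[/eqP-> /andP[/eqP[->] /eqP[->]]].
by rewrite yE.
Qed.

Lemma K4_mem_rr i j a : (edge (ir i) (ir j) a \in vertex_to_K4 E v f w z) =
  (i != j) && ~~ a || [&& a, loop v \in E & (i == w) && (j == z) || (i == z) && (j == w)].
Proof.
rewrite /vertex_to_K4 !in_setU no_ll /= orbC; congr (_ || _).
  rewrite (edge_in_map _ _ _ _ ir_inj); have := adj_complete (i, false) (j, a).
  by rewrite /adj /cedge /= => ->; case: (a); rewrite ?andbF ?andbT.
rewrite [X in X || _](_ : _ = false) /=; last first.
  by apply/negP=> /imsetP[p _ /eqP]; rewrite edge_eq /= ?andbF.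
by rewrite in_set in_set1 edge_eq eqb_id andbC andbCA !andbA andbAC.
Qed.
End K4Membership.

Section K4Reduce.
Variables (V : finType) (E : {set gedge V}) (k : 'I_4 -> V).
Hypotheses (gE : gain_graph E) (tE : tight E) (IH : smaller_generated #|V|).
Hypotheses (kI : injective k) (hK : forall i j, i != j -> edge (k i) (k j) false \in E).
Hypothesis h1 : forall x a i j, x \notin codom k ->
  edge x (k i) a \in E -> edge x (k j) a \in E -> i = j.
Hypothesis h2 : forall i j i' j', edge (k i) (k j) true \in E ->
  edge (k i') (k j') true \in E -> edge (k i) (k j) true = edge (k i') (k j') true.

Let T : finType := {u : V | u \notin codom k}.
Let V0 : finType := option T.
Let c (u : V) : V0 := insub u.
Let K := map_edges k (complete 'I_4).
Let F := E :\: K.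

Let cN i : c (k i) = None. Proof. by rewrite /c insubF // negbF // codom_f. Qed.
Let cS (t : T) : c (val t) = Some t. Proof. exact: valK. Qed.
Let tk (t : T) i : val t <> k i.
Proof. by move=> e; have := valP t; rewrite e codom_f. Qed.
Let c_None u : c u = None -> exists i, u = k i.
Proof. by rewrite /c; case: insubP => // /negbNE/codomP[i ->] _; exists i. Qed.
Let c_Some u t : c u = Some t -> u = val t.
Proof. by rewrite /c; case: insubP => // x _ <- [->]. Qed.

Let KE : K \subset E.
Proof.
apply/subsetP=> e /imsetP[_ /imsetP[[i j] + ->] ->]; rewrite inE /= => ij.
by rewrite edge_map_edge; apply: hK.
Qed.

Let gF : gain_graph F. Proof. exact: gain_graph_sub (subsetDl _ _) gE. Qed.

Let FkP i j a : edge (k i) (k j) a \in F -> a.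
Proof.
rewrite inE => /andP[nK eE]; have := gain_graph_ok gE eE; rewrite (inj_eq kI).
case: a nK eE => // nK _; rewrite orbF => ij; case/negP: nK.
by rewrite edge_in_map //; have := adj_complete (i, false) (j, false); rewrite /adj /cedge /= ij.
Qed.

Let E0 : {set gedge V0} := map_edges c F.

Let gE0 : gain_graph E0.
Proof.
apply/gain_graphP=> _ /imsetP[e eF ->].
have [u [w [a [ee ok]]]] := elimT (gain_graphP _) gF e eF; exists (c u), (c w), a.
rewrite ee edge_map_edge; split=> //.
case: a ee ok => ee; rewrite ?orbT // !orbF => uw; apply/eqP=> cuw.
case cu : (c u) cuw => [t|] /esym cw.
  by move: uw; rewrite (c_Some cu) (c_Some cw) eqxx.
have [i ui] := c_None cu; have [j wj] := c_None cw.
by have := @FkP i j false; rewrite -ui -wj -ee => /(_ eF).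
Qed.

Let E0_SS (x y : T) a : (edge (Some x) (Some y) a \in E0) = (edge (val x) (val y) a \in E).
Proof.
apply/(mem_map_edges _ _ _ _ gF)/idP=> [[u [w [/c_Some-> /c_Some->]]]|xy].
  by rewrite inE => /andP[].
exists (val x), (val y); rewrite !cS; split=> //; rewrite inE xy andbT.
apply/negP=> /(mem_map_edges _ _ _ _ (gain_graph_complete _))[i [j [ix _ _]]].
by have := valP x; rewrite -ix codom_f.
Qed.

Let E0_SN (x : T) a : reflect (exists i, edge (val x) (k i) a \in E) (edge (Some x) None a \in E0).
Proof.
apply: (iffP (mem_map_edges _ _ _ _ gF)) => [[u [w [/c_Some-> /c_None[i ->]]]]|[i xi]].
  by rewrite inE => /andP[_]; exists i.
exists (val x), (k i); rewrite cS cN; split=> //; rewrite inE xi andbT.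
apply/negP=> /(mem_map_edges _ _ _ _ (gain_graph_complete _))[i' [j [ix _ _]]].
by have := valP x; rewrite -ix codom_f.
Qed.

Let kneg i j : edge (k i) (k j) true \in E -> edge (k i) (k j) true \in F.
Proof.
move=> ij; rewrite inE ij andbT edge_in_map //.
by have := adj_complete (i, false) (j, true); rewrite /adj /cedge /= andbF => ->.
Qed.

Let E0_NN : reflect (exists i j, edge (k i) (k j) true \in E) (loop None \in E0).
Proof.
apply: (iffP (mem_map_edges _ _ _ _ gF)) => [[u [w [/c_None[i ->] /c_None[j ->]]]]|[i [j ij]]].
  by rewrite inE => /andP[_]; exists i, j.
by exists (k i), (k j); rewrite !cN; split=> //; apply: kneg.
Qed.

(** By [h1] at most one vertex of the K_4 receives an edge of gain [a] from x, so the pick recovers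
    the attachment. The default value is taken only where there is no edge to attach. *)
Let f (o : V0) (a : bool) : 'I_4 :=
  if o is Some x then odflt ord0 [pick i | edge (val x) (k i) a \in E] else ord0.
Let wz : 'I_4 * 'I_4 := odflt (ord0, ord0) [pick p | edge (k p.1) (k p.2) true \in E].
Let X := K4_vertex (None : V0).
Let E1 : {set gedge X} := vertex_to_K4 E0 None f wz.1 wz.2.
Let h (x : X) : V :=
  match x with inl y => if val y is Some t then val t else k ord0 | inr i => k i end.

Let cardV : #|V| = #|T| + 4.
Proof.
rewrite card_sig -(cardC (mem (codom k))) card_codom // card_ord addnC; congr (_ + _).
Qed.

Let h_bij : bijective h.
Proof.
apply: inj_card_bij.
  move=> [[[t|//] pt]|i] [[[s|//] ps]|j] //=.
  - by move=> /val_inj ts; subst s; congr (inl _); apply: val_inj.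
  - by move=> /tk.
  - by move=> /esym/tk.
  - by move=> /kI ->.
have cN0 : #|{: {x : V0 | x != None}}| = #|T|.
  by rewrite card_sig; have := cardC1 (None : V0); rewrite card_option /= => <-; apply: eq_card.
by rewrite cardV card_sum card_ord leq_add2r cN0.
Qed.

Let E_iso : E = map_edges h E1.
Proof.
have gX : gain_graph E1.
  rewrite /E1 K4_parts; do 3 ?[apply: gain_graphU].
  - apply: gain_graph_map; first by move=> x y [].
    apply/forall_inP=> e; rewrite inE => /(forall_inP gE0) /=.
    by rewrite card_imset //; exact: val_inj.
  - by apply/gain_graphP=> _ /imsetP[p _ ->]; exists (inl p.1), (inr (f (val p.1) p.2)), p.2.
  - apply/gain_graphP=> e; rewrite in_set in_set1 => /andP[/eqP-> _].
    by exists (inr wz.1), (inr wz.2), true; rewrite orbT.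
  - by apply: gain_graph_map; [move=> x y []|exact: gain_graph_complete].
have [g hK' gK'] := h_bij.
apply: gain_graph_ext => // [|u w a]; first exact: gain_graph_map (bij_inj h_bij) gX.
rewrite -(gK' u) -(gK' w) edge_in_map; last exact: bij_inj.
have lr (x : {x : V0 | x != None}) i :
    (edge (h (inl x)) (h (inr i)) a \in E) = (edge (inl x : X) (inr i) a \in E1).
  rewrite K4_mem_lr; case: x => [[t|//] pt] /=; apply/idP/andP=> [tiE|[/E0_SN[j tj] /eqP->]].
    split; first by apply/E0_SN; exists i.
    case: pickP => [j tj|/(_ i)]; last by rewrite tiE.
    by apply/eqP; apply: h1 tiE tj; exact: (valP t).
  by case: pickP => [//|/(_ j)]; rewrite tj.
case: (g u) (g w) => [x|i] [y|j].
- rewrite K4_mem_ll; case: x y => [[t|//] pt] [[s|//] ps] /=.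
  by rewrite E0_SS.
- exact: lr.
- by rewrite edgeC lr edgeC.
- rewrite K4_mem_rr /= {lr}; apply/idP/orP=> [ij|].
    case: a ij => ij; [right|left]; last first.
      by have := gain_graph_ok gE ij; rewrite (inj_eq kI) orbF andbT.
    have -> : loop None \in E0 by apply/E0_NN; exists i, j.
    rewrite /= /wz; case: pickP => [[i' j'] /= ij'|/(_ (i, j))]; last by rewrite ij.
    have /eqP := h2 ij ij'; rewrite edge_eq !(inj_eq kI) /=.
    by move=> /orP[]/andP[-> ->]; rewrite ?orbT.
  case=> [/andP[ij]|/and3P[-> /E0_NN[i' [j' ij']]]].
    by case: a => // _; apply: hK.
  rewrite /wz; case: pickP => [[i1 j1] /= ij1|/(_ (i', j'))]; last by rewrite ij'.
  by case/orP=> /andP[/eqP-> /eqP->] //; rewrite edgeC.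
Qed.

Let eeK (S : {set V0 * bool}) : ee K (pre c S) (pre c S) = 12 * ((None, false) \in S) + 12 * ((None, true) \in S).
Proof.
rewrite ee_map //; last exact: gain_graph_complete.
set P := pre k _.
have PE i b : ((i, b) \in P) = ((None, b) \in S) by rewrite !inE /= cN.
pose HT : {set 'I_4 * bool} := pos_level [set: 'I_4 * bool].
have h0 (s : 'I_4 * bool) : s \in HT -> ~~ s.2 by rewrite !inE.
have ch : #|HT| = 4.
  have := card_split (pos_level_trans [set: 'I_4 * bool]); rewrite -pos_level_split ?symmT //.
  by rewrite cardsT card_prod card_ord card_bool -/HT; nlia.
case bf : ((None, false) \in S); case bt : ((None, true) \in S) => /=.
- have -> : P = setT by apply/setP=> -[i b]; rewrite PE inE; case: b.
  by rewrite ee_setT ?card_complete ?card_ord //; exact: gain_graph_complete.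
- have -> : P = HT by apply/setP=> -[i b]; rewrite PE !inE /=; case: b.
  by rewrite ee_complete_pos ?pos_level_trans // ch.
- have -> : P = cjs HT by apply/setP=> -[i b]; rewrite PE !inE /=; case: b.
  by rewrite ee_cjs ee_complete_pos ?pos_level_trans // ch.
- have -> : P = set0 by apply/setP=> -[i b]; rewrite PE !inE /=; case: b.
  by rewrite /ee big_set0.
Qed.

Let card_pre (S : {set V0 * bool}) :
  #|pre c S| = #|S| + 3 * ((None, false) \in S) + 3 * ((None, true) \in S).
Proof.
pose A b := (fun i => (k i, b)) @: [set i : 'I_4 | (None, b) \in S].
have cA b : #|A b| = 4 * ((None, b) \in S).
  rewrite card_imset; last by move=> i j [/kI].
  case: (_ \in S); first by rewrite -[RHS]card_ord -cardsT; apply: eq_card => i; rewrite !inE.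
  by apply: eq_card0 => i; rewrite inE.
pose B := (fun s : T * bool => (val s.1, s.2)) @: pre Some S.
have cB : #|B| = #|pre (Some : T -> V0) S|.
  by rewrite card_imset // => -[x b] [y d] /= [/val_inj -> ->].
have kA b i d : ((k i, d) \in A b) = (d == b) && ((None, b) \in S).
  apply/imsetP/andP=> [[j]|[/eqP-> H]]; last by exists i; rewrite ?inE.
  by rewrite inE => H [/kI _ ->].
have tA b (t : T) d : ((val t, d) \in A b) = false.
  by apply/negP=> /imsetP[j _ [/tk]].
have kB i d : ((k i, d) \in B) = false.
  by apply/negP=> /imsetP[[t b] _ [/esym/tk]].
have tB (t : T) d : ((val t, d) \in B) = ((Some t, d) \in S).
  apply/imsetP/idP=> [[[s b]]|H]; last by exists (t, d); rewrite ?inE.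
  by rewrite inE /= => H [/val_inj-> ->].
have -> : pre c S = A false :|: A true :|: B.
  apply/setP=> -[u d]; rewrite !in_setU in_pre /=; case cu : (c u) => [t|].
    by rewrite (c_Some cu) !tA tB.
  by have [i ->] := c_None cu; rewrite !kA kB orbF; case: d; rewrite /= ?orbF.
rewrite cardsU (_ : _ :&: B = set0) ?cards0 ?subn0; last first.
  apply/setP=> -[u d]; rewrite !inE -!/(_ \in _); case cu : (c u) => [t|].
    by rewrite (c_Some cu) !tA.
  by have [i ->] := c_None cu; rewrite kB andbF.
rewrite cardsU (_ : _ :&: A true = set0) ?cards0 ?subn0; last first.
  apply/setP=> -[u d]; rewrite !inE; case cu : (c u) => [t|].
    by rewrite (c_Some cu) !tA.
  by have [i ->] := c_None cu; rewrite !kA; case: d; rewrite ?andbF.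
have -> : #|S| = #|B| + (((None, false) \in S) + ((None, true) \in S)).
  by rewrite cB card_option_cover.
by rewrite !cA; case: ((None, false) \in S); case: ((None, true) \in S); rewrite /=; nlia.
Qed.

(** At each level occupied by the contracted vertex the preimage has three more points and the K_4
    contributes 12 = 4 * 3 to the count, so nothing is lost. *)
Let E0_sparse : sparse E0.
Proof.
have bound S : ee E0 S S + 4 * #|pre c S| <= ee E (pre c S) (pre c S) + 4 * #|S|.
  have := ee_map_le S gF gE0; rewrite (eeD (pre c S) (pre c S) KE) eeK card_pre -/F -/E0.
  by case: ((None, false) \in S); case: ((None, true) \in S); nlia.
have [[s1 s2] _] := tE; split=> S HS.
  by move: (bound S) (s1 _ (symm_pre c HS)); nlia.
move=> S0; have ne : pre c S != set0.
  case/set0Pn: S0 => -[[t|] b] xS; apply/set0Pn; first by exists (val t, b); rewrite inE /= cS.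
  by exists (k ord0, b); rewrite inE /= cN.
by move: (bound S) (s2 _ (trans_pre c HS) ne); nlia.
Qed.

Let E0_card : #|E0| = 2 * #|V0|.
Proof.
have cK : #|K| = 6 by rewrite card_map_edges // card_complete card_ord.
have cF : #|F| = 2 * #|V| - 6 by have [_ cE] := tE; rewrite cardsDS // cK cE.
suff -> : #|E0| = #|F| by rewrite cF cardV card_option; lia.
apply: card_in_imset => e e' eF e'F.
have [u [w [a [ee _]]]] := elimT (gain_graphP _) gF e eF.
have [u' [w' [a' [ee' _]]]] := elimT (gain_graphP _) gF e' e'F.
have FE b : b \in F -> b \in E by rewrite inE => /andP[].
move: eF e'F; rewrite ee ee' => eF e'F.
have key x y x' y' : edge x y a \in F -> edge x' y' a \in F ->
    c x = c x' -> c y = c y' -> edge x y a = edge x' y' a.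
  move=> e1 e2; case cx : (c x) => [t|] /esym cx'; case cy : (c y) => [s|] /esym cy'.
  - by rewrite (c_Some cx) (c_Some cx') (c_Some cy) (c_Some cy').
  - have [i yi] := c_None cy; have [j yj] := c_None cy'.
    move: e1 e2; rewrite (c_Some cx) (c_Some cx') yi yj => /FE e1 /FE e2.
    by rewrite (h1 (valP t) e1 e2).
  - have [i yi] := c_None cx; have [j yj] := c_None cx'.
    move: e1 e2; rewrite (c_Some cy) (c_Some cy') yi yj !(edgeC _ (val s)) => /FE e1 /FE e2.
    by rewrite (h1 (valP s) e1 e2).
  - have [i xi] := c_None cx; have [i' xi'] := c_None cx'.
    have [j yj] := c_None cy; have [j' yj'] := c_None cy'.
    move: e1 e2; rewrite xi xi' yj yj' => e1 e2; have a1 := FkP e1.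
    by move: e1 e2; rewrite a1 => /FE e1 /FE e2; apply: h2.
rewrite !edge_map_edge => /eqP; rewrite edge_eq => /andP[/eqP aa].
rewrite -aa in e'F *; case/orP=> /andP[/eqP c1 /eqP c2]; first exact: key.
by rewrite (edgeC u') ; apply: key => //; rewrite edgeC.
Qed.

Lemma K4_red : generated E.
Proof.
have gen0 : generated E0.
  apply: IH => //; rewrite cardV card_option; lia.
rewrite E_iso; apply: Gen_iso; first exact: h_bij.
apply: Gen_move gen0 _ _; first exact: Move_vertex_to_K4.
have [g hK' gK'] := h_bij.
by rewrite -/E1 -(map_edgesK E1 hK') -E_iso; apply: gain_graph_map => //; apply: can_inj gK'.
Qed.
End K4Reduce.

Lemma map_edges_comp (U V W : finType) (f : U -> V) (g : V -> W) (F : {set gedge U}) :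
  map_edges g (map_edges f F) = map_edges (g \o f) F.
Proof.
rewrite /map_edges -imset_comp; apply: eq_imset => -[A a].
by rewrite /edge_map /= -imset_comp.
Qed.

Lemma map_edgesU (V W : finType) (f : V -> W) (F G : {set gedge V}) :
  map_edges f (F :|: G) = map_edges f F :|: map_edges f G.
Proof. exact: imsetU. Qed.

Lemma map_edges_fix (V : finType) (f : V -> V) (F : {set gedge V}) : gain_graph F ->
  (forall u v a, edge u v a \in F -> f u = u) -> map_edges f F = F.
Proof.
move=> /gain_graphP gF H; rewrite -[RHS]imset_id; apply: eq_in_imset => e eF.
have [u [v [a [ee _]]]] := gF e eF; rewrite ee in eF *.
by rewrite edge_map_edge (H u v a) // (H v u a) // edgeC.
Qed.

(** * Undoing a vertex split *)

Section SplitReduce0.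
Variables (V : finType) (E : {set gedge V}) (w a b : V) (g : bool).
Hypotheses (gE : gain_graph E) (tE : tight E) (IH : smaller_generated #|V|).
Hypotheses (wa : w != a) (wb : w != b) (ab : a != b).
Hypotheses (Ewa : edge w a false \in E) (Ewb : edge w b g \in E) (Eab : edge a b g \in E).
Hypotheses (nwa : edge w a true \notin E) (nll : ~~ ((loop w \in E) && (loop a \in E))).
Hypothesis ncom : forall u d, u != w -> u != a -> edge w u d \in E -> edge a u d \in E ->
  u = b /\ d = g.
Hypothesis cT : forall S, trans S -> (w, false) \in S -> (a, false) \in S -> (b, g) \notin S ->
  ee E S S + 6 <= 4 * #|S|.
Hypothesis cS : forall S, symm S -> (w, false) \in S -> (a, false) \in S -> (b, g) \notin S ->
  ee E S S + 4 <= 4 * #|S|.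

Let T := others w.
Let a' : T := Sub a (etrans (congr1 negb (eq_sym a w)) wa).
Let b' : T := Sub b (etrans (congr1 negb (eq_sym b w)) wb).
Let c (u : V) : T := insubd a' u.
Let n1 := edge w a false.
Let n2 := edge w b g.
Let F := E :\: [set n1; n2].

Let cw : c w = a'. Proof. by rewrite /c /insubd insubF // eqxx. Qed.
Let cval (x : T) : c (val x) = x. Proof. by rewrite /c /insubd valK. Qed.
Let ca : c a = a'. Proof. exact: (cval a'). Qed.
Let cb : c b = b'. Proof. exact: (cval b'). Qed.
Let valc u : u != w -> val (c u) = u. Proof. by move=> uw; rewrite /c val_insubd uw. Qed.
Let c_a u : c u = a' -> u = w \/ u = a.
Proof.
have [->|uw] := eqVneq u w; first by left.
by move=> /(congr1 val); rewrite (valc uw); right.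
Qed.
Let c_eq u v : c u = c v -> u = v \/ (u = w /\ v = a) \/ (u = a /\ v = w).
Proof.
have [->|uw] := eqVneq u w; have [->|vw] := eqVneq v w; first by left.
- by rewrite cw => /esym/c_a[->|->]; [left|right; left].
- by rewrite cw => /c_a[->|->]; [left|right; right].
by move=> /(congr1 val); rewrite !valc //; left.
Qed.

Let n12 : n1 != n2. Proof. by rewrite edge_eq (negPf ab) (negPf wb) !andbF. Qed.
Let gF : gain_graph F. Proof. exact: gain_graph_sub (subsetDl _ _) gE. Qed.
Let FE e : e \in F -> e \in E. Proof. by rewrite inE => /andP[]. Qed.
Let F_wa d : edge w a d \notin F.
Proof.
by case: d; apply/negP=> H; [have := FE H; rewrite (negPf nwa)|move: H; rewrite !inE eqxx].
Qed.
Let F_wb : edge w b g \notin F.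
Proof. by rewrite !inE eqxx orbT. Qed.

Let E0 : {set gedge T} := map_edges c F.

Let gE0 : gain_graph E0.
Proof.
apply/gain_graphP=> _ /imsetP[e eF ->].
have [u [v [d [ee ok]]]] := elimT (gain_graphP _) gF e eF; exists (c u), (c v), d.
rewrite ee edge_map_edge; split=> //; rewrite ee in eF.
case: d ok eF {ee} => [|/=]; rewrite ?orbT // !orbF => uv eF; apply/eqP=> /c_eq[|[[uw va]|[ua vw]]].
- by move=> e1; rewrite e1 eqxx in uv.
- by have := F_wa false; rewrite -uw -va eF.
- by have := F_wa false; rewrite edgeC -ua -vw eF.
Qed.

(** With wa and wb removed, contraction could only identify two edges of equal gain from w and from
    a to the same vertex, or the two loops; [ncom] and [nll] exclude this. *)
Let inj_F : {in F &, injective (edge_map c)}.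
Proof.
move=> e e' eF e'F.
have [u [v [d [ee _]]]] := elimT (gain_graphP _) gF e eF.
have [u' [v' [d' [ee' _]]]] := elimT (gain_graphP _) gF e' e'F.
rewrite ee ee' in eF e'F *.
have one v1 v2 : edge w v1 d \in F -> edge a v2 d \in F -> c v1 = c v2 -> edge w v1 d = edge a v2 d.
  move=> e1 e2 /c_eq[v12|[[v1w v2a]|[v1a v2w]]].
  - have [v1w|v1w] := eqVneq v1 w; first by have := F_wa d; rewrite edgeC -v1w v12 e2.
    have [v1a|v1a] := eqVneq v1 a; first by have := F_wa d; rewrite -{1}v1a e1.
    have := ncom v1w v1a (FE e1); rewrite {1}v12 => /(_ (FE e2))[vb dg].
    by have := F_wb; rewrite -vb -dg e1.
  - have := FE e1; have := FE e2; rewrite v1w v2a => l2 l1.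
    have := gain_graph_ok gE l1; rewrite eqxx /= => d1.
    by move: nll; rewrite /loop; rewrite d1 in l1 l2; rewrite l1 l2.
  - by have := F_wa d; rewrite -{1}v1a e1.
have key x y x' y' : edge x y d \in F -> edge x' y' d \in F ->
    c x = c x' -> c y = c y' -> edge x y d = edge x' y' d.
  move=> e1 e2 /c_eq[xx|[[xw xa]|[xa xw]]] cy.
  - move: e2 cy; rewrite -xx => e2 /c_eq[->//|[[yw ya]|[ya yw]]].
    + move: e1 e2; rewrite yw ya !(edgeC x) => e1 e2; exact: one.
    + by move: e1 e2; rewrite yw ya !(edgeC x) => e1 e2; apply/esym; apply: one.
  - by move: e1 e2; rewrite xw xa => e1 e2; apply: one.
  - by move: e1 e2; rewrite xw xa => e1 e2; apply/esym; apply: one => //.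
rewrite !edge_map_edge => /eqP; rewrite edge_eq => /andP[/eqP dd].
rewrite -dd in e'F *; case/orP=> /andP[/eqP c1 /eqP c2]; first exact: key.
by rewrite (edgeC u'); apply: key => //; rewrite edgeC.
Qed.

Let card_pre (S : {set T * bool}) :
  #|pre c S| = #|S| + ((a', false) \in S) + ((a', true) \in S).
Proof.
pose B := (fun s : T * bool => (val s.1, s.2)) @: S.
have cB : #|B| = #|S| by rewrite card_imset // => -[x d] [y e] /= [/val_inj -> ->].
have Bw d : ((w, d) \in B) = false.
  by apply/negP=> /imsetP[[x e] _ [xw _]]; have := valP x; rewrite /= -xw eqxx.
have Bv u d : u != w -> ((u, d) \in B) = ((c u, d) \in S).
  move=> uw; apply/imsetP/idP=> [[[x e] xS [-> ->]]|H]; first by rewrite cval.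
  by exists (c u, d); rewrite //= valc.
rewrite (cardsD1 (w, false)) (cardsD1 (w, true) (_ :\ _)) in_setD1 !in_pre /= cw xpair_eqE andbF /=.
have -> : pre c S :\ (w, false) :\ (w, true) = B.
  apply/setP=> -[u d]; rewrite !in_setD1 in_pre /= !xpair_eqE.
  by have [->|uw] := eqVneq u w; [rewrite Bw; case: d|rewrite Bv].
by rewrite cB addnA addnC addnA.
Qed.

Let ee_n S : ee E S S = ee F S S + ee [set n1] S S + ee [set n2] S S.
Proof.
have nE : [set n1; n2] \subset E by rewrite subUset !sub1set; apply/andP.
by rewrite (eeD _ _ nE) ee_set2 // addnA.
Qed.

(** Each occupied level of the contracted vertex lowers the bound by 4, and the removed edges wa and
    wb compensate 2 each. If b is missing only wa does, and the other 2 come from the stronger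
    bounds [cT] and [cS]. *)
Let E0_sparse : sparse E0.
Proof.
have bound S : ee E0 S S + (2 * ((a', false) \in S) + 2 * ((a', true) \in S))
   + (2 * (((a', false) \in S) && ((b', g) \in S)) + 2 * (((a', true) \in S) && ((b', ~~ g) \in S)))
   <= ee E (pre c S) (pre c S).
  have := ee_map_le S gF gE0; rewrite ee_n !ee_edge ?wa ?wb // !in_pre /= cw ca cb !andbb -/E0.
  by case: ((a', false) \in S); case: ((a', true) \in S); case: ((b', g) \in S);
    case: ((b', ~~ g) \in S); rewrite /=; nlia.
have [[s1 s2] _] := tE.
have wS S d : ((w, d) \in pre c S) = ((a', d) \in S) by rewrite in_pre /= cw.
have aS S d : ((a, d) \in pre c S) = ((a', d) \in S) by rewrite in_pre /= ca.
have bS S d : ((b, d) \in pre c S) = ((b', d) \in S) by rewrite in_pre /= cb.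
split=> S HS.
  have sy := symm_pre c HS.
  have h : (a', false) \in S -> (b', g) \notin S -> ee E (pre c S) (pre c S) + 4 <= 4 * #|pre c S|.
    by move=> H1 H2; apply: cS; rewrite ?wS ?aS ?bS.
  have := s1 _ sy; have := bound S; move: h; rewrite card_pre.
  have -> : ((a', true) \in S) = ((a', false) \in S) by rewrite -(symmP _ HS).
  have -> : ((b', ~~ g) \in S) = ((b', g) \in S) by rewrite -(symmP _ HS) /cj /= negbK.
  case: ((a', false) \in S); case: ((b', g) \in S) => /= h; try nlia.
  by have := h isT isT; nlia.
move=> S0; have tr := trans_pre c HS.
have ne : pre c S != set0.
  by case/set0Pn: S0 => -[x d] xS; apply/set0Pn; exists (val x, d); rewrite in_pre /= cval.
have h : (a', false) \in S -> (b', g) \notin S -> ee E (pre c S) (pre c S) + 6 <= 4 * #|pre c S|.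
  by move=> H1 H2; apply: cT; rewrite ?wS ?aS ?bS.
have h' : (a', true) \in S -> (b', ~~ g) \notin S -> ee E (pre c S) (pre c S) + 6 <= 4 * #|pre c S|.
  move=> H1 H2; rewrite -ee_cjs -card_cjs; apply: cT; first exact: trans_cjs.
  - by rewrite in_cjs wS.
  - by rewrite in_cjs aS.
  - by rewrite in_cjs bS.
have := s2 _ tr ne; have := bound S; move: h h'; rewrite card_pre.
have := trans_and (a', false) HS; rewrite /cj /=.
case: ((a', false) \in S); case: ((a', true) \in S) => //= _; case: ((b', g) \in S);
case: ((b', ~~ g) \in S) => /= h h'; try nlia.
- by have := h isT isT; nlia.
- by have := h isT isT; nlia.
- by have := h' isT isT; nlia.
- by have := h' isT isT; nlia.
Qed.

Let cT1 : #|T|.+1 = #|V|.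
Proof.
have := card_option T; rewrite (bij_eq_card (@unopt_bij V w)) => ->; done.
Qed.

Let E0_card : #|E0| = 2 * #|T|.
Proof.
rewrite card_in_imset //; have nE : [set n1; n2] \subset E by rewrite subUset !sub1set; apply/andP.
have [_ cE] := tE; rewrite cardsDS // cards2 n12 cE; move: cT1; nlia.
Qed.

Let Fw := F :&: star E w.
Let Fo := F :\: star E w.
(** The class moved to the new vertex consists of all edges at w that remain, a loop included. *)
Let C := map_edges c Fw.

Let Fw_in u v d : edge u v d \in Fw -> (u == w) || (v == w).
Proof. by rewrite !inE => /and3P[_ _]; rewrite !(eq_sym w). Qed.

Let gFw : gain_graph Fw. Proof. by apply: gain_graph_sub gF; apply: subsetIl. Qed.
Let gFo : gain_graph Fo. Proof. by apply: gain_graph_sub gF; apply: subsetDl. Qed.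

Let a'b' : a' != b'. Proof. by rewrite -val_eqE. Qed.

Let split0 := vertex_split E0 a' b' g C.

Let E_iso : E = map_edges (@unopt V w) split0.
Proof.
have E0C : E0 :\: C = map_edges c Fo.
  rewrite /E0 /C /map_edges -(setID F (star E w)) imsetU -/Fw -/Fo setDUl setDv set0U.
  apply/setDidPl; rewrite -setI_eq0; apply/eqP/setP=> e; rewrite !inE; apply/negP.
  move=> /andP[/imsetP[e1 e1o ->] /imsetP[e2 e2w]] e12.
  have e1F : e1 \in F by move: e1o; rewrite inE => /andP[].
  have e2F : e2 \in F by move: e2w; rewrite inE => /andP[].
  move: e1o e2w; rewrite (inj_F e1F e2F e12) !inE => /andP[h1 _] /andP[_ h2].
  by rewrite h2 in h1.
rewrite /split0 /vertex_split /add_vertex E0C.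
rewrite !map_edgesU !map_edges_set1 !map_edges_comp !edge_map_edge /=.
rewrite (map_edges_fix gFo); last first.
  move=> u v d; rewrite inE => /andP[ns eF] /=; rewrite valc //.
  by apply: contraNneq ns => uw; rewrite inE (FE eF) !inE uw eqxx.
rewrite (map_edges_fix gFw); last first.
  move=> u v d eF /=; have eF' : edge u v d \in F by move: eF; rewrite inE => /andP[].
  have [->|uw] := eqVneq u w; first by rewrite cw eqxx.
  have ua : u != a.
    have := Fw_in eF; rewrite (negPf uw) /= => /eqP vw.
    by apply: contraTneq eF' => ->; rewrite vw edgeC.
  by rewrite -val_eqE /= valc // (negPf ua) /= valc.
have -> : Fo :|: (Fw :|: [set edge w a false; edge w b g]) = E; last by [].
apply/setP=> e; have FD : (e \in F) = [&& e != n1, e != n2 & e \in E] by rewrite in_setD in_set2 negb_or andbA.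
rewrite !in_setU in_setD in_setI !in_set1 FD -/n1 -/n2.
have [->|_] := eqVneq e n1; first by rewrite /= ?orbT; symmetry; exact: Ewa.
have [->|_] := eqVneq e n2; first by rewrite /= ?orbT; symmetry; exact: Ewb.
by case: (e \in star E w); case: (e \in E).
Qed.

Lemma split_red0 : generated E.
Proof.
have gen0 : generated E0 by apply: IH => //; rewrite -cT1.
rewrite E_iso; apply: Gen_iso; first exact: unopt_bij.
apply: Gen_move gen0 _ _.
  apply: Move_vertex_split a'b' _ _.
    rewrite -ca -cb -edge_map_edge; apply: imset_f; rewrite !inE Eab andbT negb_or.
    by rewrite !edge_eq !(eq_sym a) !(eq_sym b) (negPf wa) (negPf wb) !andbF.
  apply/subsetP=> _ /imsetP[e ew ->].
  have [u [v [d [ee _]]]] := elimT (gain_graphP _) gFw e ew.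
  have eF : e \in F by move: ew; rewrite inE => /andP[].
  rewrite in_setD1 inE imset_f // andTb; apply/andP; split; last first.
    have := Fw_in; rewrite ee in ew *; move=> /(_ u v d ew).
    by rewrite edge_map_edge !inE => /orP[/eqP->|/eqP->]; rewrite cw eqxx ?orbT.
  have key x y : edge x y d \in F -> x = w \/ y = w -> c x = a' -> c y = b' -> d = g -> False.
    move=> xF xyw cx cy dg; have yw : y <> w.
      by move=> yw; move: a'b'; rewrite -cy yw cw eqxx.
    have yb : y = b by rewrite -(valc (introN eqP yw)) cy.
    case: xyw => // xw; have := F_wb; rewrite -xw -yb -dg xF //.
  apply/negP; rewrite ee edge_map_edge edge_eq => /andP[/eqP dg].
  have := Fw_in; rewrite ee in ew eF; move=> /(_ u v d ew) uw.
  case/orP=> /andP[/eqP c1 /eqP c2]; first by apply: (key u v) => //; case/orP: uw => /eqP; auto.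
  by apply: (key v u) => //; [rewrite edgeC|case/orP: uw => /eqP; auto].
have [h unK gK] := @unopt_bij V w.
rewrite -/split0 -(map_edgesK split0 unK) -E_iso.
by apply: gain_graph_map => //; apply: can_inj gK.
Qed.
End SplitReduce0.

Section SplitReduce.
Variable V : finType.
Implicit Types (E : {set gedge V}) (s t u w a b : V * bool) (Z : {set V * bool}).

(** Contraction of wa, with wb merged into ab. [sp_nwa], [sp_loops] and [sp_common] ensure that no
    further edge disappears, and [sp_blocks] that sparsity survives. Stated in the cover, the
    conditions are invariant under switching and under exchange of levels. *)
Record splittable E w a b := Splittable {
  sp_wa : w.1 != a.1; sp_wb : w.1 != b.1; sp_ab : a.1 != b.1;
  sp_awa : adj E w a; sp_awb : adj E w b; sp_aab : adj E a b;
  sp_nwa : ~~ adj E w (cj a);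
  sp_loops : ~~ (adj E w (cj w) && adj E a (cj a));
  sp_common : forall u, u.1 != w.1 -> u.1 != a.1 -> adj E w u -> adj E a u -> u = b;
  sp_blocks : forall Z, block E Z -> w \in Z -> a \in Z -> b \notin Z -> False }.

Lemma not_block_trans E Z : gain_graph E -> sparse E -> trans Z -> Z != set0 ->
  ~ block E Z -> ee E Z Z + 6 <= 4 * #|Z|.
Proof.
move=> gE [_ h2] tZ Z0 nb; have := h2 _ tZ Z0; rewrite leq_eqVlt => /orP[/eqP h|]; last first.
  by have [k ->] := dvd_trans gE tZ; nlia.
by case: nb; apply/andP; split=> //; rewrite tZ h leqnn.
Qed.

Lemma not_block_symm E Z : gain_graph E -> sparse E -> symm Z -> Z != set0 ->
  ~ block E Z -> ee E Z Z + 4 <= 4 * #|Z|.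
Proof.
move=> gE [h1 _] sZ Z0 nb; have := h1 _ sZ; rewrite leq_eqVlt => /orP[/eqP h|]; last first.
  by have [k ->] := dvd_symm gE sZ; nlia.
by case: nb; apply/andP; split=> //; rewrite sZ h leqnn orbT.
Qed.

Lemma split_red1 E w a b : gain_graph E -> tight E -> smaller_generated #|V| ->
  splittable E w a b -> w.2 = false -> a.2 = false -> generated E.
Proof.
move=> gE tE IH [wa wb ab awa awb aab nwa nl com nb] w0 a0.
case: w a b w0 a0 wa wb ab awa awb aab nwa nl com nb => [w i] [a j] [b g] /= -> -> wa wb ab.
rewrite /adj /cedge /cj /= => awa awb aab nwa nl com nb; have [sE _] := tE.
apply: (@split_red0 V E w a b g) => //.
- move=> u d uw ua wu au; have := com (u, d) uw ua; rewrite /= => /(_ wu au) [-> ->] //.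
- move=> S tS wS aS bS; apply: not_block_trans => //; first by apply/set0Pn; exists (w, false).
  by move=> bl; apply: (nb S).
- move=> S tS wS aS bS; apply: not_block_symm => //; first by apply/set0Pn; exists (w, false).
  by move=> bl; apply: (nb S).
Qed.

Lemma flipsK v : involutive (@flips V v).
Proof. by move=> S; apply/setP=> s; rewrite !inE flipK. Qed.

Lemma block_switch E v Z : gain_graph E -> block (switch v E) Z = block E (flips v Z).
Proof.
move=> gE; rewrite /block ee_switch // card_flips -!card_gt0 card_flips.
have -> : trans (flips v Z) = trans Z.
  by apply/idP/idP=> /(trans_flips v) //; rewrite flipsK.
have -> : symm (flips v Z) = symm Z.
  by apply/idP/idP=> /(symm_flips v) //; rewrite flipsK.
by [].
Qed.

Lemma splittable_switch E v w a b : gain_graph E -> splittable E w a b ->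
  splittable (switch v E) (flip v w) (flip v a) (flip v b).
Proof.
move=> gE [wa wb ab awa awb aab nwa nl com nb].
split=> //; rewrite -?flip_cj ?adj_switch ?flipK //.
- move=> u uw ua; rewrite !adj_switch // !flipK => wu au.
  by rewrite -(com (flip v u)) ?flipK.
- move=> Z; rewrite block_switch // => bZ wZ aZ bZ'.
  by apply: (nb _ bZ); rewrite inE.
Qed.

Lemma splittable_cj E w a b : splittable E w a b -> splittable E (cj w) (cj a) (cj b).
Proof.
move=> [wa wb ab awa awb aab nwa nl com nb].
split=> //; rewrite ?adj_cj // ?adj_cjl ?cjK //.
- move=> u uw ua wu au; rewrite -[u]cjK; congr cj.
  by apply: com => //; rewrite -adj_cjl.
- move=> Z bZ wZ aZ bZ'.
  by apply: (nb _ (block_cjs bZ)); rewrite inE.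
Qed.

(** Conjugation moves w to level 0, and then switching at the vertex under a moves a to level 0, as
    the special form of the contraction requires. *)
Lemma split_red E w a b : gain_graph E -> tight E -> smaller_generated #|V| ->
  splittable E w a b -> generated E.
Proof.
move=> gE tE IH sp.
have step E' w' a' b' : gain_graph E' -> tight E' -> splittable E' w' a' b' ->
    w'.2 = false -> generated E'.
  move=> gE' tE' sp' w0; case a0 : (a'.2); last exact: split_red1 sp' w0 a0.
  rewrite -(switchK a'.1 E'); apply: Gen_switch.
  apply: (split_red1 _ _ IH (splittable_switch a'.1 gE' sp')).
  - exact: gain_graph_switch.
  - exact: tight_switch.
  - by rewrite /flip /= (negPf (sp_wa sp')) w0.
  - by rewrite /flip /= eqxx a0.
case w0 : (w.2); last exact: step sp w0.
by apply: (step _ _ _ _ gE tE (splittable_cj sp)); rewrite /= w0.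
Qed.
End SplitReduce.

(** * Vertices of degree three *)

Definition same_pair (T : eqType) (p q r t : T) := (p == r) && (q == t) || (p == t) && (q == r).

Ltac distinct_pairs := rewrite /same_pair; use_neqs; rewrite ?eqxx ?andbF ?orbF //.

Section Irreducible.
Variables (V : finType) (E : {set gedge V}).
Hypotheses (gE : gain_graph E) (tE : tight E) (IH : smaller_generated #|V|).
Hypothesis nG : ~ generated E.
Implicit Types (s t u w x : V * bool) (M S X Z : {set V * bool}).

Let sE : sparse E. Proof. by case: tE. Qed.

Definition nbset s := [set t | adj E s t].

(** So [dg E setT s] is the degree in the gain graph: a loop gives one neighbour in the cover but
    counts twice. *)
Lemma dgT s : dg E setT s = #|nbset s| + adj E s (cj s).
Proof.
have -> : adj E s (cj s) = \sum_t (t == cj s) * adj E s t :> nat.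
  by rewrite (bigD1 (cj s)) //= eqxx mul1n big1 ?addn0 // => t /negPf->.
rewrite dgE -sum1_card [X in _ = X + _]big_mkcond -big_split /=.
apply: eq_big => [t|t _]; first by rewrite inE.
rewrite inE /wt same_vertex; case st: (adj E s t); rewrite ?muln1 ?muln0 //.
have -> : (s == t) = false by apply/negP=> /eqP ss; rewrite -ss adj_irr in st.
by rewrite -cj_eq (eq_sym t).
Qed.

(** Deleting a vertex leaves a sparse graph, which has at most 2 |V| - 2 edges, so at least two
    edges meet the vertex. *)
Lemma deg_tight s : 2 + adj E s (cj s) <= dg E setT s.
Proof.
pose S := ~: [set s; cj s].
have sS : symm S by apply/symmC/symmI=> t; rewrite !inE cj_eq (inj_eq (@cj_inj V)) orbC.
have sN : s \notin S by rewrite !inE eqxx.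
have eT : setT = cj s |: (s |: S) by apply/setP=> t; rewrite !inE; do 2 case: (_ == _).
have := ee_add_symm gE sS sN; have := card_add_symm sS sN; rewrite -eT.
have [[h _] cE] := tE; have := h _ sS; rewrite ee_setT // cE cardsT card_prod card_bool.
have -> : dg E setT s = dg E S s + wt E s (cj s).
  rewrite !dgE [in LHS]eT big_setU1 ?big_setU1 //=; last by rewrite !inE cj_neq eqxx orbT.
  by rewrite wt_ss // addnC.
by rewrite /wt eqxx; case: (adj _ _ _); rewrite /=; nlia.
Qed.

Definition nbhd s l := uniq l /\ forall t, adj E s t = (t \in l).

Lemma nbhd_exists s : exists l, nbhd s l /\ size l = #|nbset s|.
Proof.
exists (enum (nbset s)); split; last by rewrite cardE.
by split; [exact: enum_uniq|move=> t; rewrite mem_enum inE].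
Qed.

Lemma nbhd_nbrs s l : nbhd s l -> nbrs E s.1 (if s.2 then map (@cj V) l else l).
Proof.
case: s => v [] [ul al] //=; split; first by rewrite map_inj_uniq //; exact: cj_inj.
by move=> t; rewrite -[t]cjK (mem_map (@cj_inj V)) -al -adj_cjl.
Qed.

Lemma nbrs_ge3 s : 3 <= #|nbset s|.
Proof.
have := deg_tight s; rewrite dgT leq_add2r leq_eqVlt => /orP[/eqP c2|//]; exfalso.
have [l [/nbhd_nbrs nl]] := nbhd_exists s; rewrite -c2.
case: l nl => [|n [|m [|? ?]]] //= nl _; apply: nG.
by case: (s.2) nl; apply: H1_red.
Qed.

Lemma avoids_mem s S : avoids s.1 S -> (s \notin S) && (cj s \notin S).
Proof. by case: s => v []; rewrite /avoids /cj //= andbC. Qed.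

Lemma nbhd_perm s l l' : nbhd s l -> perm_eq l l' -> nbhd s l'.
Proof. by move=> [ul al] p; split; [rewrite -(perm_uniq p)|move=> t; rewrite al (perm_mem p)]. Qed.

Lemma nbhd_noloop s l : nbhd s l -> ~~ adj E s (cj s) ->
  (s.1, true) \notin (if s.2 then map (@cj V) l else l).
Proof.
case: s => v [] [_ al]; rewrite al //=; apply: contra => /mapP[t tl /eqP].
by rewrite -cj_eq => /eqP tt; rewrite -tt in tl.
Qed.

(** The two reasons why H2 cannot be undone at [s] with restored edge n1 n2. *)
Lemma nbhd_H2 s n1 n2 n3 : nbhd s [:: n1; n2; n3] -> ~~ adj E s (cj s) ->
  adj E n1 n2 \/ exists Z, [/\ block E Z, s \notin Z, cj s \notin Z, n1 \in Z & n2 \in Z].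
Proof.
move=> H nl; case: (boolP (adj E n1 n2)) => [|a12]; first by left.
case: (boolP [exists Z, [&& block E Z, s \notin Z, cj s \notin Z, n1 \in Z & n2 \in Z]]) => [|nb].
  by case/existsP=> Z /and5P[*]; right; exists Z.
exfalso; apply: nG; have := nbhd_nbrs H; have := nbhd_noloop H nl.
have K Z : block E Z -> avoids s.1 Z -> n1 \in Z -> n2 \in Z -> False.
  move=> bZ /avoids_mem/andP[sZ csZ] Z1 Z2; case/negP: nb; apply/existsP; exists Z.
  by rewrite bZ sZ csZ Z1 Z2.
case: (s.2) => /= L L'; last by apply: H2_red L' L a12 _ => // Z bZ aZ; exact: K.
apply: H2_red L' L _ _ => //; first by rewrite adj_cj.
move=> Z bZ aZ Z1 Z2; apply: (K (cjs Z)); rewrite ?inE //; first exact: block_cjs.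
by move: aZ; rewrite /avoids !inE /cj /= andbC.
Qed.

Lemma nbhd_mem s l n : nbhd s l -> n \in l -> adj E s n. Proof. by move=> [_ ->]. Qed.

(** Blocks for two pairs share a neighbour and combine; a block for one pair absorbs the third
    neighbour if that is adjacent to both. Either way a block avoiding [s] contains all three
    neighbours, which is impossible, so every pair is adjacent. *)
Lemma deg3_noloop s n1 n2 n3 : nbhd s [:: n1; n2; n3] -> ~~ adj E s (cj s) ->
  [/\ adj E n1 n2, adj E n1 n3 & adj E n2 n3].
Proof.
have two m1 m2 m3 : nbhd s [:: m1; m2; m3] -> ~~ adj E s (cj s) ->
    (exists Z, [/\ block E Z, s \notin Z, cj s \notin Z, m1 \in Z & m2 \in Z]) ->
    (exists Z, [/\ block E Z, s \notin Z, cj s \notin Z, m1 \in Z & m3 \in Z]) -> False.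
  move=> H nl [Z [bZ sZ cZ Z1 Z2]] [Y [bY sY cY Y1 Y3]].
  have ne : Z :&: Y != set0 by apply/set0Pn; exists m1; rewrite inE Z1.
  have [X [bX /subsetP ZX XZ]] := block_union sE bZ bY ne.
  have sup t : t \notin Z -> t \notin Y -> cj t \notin Z -> cj t \notin Y -> t \notin X.
    move=> h1 h2 h3 h4; apply/negP=> /XZ.
    by rewrite !inE (negPf h1) (negPf h2) (negPf h3) (negPf h4).
  apply: (no_block3 gE sE bX (sup s sZ sY cZ cY)).
    by apply: sup; rewrite ?cjK.
  have [ul _] := H; apply: (dg_ge (l := [:: m1; m2; m3])) => //=.
  by rewrite !ZX ?inE ?Z1 ?Z2 ?Y3 ?orbT //= !(nbhd_mem H) ?inE ?eqxx ?orbT.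
have one m1 m2 m3 : nbhd s [:: m1; m2; m3] -> ~~ adj E s (cj s) ->
    (exists Z, [/\ block E Z, s \notin Z, cj s \notin Z, m1 \in Z & m2 \in Z]) ->
    adj E m1 m3 -> adj E m2 m3 -> False.
  move=> H nl [Z [bZ sZ cZ Z1 Z2]] a1 a2.
  have [ul _] := H; have m12 : m1 != m2.
    by move: ul; rewrite /= !inE negb_or => /andP[/andP[]].
  rewrite adjC in a1; rewrite adjC in a2.
  have [X [bX X3 /subsetP ZX XZ]] := block_add gE sE bZ Z1 Z2 m12 a1 a2.
  have a3 : adj E s m3 by rewrite (nbhd_mem H) ?inE ?eqxx ?orbT.
  have s3 : s != m3 by apply/eqP=> s3; rewrite -s3 adj_irr in a3.
  have s3' : s != cj m3.
    by apply: contraNneq nl => ss; rewrite {2}ss cjK.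
  have s3'' : cj s != m3 by rewrite cj_eq.
  have s4 : cj s != cj m3 by rewrite (inj_eq (@cj_inj V)).
  apply: (no_block3 gE sE bX (s := s)).
  - by apply/negP=> /XZ; rewrite (negPf sZ) (negPf cZ) (negPf s3) (negPf s3').
  - by apply/negP=> /XZ; rewrite cjK (negPf sZ) (negPf cZ) (negPf s3'') (negPf s4).
  apply: (dg_ge (l := [:: m1; m2; m3])) => //=.
  by rewrite X3 (ZX m1) // (ZX m2) //= !(nbhd_mem H) ?inE ?eqxx ?orbT.
move=> H nl.
have H13 : nbhd s [:: n1; n3; n2] by apply: nbhd_perm H _; apply/permP=> a /=; rewrite (addnCA (a n2)).
have H23 : nbhd s [:: n2; n3; n1] by apply: nbhd_perm H _; rewrite (perm_catC [:: n1]).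
have H21 : nbhd s [:: n2; n1; n3] by apply: nbhd_perm H _; apply/permP=> a /=; rewrite addnCA.
have H31 : nbhd s [:: n3; n1; n2] by apply: nbhd_perm H _; rewrite (perm_catC [:: n1; n2]).
have H32 : nbhd s [:: n3; n2; n1] by apply: nbhd_perm H23 _; apply/permP=> a /=; rewrite addnCA.
have sw m1 m2 : (exists Z, [/\ block E Z, s \notin Z, cj s \notin Z, m1 \in Z & m2 \in Z]) ->
  exists Z, [/\ block E Z, s \notin Z, cj s \notin Z, m2 \in Z & m1 \in Z].
  by move=> [Z [*]]; exists Z; split.
case: (nbhd_H2 H nl) => [a12|b12]; case: (nbhd_H2 H13 nl) => [a13|b13];
  case: (nbhd_H2 H23 nl) => [a23|b23]; split=> //; exfalso.
all: try exact: (two _ _ _ H nl b12 b13).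
all: try exact: (two _ _ _ H21 nl (sw _ _ b12) b23).
all: try exact: (two _ _ _ H31 nl (sw _ _ b13) (sw _ _ b23)).
all: try (rewrite adjC in a12); try (rewrite adjC in a13); try (rewrite adjC in a23).
all: try by apply: (one _ _ _ H nl b12); rewrite adjC.
all: try by apply: (one _ _ _ H13 nl b13); rewrite // adjC.
all: try by apply: (one _ _ _ H23 nl b23); rewrite // adjC.
Qed.

Definition tight_trans M := trans M && (4 * #|M| <= ee E M M + 4).
(** At least two sides of the triangle w, a, b are doubled by a parallel edge. *)
Definition two_chords w a b := [|| adj E w (cj a) && adj E w (cj b), adj E w (cj a) && adj E a (cj b)
  | adj E w (cj b) && adj E a (cj b)].

Lemma cedge_cj_neq M p q r t : trans M -> p \in M -> q \in M -> r \in M -> t \in M ->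
  ~~ same_pair p q r t -> cedge p (cj q) != cedge r (cj t).
Proof.
move=> tM pM qM rM tM'; apply: contra; rewrite cedge_eq !cjK !(inj_eq (@cj_inj V)).
have no x y : x \in M -> y \in M -> (x == cj y) = false.
  by move=> xM yM; apply/eqP=> xy; rewrite -[y]cjK -xy (transP tM xM) in yM.
by rewrite (no p r) // (no p t) //= !orbF !orFb !cj_eq.
Qed.

(** The usual source of contradictions below: each pair records an edge between M and its conjugate,
    a loop when its entries agree, and only two such edges are possible. *)
Lemma three_extras M p1 q1 p2 q2 p3 q3 : tight_trans M ->
  [&& p1 \in M, q1 \in M & adj E p1 (cj q1)] -> [&& p2 \in M, q2 \in M & adj E p2 (cj q2)] ->
  [&& p3 \in M, q3 \in M & adj E p3 (cj q3)] ->
  ~~ same_pair p1 q1 p2 q2 -> ~~ same_pair p1 q1 p3 q3 -> ~~ same_pair p2 q2 p3 q3 -> False.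
Proof.
move=> /andP[tM eM] /and3P[p1M q1M a1] /and3P[p2M q2M a2] /and3P[p3M q3M a3] u12 u13 u23.
have := @extra_le2 _ E M [:: (p1, cj q1); (p2, cj q2); (p3, cj q3)] sE tM eM.
rewrite /= !cjK p1M q1M p2M q2M p3M q3M a1 a2 a3 !inE /=.
by rewrite (negPf (cedge_cj_neq tM p1M q1M p2M q2M u12)) (negPf (cedge_cj_neq tM p1M q1M p3M q3M u13))
  (negPf (cedge_cj_neq tM p2M q2M p3M q3M u23)) /= => /(_ isT isT).
Qed.

Lemma tb_block M a : tight_trans M -> a \in M -> block E M.
Proof. by move=> /andP[tM eM] aM; apply: block_trans => //; apply/set0Pn; exists a. Qed.

Lemma tb_add M w a b : tight_trans M -> w \notin M -> cj w \notin M -> a \in M -> b \in M -> a != b ->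
  adj E w a -> adj E w b -> tight_trans (w |: M).
Proof.
move=> /andP[tM eM] wM cwM aM bM ab wa wb; apply/andP; split.
  apply: transI => t; rewrite !inE => /orP[/eqP->|tM']; first by rewrite cj_neq (negPf cwM).
  by rewrite (transP tM tM') orbF => /eqP cw; rewrite -cw cjK tM' in cwM.
have d2 : 2 <= dg E M w.
  by apply: (dg_ge (l := [:: a; b])); rewrite /= ?inE ?ab ?aM ?bM ?wa ?wb.
by rewrite ee_add1 // cardsU1 wM; move: d2 eM; nlia.
Qed.

Lemma adj_neq s t : adj E s t -> s != t.
Proof. by apply: contraTneq => ->; rewrite adj_irr. Qed.

(* The local obstructions to contracting [wa] in the triangle [w, a, b]. *)
Definition uncontractible w a b := [\/ adj E w (cj a), adj E w (cj w) && adj E a (cj a)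
  | exists u, [&& u.1 != w.1, u.1 != a.1, adj E w u, adj E a u & u != b]].

Lemma fst_neq w a : w != a -> w != cj a -> w.1 != a.1.
Proof. by move=> h1 h2; rewrite same_vertex negb_or h1. Qed.

(** The block condition of a contraction holds here. A block through w and a that misses b would
    combine with M, after deletion of the edge wb, to a block containing both ends of that edge. *)
Lemma branch_fail M w a b : tight_trans M -> a \in M -> b \in M -> adj E a b ->
  w \notin M -> cj w \notin M -> adj E w a -> adj E w b -> uncontractible w a b.
Proof.
move=> tbM aM bM ab wM cwM wa wb; have /andP[tM eM] := tbM.
have [wca|nwca] := boolP (adj E w (cj a)); first by constructor 1.
have [ll|nll] := boolP (adj E w (cj w) && adj E a (cj a)); first by constructor 2.
have [/existsP ex|nex] := boolP [exists u, [&& u.1 != w.1, u.1 != a.1, adj E w u, adj E a u & u != b]].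
  by constructor 3.
exfalso; apply: nG; apply: (@split_red _ E w a b) => //.
have wM1 x : x \in M -> w.1 != x.1.
  move=> xM; apply: fst_neq; first by apply: contraNneq wM => ->.
  by rewrite -cj_eq; apply: contraNneq cwM => ->.
split=> //; [exact: wM1|exact: wM1| |move=> u uw ua wu au|move=> Z bZ wZ aZ bZ'].
- apply: fst_neq (adj_neq ab) _; apply/eqP=> abE.
  by have := transP tM bM; rewrite -abE aM.
- by apply/eqP; apply: contraNT nex => ub; apply/existsP; exists u; apply/and5P.
have wb' : w != b := adj_neq wb.
pose E' := E :\ cedge w b.
have sE' : sparse E' by apply: sparse_sub sE; apply: subsetDl.
have bM' : block E' M.
  by apply: block_del; [exact: tb_block aM|rewrite ee_set1 // (negPf wM) (negPf cwM)].
have bZ2 : block E' Z.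
  apply: block_del => //; rewrite ee_set1 // (negPf bZ') andbF /=.
  case/andP: (bZ) => _ /orP[] /andP[hZ _]; first by rewrite (transP hZ wZ).
  by rewrite (symmP b hZ) (negPf bZ') andbF.
have ne : Z :&: M != set0 by apply/set0Pn; exists a; rewrite inE aZ.
have [X [bX /subsetP ZX _]] := block_union sE' bZ2 bM' ne.
by apply: (block_adj gE sE wb' wb bX); apply: ZX; rewrite inE ?wZ ?bM ?orbT.
Qed.

Lemma cfg_three M u w a p q : tight_trans M -> u \in M -> w \in M -> a \in M ->
  u != w -> u != a -> w != a -> two_chords u w a -> [&& p \in M, q \in M & adj E p (cj q)] ->
  ~~ same_pair p q u w -> ~~ same_pair p q u a -> ~~ same_pair p q w a -> False.
Proof.
move=> tbM uM wM aM uw ua wa c pq h1 h2 h3.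
have h4 : ~~ same_pair u w u a by rewrite /same_pair; use_neqs; rewrite ?andbF.
have h5 : ~~ same_pair u w w a by rewrite /same_pair; use_neqs; rewrite ?andbF.
have h6 : ~~ same_pair u a w a by rewrite /same_pair; use_neqs; rewrite ?andbF.
case/or3P: c => /andP[c1 c2].
- by apply: (three_extras tbM pq _ _ h1 h2 h4); rewrite uM ?wM ?aM.
- by apply: (three_extras tbM pq _ _ h1 h3 h5); rewrite ?uM wM ?aM.
- by apply: (three_extras tbM pq _ _ h2 h3 h6); rewrite ?uM ?wM ?aM.
Qed.

(* If neither [wa] nor [wb] is contractible then each has a local obstruction; a
   common neighbour outside M gives the same situation for the larger set w |: M,
   and otherwise the obstructions are edges from w |: M to its conjugate, of which
   there are at most two. *)
Lemma branch M w a b : tight_trans M -> a \in M -> b \in M -> adj E a b ->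
  w \notin M -> cj w \notin M -> adj E w a -> adj E w b -> two_chords w a b.
Proof.
have [n le] := ubnP #|~: M|; elim: n => // n IHn in M w a b le *.
move=> tbM aM bM ab wM cwM wa wb.
have ab' : a != b := adj_neq ab.
have wN x : x \in M -> w != x by move=> xM; apply: contraNneq wM => ->.
have wCN x : x \in M -> x != cj w by move=> xM; apply: contraNneq cwM => <-.
have tbM' : tight_trans (w |: M) by apply: (tb_add tbM wM cwM aM bM).
have /andP[tM eM] := tbM.
have no3 u : adj E w u -> u \in M -> u != a -> u != b -> False.
  move=> wu uM ua ub; apply: (no_block3 gE sE (tb_block tbM aM) wM cwM).
  apply: (dg_ge (l := [:: u; a; b])); rewrite /= ?inE ?negb_or ?ua ?ub ?ab' //.
  by rewrite aM bM uM wa wb wu.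
(* A common neighbour [u] of w and c is attached to the edge wc of the larger tight set [w |: M], so
   the induction hypothesis doubles two sides of the triangle u, w, c. *)
have IHw u c : c \in M -> adj E w c -> u \notin M -> cj u \notin M -> u.1 != w.1 ->
    adj E w u -> adj E c u -> two_chords u w c /\ tight_trans (u |: (w |: M)).
  move=> cM wc uM cuM uw wu cu.
  have /andP[uw1 uw2] := cover_neq uw.
  have uM' : u \notin w |: M by rewrite !inE (negPf uw1).
  have cuM' : cj u \notin w |: M by rewrite !inE cj_eq (negPf uw2).
  split; last by apply: (tb_add tbM' uM' cuM' (setU11 _ _) (setU1r _ cM) (wN _ cM)); rewrite adjC.
  apply: (IHn (w |: M)) => //; rewrite ?setU11 ?setU1r //; [|by rewrite adjC|by rewrite adjC].
  have := cardsC (w |: M); have := cardsC M; rewrite cardsU1 wM; move: le; nlia.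
have cases c d : c \in M -> d \in M -> uncontractible w c d -> (c == a) && (d == b) || (c == b) && (d == a) ->
    [\/ adj E w (cj c), adj E w (cj w) && adj E c (cj c),
     exists t, [&& t \in M, t != c, adj E w (cj t) & adj E c (cj t)] |
     exists u, [/\ u \notin M, cj u \notin M, u.1 != w.1, adj E w u & adj E c u]].
  move=> cM dM [f|f|[u /and5P[uw uc wu cu ud]]] cd; [by constructor 1|by constructor 2|].
  have [cuM|cuM] := boolP (cj u \in M).
    constructor 3; exists (cj u); rewrite cuM cjK wu cu !andbT /= cj_eq.
    by have /andP[] := cover_neq uc.
  constructor 4; exists u; split=> //; apply/negP=> uM.
  have /andP[uc' _] := cover_neq uc.
  by case/orP: cd uc' ud => /andP[/eqP-> /eqP->] h1 h2; apply: (no3 u).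
(* The triangle u, w, c has two doubled sides, and every obstruction for the remaining edge wd adds
   a third edge between a tight transversal set and its conjugate, or gives [u] three neighbours in
   a block. *)
have ext c d u : c \in M -> d \in M -> adj E w c -> adj E w d -> c != d ->
    (c == a) && (d == b) || (c == b) && (d == a) -> uncontractible w d c ->
    u \notin M -> cj u \notin M -> u.1 != w.1 -> adj E w u -> adj E c u -> False.
  move=> cM dM wc wd cd cdab fd uM cuM uw wu cu.
  have [cfgc tb3] := IHw u c cM wc uM cuM uw wu cu.
  have uN x : x \in M -> u != x by move=> xM; apply: contraNneq uM => ->.
  have /andP[uw1 uw2] := cover_neq uw.
  have wc' := wN _ cM; have wd' := wN _ dM; have uc' := uN _ cM; have ud' := uN _ dM.
  have inM x : x \in M -> x \in u |: (w |: M) by move=> xM; rewrite !inE xM !orbT.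
  have wI : w \in u |: (w |: M) by rewrite !inE eqxx orbT.
  have uI : u \in u |: (w |: M) by rewrite !inE eqxx.
  have c3 p q h := @cfg_three _ u w c p q tb3 uI wI (inM _ cM) uw1 uc' wc' cfgc h.
  have dI := inM _ dM; have dc : (d == a) && (c == b) || (d == b) && (c == a).
    by rewrite andbC orbC andbC.
  case: (cases d c dM cM fd dc).
  - by move=> e1; apply: (c3 w d); rewrite ?wI ?dI //; distinct_pairs.
  - by move=> /andP[e1 e2]; apply: (c3 w w); rewrite ?wI ?dI //; distinct_pairs.
  - move=> [t /and4P[tM' td e1 e2]]; have ut := uN _ tM'; have wt' := wN _ tM'.
    by apply: (c3 d t); rewrite ?inM //; distinct_pairs.
  move=> [y [yM cyM yw wy dy]].
  have [yu|yu] := eqVneq y u.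
    rewrite yu in wy dy; apply: (no_block3 gE sE (tb_block tbM' (setU11 _ _)) (s := u)).
    - by rewrite !inE negb_or uw1.
    - by rewrite !inE negb_or cj_eq uw2.
    apply: (dg_ge (l := [:: w; c; d])); rewrite /= ?inE ?negb_or ?wc' ?wd' ?cd //=.
    by rewrite eqxx cM dM !orbT (adjC E u) wu (adjC E u) cu (adjC E u) dy.
  have [ycu|ycu] := eqVneq y (cj u).
    rewrite ycu in wy dy.
    by apply: (c3 d u); rewrite ?uI ?dI //; distinct_pairs.
  have [cfgd _] := IHw y d dM wd yM cyM yw wy dy.
  have /andP[yw1 yw2] := cover_neq yw.
  have yM3 : y \notin u |: (w |: M) by rewrite !inE !negb_or yu yw1.
  have cyM3 : cj y \notin u |: (w |: M) by rewrite !inE !negb_or !cj_eq ycu yw2.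
  have tb4 : tight_trans (y |: (u |: (w |: M))).
    by apply: (tb_add tb3 yM3 cyM3 wI dI wd'); rewrite adjC.
  have c4 p q h := @cfg_three _ u w c p q tb4 (setU1r _ uI) (setU1r _ wI) (setU1r _ (inM _ cM))
    uw1 uc' wc' cfgc h.
  have yN x : x \in M -> y != x by move=> xM; apply: contraNneq yM => ->.
  have yc := yN _ cM; have yd := yN _ dM.
  case/or3P: cfgd => /andP[d1 d2].
  - by apply: (c4 y w); rewrite ?setU11 ?(setU1r _ wI) //; distinct_pairs.
  - by apply: (c4 y w); rewrite ?setU11 ?(setU1r _ wI) //; distinct_pairs.
  - by apply: (c4 y d); rewrite ?setU11 ?(setU1r _ dI) //; distinct_pairs.
have ba : adj E b a by rewrite adjC.
have ba' : b != a by rewrite eq_sym.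
have fA := branch_fail tbM aM bM ab wM cwM wa wb.
have fB := branch_fail tbM bM aM ba wM cwM wb wa.
have ab1 : (a == a) && (b == b) || (a == b) && (b == a) by rewrite !eqxx.
have ba1 : (b == a) && (a == b) || (b == b) && (a == a) by rewrite !eqxx orbT.
case: (cases a b aM bM fA ab1) => [A1|/andP[A2 A2']|[t /and4P[tM' ta A3 A3']]|[u [*]]];
  last by exfalso; apply: (ext a b u).
all: case: (cases b a bM aM fB ba1) => [B1|/andP[B2 B2']|[y /and4P[yM yb B3 B3']]|[u [*]]];
  last by exfalso; apply: (ext b a u).
all: have wa' := wN _ aM; have wb' := wN _ bM; have wI := setU11 w M.
all: have inM x : x \in M -> x \in w |: M by move=> xM; apply: setU1r.
all: have aI := inM _ aM; have bI := inM _ bM.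
all: try (have wt' := wN _ tM'; have tI := inM _ tM').
all: try (have wy' := wN _ yM; have yI := inM _ yM).
(* If the common neighbour [cj t] is the conjugate of b, it doubles the sides wb and ab, as claimed.
   Otherwise its two edges differ from the doubled sides and help to exceed the bound. *)
all: try (have [tb'|tb'] := eqVneq t b;
  first by rewrite tb' in A3 A3'; rewrite /two_chords A3 A3' !orbT).
all: try (have [ya'|ya'] := eqVneq y a;
  first by rewrite ya' in B3 B3'; rewrite -adj_cjl adjC in B3'; rewrite /two_chords B3 B3' !orbT).
- by rewrite /two_chords A1 B1.
all: exfalso.
- by apply: (three_extras tbM' (p1 := w) (q1 := a) (p2 := w) (q2 := w) (p3 := b) (q3 := b));
    rewrite ?wI ?aI ?bI //; distinct_pairs.
- by apply: (three_extras tbM' (p1 := w) (q1 := a) (p2 := w) (q2 := y) (p3 := b) (q3 := y));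
    rewrite ?wI ?aI ?bI ?yI //; distinct_pairs.
- by apply: (three_extras tbM' (p1 := w) (q1 := b) (p2 := w) (q2 := w) (p3 := a) (q3 := a));
    rewrite ?wI ?aI ?bI //; distinct_pairs.
- by apply: (three_extras tbM' (p1 := w) (q1 := w) (p2 := a) (q2 := a) (p3 := b) (q3 := b));
    rewrite ?wI ?aI ?bI //; distinct_pairs.
- by apply: (three_extras tbM' (p1 := w) (q1 := w) (p2 := a) (q2 := a) (p3 := w) (q3 := y));
    rewrite ?wI ?aI ?bI ?yI //; distinct_pairs.
- by apply: (three_extras tbM' (p1 := w) (q1 := b) (p2 := w) (q2 := t) (p3 := a) (q3 := t));
    rewrite ?wI ?aI ?bI ?tI //; distinct_pairs.
- by apply: (three_extras tbM' (p1 := w) (q1 := w) (p2 := w) (q2 := t) (p3 := a) (q3 := t));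
    rewrite ?wI ?aI ?bI ?tI //; distinct_pairs.
- by apply: (three_extras tbM' (p1 := w) (q1 := t) (p2 := a) (q2 := t) (p3 := b) (q3 := y));
    rewrite ?wI ?aI ?bI ?tI ?yI //; distinct_pairs.
Qed.
End Irreducible.

(** * Switching at sets of vertices, and balanced cliques *)

Section SwitchSet.
Variable V : finType.
Implicit Types (E : {set gedge V}) (X : {set V}) (s t : V * bool).

Definition switchX X E := foldr (@switch V) E (enum X).
Definition flipX X s : V * bool := (s.1, s.2 (+) (s.1 \in X)).

Lemma gain_graph_switchX X E : gain_graph E -> gain_graph (switchX X E).
Proof.
by move=> gE; rewrite /switchX; elim: (enum X) => //= v l; apply: gain_graph_switch.
Qed.

Lemma tight_switchX X E : gain_graph E -> tight E -> tight (switchX X E).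
Proof.
move=> gE tE; suff [] : gain_graph (switchX X E) /\ tight (switchX X E) by [].
rewrite /switchX; elim: (enum X) => //= v l [g t].
by split; [apply: gain_graph_switch|apply: tight_switch].
Qed.

Lemma generated_switchX X E : generated (switchX X E) -> generated E.
Proof.
rewrite /switchX; elim: (enum X) => //= v l IHl H; apply: IHl.
by rewrite -[foldr _ _ _](switchK v); apply: Gen_switch.
Qed.

Lemma adj_switchX X E s t : gain_graph E -> adj (switchX X E) s t = adj E (flipX X s) (flipX X t).
Proof.
move=> gE; have H l : gain_graph (foldr (@switch V) E l).
  by elim: l => //= v l; apply: gain_graph_switch.
suff K l : uniq l -> adj (foldr (@switch V) E l) s t =
    adj E (s.1, s.2 (+) (s.1 \in l)) (t.1, t.2 (+) (t.1 \in l)).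
  by rewrite /switchX K ?enum_uniq // !mem_enum.
elim: l s t => [|v l IHl] s t /=; first by rewrite !addbF -!surjective_pairing.
case/andP=> vl ul; have K x : (x == v) (+) (x \in l) = (x \in v :: l).
  by rewrite inE; case: eqVneq => // ->; rewrite (negPf vl).
by rewrite adj_switch // IHl //= -!addbA !K.
Qed.
End SwitchSet.

Section K4Levels.
Variables (V : finType) (E : {set gedge V}) (k : 'I_4 -> V * bool).
Hypotheses (gE : gain_graph E) (tE : tight E) (IH : smaller_generated #|V|).
Hypotheses (kI : injective (fun i => (k i).1)) (hK : forall i j, i != j -> adj E (k i) (k j)).
Hypothesis h1 : forall w i j, (forall l, w.1 != (k l).1) ->
  adj E w (k i) -> adj E w (k j) -> i = j.
Hypothesis h2 : forall i j i' j', adj E (k i) (cj (k j)) -> adj E (k i') (cj (k j')) ->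
  cedge (k i) (cj (k j)) = cedge (k i') (cj (k j')).

(** Switching at the vertices whose point lies at level 1 makes all gains of the K_4 trivial. *)
Lemma K4_red_levels : generated E.
Proof.
pose X := [set x | (x, true) \in codom k].
have kX i : ((k i).1 \in X) = (k i).2.
  rewrite inE; apply/codomP/idP=> [[j kj]|k2]; last by exists i; rewrite -k2 -surjective_pairing.
  by have -> : i = j; [apply: kI => /=; rewrite -kj|rewrite -kj].
have fk i b : flipX X ((k i).1, b) = ((k i).1, b (+) (k i).2) by rewrite /flipX /= kX.
have fk0 i : flipX X ((k i).1, false) = k i by rewrite fk -surjective_pairing.
have eX u v a b : (edge u v (a (+) b) \in switchX X E) = adj E (flipX X (u, a)) (flipX X (v, b)).
  by rewrite -adj_switchX.
apply: (generated_switchX (X := X)).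
apply: (@K4_red _ _ (fun i => (k i).1)) => //.
- exact: gain_graph_switchX.
- exact: tight_switchX.
- by move=> i j ij; rewrite (eX _ _ false false) !fk0 hK.
- move=> x a i j xk; rewrite -{1 2}(addbF a) !eX !fk0; apply: h1 => l /=.
  by apply: contraNneq xk => ->; apply: codom_f.
- move=> i j i' j'; rewrite !(eX _ _ false true) !fk0 !fk => e1 e2.
  by have [e _] := h2 e1 e2; rewrite /edge e.
Qed.
End K4Levels.

Section Cliques.
Variables (V : finType) (E : {set gedge V}).
Hypotheses (gE : gain_graph E) (tE : tight E) (IH : smaller_generated #|V|).
Hypothesis nG : ~ generated E.
Implicit Types (s t u w x : V * bool) (M S X Z : {set V * bool}).

Let sE : sparse E. Proof. by case: tE. Qed.

(** One of the two lifts of a balanced complete subgraph. *)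
Definition clique M := trans M && [forall s in M, forall t in M, (s != t) ==> adj E s t].

Lemma cliqueP M s t : clique M -> s \in M -> t \in M -> s != t -> adj E s t.
Proof. by case/andP=> _ /forall_inP H sM tM; move: (H s sM) => /forall_inP/(_ t tM)/implyP. Qed.

Lemma clique_trans M : clique M -> trans M. Proof. by case/andP. Qed.

Lemma trans_fst M s t : trans M -> s \in M -> t \in M -> s.1 = t.1 -> s = t.
Proof.
move=> tM sM tM' /eqP; rewrite same_vertex => /orP[/eqP//|/eqP st].
by have := transP tM tM'; rewrite -st sM.
Qed.

Lemma clique_ee M : clique M -> ee E M M = #|M| * #|M|.-1.
Proof.
move=> cM; have tM := clique_trans cM; rewrite ee_dg -sum_nat_const; apply: eq_bigr => s sM.
rewrite dgE (bigD1 s) //= wt_ss // add0n (eq_bigr (fun=> 1)).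
  by rewrite sum1_card (cardsD1 s M) sM /=; apply: eq_card => t; rewrite !inE andbC.
move=> t /andP[tM' ts]; rewrite /wt (cliqueP cM sM tM') 1?eq_sym //.
by case: eqP => // e; rewrite (trans_fst tM tM' sM e) eqxx in ts.
Qed.

Definition extra M p q := [&& p \in M, q \in M & adj E p (cj q)].
Definition two_extras M := exists p q r t, [/\ extra M p q, extra M r t & ~~ same_pair p q r t].

(** Otherwise the K_4 can be contracted: no outside point is joined to it twice, and it spans at
    most one further edge, which becomes a loop at the contracted vertex. *)
Lemma clique_K4 M : clique M -> #|M| = 4 -> two_extras M \/
  exists w a b, [/\ w \notin M, cj w \notin M, a \in M, b \in M & [&& a != b, adj E w a & adj E w b]].
Proof.
move=> cM M4; have tM := clique_trans cM.
case: (boolP [exists p, exists q, exists r, exists t,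
  [&& extra M p q, extra M r t & ~~ same_pair p q r t]]) => [|n1].
  by case/existsP=> p /existsP[q /existsP[r /existsP[t /and3P[*]]]]; left; exists p, q, r, t.
case: (boolP [exists w, exists a, exists b, [&& w \notin M, cj w \notin M, a \in M, b \in M
  & [&& a != b, adj E w a & adj E w b]]]) => [|n2].
  by case/existsP=> w /existsP[a /existsP[b /and5P[*]]]; right; exists w, a, b.
exfalso; apply: nG; pose k i := enum_val (cast_ord (esym M4) i).
have kM i : k i \in M := enum_valP _.
have kI : injective k by move=> i j /enum_val_inj/cast_ord_inj.
apply: (@K4_red_levels _ E k gE tE IH).
- by move=> i j ij; apply: kI; apply: (trans_fst tM (kM i) (kM j) ij).
- by move=> i j ij; apply: (cliqueP cM); rewrite ?kM // (inj_eq kI).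
- move=> w i j wk wi wj; apply/eqP; apply: contraNT n2 => ij.
  apply/existsP; exists w; apply/existsP; exists (k i); apply/existsP; exists (k j).
  rewrite !kM wi wj (inj_eq kI) ij /= andbT.
  have no x : x.1 = w.1 -> x \notin M.
    move=> xw; apply/negP=> xM; have /codomP[l kl] : x \in codom k.
      apply/codomP; exists (cast_ord M4 (enum_rank_in xM x)).
      by rewrite /k cast_ordK enum_rankK_in.
    by have := wk l; rewrite -kl xw eqxx.
  by rewrite !no.
move=> i j i' j' e1 e2; apply/eqP; apply: contraNT n1 => ne.
apply/existsP; exists (k i); apply/existsP; exists (k j); apply/existsP; exists (k i').
apply/existsP; exists (k j'); rewrite /extra !kM e1 e2 /=; apply: contra ne.
by case/orP=> /andP[/eqP-> /eqP->] //; rewrite cedgeC cedge_cjl.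
Qed.
End Cliques.

(** * Tight symmetric sets *)

Section Minimal.
Variables (V : finType) (E : {set gedge V}).
Hypotheses (gE : gain_graph E) (tE : tight E).
Implicit Types (s t u w x : V * bool) (M S X Y Z B P Q : {set V * bool}).

Let sE : sparse E. Proof. by case: tE. Qed.

Definition full X := symm X && (4 * #|X| <= ee E X X).

(** Tight symmetric sets are closed under intersection, so a minimal one is contained in or disjoint
    from any other. This is what the extension argument for closedness uses. *)
Definition min_full B := [/\ full B, B != set0 &
  forall X, full X -> X != set0 -> X \subset B -> X = B].

Lemma symm_sym P : symm (P :|: cjs P).
Proof. by apply: symmI => t; rewrite !inE cjK orbC. Qed.

Lemma sub_sym X Q : symm X -> trans Q -> X \subset Q :|: cjs Q ->
  X = (X :&: Q) :|: cjs (X :&: Q).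
Proof.
move=> sX tQ /subsetP XQ; apply/setP=> t; rewrite !inE (symmP _ sX).
by case tX: (t \in X) => //=; have := XQ t tX; rewrite !inE => ->.
Qed.

(** A symmetric subset of the closure of Q is the closure of its trace P on Q, and its count is
    twice [ee E P P + ee E P (cjs P)]. Minimality thus reduces to subsets of Q. *)
Lemma mz_intro Q : trans Q -> Q != set0 -> 4 * #|Q| <= ee E Q Q + ee E Q (cjs Q) ->
  (forall P, P \subset Q -> P != set0 -> P != Q -> ee E P P + ee E P (cjs P) < 4 * #|P|) ->
  min_full (Q :|: cjs Q).
Proof.
move=> tQ Q0 eQ H; split.
- by rewrite /full symm_sym ee_split // card_split //; move: eQ; nlia.
- by case/set0Pn: Q0 => t tQ'; apply/set0Pn; exists t; rewrite inE tQ'.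
move=> X /andP[sX eX] X0 XB; have eXP := sub_sym sX tQ XB; set P := X :&: Q in eXP.
have PQ : P \subset Q := subsetIr _ _.
have tP := trans_sub PQ tQ.
have P0 : P != set0.
  by apply: contraNneq X0 => P0; rewrite eXP P0; apply/eqP/setP=> t; rewrite !inE.
have [PQ'|PnQ] := eqVneq P Q; first by rewrite eXP PQ'.
have := H P PQ P0 PnQ; rewrite eXP ee_split // card_split // in eX; move: eX; nlia.
Qed.

(** The extra edge has two lifts from Q to its conjugate, or a single one of weight 2 if it is a
    loop, and none of them starts in P and ends in the conjugate of P. *)
Lemma cross_extra P Q p q : P \subset Q -> extra E Q p q -> ~~ ((p \in P) && (q \in P)) ->
  ee E P (cjs P) + 2 <= ee E Q (cjs Q).
Proof.
move=> /subsetP PQ /and3P[pQ qQ pq] npq.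
have [e|ne] := eqVneq p q.
  rewrite -e in qQ pq npq *; rewrite andbb in npq.
  have := @ee_leq _ E [:: (P, cjs P); ([set p], [set cj p])] [:: (Q, cjs Q)].
  rewrite !big_cons !big_nil !addn0 /= {2}/ee !big_set1 /wt pq eqxx /=; apply=> s t.
  rewrite !big_cons !big_nil /= !inE; move: (PQ s) (PQ (cj t)).
  case: (eqVneq s p) => [->|_]; last by do 4 case: (_ \in _) => //=; auto.
  case: (eqVneq t (cj p)) => [->|_]; last by do 4 case: (_ \in _) => //=; auto.
  by rewrite cjK (negPf npq) pQ.
have := @ee_leq _ E [:: (P, cjs P); ([set p], [set cj q]); ([set q], [set cj p])] [:: (Q, cjs Q)].
have qp : adj E q (cj p) by rewrite -adj_cjl adjC.
rewrite !big_cons !big_nil !addn0 /= {2 3}/ee !big_set1 /wt pq qp /=.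
move=> H; apply: leq_trans (H _); first by rewrite leq_add2l; case: (_ == _); case: (_ == _).
move=> s t; rewrite !big_cons !big_nil /= !inE; move: (PQ s) (PQ (cj t)).
have ne' : cj p != cj q by rewrite (inj_eq (@cj_inj V)).
case: (eqVneq s p) => [->|sp].
  rewrite (negPf ne) /=; case: (eqVneq t (cj q)) => [->|_]; last by do 4 case: (_ \in _) => //=; auto.
  by rewrite cjK pQ qQ; move: npq; case: (p \in P); case: (q \in P).
rewrite /=; case: (eqVneq s q) => [->|_]; last by do 4 case: (_ \in _) => //=; auto.
case: (eqVneq t (cj p)) => [->|_]; last by do 4 case: (_ \in _) => //=; auto.
by rewrite cjK pQ qQ; move: npq; case: (p \in P); case: (q \in P).
Qed.

Lemma cross_le Q c : trans Q -> 4 * #|Q| <= ee E Q Q + c -> ee E Q (cjs Q) <= c.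
Proof.
move=> tQ eQ; have [h _] := sE; have := h _ (symm_sym Q).
by rewrite ee_split // card_split //; move: eQ; nlia.
Qed.

Lemma cross_mono P Q : P \subset Q -> ee E P (cjs P) <= ee E Q (cjs Q).
Proof.
move=> PQ; apply: ee_mono => //; apply/subsetP=> t; rewrite !inE.
exact: (subsetP PQ).
Qed.

Lemma cross1 p : ee E [set p] (cjs [set p]) <= 2.
Proof.
have -> : cjs [set p] = [set cj p] by apply/setP=> t; rewrite !inE cj_eq.
by rewrite /ee !big_set1; apply: leq_trans (ee_wt_le2 _ _ _) _; rewrite ltnS leq_b1.
Qed.

(** For two or three points k(k-1) + 4 is less than 4k, and a single point carries at most a loop,
    of weight 2. *)
Lemma small_not_full P : trans P -> P != set0 -> #|P| <= 3 -> ee E P (cjs P) <= 4 ->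
  ee E P P + ee E P (cjs P) < 4 * #|P|.
Proof.
move=> tP; rewrite -card_gt0 => P0 P3 c4; have := ee_trans_le gE tP.
case P1: (#|P| == 1).
  by case/cards1P: P1 => p ->; rewrite cards1 /=; have := cross1 p; nlia.
by move: P0 P1 P3 c4; case: #|P| => [|[|[|[|n]]]] //=; nlia.
Qed.

Lemma mz_K4 M : clique E M -> #|M| = 4 -> two_extras E M -> min_full (M :|: cjs M).
Proof.
move=> cM M4 [p [q [r [t [e1 e2 u12]]]]]; have tM := clique_trans cM.
have eM := clique_ee gE cM; rewrite M4 /= in eM.
have c4 : ee E M (cjs M) <= 4 by apply: cross_le; rewrite // M4 eM.
have [/and3P[pM qM a1] /and3P[rM tM' a2]] := (e1, e2).
have := @ee_extra _ E M [:: (p, cj q); (r, cj t)] tM.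
rewrite /= mem_seq1 !cjK pM qM rM tM' a1 a2 (cedge_cj_neq tM pM qM rM tM' u12) => /(_ isT isT) eE.
apply: mz_intro => //; first by rewrite -card_gt0 M4.
  by rewrite ee_split // in eE; move: eE; rewrite eM M4; nlia.
move=> P PM P0 PnM; have tP := trans_sub PM tM.
apply: small_not_full => //; last by apply: leq_trans (cross_mono PM) c4.
have := subset_leqif_cards PM => -[le eq]; rewrite M4 in le eq.
by move: le; rewrite leq_eqVlt eq (negPf PnM).
Qed.

(** The five vertices span the 6 edges of the K_4, the edges wa and wb, and two edges doubling sides
    of the triangle w, a, b: ten in all, twice the number of vertices. *)
Lemma mz_Q5 M w a b : clique E M -> #|M| = 4 -> w \notin M -> cj w \notin M -> a \in M -> b \in M ->
  a != b -> adj E w a -> adj E w b -> two_chords E w a b -> min_full ((w |: M) :|: cjs (w |: M)).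
Proof.
move=> cM M4 wM cwM aM bM ab wa wb cf; have tM := clique_trans cM.
have eM := clique_ee gE cM; rewrite M4 /= in eM.
have tbM : tight_trans E M by rewrite /tight_trans tM M4 eM.
have /andP[tQ eQ] : tight_trans E (w |: M) by apply: (tb_add gE tbM wM cwM aM bM ab).
have d2 : dg E M w <= 2.
  rewrite leqNgt; apply/negP=> d3; exact: (no_block3 gE sE (tb_block tbM aM) wM cwM d3).
have eQ' : ee E (w |: M) (w |: M) = ee E M M + 2 * dg E M w by rewrite ee_add1.
have cQ : #|w |: M| = 5 by rewrite cardsU1 wM M4.
have c4 : ee E (w |: M) (cjs (w |: M)) <= 4 by apply: cross_le.
have wI := setU11 w M; have aI := setU1r w aM; have bI := setU1r w bM.
have wa' : w != a by apply: adj_neq wa.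
have wb' : w != b by apply: adj_neq wb.
(* One of the doubled sides is chosen at w, so that the four-point subset M, which misses w, loses
   it and cannot be tight. *)
have [p [q [r [t [e1 e2 u12 wpq]]]]] : exists p q r t, [/\ extra E (w |: M) p q,
    extra E (w |: M) r t, ~~ same_pair p q r t & p == w].
  case/or3P: cf => /andP[c1 c2].
  - by exists w, a, w, b; rewrite /extra wI aI bI c1 c2; split=> //; distinct_pairs.
  - by exists w, a, a, b; rewrite /extra wI aI bI c1 c2; split=> //; distinct_pairs.
  - by exists w, b, a, b; rewrite /extra wI aI bI c1 c2; split=> //; distinct_pairs.
have [/and3P[pM qM a1] /and3P[rM tM' a2]] := (e1, e2).
have := @ee_extra _ E (w |: M) [:: (p, cj q); (r, cj t)] tQ.
rewrite /= mem_seq1 !cjK pM qM rM tM' a1 a2 (cedge_cj_neq tQ pM qM rM tM' u12) => /(_ isT isT) eE.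
apply: mz_intro => //; first by rewrite -card_gt0 cQ.
  by rewrite ee_split // in eE; move: eE eQ; rewrite cQ; nlia.
move=> P PQ P0 PnQ; have tP := trans_sub PQ tQ.
have cP := leq_trans (cross_mono PQ) c4.
have := subset_leqif_cards PQ => -[le eq]; rewrite cQ in le eq.
move: le; rewrite leq_eqVlt eq (negPf PnQ) /= ltnS leq_eqVlt => /orP[/eqP P4|P3]; last first.
  by apply: small_not_full.
have [wP|wP] := boolP (w \in P); last first.
  have PM : P \subset M.
    apply/subsetP=> x xP; have := subsetP PQ x xP; rewrite !inE.
    by case: eqP => // xw; rewrite -xw xP in wP.
  have c2 : ee E P (cjs P) + 2 <= 4.
    apply: leq_trans c4; apply: (cross_extra PQ e1).
    by rewrite (eqP wpq) (negPf wP).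
  by have := ee_trans_le gE tP; rewrite P4 /=; move: c2; nlia.
have PwM : P :\ w \subset M.
  apply/subsetP=> x; rewrite !inE => /andP[xw xP].
  by have := subsetP PQ x xP; rewrite !inE (negPf xw).
have cPw : #|P :\ w| = 3 by have := cardsD1 w P; rewrite wP P4; nlia.
have := ee_trans_le gE (trans_sub PwM tM); rewrite cPw /=.
have := dg_mono E w PwM; rewrite (ee_rem1 gE wP).
have -> : dg E P w = dg E (P :\ w) w.
  by rewrite !dgE -{1}(setD1K wP) big_setU1 ?setD11 //= wt_ss.
by move: d2 cP; rewrite P4; nlia.
Qed.

(** A lift of the base graph R, with [x] over its vertex v. *)
Definition Rconf x y z := [&& x.1 != y.1, x.1 != z.1, y.1 != z.1, adj E x (cj x), adj E x y
  & [&& adj E x (cj y), adj E x z, adj E x (cj z) & adj E y z]].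

Definition tri x y z : {set V * bool} := [set x; y; z].

Lemma tri_clique x y z : x.1 != y.1 -> x.1 != z.1 -> y.1 != z.1 ->
  adj E x y -> adj E x z -> adj E y z -> clique E (tri x y z) /\ #|tri x y z| = 3.
Proof.
move=> xy xz yz axy axz ayz.
have /andP[xy1 xy2] := cover_neq xy; have /andP[xz1 xz2] := cover_neq xz.
have /andP[yz1 yz2] := cover_neq yz; split; last first.
  by rewrite /tri -setUA cardsU1 cards2 !inE negb_or xy1 xz1 yz1.
apply/andP; split.
  have no u : cj u = u -> False by move/eqP; rewrite cj_neq.
  apply: transI => s; rewrite !inE => /orP[/orP[]|] /eqP-> /orP[/orP[]|] /eqP e;
    first [exact: no e | have := congr1 fst e => /= /eqP; rewrite ?(negPf xy) ?(negPf xz) ?(negPf yz) //;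
    by rewrite eq_sym ?(negPf xy) ?(negPf xz) ?(negPf yz)].
apply/forall_inP=> s sT; apply/forall_inP=> t tT; apply/implyP.
move: sT tT; rewrite !inE => /orP[/orP[]|] /eqP-> /orP[/orP[]|] /eqP->; rewrite ?eqxx //.
all: by rewrite adjC.
Qed.

Lemma clique_add M s : clique E M -> s \notin M -> cj s \notin M ->
  (forall t, t \in M -> adj E s t) -> clique E (s |: M).
Proof.
move=> cM sM csM H; have tM := clique_trans cM; apply/andP; split.
  apply: transI => t; rewrite !inE => /orP[/eqP->|tM']; first by rewrite cj_neq (negPf csM).
  by rewrite (transP tM tM') orbF => /eqP cw; rewrite -cw cjK tM' in csM.
apply/forall_inP=> t tM'; apply/forall_inP=> u uM; apply/implyP=> tu.
move: tM' uM; rewrite !inE => /orP[/eqP e1|tM'] /orP[/eqP e2|uM].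
- by rewrite e1 e2 eqxx in tu.
- by rewrite e1 H.
- by rewrite e2 adjC H.
- exact: cliqueP cM _ _ _.
Qed.

Lemma mz_R x y z : Rconf x y z -> min_full (tri x y z :|: cjs (tri x y z)).
Proof.
case/and5P=> xy xz yz xx /andP[axy /and4P[axy' axz axz' ayz]].
have [cM M3] := tri_clique xy xz yz axy axz ayz; have tM := clique_trans cM.
have /andP[xy1 _] := cover_neq xy; have /andP[xz1 _] := cover_neq xz.
have /andP[yz1 _] := cover_neq yz.
have eM := clique_ee gE cM; rewrite M3 /= in eM.
have c6 : ee E (tri x y z) (cjs (tri x y z)) <= 6 by apply: cross_le; rewrite // M3 eM.
have [xQ yQ zQ] : [/\ x \in tri x y z, y \in tri x y z & z \in tri x y z].
  by rewrite !inE !eqxx !orbT.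
have u1 : ~~ same_pair x x x y by distinct_pairs.
have u2 : ~~ same_pair x x x z by distinct_pairs.
have u3 : ~~ same_pair x y x z by distinct_pairs.
have := @ee_extra _ E (tri x y z) [:: (x, cj x); (x, cj y); (x, cj z)] tM.
rewrite /= !in_cons !in_nil !orbF !negb_or !cjK xQ yQ zQ xx axy' axz'.
rewrite (cedge_cj_neq tM xQ xQ xQ yQ u1) (cedge_cj_neq tM xQ xQ xQ zQ u2).
rewrite (cedge_cj_neq tM xQ yQ xQ zQ u3) => /(_ isT isT) eE.
apply: mz_intro => //; first by rewrite -card_gt0 M3.
  by rewrite ee_split // in eE; move: eE; rewrite eM M3; nlia.
move=> P PM P0 PnM; have tP := trans_sub PM tM.
have := subset_leqif_cards PM => -[le eq]; rewrite M3 in le eq.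
apply: small_not_full => //.
suff : ee E P (cjs P) + 2 <= 6 by nlia.
apply: leq_trans c6; have [m mQ mP] : exists2 m, m \in tri x y z & m \notin P.
  apply/exists_inP; apply: contraNT PnM; rewrite negb_exists_in => /forall_inP H.
  by rewrite eqEsubset PM; apply/subsetP=> m /H; rewrite negbK.
have := mQ; rewrite !inE => /orP[/orP[]|] /eqP mE; rewrite mE in mP.
- by apply: (cross_extra PM (p := x) (q := y)); rewrite /extra ?xQ ?yQ ?(negPf mP).
- by apply: (cross_extra PM (p := x) (q := y)); rewrite /extra ?xQ ?yQ ?(negPf mP) ?andbF.
- by apply: (cross_extra PM (p := x) (q := z)); rewrite /extra ?xQ ?zQ ?(negPf mP) ?andbF.
Qed.

(** If two of p, q, r lie over the same vertex they are conjugate, so this vertex has a loop and is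
    joined twice both to [s] and to the third point: this is R. Otherwise the four points are over
    distinct vertices. *)
Lemma tetra s p q r : ~~ adj E s (cj s) -> uniq [:: p; q; r] -> adj E s p -> adj E s q -> adj E s r ->
  adj E p q -> adj E p r -> adj E q r ->
  (exists M, [/\ clique E M, #|M| = 4, s \in M & [set p; q; r] \subset M]) \/
  exists x y, Rconf x s y.
Proof.
move=> nl; rewrite /= !inE negb_or andbT => /andP[/andP[pq pr] qr] sp sq sr apq apr aqr.
have fs t : adj E s t -> s.1 != t.1.
  move=> st; apply: fst_neq (adj_neq gE st) _; apply: contraNneq nl => ss.
  by rewrite {2}ss cjK.
have conf x y z : adj E s x -> adj E s y -> adj E s z -> adj E x y -> adj E x z -> adj E y z ->
    z != x -> x = cj y -> Rconf x s z.
  move=> sx sy sz xy xz yz zx e.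
  have ey : cj x = y by rewrite e cjK.
  have zx' : x.1 != z.1 by rewrite eq_sym; apply: fst_neq zx _; rewrite ey eq_sym; apply: adj_neq yz.
  have sx' : x.1 != s.1 by rewrite eq_sym fs.
  by apply/and5P; split; rewrite ?fs // ?ey // -!adj_cjl ey !(adjC E _ s) sx sy xz yz.
have [e|pq1] := eqVneq p.1 q.1.
  right; exists p, r; apply: (conf p q r) => //; first by rewrite eq_sym.
  by move/eqP: e; rewrite same_vertex (negPf pq) => /eqP.
have [e|pr1] := eqVneq p.1 r.1.
  right; exists p, q; apply: (conf p r q) => //; [by rewrite adjC|by rewrite eq_sym|].
  by move/eqP: e; rewrite same_vertex (negPf pr) => /eqP.
have [e|qr1] := eqVneq q.1 r.1.
  right; exists q, p; apply: (conf q r p) => //; [by rewrite adjC|by rewrite adjC|].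
  by move/eqP: e; rewrite same_vertex (negPf qr) => /eqP.
left; have [cM M3] := tri_clique pq1 pr1 qr1 apq apr aqr.
have sM : s \notin tri p q r by rewrite !inE !negb_or (adj_neq gE sp) (adj_neq gE sq) (adj_neq gE sr).
have csM : cj s \notin tri p q r.
  apply/negP; rewrite !inE => /orP[/orP[]|] /eqP e;
    by [have := fs _ sp; rewrite -e eqxx|have := fs _ sq; rewrite -e eqxx|have := fs _ sr; rewrite -e eqxx].
exists (s |: tri p q r); split; [|by rewrite cardsU1 sM M3|exact: setU11|exact: subsetUr].
apply: clique_add => // t; rewrite !inE => /orP[/orP[]|] /eqP-> //.
Qed.
End Minimal.

(** * Tight symmetric sets are closed under adjacency *)

Section Closed.
Variables (V : finType) (E : {set gedge V}).
Hypotheses (gE : gain_graph E) (tE : tight E) (IH : smaller_generated #|V|).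
Hypothesis nG : ~ generated E.
Implicit Types (s t u w x : V * bool) (M S X Y Z B P Q : {set V * bool}).

Let sE : sparse E. Proof. by case: tE. Qed.

Lemma deg3_struct s : dg E setT s <= 3 ->
  (exists M, [/\ clique E M, #|M| = 4 & s \in M]) \/ exists x y, Rconf E x s y.
Proof.
move=> d3; have n3 := nbrs_ge3 gE tE IH nG s; rewrite dgT // in d3.
have nl : ~~ adj E s (cj s) by move: d3 n3; case: adj => //=; nlia.
have c3 : #|nbset E s| = 3 by move: d3 n3; nlia.
have [l [H sl]] := nbhd_exists E s; rewrite c3 in sl.
case: l H sl => [|p [|q [|r [|? ?]]]] // H _; have [ul al] := H.
have [pq pr qr] := deg3_noloop gE tE IH nG H nl.
have := tetra gE nl ul; rewrite !al !inE !eqxx !orbT => /(_ isT isT isT pq pr qr).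
by case=> [[M [*]]|]; [left; exists M|right].
Qed.

Lemma deg3_mz s : dg E setT s <= 3 -> exists2 B, min_full E B & s \in B.
Proof.
case/deg3_struct=> [[M [cM M4 sM]]|[x [y R]]]; last first.
  exists (tri x s y :|: cjs (tri x s y)); first exact: mz_R.
  by rewrite !inE eqxx orbT.
case: (clique_K4 gE tE IH nG cM M4) => [e2|[w [a [b [wM cwM aM bM /and3P[ab wa wb]]]]]].
  by exists (M :|: cjs M); [exact: mz_K4|rewrite inE sM].
exists ((w |: M) :|: cjs (w |: M)); last by rewrite !inE sM !orbT.
have tbM : tight_trans E M by rewrite /tight_trans (clique_trans cM) (clique_ee gE cM) M4.
have cf := branch gE tE IH nG tbM aM bM (cliqueP cM aM bM ab) wM cwM wa wb.
exact: mz_Q5 cf.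
Qed.

Lemma full_cap X Y : full E X -> full E Y -> full E (X :&: Y) /\ full E (X :|: Y).
Proof.
move=> /andP[sX eX] /andP[sY eY].
have [h1 h2] := symm_union_tight sE sX sY eX eY.
by rewrite /full symmI2 // symmU // h1 h2.
Qed.

Lemma full_ee X : full E X -> ee E X X = 4 * #|X|.
Proof. by move=> /andP[sX eX]; apply/eqP; rewrite eqn_leq eX andbT; have [h _] := sE; apply: h. Qed.

(* Enlarge X to a maximal tight Y without edges between X and Y :\: X.  All degrees
   outside Y are at least four, so the degree sum leaves no edge between Y and its
   complement. *)
Lemma full_closed0 X : full E X -> ee E X (~: X) = 0.
Proof.
move=> fX; pose P Y := [&& full E Y, X \subset Y & ee E X (Y :\: X) == 0].
have PX : P X by rewrite /P fX subxx setDv; apply/eqP; rewrite /ee; apply: big1 => s _; rewrite big_set0.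
have [Y /and3P[fY XY /eqP e0] mY] := @arg_maxnP _ X P (fun Y => #|Y|) PX.
have deg v : v \notin Y -> 4 <= dg E setT v.
  move=> vY; rewrite leqNgt; apply/negP => /deg3_mz[B [fB B0 mB] vB].
  have [f1 f2] := full_cap fB fY.
  have [I0|I0] := eqVneq (B :&: Y) set0; last first.
    have BY := mB _ f1 I0 (subsetIl _ _); have := vB.
    by rewrite -BY inE (negPf vY) andbF.
  have d : [disjoint Y & B] by rewrite disjoint_sym -setI_eq0 I0.
  have eYB : ee E Y B = 0.
    have := ee_disjU E d; rewrite setUC (full_ee f2) setUC cardsU setIC I0 cards0 subn0.
    by rewrite (full_ee fY) (full_ee fB); nlia.
  have eXB : ee E X B = 0 by apply/eqP; rewrite -leqn0 -eYB; apply: ee_mono.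
  have : P (Y :|: B).
    rewrite /P setUC f2 setUC (subset_trans XY (subsetUl _ _)) /= -leqn0.
    apply: (@leq_trans (ee E X (Y :\: X) + ee E X B)); last by rewrite e0 eXB.
    rewrite !(eeC E X); have -> : (Y :|: B) :\: X = (Y :\: X) :|: B :\: (Y :|: X).
      by apply/setP=> t; rewrite !inE; do 3 case: (_ \in _).
    rewrite ee_rect; first by rewrite leq_add2l; apply: ee_mono => //; apply: subsetDl.
    by rewrite disjoints_subset; apply/subsetP=> t; rewrite !inE => /andP[_ ->].
  move/mY; rewrite cardsU (setIC Y) I0 cards0 subn0.
  have : 0 < #|B| by rewrite card_gt0.
  by nlia.
have eT : setT = Y :|: ~: Y by rewrite setUCr.
have dY : [disjoint Y & ~: Y] by rewrite disjoints_subset setCK.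
have h1 : ee E setT setT = ee E Y setT + ee E (~: Y) setT by rewrite {1}eT ee_rect.
have h2 : ee E Y setT = ee E Y Y + ee E Y (~: Y).
  by rewrite (eeC E Y setT) {1}eT ee_rect // (eeC E (~: Y)).
have h3 : 4 * #|~: Y| <= ee E (~: Y) setT.
  rewrite ee_dg mulnC -sum_nat_const; apply: leq_sum => v; rewrite inE; exact: deg.
have h4 := cardsC Y; rewrite card_prod card_bool in h4.
have h5 : ee E Y (~: Y) = 0.
  move: h1; rewrite ee_setT // (proj2 tE) h2 (full_ee fY).
  by move: h3 h4; nlia.
apply/eqP; rewrite -leqn0; apply: (@leq_trans (ee E X (Y :\: X) + ee E Y (~: Y))); last first.
  by rewrite e0 h5.
rewrite !(eeC E _ (_ :\: _)) (eeC E X) (eeC E Y).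
have -> : ~: X = (Y :\: X) :|: ~: Y.
  apply/setP=> t; rewrite !inE; have := subsetP XY t.
  by case: (t \in X) => [->|] //=; case: (t \in Y).
rewrite ee_rect; first by rewrite leq_add2l; apply: ee_mono.
by rewrite disjoints_subset setCK subsetDl.
Qed.

Definition adj_closed X := symm X /\ forall s t, s \in X -> adj E s t -> t \in X.

Lemma ee_eq0 S T s t : ee E S T = 0 -> s \in S -> t \in T -> ~~ adj E s t.
Proof.
move=> e0 sS tT; apply/negP=> st; have : ee E [set s] [set t] <= ee E S T.
  by apply: ee_mono; rewrite sub1set.
by rewrite e0 /ee !big_set1 /wt st.
Qed.

Lemma full_closed X : full E X -> adj_closed X.
Proof.
move=> fX; split; first by case/andP: fX.
move=> s t sX st; case: (boolP (t \in X)) => // tX.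
have /negP[] : ~~ adj E s t; last by [].
by apply: (ee_eq0 (full_closed0 fX) sX); rewrite inE.
Qed.

(** A tight symmetric set is closed under adjacency, so one that contains a neighbour of [s]
    contains [s]. Hence nothing blocks the inverse of H3d. *)
Lemma nbhd_N22 s n m : nbhd E s [:: n; cj n; m; cj m] -> ~~ adj E s (cj s) ->
  ~~ adj E n (cj n) -> ~~ adj E m (cj m) -> False.
Proof.
move=> H nl an am; apply: nG; have L := nbhd_nbrs H; have L' := nbhd_noloop H nl.
have K X t : symm X -> 4 * #|X| <= ee E X X -> avoids s.1 X -> adj E s t -> t \notin X.
  move=> sX eX /avoids_mem/andP[sN _] st; apply: contra sN => tX.
  by have [_ c] := full_closed (introT andP (conj sX eX)); apply: (c t) => //; rewrite adjC.
have sn : adj E s n by rewrite (nbhd_mem H) ?inE ?eqxx.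
have sm : adj E s m by rewrite (nbhd_mem H) ?inE ?eqxx ?orbT.
case: (s.2) L L' => /= L L'.
  apply: (N22_red gE tE IH L L'); rewrite ?adj_cj // => X sX eX aX.
  by rewrite !(symmP _ sX) !(K X).
by apply: (N22_red gE tE IH L L') => // X sX eX aX; rewrite !(K X).
Qed.

(** The five-vertex set is tight, hence closed, and its two extra edges are the doubled sides. If
    both are at w, the neighbours of w form two conjugate pairs without loops and H3d can be undone.
    Otherwise w has degree three, and its conjugate neighbours must be adjacent, which is a third
    extra edge. *)
Lemma no_Q5 M w a b : clique E M -> #|M| = 4 -> w \notin M -> cj w \notin M -> a \in M -> b \in M ->
  a != b -> adj E w a -> adj E w b -> False.
Proof.
move=> cM M4 wM cwM aM bM ab wa wb.
have tbM : tight_trans E M by rewrite /tight_trans (clique_trans cM) (clique_ee gE cM) M4.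
have aab := cliqueP cM aM bM ab.
have cf := branch gE tE IH nG tbM aM bM aab wM cwM wa wb.
have [fB _ _] := mz_Q5 gE tE cM M4 wM cwM aM bM ab wa wb cf.
have [_ clB] := full_closed fB.
have tbQ : tight_trans E (w |: M) := tb_add gE tbM wM cwM aM bM ab wa wb.
have wI := setU11 w M; have aI := setU1r w aM; have bI := setU1r w bM.
have wa' := adj_neq gE wa; have wb' := adj_neq gE wb.
have nb t : adj E w t -> [|| t == a, t == b | extra E (w |: M) w (cj t)].
  move=> wt; have := clB w t; rewrite inE wI => /(_ isT wt); rewrite inE => /orP[tQ|].
    move: tQ; rewrite !inE => /orP[/eqP tw|tM]; first by rewrite tw adj_irr in wt.
    apply: contraT; rewrite !negb_or => /and3P[ta tb' _].
    case: (no_block3 gE sE (tb_block tbM aM) wM cwM).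
    apply: (dg_ge (l := [:: t; a; b])); rewrite /= ?inE ?negb_or ?ta ?tb' ?ab //.
    by rewrite aM bM tM wa wb wt.
  by rewrite inE => cQ; rewrite /extra wI cQ cjK wt !orbT.
have three' := three_extras tE tbQ.
have ba : adj E b a by rewrite adjC.
have wci x : adj E w (cj x) -> w != cj x := fun h => adj_neq gE h.
have tQ : trans (w |: M) by case/andP: tbQ.
have Qc x y : x \in w |: M -> y \in w |: M -> x != cj y.
  by move=> xQ yQ; apply/eqP=> e; have := transP tQ yQ; rewrite -e xQ.
have [ab1 ab2 ab3 ab4] : [/\ a != cj a, a != cj b, b != cj a & b != cj b] by rewrite !Qc.
case/or3P: cf => /andP[c1 c2].
- have e1 : extra E (w |: M) w a by rewrite /extra wI aI.
  have e2 : extra E (w |: M) w b by rewrite /extra wI bI.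
  have u12 : ~~ same_pair w a w b by distinct_pairs.
  have no p q : extra E (w |: M) p q -> ~~ same_pair p q w a -> ~~ same_pair p q w b -> False.
    by move=> h1 h2 h3; apply: (three' _ _ _ _ _ _ h1 e1 e2).
  apply: (@nbhd_N22 w a b).
  - split; first by rewrite /= !inE !negb_or ab1 ab ab2 ab4 cj_eq ab2 (inj_eq (@cj_inj V)) ab.
    move=> t; apply/idP/idP=> [wt|]; last by rewrite !inE => /or4P[]/eqP->.
    rewrite !inE; case/or3P: (nb t wt) => [->|->|e3]; rewrite ?orbT //.
    rewrite -!cj_eq; apply: contraT; rewrite !negb_or => /and4P[_ h1 _ h2].
    by case: (no w (cj t) e3); distinct_pairs.
  - by apply/negP=> ww; apply: (no w w); rewrite /extra ?wI //; distinct_pairs.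
  - by apply/negP=> ww; apply: (no a a); rewrite /extra ?aI //; distinct_pairs.
  - by apply/negP=> ww; apply: (no b b); rewrite /extra ?bI //; distinct_pairs.
- have e1 : extra E (w |: M) w a by rewrite /extra wI aI.
  have e2 : extra E (w |: M) a b by rewrite /extra aI bI.
  have u12 : ~~ same_pair w a a b by distinct_pairs.
  have no p q : extra E (w |: M) p q -> ~~ same_pair p q w a -> ~~ same_pair p q a b -> False.
    by move=> h1 h2 h3; apply: (three' _ _ _ _ _ _ h1 e1 e2).
  have H : nbhd E w [:: a; b; cj a].
    split; first by rewrite /= !inE !negb_or ab1 ab ab3.
    move=> t; apply/idP/idP=> [wt|]; last by rewrite !inE => /or3P[]/eqP->.
    rewrite !inE; case/or3P: (nb t wt) => [->|->|e3]; rewrite ?orbT //.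
    rewrite -!cj_eq; apply: contraT; rewrite !negb_or => /and3P[_ _ h1].
    by case: (no w (cj t) e3); distinct_pairs.
  have nl : ~~ adj E w (cj w) by apply/negP=> ww; apply: (no w w); rewrite /extra ?wI //; distinct_pairs.
  have [_ aa _] := deg3_noloop gE tE IH nG H nl.
  by apply: (no a a); rewrite /extra ?aI //; distinct_pairs.
have e1 : extra E (w |: M) w b by rewrite /extra wI bI.
have e2 : extra E (w |: M) a b by rewrite /extra aI bI.
have u12 : ~~ same_pair w b a b by distinct_pairs.
have no p q : extra E (w |: M) p q -> ~~ same_pair p q w b -> ~~ same_pair p q a b -> False.
  by move=> h1 h2 h3; apply: (three' _ _ _ _ _ _ h1 e1 e2).
have H : nbhd E w [:: b; a; cj b].
  split; first by rewrite /= !inE !negb_or ab4 eq_sym ab ab2.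
  move=> t; apply/idP/idP=> [wt|]; last by rewrite !inE => /or3P[]/eqP->.
  rewrite !inE; case/or3P: (nb t wt) => [->|->|e3]; rewrite ?orbT //.
  rewrite -!cj_eq; apply: contraT; rewrite !negb_or => /and3P[_ _ h1].
  by case: (no w (cj t) e3); distinct_pairs.
have nl : ~~ adj E w (cj w) by apply/negP=> ww; apply: (no w w); rewrite /extra ?wI //; distinct_pairs.
have [_ aa _] := deg3_noloop gE tE IH nG H nl.
by apply: (no b b); rewrite /extra ?bI //; distinct_pairs.
Qed.

Lemma K4_two_extras M : clique E M -> #|M| = 4 -> two_extras E M.
Proof.
move=> cM M4; case: (clique_K4 gE tE IH nG cM M4) => [//|].
by move=> [w [a [b [wM cwM aM bM /and3P[ab wa wb]]]]]; case: (no_Q5 cM M4 wM cwM aM bM ab wa wb).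
Qed.
End Closed.

Section Basic.
Variables (V : finType) (E : {set gedge V}).
Hypotheses (gE : gain_graph E) (tE : tight E).
Implicit Types (s t u w x : V * bool) (M S X Y Z B P Q : {set V * bool}).

(** The preimages in the cover of base graphs up to switching; [BasicK4] stands for the five graphs
    formed from K_4. *)
Inductive basic : {set V * bool} -> Prop :=
| BasicK4 M of clique E M & #|M| = 4 & two_extras E M : basic (M :|: cjs M)
| BasicR x y z of Rconf E x y z : basic (tri x y z :|: cjs (tri x y z))
| Basic2K2 x y of x.1 != y.1 & adj E x y & adj E x (cj y) & adj E x (cj x) & adj E y (cj y) :
    basic ([set x; y] :|: cjs [set x; y])
| BasicTriangle x y z of clique E (tri x y z) & #|tri x y z| = 3
    & adj E x (cj x) & adj E y (cj y) & adj E z (cj z) : basic (tri x y z :|: cjs (tri x y z)).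

Lemma pair_clique x y : x.1 != y.1 -> adj E x y -> clique E [set x; y] /\ #|[set x; y]| = 2.
Proof.
move=> xy axy; have /andP[ne _] := cover_neq xy; rewrite cards2 ne; split=> //; apply/andP; split.
  have no u : cj u = u -> False by move/eqP; rewrite cj_neq.
  apply: transI => s; rewrite !inE => /orP[] /eqP-> /orP[] /eqP e; try exact: no e.
    by have := congr1 fst e => /= /eqP; rewrite (negPf xy).
  by have := congr1 fst e => /= /eqP; rewrite eq_sym (negPf xy).
apply/forall_inP=> s sT; apply/forall_inP=> t tT; apply/implyP.
move: sT tT; rewrite !inE => /orP[] /eqP-> /orP[] /eqP->; rewrite ?eqxx //.
by rewrite adjC.
Qed.

Lemma full_extras Q (l : seq ((V * bool) * (V * bool))) : trans Q ->
  uniq [seq cedge p.1 (cj p.2) | p <- l] -> all (fun p => extra E Q p.1 p.2) l ->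
  4 * #|Q| <= ee E Q Q + 2 * size l -> full E (Q :|: cjs Q).
Proof.
move=> tQ ul al eQ; rewrite /full symm_sym card_split //.
have := @ee_extra _ E Q [seq (p.1, cj p.2) | p <- l] tQ.
rewrite -map_comp size_map /comp /= => /(_ ul); rewrite all_map /= => H.
have {}H := H _; apply: leq_trans (H _); first by move: eQ; nlia.
by apply: sub_all al => p /and3P[h1 h2 h3]; rewrite /= cjK h1 h2 h3.
Qed.

Lemma basic_full B : basic B -> full E B.
Proof.
case=> {B} [M cM M4 e2|x y z R|x y xy axy axy' xx yy|x y z cT T3 xx yy zz].
- by have [] := mz_K4 gE tE cM M4 e2.
- by have [] := mz_R gE tE R.
- have [cQ Q2] := pair_clique xy axy; have tQ := clique_trans cQ.
  have /andP[ne _] := cover_neq xy.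
  have [xQ yQ] : x \in [set x; y] /\ y \in [set x; y] by rewrite !inE !eqxx orbT.
  apply: (@full_extras _ [:: (x, x); (y, y); (x, y)]) => //.
  + by rewrite /= !in_cons !in_nil !orbF !negb_or !(cedge_cj_neq tQ) //; distinct_pairs.
  + by rewrite /= /extra xQ yQ axy' xx yy.
  by rewrite (clique_ee gE cQ) Q2.
have tQ := clique_trans cT.
have [xQ yQ zQ] : [/\ x \in tri x y z, y \in tri x y z & z \in tri x y z].
  by rewrite !inE !eqxx !orbT.
have [xy xz yz] : [/\ x != y, x != z & y != z].
  move: T3; rewrite /tri -setUA cardsU1 cards2 !inE.
  by do 3 case: (_ == _).
apply: (@full_extras _ [:: (x, x); (y, y); (z, z)]) => //.
- by rewrite /= !in_cons !in_nil !orbF !negb_or !(cedge_cj_neq tQ) //; distinct_pairs.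
- by rewrite /= /extra xQ yQ zQ xx yy zz.
by rewrite (clique_ee gE cT) T3.
Qed.

Definition in_basic s := exists2 B, basic B & s \in B.
End Basic.

(** * The 4-regular part *)

Section Degree4.
Variables (V : finType) (E : {set gedge V}).
Hypotheses (gE : gain_graph E) (tE : tight E) (IH : smaller_generated #|V|).
Hypothesis nG : ~ generated E.
Implicit Types (s t u w x : V * bool) (M S X Y Z B P Q : {set V * bool}).

Let sE : sparse E. Proof. by case: tE. Qed.

Section Star.
Variables S1 S2 S3 D : {set V * bool}.
Let J := (S1 :&: S2) :|: (S1 :&: S3) :|: (S2 :&: S3).
Let I := S1 :&: S2 :&: S3.

(* Uncrossing of three sets with a common vertex: [J] collects what lies in at least
   two of them, and its vertices have degree at most four. *)
Lemma star_ee : (forall t, t \in D -> [&& t \notin S1, t \notin S2 & t \notin S3]) ->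
  ee E S1 S1 + ee E S2 S2 + ee E S3 S3 + 2 * ee E J D <=
  ee E (S1 :\: J) (S1 :\: J) + ee E (S2 :\: J) (S2 :\: J) + ee E (S3 :\: J) (S3 :\: J)
  + ee E I I + 2 * ee E J setT.
Proof.
move=> dD; have := @ee_leq _ E [:: (S1, S1); (S2, S2); (S3, S3); (J, D); (D, J)]
  [:: (S1 :\: J, S1 :\: J); (S2 :\: J, S2 :\: J); (S3 :\: J, S3 :\: J); (I, I); (J, setT); (setT, J)].
rewrite !big_cons !big_nil /= (eeC E D) (eeC E setT) => H.
have {}H := H _; move: (H); set L := (forall s t, _) => H'.
suff : L by move/H'; nlia.
move=> s t; rewrite !big_cons !big_nil /= /J /I !inE; move: (dD s) (dD t).
case: (s \in D) => [/(_ isT)/and3P[/negPf-> /negPf-> /negPf->] _|_].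
  by move: (t \in S1) (t \in S2) (t \in S3) (t \in D) => b1 b2 b3 b4; by_truth_table.
case: (t \in D) => [/(_ isT)/and3P[/negPf-> /negPf-> /negPf->]|_].
  by move: (s \in S1) (s \in S2) (s \in S3) => b1 b2 b3; by_truth_table.
move: (t \in S1) (t \in S2) (t \in S3) (s \in S1) (s \in S2) (s \in S3) => b1 b2 b3 b4 b5 b6.
by by_truth_table.
Qed.

Lemma star_card : #|S1| + #|S2| + #|S3| = #|S1 :\: J| + #|S2 :\: J| + #|S3 :\: J| + #|I| + 2 * #|J|.
Proof.
have c (A : {set V * bool}) : #|A| = \sum_t (t \in A) by rewrite -sum1_card big_mkcond.
rewrite !c big_distrr /= -!big_split /=; apply: eq_bigr => t _.
rewrite /J /I !inE; move: (t \in S1) (t \in S2) (t \in S3) => b1 b2 b3.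
by apply/eqP; by_truth_table.
Qed.

(** The constant 16 comes from four nonempty transversal sets with slack at least 4: the three
    private parts and the common part. The rest of [J] is paid for by degrees at most 4, and the
    weight k of the edges from [J] to [D] is gained twice. *)
Lemma star_bound k n1 n2 n3 a : trans S1 -> trans S2 -> trans S3 ->
  (forall t, t \in D -> [&& t \notin S1, t \notin S2 & t \notin S3]) ->
  [&& n1 \in S1, n1 \notin S2 & n1 \notin S3] -> [&& n2 \in S2, n2 \notin S1 & n2 \notin S3] ->
  [&& n3 \in S3, n3 \notin S1 & n3 \notin S2] -> [&& a \in S1, a \in S2 & a \in S3] ->
  (forall t, t \in S1 :|: S2 -> dg E setT t <= 4) -> k <= ee E J D ->
  ee E S1 S1 + ee E S2 S2 + ee E S3 S3 + 16 + 2 * k <= 4 * (#|S1| + #|S2| + #|S3|).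
Proof.
move=> t1 t2 t3 dD /and3P[h11 h12 h13] /and3P[h22 h21 h23] /and3P[h33 h31 h32] /and3P[a1 a2 a3] d4 kJ.
have [_ h] := sE.
have r1 : ee E (S1 :\: J) (S1 :\: J) + 4 <= 4 * #|S1 :\: J|.
  apply: h; first by apply: trans_sub t1; apply: subsetDl.
  by apply/set0Pn; exists n1; rewrite !inE h11 (negPf h12) (negPf h13).
have r2 : ee E (S2 :\: J) (S2 :\: J) + 4 <= 4 * #|S2 :\: J|.
  apply: h; first by apply: trans_sub t2; apply: subsetDl.
  by apply/set0Pn; exists n2; rewrite !inE h22 (negPf h21) (negPf h23).
have r3 : ee E (S3 :\: J) (S3 :\: J) + 4 <= 4 * #|S3 :\: J|.
  apply: h; first by apply: trans_sub t3; apply: subsetDl.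
  by apply/set0Pn; exists n3; rewrite !inE h33 (negPf h31) (negPf h32).
have r4 : ee E I I + 4 <= 4 * #|I|.
  apply: h; first by apply: trans_sub t3; apply: subsetIr.
  by apply/set0Pn; exists a; rewrite !inE a1 a2 a3.
have r5 : ee E J setT <= 4 * #|J|.
  rewrite ee_dg mulnC -sum_nat_const; apply: leq_sum => t tJ; apply: d4.
  by move: tJ; rewrite !inE; do 3 case: (_ \in _).
by move: (star_ee dD) star_card r1 r2 r3 r4 r5 kJ; nlia.
Qed.
End Star.

Lemma nbhd_H2e s n : nbhd E s [:: cj s; n; cj n] -> ~~ adj E n (cj n) -> False.
Proof.
move=> H an; apply: nG; have := nbhd_nbrs H.
by case: s H => v [] H /= L; apply: (H2e_red gE tE IH L); rewrite ?adj_cj.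
Qed.

Lemma nbhd_size s l : uniq l -> all (adj E s) l -> #|nbset E s| = size l -> nbhd E s l.
Proof.
move=> ul /allP al sl; split=> // t; apply/idP/idP=> [st|/al//].
have sub : [set x in l] \subset nbset E s by apply/subsetP=> x; rewrite !inE; exact: al.
have /eqP e : [set x in l] == nbset E s by rewrite eqEcard sub sl cardsE (card_uniqP ul) leqnn.
by have : t \in nbset E s; [rewrite inE|rewrite -e inE].
Qed.

Section Region.
Variable W : {set V * bool}.
Hypothesis clW : adj_closed E W.
Hypothesis dW : forall t, t \in W -> dg E setT t = 4.
Hypothesis bW : forall t, t \in W -> ~ in_basic E t.

Lemma clW_adj s t : adj E s t -> (s \in W) = (t \in W).
Proof.
move=> st; have [_ c] := clW; apply/idP/idP=> h; first exact: c h st.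
by apply: c h _; rewrite adjC.
Qed.

(** Nonempty parts inside and outside W would have no edges between them and slack at least 4 each,
    hence slack at least 8 together. *)
Lemma sub_W S x : trans S -> 4 * #|S| <= ee E S S + 6 -> x \in S -> x \in W -> S \subset W.
Proof.
move=> tS eS xS xW; rewrite -setD_eq0; apply: contraT => ne.
have [_ h] := sE.
have h1 := h _ (trans_sub (subsetDl S W) tS) ne.
have h2 : ee E (S :&: W) (S :&: W) + 4 <= 4 * #|S :&: W|.
  by apply: h; [exact: trans_sub (subsetIl _ _) tS|apply/set0Pn; exists x; rewrite inE xS].
have d : [disjoint S :&: W & S :\: W].
  by rewrite disjoints_subset; apply/subsetP=> t; rewrite !inE => /andP[-> ->].
have := ee_disjU E d; rewrite setID.
have -> : ee E (S :&: W) (S :\: W) = 0.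
  rewrite /ee big1 // => s; rewrite inE => /andP[_ sW]; apply: big1 => t; rewrite inE => /andP[tW _].
  rewrite /wt; case st: (adj E s t); rewrite ?muln0 //.
  by rewrite (clW_adj st) (negPf tW) in sW.
by have := cardsID W S; move: h1 h2 eS; nlia.
Qed.

Definition away s S := (s \notin S) && (cj s \notin S).

Lemma away_cjs s S : away s S -> away s (cjs S).
Proof. by rewrite /away !inE cjK andbC. Qed.

(* [tight_pair s a b] forbids adding an edge ab when s is removed, and
   [near_tight_quad s a b c d] forbids adding ab and cd simultaneously. *)
Definition tight_pair s a b := exists S, [&& trans S, 4 * #|S| <= ee E S S + 4, away s S, a \in S & b \in S].
Definition near_tight_quad s a b c d := exists S, [&& trans S, 4 * #|S| <= ee E S S + 6, away s S,
  [&& a \in S & b \in S] & [&& cj c \in S & cj d \in S]].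

Lemma T1C s a b : tight_pair s a b -> tight_pair s b a.
Proof. by move=> [S /and5P[*]]; exists S; apply/and5P. Qed.

Lemma T2_12 s a b c d : near_tight_quad s a b c d -> near_tight_quad s b a c d.
Proof. by move=> [S /and5P[? ? ? /andP[? ?] ?]]; exists S; apply/and5P; split=> //; apply/andP. Qed.

Lemma T2_34 s a b c d : near_tight_quad s a b c d -> near_tight_quad s a b d c.
Proof. by move=> [S /and5P[? ? ? ? /andP[? ?]]]; exists S; apply/and5P; split=> //; apply/andP. Qed.

Lemma T2_swap s a b c d : near_tight_quad s a b c d -> near_tight_quad s c d a b.
Proof.
move=> [S /and5P[tS eS aS /andP[h1 h2] /andP[h3 h4]]]; exists (cjs S).
by rewrite trans_cjs // ee_cjs card_cjs eS away_cjs // !inE !cjK h1 h2 h3 h4.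
Qed.

Definition pairing_blocked s a b c d := [\/ adj E a b \/ tight_pair s a b, adj E c d \/ tight_pair s c d | near_tight_quad s a b c d].

(** Two new edges in one transversal set at the same level put all four neighbours of v into it, and
    adding the point over v shows slack at least 8, which is enough for both. Only lifts at opposite
    levels can fail jointly, whence the shape of [near_tight_quad]. *)
Lemma H3_bad v a b c d : nbrs E v [:: a; b; c; d] -> (v, true) \notin [:: a; b; c; d] ->
  ~~ [&& cj a \in [:: b; c; d], cj b \in [:: a; c; d], cj c \in [:: a; b; d]
    & cj d \in [:: a; b; c]] -> pairing_blocked (v, false) a b c d.
Proof.
move=> H nl np.
have dT1 x y : tight_pair (v, false) x y \/ forall S, trans S -> 4 * #|S| <= ee E S S + 4 ->
    away (v, false) S -> x \in S -> y \in S -> False.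
  case: (boolP [exists S, [&& trans S, 4 * #|S| <= ee E S S + 4, away (v, false) S, x \in S & y \in S]]).
    by case/existsP=> S h; left; exists S.
  by move=> n; right=> S *; case/negP: n; apply/existsP; exists S; apply/and5P.
have dT2 : near_tight_quad (v, false) a b c d \/ forall S, trans S -> 4 * #|S| <= ee E S S + 6 ->
    away (v, false) S -> a \in S -> b \in S -> cj c \in S -> cj d \in S -> False.
  case: (boolP [exists S, [&& trans S, 4 * #|S| <= ee E S S + 6, away (v, false) S,
    [&& a \in S & b \in S] & [&& cj c \in S & cj d \in S]]]).
    by case/existsP=> S h; left; exists S.
  by move=> n; right=> S *; case/negP: n; apply/existsP; exists S; apply/and5P; split=> //; apply/andP.
have [ab|ab] := boolP (adj E a b); first by constructor 1; left.
have [cd|cd] := boolP (adj E c d); first by constructor 2; left.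
case: (dT1 a b) => [|nab]; first by constructor 1; right.
case: (dT1 c d) => [|ncd]; first by constructor 2; right.
case: dT2 => [|n2]; first by constructor 3.
exfalso; apply: nG; have [ul al] := H.
have [[ab' ac' ad' bc' bd'] cd'] : [/\ a != b, a != c, a != d, b != c & b != d] /\ c != d.
  by move: ul; rewrite /= !inE !negb_or andbT => /and3P[/and3P[-> -> ->] /andP[-> ->] ->].
pose s := (v, false).
have [sa sb sc sd] : [/\ adj E s a, adj E s b, adj E s c & adj E s d].
  by rewrite !al !inE !eqxx !orbT.
have ne : cedge a b != cedge c d.
  rewrite cedge_eq (negPf ac') (negPf ad') /=; apply: contra np => /orP[] /andP[/eqP-> /eqP->];
  by rewrite !cjK !inE !eqxx !orbT.
apply: (H3_red gE tE IH H nl ab cd ne _ np).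
have aw S : avoids v S -> away s S by [].
have dg4 S : a \in S -> b \in S -> c \in S -> d \in S -> 4 <= dg E S s.
  move=> h1 h2 h3 h4; apply: (dg_ge (l := [:: a; b; c; d])) => //=.
  by rewrite h1 h2 h3 h4 sa sb sc sd.
split=> S.
  move=> sS /aw/andP[sN csN]; rewrite ee_set2 // !ee_set1 // !(symmP _ sS).
  have [h _] := sE; have hS := h _ sS.
  case: (boolP (full E S)) => [fS|nf].
    have [_ clS] := full_closed gE tE IH nG fS.
    have no x : adj E s x -> x \notin S.
      by move=> sx; apply: contra sN => xS; apply: (clS x) => //; rewrite adjC.
    by rewrite (negPf (no _ sa)) (negPf (no _ sc)) /= !addn0.
  have h4 : ee E S S + 4 <= 4 * #|S|.
    move: nf; rewrite /full sS /= -ltnNge; have [k ->] := dvd_symm gE sS; nlia.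
  case hab: ((a \in S) && (b \in S)); case hcd: ((c \in S) && (d \in S)); rewrite /=; try by move: h4; nlia.
  have/andP[aS bS] := hab; have/andP[cS dS] := hcd.
  have := symm_add_le gE tE sS sN; have := dg4 S aS bS cS dS; nlia.
move=> tS S0 /aw aS; have/andP[sN csN] := aS; rewrite ee_set2 // !ee_set1 //.
have [_ h] := sE; have hS := h _ tS S0; have [k ek] := dvd_trans gE tS.
have aS' : away s (cjs S) by apply: away_cjs.
have tS' : trans (cjs S) by apply: trans_cjs.
have eqS : ee E (cjs S) (cjs S) = ee E S S by rewrite ee_cjs.
have h6 x y : (forall S, trans S -> 4 * #|S| <= ee E S S + 4 ->
    away (v, false) S -> x \in S -> y \in S -> False) ->
    (x \in S) && (y \in S) || (cj x \in S) && (cj y \in S) -> ee E S S + 6 <= 4 * #|S|.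
  move=> nxy xy; have : ~ (4 * #|S| <= ee E S S + 4); last by rewrite ek; nlia.
  move=> le; case/orP: xy => /andP[h1 h2]; first exact: (nxy S).
  by apply: (nxy (cjs S)); rewrite ?inE // card_cjs eqS.
have add4 y : y \notin S -> cj y \notin S -> 4 <= dg E S y -> ee E S S + 8 <= 4 * #|S|.
  move=> yN cyN d4; have : trans (y |: S).
    apply: transI => t; rewrite !inE => /orP[/eqP->|tM']; first by rewrite cj_neq (negPf cyN).
    by rewrite (transP tS tM') orbF => /eqP cw; rewrite -cw cjK tM' in cyN.
  move/h => /(_ _); rewrite ee_add1 // cardsU1 yN => H1.
  have {}H1 := H1 _; have : y |: S != set0 by apply/set0Pn; exists y; rewrite setU11.
  by move/H1; move: d4; nlia.
have e12 x y : ((x \in S) && (y \in S)) && ((cj x \in S) && (cj y \in S)) = false.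
  by case xS: (x \in S) => //=; rewrite (transP tS xS) ?andbF.
have h6a := h6 a b nab; have h6c := h6 c d ncd; have ea := e12 a b; have ec := e12 c d.
have h8 : (a \in S) && (b \in S) || (cj a \in S) && (cj b \in S) ->
    (c \in S) && (d \in S) || (cj c \in S) && (cj d \in S) -> ee E S S + 8 <= 4 * #|S|.
  move=> /orP[] /andP[h1 h2] /orP[] /andP[h3 h4].
  - by apply: (add4 s) => //; apply: dg4.
  - have : ~ (4 * #|S| <= ee E S S + 6); last by rewrite ek; nlia.
    by move=> le; apply: (n2 S).
  - have : ~ (4 * #|S| <= ee E S S + 6); last by rewrite ek; nlia.
    by move=> le; apply: (n2 (cjs S)); rewrite ?inE ?cjK // card_cjs eqS.
  - apply: (add4 (cj s)); rewrite ?cjK //.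
    by rewrite -(cjK s) -dg_cj cjK; apply: dg4; rewrite inE.
move: h6a h6c h8 ea ec.
case: ((a \in S) && (b \in S)); case: ((cj a \in S) && (cj b \in S));
case: ((c \in S) && (d \in S)); case: ((cj c \in S) && (cj d \in S)) => //=.
all: move=> h6a h6c h8 _ _; try have := h6a isT; try have := h6c isT; try have := h8 isT isT.
all: by move: hS; nlia.
Qed.

Lemma away_cj s S : away (cj s) S = away s S.
Proof. by rewrite /away cjK andbC. Qed.

Lemma T1_base s a b : tight_pair s (cj a) (cj b) -> tight_pair (cj s) a b.
Proof.
move=> [S /and5P[tS eS aS h1 h2]]; exists (cjs S).
by rewrite trans_cjs // ee_cjs card_cjs eS away_cjs ?away_cj // !inE h1 h2.
Qed.

Lemma T2_base s a b c d : near_tight_quad s (cj a) (cj b) (cj c) (cj d) -> near_tight_quad (cj s) a b c d.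
Proof.
move=> [S /and5P[tS eS aS /andP[h1 h2] /andP[h3 h4]]]; exists (cjs S).
by rewrite trans_cjs // ee_cjs card_cjs eS away_cjs ?away_cj // !inE h1 h2 h3 h4.
Qed.

Definition paired (a b c d : V * bool) := [&& cj a \in [:: b; c; d], cj b \in [:: a; c; d],
  cj c \in [:: a; b; d] & cj d \in [:: a; b; c]].

Lemma nbhd_bad s a b c d : nbhd E s [:: a; b; c; d] -> ~~ adj E s (cj s) -> ~~ paired a b c d ->
  pairing_blocked s a b c d.
Proof.
move=> H nl np; have L := nbhd_nbrs H; have L' := nbhd_noloop H nl.
case: s => v [] in H nl L L' *; last exact: H3_bad L L' np.
have np' : ~~ paired (cj a) (cj b) (cj c) (cj d).
  by apply: contra np; rewrite /paired !inE !(inj_eq (@cj_inj V)).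
case: (H3_bad L L' np') => [[|t1]|[|t1]|t2]; rewrite ?adj_cj.
- by constructor 1; left.
- by constructor 1; right; apply: (@T1_base (v, false)).
- by constructor 2; left.
- by constructor 2; right; apply: (@T1_base (v, false)).
- by constructor 3; apply: (@T2_base (v, false)).
Qed.

Section Neighbourhood.
Variable s : V * bool.
Hypothesis sW : s \in W.
Hypothesis nl : ~~ adj E s (cj s).

Lemma nbhdW a b c d x : nbhd E s [:: a; b; c; d] -> x \in [:: a; b; c; d] -> adj E s x /\ x \in W.
Proof. by move=> [_ al] xl; rewrite -al in xl; split=> //; rewrite -(clW_adj xl). Qed.

Lemma nbhd4_neq a b c d : nbhd E s [:: a; b; c; d] ->
  [/\ [/\ a != b, a != c & a != d], [/\ b != c & b != d] & c != d].
Proof. by case=> /=; rewrite !inE !negb_or andbT => /and3P[/and3P[-> -> ->] /andP[-> ->] ->]. Qed.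

Lemma nbN x : adj E s x -> [/\ s != x, s != cj x, cj s != x & cj s != cj x].
Proof.
move=> sx; have ne := adj_neq gE sx.
have ne' : s != cj x by apply: contraNneq nl => ss; rewrite {2}ss cjK.
by rewrite ne ne' cj_eq ne' (inj_eq (@cj_inj V)) ne.
Qed.

Lemma blk3 a b c d Z : nbhd E s [:: a; b; c; d] -> block E Z -> away s Z ->
  a \in Z -> b \in Z -> c \in Z -> False.
Proof.
move=> H bZ /andP[sZ csZ] aZ bZ' cZ; have [[ab ac _] [bc _] _] := nbhd4_neq H.
have [_ al] := H.
apply: (no_block3 gE sE bZ sZ csZ); apply: (dg_ge (l := [:: a; b; c])).
  by rewrite /= !inE negb_or ab ac bc.
by rewrite /= aZ bZ' cZ !al !inE !eqxx !orbT.
Qed.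

Lemma T1_block a b : tight_pair s a b -> exists S, [/\ block E S, trans S, 4 * #|S| <= ee E S S + 4, away s S & a \in S /\ b \in S].
Proof.
move=> [S /and5P[tS eS aS h1 h2]]; exists S; split=> //.
by apply: block_trans => //; apply/set0Pn; exists a.
Qed.

Lemma T1_T1 a b c d : nbhd E s [:: a; b; c; d] -> tight_pair s a b -> tight_pair s a c -> False.
Proof.
move=> H /T1_block[S [bS _ _ /andP[sS cS] [aS bS']]] /T1_block[T [bT _ _ /andP[sT cT] [aT cT']]].
have ne : S :&: T != set0 by apply/set0Pn; exists a; rewrite inE aS.
have [X [bX /subsetP ZX XZ]] := block_union sE bS bT ne.
have aX : away s X.
  by apply/andP; split; apply/negP=> /XZ; rewrite !inE ?cjK (negPf sS) (negPf sT) (negPf cS) (negPf cT).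
by apply: (blk3 H bX aX); apply: ZX; rewrite inE ?aS ?bS' ?cT' ?orbT.
Qed.

Lemma T1_adj2 a b c d : nbhd E s [:: a; b; c; d] -> tight_pair s a b -> adj E a c -> adj E b c -> False.
Proof.
move=> H /T1_block[S [bS _ _ /andP[sS cS] [aS bS']]] ac bc.
have [[ab _ _] _ _] := nbhd4_neq H; rewrite adjC in ac; rewrite adjC in bc.
have [X [bX X3 /subsetP ZX XZ]] := block_add gE sE bS aS bS' ab ac bc.
have [sc _] : adj E s c /\ c \in W by apply: (nbhdW H); rewrite !inE eqxx !orbT.
have [/eqP s1 s2 s3 s4] := nbN sc.
have aX : away s X.
  apply/andP; split; apply/negP=> /XZ; rewrite ?cjK (negPf sS) (negPf cS) /=.
    by move/orP=> [/eqP|]; rewrite ?(negPf s2).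
  by rewrite (negPf s3) (negPf s4).
by apply: (blk3 H bX aX); rewrite // ZX.
Qed.

(** A common weakening of adjacency of a and b, where S consists of these two points, and of
    [near_tight_quad], in the form that uncrossing of three sets takes. *)
Definition near_tight_pair a b c d := exists S, [&& trans S, 4 * #|S| <= ee E S S + 6, away s S,
  [&& a \in S & b \in S] & [&& c \notin S & d \notin S]].

Lemma T2_weak a b c d : near_tight_quad s a b c d -> near_tight_pair a b c d.
Proof.
move=> [S /and5P[tS eS aS h1 /andP[h2 h3]]]; exists S; apply/and5P; split=> //.
have nS x : cj x \in S -> x \notin S by move=> xS; rewrite -(cjK x) (transP tS xS).
by rewrite !nS.
Qed.

(** Conjugate adjacent neighbours of [s] would mean a loop at a. As a has degree four, its
    neighbours are then [cj a], [s] and [cj s], and H2e can be undone there. *)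
Lemma nbr_fst a b : adj E s a -> adj E s b -> adj E a b -> a.1 != b.1.
Proof.
move=> sa sb ab; apply: fst_neq (adj_neq gE ab) _; apply/eqP=> e.
have eb : b = cj a by rewrite e cjK.
have aW : a \in W by rewrite -(clW_adj sa).
rewrite eb in sb ab; have := dW aW; rewrite dgT // ab addn1 => -[n3].
have [s1 s2 s3 s4] := nbN sa.
apply: (@nbhd_H2e a s) => //; apply: nbhd_size; rewrite ?n3 //; last first.
  by rewrite /= ab adjC sa -adj_cjl adjC sb.
by rewrite /= !inE !negb_or (eq_sym _ s) s2 (inj_eq (@cj_inj V)) (eq_sym a) s1 (eq_sym s) cj_neq.
Qed.

Lemma adj_weak a b c d : nbhd E s [:: a; b; c; d] -> adj E a b -> near_tight_pair a b c d.
Proof.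
move=> H ab; have [[n1 n2 n3] [n4 n5] n6] := nbhd4_neq H.
have [sa _] : adj E s a /\ a \in W by apply: (nbhdW H); rewrite !inE eqxx.
have [sb _] : adj E s b /\ b \in W by apply: (nbhdW H); rewrite !inE eqxx !orbT.
have f := nbr_fst sa sb ab; have /andP[_ f'] := cover_neq f.
have [s1 s2 s3 s4] := nbN sa; have [s5 s6 s7 s8] := nbN sb.
exists [set a; b]; apply/and5P; split.
- have no u : cj u = u -> False by move/eqP; rewrite cj_neq.
  apply: transI => t; rewrite !inE => /orP[] /eqP-> /orP[] /eqP e; try exact: no e.
    by move/eqP: e; rewrite cj_eq (negPf f').
  by move: f'; rewrite -e eqxx.
- rewrite cards2 n1 ee_add1 ?inE // /dg /ee !big_set1 wt_ss // /wt ab.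
  by case: (_ == _).
- by rewrite /away !inE !negb_or s1 s5 s3 s7.
- by rewrite !inE !eqxx orbT.
by rewrite !inE !negb_or !(eq_sym c) !(eq_sym d) n2 n3 n4 n5.
Qed.

Lemma region4 S a : trans S -> 4 * #|S| <= ee E S S + 6 -> a \in S -> a \in W ->
  forall t, t \in S -> dg E setT t <= 4.
Proof. by move=> tS eS aS aW t tS'; rewrite dW //; apply: (subsetP (sub_W tS eS aS aW)). Qed.

(** The slacks 4, 6 and 6 add up to 16, but uncrossing at a, with the edge from a to [s] leaving all
    three sets, requires 18. *)
Lemma star_T1 a b c d : nbhd E s [:: a; b; c; d] -> tight_pair s a b -> near_tight_pair a c b d -> near_tight_pair a d b c -> False.
Proof.
move=> H /T1_block[S [bS tS eS aS [aS1 bS1]]].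
move=> [T /and5P[tT eT /andP[sT _] /andP[aT cT] /andP[bT dT]]].
move=> [U /and5P[tU eU /andP[sU _] /andP[aU dU] /andP[bU cU]]].
have /andP[sS _] := aS.
have [sa aW] : adj E s a /\ a \in W by apply: (nbhdW H); rewrite !inE eqxx.
have cS : c \notin S by apply/negP=> cS; exact: (blk3 H bS aS aS1 bS1 cS).
have dS : d \notin S.
  apply/negP=> dS; have H' : nbhd E s [:: a; b; d; c].
    by apply: nbhd_perm H _; apply/permP=> x /=; rewrite (addnCA (x c)).
  exact: (blk3 H' bS aS aS1 bS1 dS).
have eS' : 4 * #|S| <= ee E S S + 6 by move: eS; nlia.
have := @star_bound S T U [set s] 1 b c d a tS tT tU.
rewrite bS1 bT bU cT cS cU dU dS dT aS1 aT aU => K.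
have {}K := K _ isT isT isT isT _ _; move: (K); clear K => K.
have : ee E S S + ee E T T + ee E U U + 16 + 2 * 1 <= 4 * (#|S| + #|T| + #|U|).
  apply: K.
  - by move=> t; rewrite inE => /eqP->; rewrite sS sT sU.
  - move=> t; rewrite inE => /orP[]; first exact: region4 eS' aS1 aW _.
    exact: region4 eT aT aW _.
  have : ee E [set a] [set s] <= ee E ((S :&: T) :|: (S :&: U) :|: (T :&: U)) [set s].
    by apply: ee_mono; rewrite // sub1set !inE aS1 aT.
  by apply: leq_trans; rewrite /ee !big_set1 /wt adjC sa muln1.
by move: eS eT eU; nlia.
Qed.

(** Three slacks of 6 add up to 18, while 20 is required: besides a, also [cj d] lies in two of the
    sets, so the edges from these points to [s] and [cj s] both leave. *)
Lemma star_T2 a b c d : nbhd E s [:: a; b; c; d] -> near_tight_quad s a b c d -> near_tight_quad s a c b d -> near_tight_pair a d b c -> False.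
Proof.
move=> H [S /and5P[tS eS /andP[sS csS] /andP[aS bS] /andP[cS dS]]].
move=> [T /and5P[tT eT /andP[sT csT] /andP[aT cT] /andP[bT dT]]].
move=> [U /and5P[tU eU /andP[sU csU] /andP[aU dU] /andP[bU cU]]].
have [sa aW] : adj E s a /\ a \in W by apply: (nbhdW H); rewrite !inE eqxx.
have [sd dW'] : adj E s d /\ d \in W by apply: (nbhdW H); rewrite !inE eqxx !orbT.
have nS x : cj x \in S -> x \notin S by move=> xS; rewrite -(cjK x) (transP tS xS).
have nT x : cj x \in T -> x \notin T by move=> xT; rewrite -(cjK x) (transP tT xT).
have : ee E S S + ee E T T + ee E U U + 16 + 2 * 2 <= 4 * (#|S| + #|T| + #|U|).
  apply: (@star_bound S T U [set s; cj s] 2 b c d a tS tT tU).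
  - by move=> t; rewrite !inE => /orP[] /eqP->; rewrite ?sS ?sT ?sU ?csS ?csT ?csU.
  - by rewrite bS (nT b bT) bU.
  - by rewrite cT (nS c cS) cU.
  - by rewrite dU (nS d dS) (nT d dT).
  - by rewrite aS aT aU.
  - move=> t; rewrite inE => /orP[]; first exact: region4 eS aS aW _.
    exact: region4 eT aT aW _.
  have := @ee_leq _ E [:: ([set a], [set s]); ([set cj d], [set cj s])]
    [:: ((S :&: T) :|: (S :&: U) :|: (T :&: U), [set s; cj s])].
  rewrite !big_cons !big_nil !addn0 /= => K.
  apply: leq_trans (K _).
    by rewrite /ee !big_set1 /wt adj_cj !(adjC E _ s) sa sd; do 2 case: (_ == _).
  move=> x t; rewrite !big_cons !big_nil /= !inE.
  case: (eqVneq t s) => [->|ts].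
    rewrite (eq_sym s) cj_neq; case: eqP => [->|_]; last by case: (_ == _); case: (_ || _).
    by rewrite aS aT; case: (_ == _).
  by case: (eqVneq x (cj d)) => [->|_]; [rewrite dS dT; case: (_ == _); case: (_ == _)|rewrite !muln0; case: (_ || _); case: (_ == _)].
by move: eS eT eU; nlia.
Qed.

Lemma pairedE a b c d : paired a b c d = all (fun x => cj x \in [:: a; b; c; d]) [:: a; b; c; d].
Proof. by rewrite /paired /= !inE !cj_neq ?orbF /= ?andbT. Qed.

Definition unpaired a b c d := nbhd E s [:: a; b; c; d] /\ ~~ paired a b c d.

Lemma unpaired_perm a b c d a' b' c' d' : unpaired a b c d ->
  perm_eq [:: a; b; c; d] [:: a'; b'; c'; d'] -> unpaired a' b' c' d'.
Proof.
move=> [H np] p; split; first exact: nbhd_perm H p.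
by move: np; rewrite !pairedE (perm_all _ p) (eq_all (fun x => perm_mem p (cj x))).
Qed.

Lemma upm a b c d i j k l : unpaired a b c d -> perm_eq [:: 0; 1; 2; 3] [:: i; j; k; l] ->
  let n := nth a [:: a; b; c; d] in unpaired (n i) (n j) (n k) (n l).
Proof. by move=> U p n; apply: unpaired_perm U _; apply: (perm_map n p). Qed.

Lemma bads a b c d : unpaired a b c d -> [/\ pairing_blocked s a b c d, pairing_blocked s a c b d & pairing_blocked s a d b c].
Proof.
move=> U.
have U2 : unpaired a c b d := @upm a b c d 0 2 1 3 U isT.
have U3 : unpaired a d b c := @upm a b c d 0 3 1 2 U isT.
by split; apply: nbhd_bad => //; [case: U|case: U|case: U2|case: U2|case: U3|case: U3].
Qed.

(** Whatever blocks the other two pairings, one of three things happens: two tight sets share a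
    neighbour and combine, a third neighbour is adjacent to both a and b, or three blocking sets
    meet at a or at b and can be uncrossed. *)
Lemma no_T1 a b c d : unpaired a b c d -> tight_pair s a b -> False.
Proof.
move=> U t; have [_ B2 B3] := bads U; have [H _] := U.
have [Hba _] : unpaired b a d c := @upm a b c d 1 0 3 2 U isT.
have [Hac _] : unpaired a c b d := @upm a b c d 0 2 1 3 U isT.
have [Had _] : unpaired a d b c := @upm a b c d 0 3 1 2 U isT.
have [Hbd _] : unpaired b d a c := @upm a b c d 1 3 0 2 U isT.
have [Hbc _] : unpaired b c a d := @upm a b c d 1 2 0 3 U isT.
have [Habd _] : unpaired a b d c := @upm a b c d 0 1 3 2 U isT.
have [Hbacd _] : unpaired b a c d := @upm a b c d 1 0 2 3 U isT.
have t' := T1C t.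
have sa h1 h2 := star_T1 H t h1 h2; have sb h1 h2 := star_T1 Hba t' h1 h2.
case: B2 => [[ac|t1]|[bd|t1]|t2]; [|exact: T1_T1 H t t1| |exact: T1_T1 Hba t' t1|].
- case: B3 => [[ad|t3]|[bc|t3]|t4]; [|exact: T1_T1 Habd t t3| |exact: T1_T1 Hbacd t' t3|].
  + by apply: sa; [exact: adj_weak Hac ac|exact: adj_weak Had ad].
  + exact: T1_adj2 H t ac bc.
  + by apply: sa; [exact: adj_weak Hac ac|exact: T2_weak].
- case: B3 => [[ad|t3]|[bc|t3]|t4]; [|exact: T1_T1 Habd t t3| |exact: T1_T1 Hbacd t' t3|].
  + exact: T1_adj2 Habd t ad bd.
  + by apply: sb; [exact: adj_weak Hbd bd|exact: adj_weak Hbc bc].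
  + by apply: sb; [exact: adj_weak Hbd bd|exact/T2_weak/T2_swap].
case: B3 => [[ad|t3]|[bc|t3]|t4]; [|exact: T1_T1 Habd t t3| |exact: T1_T1 Hbacd t' t3|].
- by apply: sa; [exact: T2_weak|exact: adj_weak Had ad].
- by apply: sb; [exact/T2_weak/T2_swap|exact: adj_weak Hbc bc].
- by apply: sa; exact: T2_weak.
Qed.

Lemma no_T2T2 a b c d : unpaired a b c d -> near_tight_quad s a b c d -> near_tight_quad s a c b d -> False.
Proof.
move=> U t t'; have [_ _ B3] := bads U; have [H _] := U.
have [Hba _] : unpaired b a d c := @upm a b c d 1 0 3 2 U isT.
have Uad : unpaired a d b c := @upm a b c d 0 3 1 2 U isT.
have Ubc : unpaired b c a d := @upm a b c d 1 2 0 3 U isT.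
case: B3 => [[ad|t3]|[bc|t3]|t4].
- by apply: (star_T2 H t t'); apply: adj_weak ad; case: Uad.
- exact: no_T1 Uad t3.
- apply: (star_T2 Hba); [exact/T2_34/T2_12|exact: T2_swap|].
  by apply: adj_weak bc; case: Ubc.
- exact: no_T1 Ubc t3.
- by apply: (star_T2 H t t'); exact: T2_weak.
Qed.

(** Three of the four edges at a, to [s], c and d, leave the near-tight set. Removing a therefore
    costs at most one edge and leaves a tight set through [cj c] and [cj d], that is, a tight
    pair. *)
Lemma no_T2_adj a b c d : unpaired a b c d -> near_tight_quad s a b c d -> adj E a c -> adj E a d -> False.
Proof.
move=> U [S /and5P[tS eS aS /andP[aS' bS] /andP[cS dS]]] ac ad; have [H _] := U.
have Ucd : unpaired c d a b := @upm a b c d 2 3 0 1 U isT.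
have [sa aW] : adj E s a /\ a \in W by apply: (nbhdW H); rewrite !inE eqxx.
have [[_ ac' ad'] [_ _] cd'] := nbhd4_neq H; have /andP[sS csS] := aS.
have [_ sc _ _] := nbN sa.
have sc' : adj E s c by case: (nbhdW H (_ : c \in _)); rewrite ?inE ?eqxx ?orbT.
have sd' : adj E s d by case: (nbhdW H (_ : d \in _)); rewrite ?inE ?eqxx ?orbT.
have nS x : cj x \in S -> x \notin S by move=> xS; rewrite -(cjK x) (transP tS xS).
have d3 : 3 <= dg E (~: S) a.
  apply: (dg_ge (l := [:: s; c; d])).
    by rewrite /= !inE negb_or (adj_neq gE sc') (adj_neq gE sd') cd'.
  by rewrite /= !inE sS !nS // adjC sa ac ad.
have d4 := dW aW.
have dsum : dg E setT a = dg E S a + dg E (~: S) a.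
  by rewrite /dg !(eeC E [set a]) -(setUCr S) ee_rect // disjoints_subset setCK.
have ca : cj c != a by have /andP[_ h] := cover_neq (nbr_fst sa sc' ac); rewrite eq_sym.
have da : cj d != a by have /andP[_ h] := cover_neq (nbr_fst sa sd' ad); rewrite eq_sym.
have eS1 := ee_rem1 gE aS'; have := cardsD1 a S; rewrite aS' => cS1.
apply: (no_T1 Ucd); exists (cjs (S :\ a)); apply/and5P; split.
- by apply/trans_cjs/(trans_sub _ tS)/subsetDl.
- rewrite card_cjs ee_cjs; have [_ h] := sE.
  by move: eS1 cS1 dsum d4 d3 eS; nlia.
- by apply: away_cjs; rewrite /away !inE (negPf sS) (negPf csS) !andbF.
- by rewrite !inE ca cS.
- by rewrite !inE da dS.
Qed.

Lemma no_T2 a b c d : unpaired a b c d -> near_tight_quad s a b c d -> False.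
Proof.
move=> U t; have [_ B2 B3] := bads U; have [H _] := U.
have Uac : unpaired a c b d := @upm a b c d 0 2 1 3 U isT.
have Ubd : unpaired b d a c := @upm a b c d 1 3 0 2 U isT.
have Uad : unpaired a d b c := @upm a b c d 0 3 1 2 U isT.
have Ubc : unpaired b c a d := @upm a b c d 1 2 0 3 U isT.
have Uba : unpaired b a c d := @upm a b c d 1 0 2 3 U isT.
have Ucd : unpaired c d a b := @upm a b c d 2 3 0 1 U isT.
have Udc : unpaired d c a b := @upm a b c d 3 2 0 1 U isT.
have Uabdc : unpaired a b d c := @upm a b c d 0 1 3 2 U isT.
have t2 := T2_swap t.
case: B2 => [[ac|t1]|[bd|t1]|t3]; [|exact: no_T1 Uac t1| |exact: no_T1 Ubd t1|exact: no_T2T2 U t t3].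
- case: B3 => [[ad|t3]|[bc|t3]|t4]; [|exact: no_T1 Uad t3| |exact: no_T1 Ubc t3|exact: no_T2T2 Uabdc (T2_34 t) t4].
    exact: no_T2_adj U t ac ad.
  by apply: (no_T2_adj Ucd t2); rewrite adjC.
case: B3 => [[ad|t3]|[bc|t3]|t4]; [|exact: no_T1 Uad t3| |exact: no_T1 Ubc t3|exact: no_T2T2 Uabdc (T2_34 t) t4].
  by apply: (no_T2_adj Udc (T2_12 t2)); rewrite adjC.
exact: no_T2_adj Uba (T2_12 t) bc bd.
Qed.

Lemma good_tetra a b c : adj E s a -> adj E s b -> adj E s c -> uniq [:: a; b; c] ->
  adj E a b -> adj E a c -> adj E b c -> False.
Proof.
move=> sa sb sc u ab ac bc.
case: (tetra gE nl u sa sb sc ab ac bc) => [[M [cM M4 sM _]]|[x [y R]]]; apply: (bW sW).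
  exists (M :|: cjs M); last by rewrite inE sM.
  by apply: BasicK4 => //; exact: (K4_two_extras gE tE IH nG cM M4).
exists (tri x s y :|: cjs (tri x s y)); first exact: BasicR.
by rewrite !inE eqxx !orbT.
Qed.

(** The edge sb is contracted in the triangle with a. A tight transversal set through [s] and b that
    misses a would contain c or d, because each of its points has degree at least 2 in it. Then a
    has three neighbours in this set, which is absurd, unless [cj a] lies in it; but [cj a] keeps at
    most one of its four edges there. *)
Lemma star_leaf a b c d : nbhd E s [:: a; b; c; d] -> adj E a b -> adj E a c -> adj E a d ->
  cj b \notin [:: c; d] -> False.
Proof.
move=> H ab ac ad cb; have [[n1 n2 n3] [n4 n5] n6] := nbhd4_neq H.
have [sa aW] : adj E s a /\ a \in W by apply: (nbhdW H); rewrite !inE eqxx.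
have [sb bW'] : adj E s b /\ b \in W by apply: (nbhdW H); rewrite !inE eqxx !orbT.
have [sc cW] : adj E s c /\ c \in W by apply: (nbhdW H); rewrite !inE eqxx !orbT.
have [sd dW'] : adj E s d /\ d \in W by apply: (nbhdW H); rewrite !inE eqxx !orbT.
have nbc : ~~ adj E b c by apply/negP=> bc; apply: (@good_tetra a b c); rewrite //= !inE !negb_or n1 n2 n4.
have nbd : ~~ adj E b d by apply/negP=> bd; apply: (@good_tetra a b d); rewrite //= !inE !negb_or n1 n3 n5.
have nba : b.1 != a.1 by rewrite eq_sym; apply: nbr_fst.
have s1 x : adj E s x -> s.1 != x.1 by move=> sx; have [h1 h2 _ _] := nbN sx; apply: fst_neq.
have [_ al] := H.
apply: nG; apply: (split_red (w := s) (a := b) (b := a) gE tE IH); split; rewrite ?s1 ?(negPf nl) //.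
- by rewrite adjC.
- move: cb; rewrite al !inE !negb_or cj_neq => /andP[-> ->]; rewrite !andbT.
  by have /andP[_ h] := cover_neq nba; rewrite cj_eq.
- move=> u _ _; rewrite al !inE => /or4P[] /eqP-> //; rewrite ?adj_irr //.
    by rewrite (negPf nbc).
  by rewrite (negPf nbd).
move=> Z /andP[_ bZ] sZ bZ' aZ; case/orP: bZ => /andP[hZ eZ]; last first.
  have fZ : full E Z by rewrite /full hZ.
  by have [_ c'] := full_closed gE tE IH nG fZ; rewrite (c' s a) in aZ.
have two y : y \in Z -> Z :\ y != set0 -> 2 <= dg E Z y.
  move=> yZ ne; have [_ h] := sE; have := h _ (trans_sub (subsetDl _ _) hZ) ne.
  have := ee_rem1 gE yZ; have := cardsD1 y Z; rewrite yZ.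
  by move: eZ; nlia.
have out y l : y \in W -> uniq l -> all (fun t => (t \in ~: Z) && adj E y t) l -> size l = 3 ->
    dg E Z y <= 1.
  move=> yW ul al' sl; have := dg_ge ul al'; have := dW yW.
  have -> : dg E setT y = dg E Z y + dg E (~: Z) y.
    by rewrite /dg !(eeC E [set y]) -(setUCr Z) ee_rect // disjoints_subset setCK.
  by rewrite sl; nlia.
have sd2 : 2 <= dg E Z s.
  apply: two => //; apply/set0Pn; exists b; rewrite !inE bZ' andbT.
  by rewrite eq_sym; apply: adj_neq sb.
have [y [yl yZ ay]] : exists y, [/\ y \in [:: c; d], y \in Z & adj E a y].
  have [cZ|cZ] := boolP (c \in Z); first by exists c; rewrite !inE eqxx.
  have [dZ|dZ] := boolP (d \in Z); first by exists d; rewrite !inE eqxx orbT.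
  have := out s [:: a; c; d] sW; rewrite /= !inE !negb_or n2 n3 n6 aZ cZ dZ sa sc sd.
  by move=> /(_ isT isT erefl); rewrite leqNgt sd2.
have sy : adj E s y by rewrite al; move: yl; rewrite !inE => /orP[] ->; rewrite ?orbT.
have by' : b != y by move: yl; rewrite !inE => /orP[] /eqP->.
have u3 : uniq [:: s; b; y] by rewrite /= !inE negb_or (adj_neq gE sb) (adj_neq gE sy) by'.
have bZ2 : block E Z by apply: block_trans => //; apply/set0Pn; exists s.
have [caZ|caZ] := boolP (cj a \in Z); last first.
  apply: (no_block3 gE sE bZ2 aZ caZ); apply: (dg_ge u3).
  by rewrite /= sZ bZ' yZ adjC sa ab ay.
have : 2 <= dg E Z (cj a).
  apply: two => //; apply/set0Pn; exists s; rewrite !inE sZ andbT.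
  by have [_ h _ _] := nbN sa.
have caW : cj a \in W by have [sy' _] := clW; rewrite (symmP _ sy').
rewrite leqNgt ltnS (out _ [:: cj s; cj b; cj y]) //.
  by rewrite (map_inj_uniq (@cj_inj V) [:: s; b; y]).
by rewrite /= !inE !adj_cj (transP hZ sZ) (transP hZ bZ') (transP hZ yZ) adjC sa ab ay.
Qed.

Lemma no_star a b c d : nbhd E s [:: a; b; c; d] -> adj E a b -> adj E a c -> adj E a d -> False.
Proof.
move=> H ab ac ad; have [[n1 n2 n3] [n4 n5] n6] := nbhd4_neq H.
have [cb|] := boolP (cj b \in [:: c; d]); last exact: star_leaf H ab ac ad.
move: cb; rewrite !inE => /orP[] /eqP e.
  have H' : nbhd E s [:: a; d; b; c].
    by apply: nbhd_perm H _; apply: (@perm_map _ _ (nth a [:: a; b; c; d]) [:: 0; 1; 2; 3] [:: 0; 3; 1; 2]).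
  apply: (star_leaf H' ad ab ac); rewrite !inE; apply/negP=> /orP[] /eqP h.
    by rewrite -e -h cjK eqxx in n6.
  by move: n5; rewrite -(inj_eq (@cj_inj V)) h e eqxx.
have H' : nbhd E s [:: a; c; b; d].
  by apply: nbhd_perm H _; apply: (@perm_map _ _ (nth a [:: a; b; c; d]) [:: 0; 1; 2; 3] [:: 0; 2; 1; 3]).
apply: (star_leaf H' ac ab ad); rewrite !inE; apply/negP=> /orP[] /eqP h.
  by rewrite -e -h cjK eqxx in n6.
by move: n4; rewrite -(inj_eq (@cj_inj V)) h e eqxx.
Qed.

Lemma paired_nbl a b c d : nbhd E s [:: a; b; c; d] -> paired a b c d ->
  exists n m, nbhd E s [:: n; cj n; m; cj m].
Proof.
move=> H; have [[n1 n2 n3] [n4 n5] n6] := nbhd4_neq H.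
have two x y z : cj x = y -> cj z = x -> y = z by move=> <- <-; rewrite cjK.
have inj x y z : cj x = y -> cj z = y -> x = z by move=> <- /cj_inj.
move=> /and4P[]; rewrite !inE => /or3P[] /eqP e.
- move=> _ /or3P[] /eqP e' _; first by rewrite (two _ _ _ e e') eqxx in n4.
    by rewrite (inj _ _ _ e e') eqxx in n2.
  by exists a, c; rewrite e e'.
- move=> /or3P[] /eqP e' _ _; first by rewrite (two _ _ _ e e') eqxx in n4.
    by rewrite (inj _ _ _ e e') eqxx in n1.
  exists a, b; rewrite e e'.
  by apply: nbhd_perm H _; apply: (@perm_map _ _ (nth a [:: a; b; c; d]) [:: 0; 1; 2; 3] [:: 0; 2; 1; 3]).
- move=> /or3P[] /eqP e' _ _; first by rewrite (two _ _ _ e e') eqxx in n5.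
    exists a, b; rewrite e e'.
    by apply: nbhd_perm H _; apply: (@perm_map _ _ (nth a [:: a; b; c; d]) [:: 0; 1; 2; 3] [:: 0; 3; 1; 2]).
  by rewrite (inj _ _ _ e e') eqxx in n1.
Qed.

(** Now only adjacency can block a pairing. One pair from each of the three pairings of four points
    forms a triangle, which yields a K_4 or R with [s], or a star, which is contractible. *)
Lemma loop_needed : False.
Proof.
have n4 : #|nbset E s| = 4 by have := dW sW; rewrite dgT // (negPf nl) addn0.
have [l [H sl]] := nbhd_exists E s; rewrite n4 in sl.
case: l H sl => [|a [|b [|c [|d [|? ?]]]]] // H _.
have [pr|np] := boolP (paired a b c d).
  have [n [m H']] := paired_nbl H pr.
  have no x : adj E s x -> adj E s (cj x) -> ~~ adj E x (cj x).
    by move=> h1 h2; apply/negP=> h3; have := nbr_fst h1 h2 h3; rewrite eqxx.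
  have [_ al] := H'; apply: (nbhd_N22 gE tE IH nG H' nl); apply: no; rewrite al !inE eqxx ?orbT //.
have U : unpaired a b c d by [].
have Ub : unpaired b a c d := @upm a b c d 1 0 2 3 U isT.
have Uc : unpaired c a b d := @upm a b c d 2 0 1 3 U isT.
have Ud : unpaired d a b c := @upm a b c d 3 0 1 2 U isT.
have Uac : unpaired a c b d := @upm a b c d 0 2 1 3 U isT.
have Ubd : unpaired b d a c := @upm a b c d 1 3 0 2 U isT.
have Uad : unpaired a d b c := @upm a b c d 0 3 1 2 U isT.
have Ubc : unpaired b c a d := @upm a b c d 1 2 0 3 U isT.
have Ucd : unpaired c d a b := @upm a b c d 2 3 0 1 U isT.
have red x y z t : unpaired x y z t -> unpaired z t x y -> pairing_blocked s x y z t -> adj E x y \/ adj E z t.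
  move=> U1 U2 [[?|t1]|[?|t1]|t2]; [by left|by case: (no_T1 U1 t1)|by right|by case: (no_T1 U2 t1)|].
  by case: (no_T2 U1 t2).
have [B1 B2 B3] := bads U.
have {}B1 := red _ _ _ _ U Ucd B1; have {}B2 := red _ _ _ _ Uac Ubd B2; have {}B3 := red _ _ _ _ Uad Ubc B3.
have [[n1 n2 n3] [n5 n6] n7] := nbhd4_neq H.
have [[sa sb] [sc sd]] : (adj E s a /\ adj E s b) /\ (adj E s c /\ adj E s d).
  by have [_ al] := H; rewrite !al !inE !eqxx !orbT.
case: B1 => [ab|cd]; case: B2 => [ac|bd]; case: B3 => [ad|bc].
- exact: no_star H ab ac ad.
- by apply: (@good_tetra a b c); rewrite //= !inE !negb_or n1 n2 n5.
- by apply: (@good_tetra a b d); rewrite //= !inE !negb_or n1 n3 n6.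
- by case: Ub => Hb _; apply: (no_star Hb) => //; rewrite adjC.
- by apply: (@good_tetra a c d); rewrite //= !inE !negb_or n2 n3 n7.
- by case: Uc => Hc _; apply: (no_star Hc) => //; rewrite adjC.
- by case: Ud => Hd _; apply: (no_star Hd) => //; rewrite adjC.
- by apply: (@good_tetra b c d); rewrite //= !inE !negb_or n5 n6 n7.
Qed.
End Neighbourhood.

Lemma nbhd_H2d s p q : nbhd E s [:: cj s; p; q] -> p.1 != q.1 -> ~~ adj E p q ->
  (forall Z, block E Z -> away s Z -> p \in Z -> q \in Z -> False) -> False.
Proof.
move=> H pq apq nb; apply: nG; have L := nbhd_nbrs H.
case: s => v [] in H nb L *.
  apply: (H2d_red gE tE IH L) => //; first by rewrite adj_cj.
  move=> Z bZ aZ h1 h2; apply: (nb (cjs Z)); rewrite ?inE //; first exact: block_cjs.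
  by move: aZ; rewrite /avoids /away !inE /cj.
exact: (H2d_red gE tE IH L).
Qed.

(** Every vertex has a loop, so [s] has just two further neighbours p and q. If these are not
    adjacent, H2d can be undone: a tight transversal set through p and q gives p degree at least 2
    in it, and the loop at p and the edge to [s] add 3 outside, more than four in all. *)
Lemma region_empty s : s \in W -> False.
Proof.
move=> sW; have [ls|nl] := boolP (adj E s (cj s)); last exact: loop_needed sW nl.
have n3 : #|nbset E s| = 3 by have := dW sW; rewrite dgT // ls; nlia.
have [l [H sl]] := nbhd_exists E s; rewrite n3 in sl.
have [p [q Hpq]] : exists p q, nbhd E s [:: cj s; p; q].
  case: l H sl => [|a [|b [|c [|? ?]]]] // H _; have [_ al] := H.
  have := al (cj s); rewrite ls !inE => /esym/or3P[] /eqP ->; [by exists b, c|exists a, c|exists a, b].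
    by apply: nbhd_perm H _; apply: (@perm_map _ _ (nth a [:: a; b; c]) [:: 0; 1; 2] [:: 1; 0; 2]).
  by apply: nbhd_perm H _; apply: (@perm_map _ _ (nth a [:: a; b; c]) [:: 0; 1; 2] [:: 2; 0; 1]).
have [ul al] := Hpq; have [sp sq] : adj E s p /\ adj E s q by rewrite !al !inE !eqxx !orbT.
have := ul; rewrite /= !inE negb_or andbT => /andP[/andP[np nq] npq].
have fs x : adj E s x -> cj s != x -> s.1 != x.1.
  by move=> sx nx; apply: fst_neq (adj_neq gE sx) _; rewrite -cj_eq.
have [pW qW] : p \in W /\ q \in W by rewrite -(clW_adj sp) -(clW_adj sq).
have loopW x : x \in W -> adj E x (cj x) by move=> xW; apply: contraT => nx; case: (loop_needed xW nx).
have lp := loopW p pW; have lq := loopW q qW; have sp1 := fs p sp np; have sq1 := fs q sq nq.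
have [pq1|pq1] := eqVneq p.1 q.1.
  have e : q = cj p by move/eqP: pq1; rewrite same_vertex (negPf npq) -cj_eq => /eqP.
  apply: (bW sW); exists ([set s; p] :|: cjs [set s; p]); last by rewrite !inE eqxx.
  by apply: Basic2K2; rewrite // -e.
have [apq|apq] := boolP (adj E p q).
  have [cT T3] := tri_clique sp1 sq1 pq1 sp sq apq.
  apply: (bW sW); exists (tri s p q :|: cjs (tri s p q)); last by rewrite !inE eqxx.
  exact: BasicTriangle.
apply: (nbhd_H2d Hpq pq1 apq) => Z /andP[_ bZ] /andP[sZ csZ] pZ qZ.
case/orP: bZ => /andP[hZ eZ]; last first.
  have fZ : full E Z by rewrite /full hZ.
  by have [_ c'] := full_closed gE tE IH nG fZ; rewrite (c' p s) // adjC in sZ.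
have d2 : 2 <= dg E Z p.
  have ne : Z :\ p != set0 by apply/set0Pn; exists q; rewrite !inE qZ andbT eq_sym.
  have [_ h] := sE; have := h _ (trans_sub (subsetDl _ _) hZ) ne.
  have := ee_rem1 gE pZ; have := cardsD1 p Z; rewrite pZ.
  by move: eZ; nlia.
have d3 : 3 <= dg E (~: Z) p.
  have : dg E [set cj p; s] p <= dg E (~: Z) p.
    by apply: dg_mono; apply/subsetP=> t; rewrite !inE => /orP[] /eqP->; rewrite // (transP hZ pZ).
  have cps : cj p != s by rewrite cj_eq eq_sym.
  by rewrite dgE big_setU1 ?inE // big_set1 /wt lp (adjC E p s) sp /= eqxx; case: (_ == _); nlia.
have dsum : dg E setT p = dg E Z p + dg E (~: Z) p.
  by rewrite /dg !(eeC E [set p]) -(setUCr Z) ee_rect // disjoints_subset setCK.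
by have := dW pW; rewrite dsum; move: d2 d3; nlia.
Qed.
End Region.

(* Otherwise the smallest closed set through s avoids all basic sets, hence is
   4-regular. *)
Lemma all_good s : ~ ~ in_basic E s.
Proof.
move=> ns; pose cl X := symm X && (ee E X (~: X) == 0).
have clP X : cl X -> adj_closed E X.
  move=> /andP[sX /eqP e0]; split=> // x t xX xt; apply: contraT => tX.
  by have := ee_eq0 e0 xX (_ : t \in ~: X); rewrite inE xt => /(_ tX).
have Pcl X : adj_closed E X -> cl X.
  move=> [sX c]; rewrite /cl sX /ee big1 // => x xX; apply: big1 => t; rewrite inE => tX.
  by rewrite /wt; case xt: (adj E x t); rewrite ?muln0 //; rewrite (c x t) in tX.
pose P X := cl X && (s \in X).
have P0 : P setT by rewrite /P inE andbT; apply: Pcl; split=> [|x t _ _]; [exact: symmT|rewrite inE].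
have [W /andP[/clP clW sW] mW] := @arg_minnP _ setT P (fun X => #|X|) P0.
(* Removing a closed set from W leaves a closed set, so minimality makes W disjoint from every
   closed set that misses [s]. *)
have out B : adj_closed E B -> s \notin B -> W \subset ~: B.
  move=> [sB cB] sNB; have [sW' cW] := clW.
  have : P (W :\: B).
    rewrite /P inE sNB sW /= andbT; apply: Pcl; split.
      by apply: symmI => t; rewrite !inE (symmP _ sB) (symmP _ sW').
    move=> x t; rewrite !inE => /andP[xB xW] xt; rewrite (cW x t xW xt) andbT.
    by apply: contra xB => tB; apply: (cB t x tB); rewrite adjC.
  move/mW => le; have [_ e] := subset_leqif_cards (subsetDl W B).
  have /eqP <- : W :\: B == W by rewrite -e eqn_leq le subset_leq_card ?subsetDl.
  by apply/subsetP=> t; rewrite !inE => /andP[].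
have fc B : basic E B -> adj_closed E B by move=> bB; apply: (full_closed gE tE IH nG); apply: basic_full.
have bW t : t \in W -> ~ in_basic E t.
  move=> tW [B bB tB]; have [sB|sB] := boolP (s \in B); first by apply: ns; exists B.
  by have := subsetP (out B (fc B bB) sB) t tW; rewrite inE tB.
have dW3 t : t \in W -> 4 <= dg E setT t.
  move=> tW; rewrite leqNgt; apply/negP => /(deg3_struct gE tE IH nG).
  case=> [[M [cM M4 tM]]|[x [y R]]]; apply: (bW t tW).
    exists (M :|: cjs M); last by rewrite inE tM.
    by apply: BasicK4 => //; exact: (K4_two_extras gE tE IH nG cM M4).
  exists (tri x t y :|: cjs (tri x t y)); first exact: BasicR.
  by rewrite !inE eqxx !orbT.
have eW : ee E W setT <= 4 * #|W|.
  have [sW' _] := clW; have [h _] := sE; apply: leq_trans (h _ sW').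
  have eT : setT = W :|: ~: W by rewrite setUCr.
  have dWW : [disjoint W & ~: W] by rewrite disjoints_subset setCK.
  rewrite eeC eT ee_rect // (eeC E (~: W)).
  by have /andP[_ /eqP->] := Pcl W clW; rewrite addn0.
have dW t : t \in W -> dg E setT t = 4.
  move=> tW; apply/eqP; rewrite eqn_leq dW3 // andbT.
  have : dg E setT t + \sum_(x in W | x != t) 4 <= ee E W setT.
    rewrite ee_dg (bigD1 t tW) /= leq_add2l; apply: leq_sum => x /andP[xW _]; exact: dW3.
  rewrite sum_nat_const; have <- : #|W :\ t| = #|[pred x in W | x != t]|.
    by apply: eq_card => x; rewrite !inE andbC.
  by move: eW (cardsD1 t W); rewrite tW; nlia.
exact: region_empty clW dW bW s sW.
Qed.
End Degree4.

(** * Assembling the base graphs *)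

(** The coincidences among the ends of two distinct negative edges give the five types (d) to
    (h). *)
Lemma K4_base (T : finType) (P Q R U : T) : #|T| = 4 -> ~~ same_pair P Q R U ->
  base_graph (complete T :|: [set edge P Q neg; edge R U neg]).
Proof.
move=> T4 u; have [PQ|PQ] := eqVneq P Q.
  rewrite -{}PQ in u *; have [RU|RU] := eqVneq R U.
    rewrite -{}RU in u *; apply: Base_K4_loops => //.
    by rewrite /= inE andbT; apply: contra u => /eqP->; rewrite /same_pair eqxx.
  have [PR|PR] := eqVneq P R.
    by rewrite -PR in RU *; apply: Base_K4_loop_incident; rewrite //= inE andbT.
  have [PU|PU] := eqVneq P U.
    by rewrite (edgeC R) -PU; apply: Base_K4_loop_incident; rewrite //= inE andbT.
  by apply: Base_K4_loop_apart; rewrite //= !inE negb_or PR PU RU.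
have [RU|RU] := eqVneq R U.
  rewrite -{}RU in u *; rewrite (setUC [set _]).
  have [PR|PR] := eqVneq P R.
    by rewrite -PR in u *; apply: Base_K4_loop_incident; rewrite //= inE andbT.
  have [QR|QR] := eqVneq Q R.
    by rewrite -QR in u *; rewrite (edgeC P); apply: Base_K4_loop_incident; rewrite //= inE andbT eq_sym.
  by apply: Base_K4_loop_apart; rewrite //= !inE negb_or eq_sym PR eq_sym QR PQ.
have [PR|PR] := eqVneq P R.
  rewrite -PR in u RU *; apply: Base_K4_adjacent; rewrite //= !inE negb_or PQ RU /= andbT.
  by apply: contra u => /eqP->; rewrite /same_pair !eqxx.
have [PU|PU] := eqVneq P U.
  rewrite (edgeC R) -PU in u RU *; apply: Base_K4_adjacent; rewrite //= !inE negb_or PQ eq_sym RU /= andbT.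
  by apply: contra u => /eqP->; rewrite /same_pair !eqxx orbT.
rewrite (edgeC P).
have [QR|QR] := eqVneq Q R.
  by rewrite -QR in u RU *; apply: Base_K4_adjacent; rewrite //= !inE negb_or eq_sym PQ RU PU.
have [QU|QU] := eqVneq Q U.
  by rewrite (edgeC R) -QU in u RU *; apply: Base_K4_adjacent; rewrite //= !inE negb_or eq_sym PQ eq_sym RU PR.
by apply: Base_K4_disjoint; rewrite //= !inE !negb_or eq_sym PQ QR QU PR PU RU.
Qed.

Section Restrict.
Variable V : finType.
Implicit Types (E : {set gedge V}) (X p : {set V}).

Definition restr X E : {set gedge {x | x \in X}} := [set e | edge_map val e \in E].

Lemma edge_restr X E (u v : {x | x \in X}) a :
  (edge u v a \in restr X E) = (edge (val u) (val v) a \in E).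
Proof. by rewrite inE edge_map_edge. Qed.

Lemma gain_graph_restr X E : gain_graph E -> gain_graph (restr X E).
Proof.
move=> /forall_inP gE; apply/forall_inP=> e; rewrite inE => /gE /=.
by rewrite card_imset //; exact: val_inj.
Qed.

Lemma card_restr X E : gain_graph E -> sparse E -> #|restr X E| <= 2 * #|X|.
Proof.
move=> gE [h _]; have := h _ (symm_vlift X); rewrite ee_vlift // card_vlift => le.
have vI : injective (val : {x | x \in X} -> V) by apply: val_inj.
rewrite -(card_map_edges _ vI).
apply: (@leq_trans #|[set e in E | e.1 \subset X]|); last by move: le; nlia.
apply: subset_leq_card; apply/subsetP=> _ /imsetP[e eE ->]; rewrite inE in eE.
rewrite inE eE; apply/subsetP=> _ /imsetP[x _ ->]; exact: valP.
Qed.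

(** Sparsity allows at most 2 |X| edges on X, and a base graph has that many. So it is enough to
    exhibit the edges of the base graph. *)
Lemma restr_base X E G : gain_graph E -> sparse E -> base_graph G -> G \subset restr X E ->
  restr X E = G.
Proof.
move=> gE sE bG GE; apply/esym/eqP; rewrite eqEcard GE.
have [_ [_ ->]] := base_tight bG; rewrite card_sig; exact: card_restr.
Qed.

Lemma restr_switch X E p p' : gain_graph E -> {in X, p =i p'} ->
  restr X (switchX p E) = restr X (switchX p' E).
Proof.
move=> gE pp; apply: gain_graph_ext; do ?[apply/gain_graph_restr/gain_graph_switchX/gE].
move=> u v a; rewrite !edge_restr.
have e q : (edge (val u) (val v) a \in switchX q E) = adj E (flipX q (val u, false)) (flipX q (val v, a)).
  by rewrite -adj_switchX.
by rewrite !e /flipX /= (pp _ (valP u)) (pp _ (valP v)).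
Qed.
End Restrict.

Section Assembly.
Variables (V : finType) (E : {set gedge V}).
Hypotheses (gE : gain_graph E) (tE : tight E) (IH : smaller_generated #|V|).
Implicit Types (s t : V * bool) (Q B : {set V * bool}) (X p : {set V}).

Let sE : sparse E. Proof. by case: tE. Qed.

Definition shadow Q : {set V} := [set s.1 | s in Q].
(** Switching at this set moves the transversal set Q to level 0. *)
Definition upper Q : {set V} := [set x | (x, true) \in Q].

Lemma flip_upper Q s b : trans Q -> s \in Q -> flipX (upper Q) (s.1, b) = (s.1, b (+) s.2).
Proof.
move=> tQ sQ; rewrite /flipX /= inE; congr (_, b (+) _).
case: s sQ => x [] //= sQ.
by have := transP tQ sQ.
Qed.

Lemma edge_upper Q s t b : trans Q -> s \in Q -> t \in Q ->
  (edge s.1 t.1 b \in switchX (upper Q) E) = adj E s (if b then cj t else t).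
Proof.
move=> tQ sQ tQ'; have -> : (edge s.1 t.1 b \in switchX (upper Q) E) =
    adj (switchX (upper Q) E) (s.1, false) (t.1, b) by [].
rewrite adj_switchX // !flip_upper //= -surjective_pairing.
by case: b => /=; rewrite -?surjective_pairing.
Qed.

Lemma card_shadow Q : trans Q -> #|shadow Q| = #|Q|.
Proof. by move=> tQ; apply: card_in_imset => s t sQ tQ'; apply: trans_fst tQ sQ tQ'. Qed.

Definition below Q s (sQ : s \in Q) : {x | x \in shadow Q} := Sub s.1 (imset_f fst sQ).

Lemma below_exists Q (y : {x | x \in shadow Q}) : exists s (sQ : s \in Q), y = below sQ.
Proof.
have /imsetP[s sQ e] := valP y; exists s, sQ; exact: val_inj.
Qed.

Lemma below_neq Q s t (sQ : s \in Q) (tQ : t \in Q) : trans Q -> s != t -> below sQ != below tQ.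
Proof. by move=> tr; apply: contra => /eqP/(congr1 val)/= e; apply/eqP; apply: trans_fst tr sQ tQ e. Qed.

Lemma edge_below Q s t (sQ : s \in Q) (tQ : t \in Q) b : trans Q ->
  (edge (below sQ) (below tQ) b \in restr (shadow Q) (switchX (upper Q) E)) =
  adj E s (if b then cj t else t).
Proof. by move=> tr; rewrite edge_restr edge_upper. Qed.

Lemma complete_below Q : clique E Q ->
  complete {x | x \in shadow Q} \subset restr (shadow Q) (switchX (upper Q) E).
Proof.
move=> cQ; have tr := clique_trans cQ.
apply/subsetP=> _ /imsetP[[y z] /= yz ->]; have [s [sQ ys]] := below_exists y.
have [t [tQ zt]] := below_exists z; rewrite ys zt /= edge_below //; apply: (cliqueP cQ sQ tQ).
by move: yz; rewrite inE /= ys zt; apply: contra => /eqP st; apply/eqP/val_inj; rewrite /= st.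
Qed.

Lemma basic_base B : basic E B -> exists Q, [/\ clique E Q, B = Q :|: cjs Q &
  base_graph (restr (shadow Q) (switchX (upper Q) E))].
Proof.
have done' Q G : clique E Q -> base_graph G -> G \subset restr (shadow Q) (switchX (upper Q) E) ->
    base_graph (restr (shadow Q) (switchX (upper Q) E)).
  move=> cQ bG GE; rewrite (restr_base _ _ bG GE) //; first exact: gain_graph_switchX.
  by have [] := tight_switchX (upper Q) gE tE.
have cT Q : trans Q -> #|{: {x | x \in shadow Q}}| = #|Q| by move=> tQ; rewrite card_sig card_shadow.
case=> {B} [M cM M4 [a [b [c [d [e1 e2 u]]]]]|x y z R|x y xy axy axy' xx yy|x y z cM T3 xx yy zz].
- exists M; split=> //; have tM := clique_trans cM.
  have [/and3P[aM bM ab] /and3P[cM' dM cd]] := (e1, e2).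
  have ne s t (sQ : s \in M) (tQ : t \in M) : (below sQ == below tQ) = (s == t).
    case: (eqVneq s t) => [e|st]; last exact/negbTE/below_neq.
    by apply/eqP/val_inj; rewrite /= e.
  apply: (done' _ (complete _ :|: [set edge (below aM) (below bM) neg; edge (below cM') (below dM) neg])) => //.
    by apply: K4_base; rewrite ?cT // /same_pair !ne.
  by rewrite subUset complete_below // subUset !sub1set !edge_below // ab cd.
- case/and5P: R => xy xz yz xx /andP[axy /and4P[axy' axz axz' ayz]].
  have [cM T3] := tri_clique xy xz yz axy axz ayz; have tM := clique_trans cM.
  exists (tri x y z); split=> //.
  have [xM yM zM] : [/\ x \in tri x y z, y \in tri x y z & z \in tri x y z].
    by rewrite !inE !eqxx !orbT.
  have u3 : uniq [:: below xM; below yM; below zM].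
    have /andP[xy' _] := cover_neq xy; have /andP[xz' _] := cover_neq xz.
    by have /andP[yz' _] := cover_neq yz; rewrite /= !inE negb_or !below_neq.
  apply: (done' _ _ cM (Base_R _ u3)); first by rewrite cT.
  by rewrite !subUset !sub1set !edge_below // axy axy' axz axz' ayz xx.
- have /andP[ne _] := cover_neq xy; have [cM M2] := pair_clique xy axy.
  have tM := clique_trans cM.
  exists [set x; y]; split=> //.
  have [xM yM] : x \in [set x; y] /\ y \in [set x; y] by rewrite !inE !eqxx orbT.
  have u2 : uniq [:: below xM; below yM] by rewrite /= inE below_neq.
  apply: (done' _ _ cM (Base_2K2 _ u2)); first by rewrite cT.
  by rewrite !subUset !sub1set !edge_below // axy axy' xx yy.
exists (tri x y z); split=> //; have tM := clique_trans cM.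
apply: (done' _ _ cM (Base_triangle _)); first by rewrite cT.
rewrite subUset complete_below //; apply/subsetP=> _ /imsetP[v _ ->].
have [s [sQ ->]] := below_exists v; rewrite edge_below //.
by move: sQ; rewrite !inE => /orP[/orP[]|] /eqP->.
Qed.

(** X is the component of x: it is closed, and contained in every closed set that it meets.
    Switching at [p] makes it a base graph. *)
Definition piece X p (x : V) := [/\ x \in X,
  forall u v a, u \in X -> edge u v a \in E -> v \in X,
  forall Y : {set V}, (forall u v a, u \in Y -> edge u v a \in E -> v \in Y) ->
    forall y, y \in X -> y \in Y -> X \subset Y
  & base_graph (restr X (switchX p E))].

Lemma in_shadow Q s : trans Q -> (s \in Q :|: cjs Q) = (s.1 \in shadow Q).
Proof.
move=> tQ; rewrite !inE; apply/idP/imsetP=> [/orP[h|h]|[t tQ' e]].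
- by exists s.
- by exists (cj s).
have /orP[/eqP->|/eqP->] : (s == t) || (s == cj t) by rewrite -same_vertex e.
  by rewrite tQ'.
by rewrite cjK tQ' orbT.
Qed.

Lemma pieces : ~ generated E -> forall x, exists Xp, piece Xp.1 Xp.2 x.
Proof.
move=> nG x; have := NNPP _ (all_good gE tE IH nG (s := (x, false))) => -[B bB xB].
have [_ clB] := full_closed gE tE IH nG (basic_full gE tE bB).
have [Q [cQ eB bQ]] := basic_base bB; have tQ := clique_trans cQ.
exists (shadow Q, upper Q); split=> //=.
- by rewrite -(in_shadow (x, false)) // -eB.
- move=> u v a; rewrite -(in_shadow (u, false)) // -(in_shadow (v, a)) // -eB => uB uv.
  exact: (clB (u, false) (v, a)) uB uv.
move=> Y clY y /imsetP[s sQ ->] sY; apply/subsetP=> _ /imsetP[t tQ' ->].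
have [<-//|st] := eqVneq s t.
by apply: (clY s.1 t.1 (s.2 (+) t.2)) => //; exact: (cliqueP cQ).
Qed.

Lemma assemble : (forall x, exists Xp, piece Xp.1 Xp.2 x) -> generated E.
Proof.
move=> H; have {H}[f fP] := fin_all_exists H.
have same x v : x \in (f v).1 -> (f x).1 = (f v).1.
  move=> xv; have [xx cx mx _] := fP x; have [vv cv mv _] := fP v.
  by apply/eqP; rewrite eqEsubset (mx _ cv x) // (mv _ cx x).
have fx x : x \in (f x).1 by have [] := fP x.
pose I : finType := {X : {set V} | [exists v, (f v).1 == X]}.
have rep (i : I) : exists v, (f v).1 = val i by have /existsP[v /eqP] := valP i; exists v.
have {rep}[r rP] := fin_all_exists rep.
have iP x : [exists v, (f v).1 == (f x).1] by apply/existsP; exists x.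
pose idx x : I := Sub (f x).1 (iP x).
have idxE x (i : I) : x \in val i -> idx x = i.
  by rewrite -(rP i) => /same e; apply: val_inj; rewrite /= e.
(* Different vertices of one component may come with different switching sets. The glued set uses
   the one of a fixed representative [r] on each component. *)
pose p := [set x | x \in (f (r (idx x))).2].
pose W (i : I) : finType := {x | x \in val i}.
pose Ei (i : I) : {set gedge (W i)} := restr (val i) (switchX p E).
have bE i : base_graph (Ei i).
  have [_ _ _] := fP (r i); rewrite rP /Ei => b.
  by rewrite (restr_switch (p' := (f (r i)).2)) // => x xi; rewrite inE (idxE x i).
pose h (t : {i : I & W i}) : V := val (tagged t).
pose g x : {i : I & W i} := existT W (idx x) (Sub x (fx x)).
have gK : cancel g h by [].
have hI : injective h.
  move=> [i x] [j y]; rewrite /h /= => xy.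
  have ij : i = j by rewrite -(idxE _ _ (valP x)) -(idxE _ _ (valP y)); congr idx.
  by subst j; congr existT; apply: val_inj.
have hb : bijective h by exists g => // t; apply: hI; rewrite gK.
apply: (generated_switchX (X := p)).
suff -> : switchX p E = map_edges h (disjoint_union Ei).
  by apply: Gen_iso => //; apply: Gen_base.
have gs : gain_graph (switchX p E) by apply: gain_graph_switchX.
have adjS u v a : edge u v a \in switchX p E -> exists b, edge u v b \in E.
  by move=> e; have : adj (switchX p E) (u, false) (v, a) by []; rewrite adj_switchX //; eexists; eassumption.
apply/setP=> e; apply/idP/imsetP=> [eE|[e0 /bigcupP[i _ /imsetP[e1 e1i ->]] ->]].
  have [u [v [a [ee _]]]] := elimT (gain_graphP _) gs e eE; rewrite ee in eE *.
  have [b uv] := adjS _ _ _ eE; have [_ cl _ _] := fP u.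
  have vu : v \in val (idx u) by apply: (cl u v b).
  exists (edge (g u) (existT W (idx u) (Sub v vu)) a); last by rewrite edge_map_edge.
  apply/bigcupP; exists (idx u) => //.
  rewrite -(edge_map_edge (existT W (idx u)) (Sub u (fx u)) (Sub v vu)); apply: imset_f.
  by rewrite edge_restr.
move: e1i; rewrite inE => e1i.
have -> // : edge_map h (edge_map (fun x : W i => existT W i x) e1) = edge_map val e1.
by rewrite /edge_map /= -imset_comp.
Qed.
End Assembly.

Lemma tight_generated n (V : finType) (E : {set gedge V}) : #|V| < n -> gain_graph E -> tight E ->
  generated E.
Proof.
elim: n V E => // n IHn V E Vn gE tE.
have IH : smaller_generated #|V|.
  by move=> W F WV; apply: IHn; apply: leq_trans WV _.
by apply: NNPP => nG; apply: (nG); apply: assemble => //; apply: pieces.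
Qed.

Theorem theorem3p20 (V : finType) (E : {set gedge V}) (hG : gain_graph E) :
  gain_tight_220 E <-> generated E.
Proof.
rewrite sparse_gain_tight //; split; first exact: (tight_generated (ltnSn _)).
by move=> /generated_tight[].
Qed.
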